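(* Consider the Poissonized Karlin occupancy scheme with probabilities $(p_k)_{k\in\mathbb N}$, counting function $\rho$ and variables $K_j(t)$ as in the context. Assume that, for some $L$ slowly varying at $+\infty$, $\rho(t)\sim tL(t)$ as $t\to\infty$. Put $\hat L(t):=\int_t^\infty y^{-1}L(y)\,dy$, which is well-defined for large $t$. (1) For each $j\ge2$, $$\limsup_{t\to\infty}\frac{K_j(t)-\mathbb E K_j(t)}{(\operatorname{Var}K_j(t)\log\log\operatorname{Var}K_j(t))^{1/2}}=2^{1/2}\quad\text{almost surely},$$ and, as $t\to\infty$, $$\mathbb E K_j(t)\sim\frac1{j-1}tL(t)\quad\text{and}\quad\operatorname{Var}K_j(t)\sim\frac{(2j-3)!}{((j-1)!)^22^{2j-3}}tL(t).$$ (2) If, for each small enough $\gamma>0$, $$\lim_{n\to\infty}\frac{\hat L(\exp((n+1)^{1+\gamma}))}{\hat L(\exp(n^{1+\gamma}))}=0,\qquad(\ast)$$ then $$\limsup_{t\to\infty}\frac{K_1(t)-\mathbb E K_1(t)}{(\operatorname{Var}K_1(t)\log\log\operatorname{Var}K_1(t))^{1/2}}=2^{1/2}\quad\text{almost surely}.$$ If the condition that $(\ast)$ holds for each small enough $\gamma>0$ fails, then $$\limsup_{t\to\infty}\frac{K_1(t)-\mathbb E K_1(t)}{(\operatorname{Var}K_1(t)\log\log\operatorname{Var}K_1(t))^{1/2}}\le2^{1/2}\quad\text{almost surely}.$$ (3) In any event, $\operatorname{Var}K_1(t)\sim\mathbb E K_1(t)\sim t\hat L(t)$ as $t\to\inf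ty$.
   Context: Let $(p_k)_{k\in\mathbb N}$ be a discrete probability distribution with $p_k>0$ for infinitely many $k$. Balls are allocated independently over boxes $1,2,\dots$, each ball hitting box $k$ with probability $p_k$. In the Poissonized version of Karlin's occupancy scheme the $n$th ball is thrown at time $S_n$, where $(S_n)_{n\in\mathbb N}$ is a random walk with independent exponential(1) increments, independent of the box indices; thus the number of balls thrown up to time $t$ is a unit-rate Poisson process. $K_j(t)$ denotes the number of boxes containing at least $j$ balls at time $t\ge0$. Equivalently, $K_j(t)=\sum_{k\ge1}\mathbf 1_{\{\pi_k(t)\ge j\}}$, where $\pi_k(t)$ is the number of balls in box $k$ at time $t$; the processes $(\pi_k(t))_{t\ge0}$, $k\in\mathbb N$, are independent Poisson processes with intensities $p_k$. The counting function is $\rho(t):=\#\{k\in\mathbb N:1/p_k\le t\}$, $t>0$. A positive measurable function $L$ on a neighborhood of $\infty$ is slowly varying at $\infty$ if $L(\lambda t)/L(t)\to1$ as $t\to\infty$ for all $\lambda>0$. $x(t)\sim y(t)$ means $x(t)/y(t)\to1$. ''For each small enough $\gamma>0$'' means for all $\gamma\in(0,\gamma_0)$ for some $\gamma_0>0$. *)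

(* Defs.v *)
From HB Require Import structures.
From mathcomp Require Import all_boot all_order all_algebra.
From mathcomp Require Import all_classical all_reals all_analysis.

Set Implicit Arguments.
Unset Strict Implicit.
Unset Printing Implicit Defensive.

Import Order.TTheory GRing.Theory Num.Theory.
Import numFieldNormedType.Exports.

Local Open Scope classical_set_scope.
Local Open Scope ring_scope.

Section Asymptotics.
Context {R : realType}.

(* Since x / 0 = 0, the limit 1 forces g to be eventually nonzero. *)
Definition asymp_equiv (f g : R -> R) : Prop :=
  f t / g t @[t --> +oo] --> (1 : R).

Definition slowly_varying (L : R -> R) : Prop :=
  (exists a : R, measurable_fun `[a, +oo[ L /\ forall t, a <= t -> 0 < L t) /\
  (forall l : R, 0 < l -> L (l * t) / L t @[t --> +oo] --> (1 : R)).

Definition hatL (L : R -> R) (t : R) : R :=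
  \int[lebesgue_measure]_(y in `[t, +oo[) (y^-1 * L y).

(* Boxes with p k = 0 have 1 / p k = +oo and are never counted, whereas
   0^-1 = 0 here: hence the explicit condition 0 < p k. *)
Definition rho (p : nat -> R) (t : R) : R :=
  fine (counting [set k | 0 < p k /\ (p k)^-1 <= t]).

Definition hatL_ratio_vanishes (L : R -> R) (gamma : R) : Prop :=
  hatL L (expR (n.+1%:R `^ (1 + gamma))) / hatL L (expR (n%:R `^ (1 + gamma)))
    @[n --> \oo] --> (0 : R).

Definition hatL_condition (L : R -> R) : Prop :=
  exists2 gamma0 : R, 0 < gamma0 &
    forall gamma : R, 0 < gamma < gamma0 -> hatL_ratio_vanishes L gamma.

End Asymptotics.

Section Independence.
Context {d} {T : measurableType d} {R : realType} (P : probability T R).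

Definition mutually_independent (I : eqType) (F : I -> set (set T)) : Prop :=
  forall (J : seq I) (A : I -> set T), uniq J ->
    (forall i, i \in J -> F i (A i)) ->
    P (\big[setI/setT]_(i <- J) A i) = (\prod_(i <- J) P (A i))%E.

(* sigma-algebras generated by the increments (left) and box indices (right) *)
Definition karlin_sigma (xi : nat -> {RV P >-> R}) (X : nat -> {RV P >-> nat})
    (i : nat + nat) : set (set T) :=
  match i with
  | inl n => preimage_set_system setT (xi n) measurable
  | inr n => preimage_set_system setT (X n) measurable
  end.

(* Balls and boxes are numbered from 0: ball n falls into box X n at time
   xi 0 + ... + xi n. *)
Record poissonized_karlin (p : nat -> R) (xi : nat -> {RV P >-> R})
    (X : nat -> {RV P >-> nat}) : Prop := PoissonizedKarlin {
  increment_law : forall n (A : set R), measurable A ->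
    distribution P (xi n) A = exponential_prob 1 A ;
  box_law : forall n k, distribution P (X n) [set k] = (p k)%:E ;
  karlin_independent : mutually_independent (karlin_sigma xi X) }.

End Independence.

Section Occupancy.
Context {d} {T : measurableType d} {R : realType} {P : probability T R}.
Variables (xi : nat -> {RV P >-> R}) (X : nat -> {RV P >-> nat}).

Definition throw_time (n : nat) (w : T) : R := \sum_(i < n.+1) xi i w.

Definition box_content (k : nat) (t : R) (w : T) : \bar R :=
  counting [set n | throw_time n w <= t /\ X n w = k].

(* The set of boxes counted is almost surely finite; [fine] gives the value 0
   on the null event where it is not. *)
Definition occupancy (j : nat) (t : R) (w : T) : R :=
  fine (counting [set k | (j%:R%:E <= box_content k t w)%E]).

Definition meanK (j : nat) (t : R) : R := fine 'E_P[occupancy j t]%E.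

Definition varK (j : nat) (t : R) : R := fine 'V_P[occupancy j t]%E.

Definition lil_limsup (j : nat) (w : T) : \bar R :=
  limf_esup (fun t : R => ((occupancy j t w - meanK j t) /
    Num.sqrt (varK j t * ln (ln (varK j t))))%:E) (pinfty_nbhs R).

End Occupancy.

(* Main.v *)
Require Import Defs.
From HB Require Import structures.
From mathcomp Require Import all_boot all_order all_algebra.
From mathcomp Require Import all_classical all_reals all_analysis.
From mathcomp Require Import measurable_realfun ring lra.

(** The Poissonized contents of the boxes are independent Poisson processes, so
that the occupancy number [K j t] is a sum of independent bits, box [k] being
hit with probability [ptail j (t * p k)], the probability that a Poisson
variable of mean [t * p k] is at least [j].  Its mean [boxmean p j t] and its
variance [boxvar p j t] are therefore sums of a fixed function of [t * p k] over
the boxes.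

Independence ([box_independence]) comes from the generating function of the
contents at two times ([Ev_pgf]): the number of balls thrown is a Poisson
variable at each time with independent increments ([law_passage2]), each ball
carries an independent label, and the resulting exponential factorizes over the
boxes.  Power series are determined by their values, so the factorization passes
from generating functions to the laws.

Asymptotics.  For levels at least 2, [ptail j y] is of order [y ^ 2] at 0 at
most.  Then the sum of [F (t * p k)] is the integral of [rho (t / y)] against
[dF y], and since [rho (t / y)] is close to [rho t / y] the sum is equivalent to
[rho t] times the integral of [dF y / y] ([boxsum_rho_cvg]).  At level 1 that
integral diverges at 0: the boxes with a small [t * p k] dominate.  There the
mean and the variance are both equivalent to [capped p t], the sum of
[min 1 (t * p k)], because the errors are of order [rho p t = o (capped p t)];
and [capped p t / t] is exactly the integral of [rho y / y ^ 2] over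
[[t, +oo[] ([integral_rho]), hence equivalent to [hatL L t].

Upper half of the iterated logarithm ([upper_lil]).  Only three properties of
the process are used: exponential tails of the fluctuations and of their
increments, monotonicity of the occupancy number, and the regularity of its
mean.  In the dyadic block [[2 ^ n, 2 ^ n.+1]] the fluctuations at a fixed
number of coarse points obey the sharp Gaussian tail bound, which is summable
over the blocks since [log n] is equivalent to the iterated logarithm of the
variance; chaining over finer and finer grids bounds the oscillation between the
coarse points by an arbitrarily small multiple of the same quantity; at mesh 1,
monotonicity ends the argument.

Lower half ([lower_lil]).  Along the epochs [exp (n ^ (1 + kap))] choose windows
of boxes, disjoint for distinct epochs, outside of which the variance at the
corresponding epoch is a negligible fraction.  The contributions of the windows
are independent for two distinct epochs, and reach almost the required level
with probability at least of order [1 / n], by a lower bound for the tail of a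
sum of independent bits ([lower_tail]).  The second Borel-Cantelli lemma, which
needs pairwise independence only, makes this happen infinitely often, and the
rest is negligible by the first one.  At levels at least 2 the window is
[h <= t * p k < 1 / h]: such windows separate at once because the ratio of
successive epochs tends to infinity.  At level 1 the variance comes from the
boxes with a small [t * p k]; the window consists of the boxes with [1 / p k]
between two successive epochs, and what lies beyond the later epoch is a
fraction [hatL] (later epoch) / [hatL] (earlier epoch) of the variance.  This is
where the condition on [hatL] enters. *)

Set Implicit Arguments.
Unset Strict Implicit.
Unset Printing Implicit Defensive.

Import Order.TTheory GRing.Theory Num.Theory.
Import numFieldNormedType.Exports.

Local Open Scope classical_set_scope.
Local Open Scope ring_scope.

(** * Expectations of bounded variables and generating functions *)

Lemma cvgr_scaleF {R : realType} {S : Type} {F : set_system S} {FF : Filter F}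
    (c l : R) (u : S -> R) :
  u x @[x --> F] --> l -> c * u x @[x --> F] --> c * l.
Proof. by move=> ul; apply: cvgM => //; exact: cvg_cst. Qed.

Lemma cvgr_scale {R : realType} (c l : R) (u : nat -> R) :
  u @ \oo --> l -> (fun n => c * u n) @ \oo --> c * l.
Proof. exact: cvgr_scaleF. Qed.

Lemma cvgr_sum {R : realType} {S : Type} {F : set_system S} {FF : Filter F}
    N (u : 'I_N -> S -> R) (l : 'I_N -> R) :
  (forall i, u i x @[x --> F] --> l i) ->
  \sum_(i < N) u i x @[x --> F] --> \sum_(i < N) l i.
Proof.
elim: N u l => [|N IH] u l ul.
  rewrite big_ord0 (_ : (fun x => _) = cst 0); first exact: cvg_cst.
  by apply/funext => x; rewrite big_ord0.
rewrite big_ord_recl (_ : (fun x => _) = (fun x => u ord0 x + \sum_(i < N) u (lift ord0 i) x)).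
  by apply: cvgD => //; exact: IH.
by apply/funext => x; rewrite big_ord_recl.
Qed.

Lemma cvgr_eq_lim {R : realType} (l l' : R) (u v : nat -> R) :
  u @ \oo --> l -> v @ \oo --> l' -> (forall n, u n = v n) -> l = l'.
Proof.
move=> ul vl uv; have vE : v = u by apply/funext => n; rewrite uv.
by move: vl; rewrite vE => vl; exact: (cvg_unique _ ul vl).
Qed.

Section BoundedExpectation.
Context {d} {T : measurableType d} {R : realType} (P : probability T R).

(** Boundedness makes every integrability condition below automatic. *)
Definition bdd_rv (f : T -> R) : Prop :=
  measurable_fun setT f /\ exists M : R, forall w, `|f w| <= M.

Definition Ev (f : T -> R) : R := \int[P]_w f w.

Lemma bdd_rv_integrable f : bdd_rv f -> P.-integrable setT (EFin \o f).
Proof.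
move=> [mf [M fM]]; apply: measurable_bounded_integrable => //.
  by rewrite (le_lt_trans (probability_le1 P measurableT))// ltry.
exists M; split; first exact: num_real.
by move=> x Mx w _; exact: le_trans (fM w) (ltW Mx).
Qed.

Lemma bdd_rv_cst c : bdd_rv (fun=> c).
Proof. by split; [exact: measurable_cst | exists `|c|]. Qed.

Lemma bdd_rvD f g : bdd_rv f -> bdd_rv g -> bdd_rv (fun w => f w + g w).
Proof.
move=> [mf [M fM]] [mg [N gN]]; split; first exact: measurable_funD.
by exists (M + N) => w; rewrite (le_trans (ler_normD _ _))// lerD.
Qed.

Lemma bdd_rvM f g : bdd_rv f -> bdd_rv g -> bdd_rv (fun w => f w * g w).
Proof.
move=> [mf [M fM]] [mg [N gN]]; split; first exact: measurable_funM.
by exists (M * N) => w; rewrite normrM ler_pM.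
Qed.

Lemma bdd_rvN f : bdd_rv f -> bdd_rv (fun w => - f w).
Proof.
move=> [mf [M fM]]; split; first exact: measurable_funN.
by exists M => w; rewrite normrN.
Qed.

Lemma bdd_rvB f g : bdd_rv f -> bdd_rv g -> bdd_rv (fun w => f w - g w).
Proof. by move=> bf bg; apply: bdd_rvD => //; exact: bdd_rvN. Qed.

Lemma bdd_rv_indic A : measurable A -> bdd_rv (\1_A : T -> R).
Proof.
move=> mA; split; first exact: measurable_indic.
by exists 1 => w; rewrite indicE; case: (_ \in _); rewrite ?normr1 ?normr0.
Qed.

Lemma bdd_rv_sum I (r : seq I) (Q : pred I) (f : I -> T -> R) :
  (forall i, Q i -> bdd_rv (f i)) ->
  bdd_rv (fun w => \sum_(i <- r | Q i) f i w).
Proof.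
move=> bf; elim: r => [|i r IH].
  by under eq_fun do rewrite big_nil; exact: bdd_rv_cst.
under eq_fun do rewrite big_cons.
by case: (boolP (Q i)) => // Qi; apply: bdd_rvD => //; exact: bf.
Qed.

Lemma bdd_rv_prod I (r : seq I) (Q : pred I) (f : I -> T -> R) :
  (forall i, Q i -> bdd_rv (f i)) ->
  bdd_rv (fun w => \prod_(i <- r | Q i) f i w).
Proof.
move=> bf; elim: r => [|i r IH].
  by under eq_fun do rewrite big_nil; exact: bdd_rv_cst.
under eq_fun do rewrite big_cons.
by case: (boolP (Q i)) => // Qi; apply: bdd_rvM => //; exact: bf.
Qed.

Lemma Ev_cst c : Ev (fun=> c) = c.
Proof.
rewrite /Ev Rintegral_cst//=.
by rewrite probability_setT/= mulr1.
Qed.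

Lemma EvD f g : bdd_rv f -> bdd_rv g -> Ev (fun w => f w + g w) = Ev f + Ev g.
Proof. by move=> bf bg; rewrite /Ev RintegralD//; exact: bdd_rv_integrable. Qed.

Lemma EvZ c f : bdd_rv f -> Ev (fun w => c * f w) = c * Ev f.
Proof. by move=> bf; rewrite /Ev RintegralZl//; exact: bdd_rv_integrable. Qed.

Lemma EvN f : bdd_rv f -> Ev (fun w => - f w) = - Ev f.
Proof.
move=> bf; rewrite -mulN1r -EvZ//; congr Ev; apply/funext => w.
by rewrite mulN1r.
Qed.

Lemma EvB f g : bdd_rv f -> bdd_rv g -> Ev (fun w => f w - g w) = Ev f - Ev g.
Proof. by move=> bf bg; rewrite EvD ?EvN//; exact: bdd_rvN. Qed.

Lemma Ev_sum I (r : seq I) (Q : pred I) (f : I -> T -> R) :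
  (forall i, Q i -> bdd_rv (f i)) ->
  Ev (fun w => \sum_(i <- r | Q i) f i w) = \sum_(i <- r | Q i) Ev (f i).
Proof.
move=> bf; elim: r => [|i r IH].
  by under eq_fun do rewrite big_nil; rewrite big_nil Ev_cst.
under eq_fun do rewrite big_cons.
rewrite big_cons; case: (boolP (Q i)) => // Qi.
by rewrite EvD ?IH//; [exact: bf | exact: bdd_rv_sum].
Qed.

Lemma Ev_ge0 f : (forall w, 0 <= f w) -> 0 <= Ev f.
Proof. by move=> f0; exact: Rintegral_ge0. Qed.

Lemma Ev_le f g : bdd_rv f -> bdd_rv g -> (forall w, f w <= g w) ->
  Ev f <= Ev g.
Proof.
by move=> bf bg fg; apply: le_Rintegral => //; exact: bdd_rv_integrable.
Qed.

Lemma Ev_indic A : measurable A -> Ev \1_A = fine (P A).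
Proof.
by move=> mA; rewrite /Ev /Rintegral integral_indic// setIT.
Qed.

Lemma Ev_ae f g : bdd_rv f -> bdd_rv g -> {ae P, forall w, f w = g w} ->
  Ev f = Ev g.
Proof.
move=> [mf _] [mg _] fg; rewrite /Ev /Rintegral; congr fine.
apply: ae_eq_integral => //; [exact/measurable_EFinP|exact/measurable_EFinP|].
by apply: filterS fg => w fgw _ /=; rewrite fgw.
Qed.

Lemma Ev_cvg (f_ : nat -> T -> R) f M : (forall n, measurable_fun setT (f_ n)) ->
  bdd_rv f -> (forall n w, `|f_ n w| <= M) ->
  {ae P, forall w, f_ n w @[n --> \oo] --> f w} ->
  Ev (f_ n) @[n --> \oo] --> Ev f.
Proof.
move=> mf_ [mf bf] fM cf.
have [] := @dominated_convergence _ T R P setT measurableT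
  (fun n => EFin \o f_ n) (EFin \o f) (fun=> M%:E).
- by move=> n; exact/measurable_EFinP.
- exact/measurable_EFinP.
- by apply: filterS cf => w cw _; apply/cvg_EFin => //; exact: nearW.
- by have := bdd_rv_integrable (bdd_rv_cst M).
- by apply: aeW => w n _ /=; rewrite lee_fin.
move=> _ _ h; rewrite /Ev /Rintegral; apply: fine_cvg.
rewrite fineK//; apply: integrable_fin_num => //.
by apply: bdd_rv_integrable.
Qed.

(** This gives the measurability of quantities read off at a random index, such as
the number of balls thrown up to a given time. *)
Lemma measurable_glue d' (S : measurableType d') (U : T -> nat)
    (g : nat -> T -> S) :
  measurable_fun setT U -> (forall u, measurable_fun setT (g u)) ->
  measurable_fun setT (fun w => g (U w) w).
Proof.
move=> mU mg.
have mE u : measurable (U @^-1` [set u]) by rewrite -[X in measurable X]setTI; exact: mU.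
have -> : [set: T] = \bigcup_u (U @^-1` [set u]).
  by apply/seteqP; split => // w _; exists (U w).
apply/measurable_fun_bigcup => // u.
apply: (@eq_measurable_fun _ _ _ _ _ (g u)).
  by move=> w; rewrite inE/= => ->.
exact: measurable_funTS.
Qed.

Lemma measurable_nat (U : T -> nat) :
  (forall u, measurable [set w | U w = u]) -> measurable_fun setT U.
Proof.
move=> mU _ B _; rewrite setTI.
have -> : U @^-1` B = \bigcup_(u in B) [set w | U w = u].
  by apply/seteqP; split => [w Bw|w [u Bu /= eu]]; [exists (U w) | rewrite /preimage/= eu].
by apply: bigcup_measurable.
Qed.

Lemma bdd_rv_nat2 (U V : T -> nat) (f : nat -> nat -> R) M :
  measurable_fun setT U -> measurable_fun setT V ->
  (forall u v, `|f u v| <= M) -> bdd_rv (fun w => f (U w) (V w)).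
Proof.
move=> mU mV fM; split; last by exists M.
apply: (@measurable_glue _ _ U (fun u w => f u (V w))) => // u.
apply: (@measurable_glue _ _ V (fun v w => f u v)) => // v.
Qed.

Lemma bdd_rv_nat (U : T -> nat) (f : nat -> R) M :
  measurable_fun setT U -> (forall u, `|f u| <= M) -> bdd_rv (fun w => f (U w)).
Proof. by move=> mU fM; exact: (@bdd_rv_nat2 U U (fun u _ => f u) M). Qed.

Lemma bdd_rv_eq (U : T -> nat) u : measurable_fun setT U ->
  bdd_rv (fun w => (U w == u)%:R).
Proof.
move=> mU; apply: (@bdd_rv_nat U (fun v => (v == u)%:R) 1) => // v.
by case: eqP; rewrite ?normr1 ?normr0.
Qed.

(** Bounded convergence along the partition into the level sets of [U]. *)
Lemma Ev_partition (U : T -> nat) f : measurable_fun setT U -> bdd_rv f ->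
  series (fun u => Ev (fun w => f w * (U w == u)%:R)) @ \oo --> Ev f.
Proof.
move=> mU bf.
have bU u : bdd_rv (fun w => f w * (U w == u)%:R).
  by apply: bdd_rvM => //; exact: bdd_rv_eq.
have -> : series (fun u => Ev (fun w => f w * (U w == u)%:R)) =
    (fun n => Ev (fun w => f w * (U w < n)%:R)).
  apply/funext => n; rewrite /series/= -Ev_sum//.
  congr Ev; apply/funext => w; rewrite -mulr_sumr; congr (_ * _).
  elim: n => [|n IH]; first by rewrite big_geq.
  rewrite big_nat_recr//= IH ltnS [in RHS]leq_eqVlt.
  by case: eqP => [->|_] /=; rewrite ?ltnn ?addr0 ?add0r.
have [mf [M fM]] := bf.
apply: (@Ev_cvg _ _ M) => //.
- move=> n; apply: (bdd_rvM bf _).1.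
  apply: (@bdd_rv_nat U (fun u => (u < n)%:R) 1) => // u.
  by case: ltnP; rewrite ?normr1 ?normr0.
- move=> n w; rewrite normrM (le_trans _ (fM w))// ler_piMr//.
  by case: ltnP; rewrite ?normr1 ?normr0.
apply: aeW => w; apply: cvg_near_cst; near=> n.
suff -> : (U w < n)%N by rewrite mulr1.
by near: n; exact: nbhs_infty_gt.
Unshelve. all: by end_near. Qed.

End BoundedExpectation.

(** Induction on the index: once the coefficients before [n] vanish, the tail of the
series gives [`|b n| <= 2 * M * x] for small [x]. *)
Lemma power_series_eq0 {R : realType} (b : nat -> R) M :
  (forall n, `|b n| <= M) ->
  (forall x : R, 0 <= x < 1 -> series (fun n => b n * x ^+ n) @ \oo --> (0 : R)) ->
  forall n, b n = 0.
Proof.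
move=> bM b0; elim/ltn_ind => n IH; apply/eqP; rewrite -normr_eq0.
have M0 : 0 <= M by exact: le_trans (bM 0).
have key x : 0 < x <= 2^-1 -> `|b n| <= 2 * M * x.
  move=> /andP[x0 x2].
  have x1 : x < 1 by lra.
  have x01 : 0 <= x < 1 by rewrite ltW.
  suff : `|b n * x ^+ n| <= 2 * M * x ^+ n.+1.
    by rewrite normrM (ger0_norm (exprn_ge0 _ (ltW x0))) exprS mulrA ler_pM2r ?exprn_gt0.
  have geo m : \sum_(n.+1 <= i < n.+1 + m) x ^+ i <= 2 * x ^+ n.+1.
    suff : \sum_(n.+1 <= i < n.+1 + m) x ^+ i <=
        2 * x ^+ n.+1 * (1 - x ^+ m).
      by move/le_trans; apply; rewrite ler_piMr ?gerBl ?exprn_ge0 ?mulr_ge0 ?exprn_ge0// ltW.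
    elim: m => [|m IHm]; first by rewrite addn0 big_geq// expr0 subrr mulr0.
    rewrite addnS big_nat_recr ?leq_addr//= (le_trans (lerD IHm (lexx _)))//.
    rewrite exprD -[X in _ + X]mulr1 [x ^+ m.+1]exprS.
    have : 0 <= x ^+ n.+1 * x ^+ m by rewrite mulr_ge0 ?exprn_ge0 ?ltW.
    set y := x ^+ n.+1; set z := x ^+ m => yz.
    have : y * z * (2 * x) <= y * z * 1 by rewrite ler_wpM2l//; lra.
    lra.
  rewrite -normrN -sub0r.
  have /cvg_norm h : (series (fun k => b k * x ^+ k) m - b n * x ^+ n) @[m --> \oo]
      --> (0 - b n * x ^+ n).
    by apply: cvgB; [exact: b0 | exact: cvg_cst].
  apply: (cvgr_to_le h); exists n.+1 => // m /= nm.
  rewrite /series/= (big_cat_nat (leq0n n.+1) nm)//= big_nat_recr//= big_nat.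
  rewrite big1 ?add0r; last by move=> i /andP[_ /IH ->]; rewrite mul0r.
  rewrite addrAC subrr add0r -(subnKC nm).
  rewrite (le_trans (ler_norm_sum _ _ _))//.
  rewrite (@le_trans _ _ (M * \sum_(n.+1 <= i < n.+1 + (m - n.+1)) x ^+ i))//.
    rewrite mulr_sumr; apply: ler_sum => i _.
    by rewrite normrM (ger0_norm (exprn_ge0 _ (ltW x0))) ler_wpM2r// exprn_ge0// ltW.
  by rewrite -mulrA mulrCA ler_wpM2l.
rewrite eq_le normr_ge0 andbT; apply/ler_addgt0Pl => e e0; rewrite addr0.
set x := Num.min 2^-1 (e / (2 * M + 1)).
have D0 : 0 < 2 * M + 1 by lra.
have x0 : 0 < x by rewrite /x lt_min invr_gt0 ltr0n/= divr_gt0.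
have xe : x <= e / (2 * M + 1) by rewrite /x ge_min lexx orbT.
rewrite (le_trans (key x _))//; first by rewrite x0/= /x ge_min lexx.
have : (2 * M + 1) * x <= e by rewrite mulrC -ler_pdivlMr.
lra.
Qed.

Section GeneratingFunctions.
Context {d} {T : measurableType d} {R : realType} (P : probability T R).
Notation Ev := (Ev P).

(** A generating function [Ev (Y * x ^ U)] that is, as a function of [x], a
multiple of a given power series determines the weights of [Y] on the level
sets of [U]. *)
Lemma Ev_pgf_coef (U : T -> nat) (Y : T -> R) (a : nat -> R) (A : R -> R)
    (c M : R) :
  measurable_fun setT U -> bdd_rv Y -> (forall n, `|a n| <= M) ->
  (forall x : R, 0 <= x < 1 -> series (fun n => a n * x ^+ n) @ \oo --> A x) ->
  (forall x : R, 0 <= x < 1 -> Ev (fun w => Y w * x ^+ U w) = c * A x) ->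
  forall u, Ev (fun w => Y w * (U w == u)%:R) = c * a u.
Proof.
move=> mU bY aM aA YA u.
have bYU v : bdd_rv (fun w => Y w * (U w == v)%:R).
  by apply: bdd_rvM => //; exact: bdd_rv_eq.
have [mY [N YN]] := bY.
apply/eqP; rewrite -subr_eq0; apply/eqP; move: u.
apply: (@power_series_eq0 _ _ (N + `|c| * M)).
  move=> n; rewrite (le_trans (ler_normB _ _))// lerD//.
    rewrite ler_norml.
    have YUN w : `|Y w * (U w == n)%:R| <= N.
      by rewrite normrM (le_trans _ (YN w))// ler_piMr//; case: eqP; rewrite ?normr1 ?normr0.
    rewrite -{1}(Ev_cst P (- N)) -{2}(Ev_cst P N); apply/andP; split.
      apply: Ev_le => [|//|w]; first exact: bdd_rv_cst.
      by have := YUN w; rewrite ler_norml => /andP[].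
    apply: Ev_le => [//||w]; first exact: bdd_rv_cst.
    by have := YUN w; rewrite ler_norml => /andP[].
  by rewrite normrM ler_wpM2l.
move=> x x01.
have -> : (fun n => (Ev (fun w => Y w * (U w == n)%:R) - c * a n) * x ^+ n) =
   (fun n => Ev (fun w => (Y w * x ^+ U w) * (U w == n)%:R)) \- (fun n => c * (a n * x ^+ n)).
  apply/funext => n /=; rewrite mulrBl mulrA; congr (_ - _).
  rewrite mulrC -EvZ//; congr Ev; apply/funext => w.
  case: eqP => [->|_]; last by rewrite !mulr0.
  by rewrite !mulr1 mulrC.
have -> : series ((fun n => Ev (fun w => (Y w * x ^+ U w) * (U w == n)%:R)) \-
    (fun n => c * (a n * x ^+ n))) =
   (fun n => series (fun n => Ev (fun w => (Y w * x ^+ U w) * (U w == n)%:R)) n -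
      c * series (fun n => a n * x ^+ n) n).
  by apply/funext => n; rewrite /series/= sumrB mulr_sumr.
rewrite -(subrr (c * A x)); apply: cvgB; last by apply: cvgr_scale; exact: aA.
rewrite -YA//; apply: Ev_partition => //; apply: bdd_rvM => //.
apply: (@bdd_rv_nat _ _ _ U (fun u => x ^+ u) 1) => // v.
by rewrite normrX exprn_ile1// ger0_norm; case/andP: x01 => // x0 /ltW.
Qed.

(** Summation over the countably many level sets of [U], then of [V]. *)
Lemma Ev_factor2 (U V : T -> nat) (Y : T -> R) (c : R) :
  measurable_fun setT U -> measurable_fun setT V -> bdd_rv Y ->
  (forall u v, Ev (fun w => Y w * (U w == u)%:R * (V w == v)%:R) =
     c * Ev (fun w => (U w == u)%:R * (V w == v)%:R)) ->
  forall (f : nat -> nat -> R) M, (forall u v, `|f u v| <= M) ->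
  Ev (fun w => Y w * f (U w) (V w)) = c * Ev (fun w => f (U w) (V w)).
Proof.
move=> mU mV bY YUV f M fM.
have bf := bdd_rv_nat2 mU mV fM.
have bU u := @bdd_rv_eq _ _ R _ u mU; have bV v := @bdd_rv_eq _ _ R _ v mV.
have part Z : bdd_rv Z -> series (fun u => Ev (fun w => Z w * f (U w) (V w) *
    (U w == u)%:R)) @ \oo --> Ev (fun w => Z w * f (U w) (V w)).
  by move=> bZ; apply: Ev_partition => //; exact: bdd_rvM.
have part2 Z u : bdd_rv Z -> series (fun v => f u v * Ev (fun w => Z w * (U w == u)%:R *
    (V w == v)%:R)) @ \oo --> Ev (fun w => Z w * f (U w) (V w) * (U w == u)%:R).
  move=> bZ.
  rewrite (_ : (fun v => _) = (fun v => Ev (fun w => Z w * f (U w) (V w) *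
    (U w == u)%:R * (V w == v)%:R))); last first.
    apply/funext => v; rewrite -EvZ; last by apply: bdd_rvM => //; exact: bdd_rvM.
    congr Ev; apply/funext => w.
    case: (U w =P u) => [->|_]; last by rewrite !(mulr0, mul0r).
    by case: (V w =P v) => [->|_]; rewrite !(mulr0, mulr1)// mulrC.
  by apply: Ev_partition => //; apply: bdd_rvM => //; exact: bdd_rvM.
have b1 : bdd_rv (fun _ : T => 1 : R) by exact: bdd_rv_cst.
have e2 u : Ev (fun w => Y w * f (U w) (V w) * (U w == u)%:R) =
    c * Ev (fun w => 1 * f (U w) (V w) * (U w == u)%:R).
  have h1 := part2 _ u bY; have h2 := cvgr_scale (c := c) (part2 _ u b1).
  apply: (cvgr_eq_lim h1 h2) => n; rewrite /series/= mulr_sumr.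
  apply: eq_bigr => v _; rewrite YUV mulrCA.
  by under [in RHS]eq_fun do rewrite mul1r.
have h1 := part _ bY; have h2 := cvgr_scale (c := c) (part _ b1).
rewrite (_ : (fun w => f (U w) (V w)) = (fun w => 1 * f (U w) (V w))); last first.
  by apply/funext => w; rewrite mul1r.
apply: (cvgr_eq_lim h1 h2) => n; rewrite /series/= mulr_sumr.
by apply: eq_bigr => u _; rewrite e2.
Qed.

End GeneratingFunctions.

(** * Blocks of independent sigma-algebras *)

Section IndependentBlocks.
Context {d} {T : measurableType d} {R : realType} (P : probability T R).
Variables (I : eqType) (F : I -> set (set T)).
Hypothesis F_indep : mutually_independent P F.
Hypothesis F_measurable : forall i A, F i A -> measurable A.
Hypothesis FI : forall i, setI_closed (F i).

(** The pi-system that generates the sigma-algebra of the families indexed by [J]. *)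
Definition rectangles (J : seq I) : set (set T) :=
  [set E | exists2 A : I -> set T, (forall i, i \in J -> F i (A i)) &
     E = \big[setI/setT]_(i <- J) A i].

Lemma rectangles_measurable J E : rectangles J E -> measurable E.
Proof.
move=> [A FA ->]; rewrite big_seq; apply: big_ind => //.
- exact: measurableI.
- by move=> i iJ; exact: F_measurable (FA _ iJ).
Qed.

Lemma rectanglesI J : setI_closed (rectangles J).
Proof.
move=> _ _ [A FA ->] [B FB ->]; exists (fun i => A i `&` B i).
  by move=> i iJ; apply: FI; [exact: FA | exact: FB].
by rewrite -big_split.
Qed.

Lemma g_rectangles_measurable J E : <<s rectangles J >> E -> measurable E.
Proof.
apply: smallest_sub; first exact: sigma_algebra_measurable.
by move=> A; exact: rectangles_measurable.
Qed.

Lemma rectangles_indep J1 J2 E B : uniq (J1 ++ J2) ->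
  rectangles J1 E -> rectangles J2 B -> P (E `&` B) = (P E * P B)%E.
Proof.
move=> uJ [A FA ->] [C FC ->].
pose D i := if i \in J1 then A i else C i.
have uJ' := uJ; move: uJ'; rewrite cat_uniq => /and3P[u1 /hasPn J12 u2].
have e1 : \big[setI/setT]_(i <- J1) A i = \big[setI/setT]_(i <- J1) D i.
  by apply: eq_big_seq => i iJ; rewrite /D iJ.
have e2 : \big[setI/setT]_(i <- J2) C i = \big[setI/setT]_(i <- J2) D i.
  by apply: eq_big_seq => i /J12/= iJ; rewrite /D (negbTE iJ).
have FD1 i : i \in J1 -> F i (D i) by move=> iJ; rewrite /D iJ; exact: FA.
have FD2 i : i \in J2 -> F i (D i).
  by move=> iJ; rewrite /D (negbTE (J12 _ iJ)); exact: FC.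
have FD i : i \in J1 ++ J2 -> F i (D i).
  by rewrite mem_cat => /orP[]; [exact: FD1 | exact: FD2].
have h := F_indep uJ FD; rewrite !big_cat in h.
rewrite e1 e2; apply: (eq_trans h).
by rewrite (F_indep u1 FD1) (F_indep u2 FD2).
Qed.

(** A sub-sigma-algebra generated by finitely many of the independent families
is independent of the events that involve other families: the events
satisfying the product formula form a Dynkin system. *)
Lemma g_rectangles_indep J1 J2 E B : uniq (J1 ++ J2) ->
  <<s rectangles J1 >> E -> rectangles J2 B -> P (E `&` B) = (P E * P B)%E.
Proof.
move=> uJ sE RB.
have mB := rectangles_measurable RB.
suff : <<s rectangles J1 >> `<=`
    [set E | measurable E /\ P (E `&` B) = (P E * P B)%E].
  by move=> /(_ _ sE)[].
apply: lambda_system_subset => //; first exact: rectanglesI; last first.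
  move=> A RA; split; first exact: rectangles_measurable RA.
  exact: rectangles_indep uJ RA RB.
apply/dynkin_lambda_system; split.
- by split => //; rewrite setTI probability_setT mul1e.
- move=> A [mA PA]; split; first exact: measurableC.
  rewrite setIC -setDE measureD//; last first.
    by rewrite (le_lt_trans (probability_le1 _ _))// ltry.
  transitivity (P B - P A * P B)%E.
    by congr (_ - _)%E; rewrite setIC; exact: PA.
  rewrite probability_setC// muleBl ?mul1e ?fin_num_measure//.
- move=> A tA mPA; split.
    by apply: bigcup_measurable => k _; exact: (mPA k).1.
  rewrite setI_bigcupl measure_bigcup//=; last 2 first.
    by move=> k _; apply: measurableI => //; exact: (mPA k).1.
    by apply: trivIset_setIr.
  rewrite measure_bigcup//=; last by move=> k _; exact: (mPA k).1.
  rewrite muleC -(fineK (fin_num_measure P B mB)) -nneseriesZl//.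
  apply: eq_eseriesr => k _; rewrite fineK ?fin_num_measure// muleC.
  exact: (mPA k).2.
Qed.

End IndependentBlocks.

(** Disintegration: the pair has the product law, so Fubini's theorem applies to
every measurable set of pairs. *)
Lemma indep_density {d d'} {T : measurableType d} {S : measurableType d'}
    {R : realType} (P : probability T R) (Z : {RV P >-> S}) (x : {RV P >-> R})
    (f : R -> R) (C : set (S * R)) :
  measurable_fun setT f -> (forall r, 0 <= f r) ->
  (forall B, measurable B ->
     P (x @^-1` B) = (\int[lebesgue_measure]_(r in B) (f r)%:E)%E) ->
  (forall A B, measurable A -> measurable B ->
     P (Z @^-1` A `&` x @^-1` B) = (P (Z @^-1` A) * P (x @^-1` B))%E) ->
  measurable C ->
  P [set w | C (Z w, x w)] =
  (\int[lebesgue_measure]_r ((f r)%:E * P [set w | C (Z w, r)]))%E.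
Proof.
move=> mf f0 lawx Zx mC.
have mpair : measurable_fun setT (fun w => (Z w, x w)).
  by apply: measurable_fun_pair; exact: measurable_funPT.
pose W : {RV P >-> (S * R)%type} := mfun_Sub (mem_set mpair).
have WE A B : measurable A -> measurable B ->
    distribution P W (A `*` B) = (distribution P Z A * distribution P x B)%E.
  by move=> mA mB; exact: Zx.
have -> : P [set w | C (Z w, x w)] = distribution P W C by [].
rewrite -(@product_measure_unique _ _ _ _ R (distribution P Z) (distribution P x)
  (distribution P W) WE C mC) /product_measure1.
transitivity (\int[distribution P Z]_w \int[lebesgue_measure]_r
    ((\1_C (w, r))%:E * (f r)%:E))%E.
  apply: eq_integral => w _.
  have -> : (distribution P x \o xsection C) w =
      (\int[lebesgue_measure]_(r in xsection C w) (f r)%:E)%E.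
    by apply: lawx; exact: measurable_xsection.
  rewrite integral_mkcond/=; apply: eq_integral => r _.
  rewrite patchE indicE mem_xsection.
  by case: (_ \in C); rewrite ?mul1e ?mul0e.
have mCf : measurable_fun setT (fun z : S * R => ((\1_C z)%:E * (f z.2)%:E)%E).
  apply: emeasurable_funM; first by apply/measurable_EFinP.
  by apply/measurable_EFinP; apply: measurableT_comp.
rewrite (@fubini_tonelli _ _ _ _ _ (distribution P Z) (@lebesgue_measure R)
  (fun z => ((\1_C z)%:E * (f z.2)%:E)%E))//; last first.
  by move=> z; rewrite mule_ge0// lee_fin.
apply: eq_integral => r _.
have mC2 := measurable_ysection r mC.
transitivity (\int[distribution P Z]_w ((\1_(ysection C r) w)%:E * (f r)%:E))%E.
  by apply: eq_integral => w _; rewrite !indicE mem_ysection.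
rewrite ge0_integralZr//=; last by rewrite lee_fin.
  2: by apply/measurable_EFinP.
rewrite muleC; congr (_ * _)%E.
rewrite integral_indic ?setIT//; congr (P _).
by apply/seteqP; split => w; rewrite /ysection/= inE.
Qed.

Section Increment.
Context {d} {T : measurableType d} {R : realType} (P : probability T R).
Variables (p : nat -> R) (xi : nat -> {RV P >-> R}) (X : nat -> {RV P >-> nat}).
Hypothesis scheme : poissonized_karlin p xi X.

Let F := karlin_sigma xi X.

Lemma karlin_sigma_measurable i A : F i A -> measurable A.
Proof.
case: i => n [B mB <-]; rewrite setTI.
  by rewrite -[X in measurable X]setTI; exact: measurable_funPT.
by rewrite -[X in measurable X]setTI; exact: measurable_funPT.
Qed.

Lemma karlin_sigmaI i : setI_closed (F i).
Proof.
case: i => n _ _ [B mB <-] [C mC <-]; rewrite -setIIr -preimage_setI.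
  by exists (B `&` C) => //; exact: measurableI.
by exists (B `&` C).
Qed.

Let J n : seq (nat + nat) := [seq inl i | i <- iota 0 n].

(** The events that depend on the first [n] waiting times, given by their
generators. *)
Definition past n : set (set T) := rectangles F (J n).

Lemma past_measurable n E : <<s past n >> E -> measurable E.
Proof. exact: (g_rectangles_measurable karlin_sigma_measurable). Qed.

Let idp n (w : T) : g_sigma_algebraType (past n) := w.

Let midp n : measurable_fun setT (idp n).
Proof. by move=> _ A mA; rewrite setTI; exact: past_measurable mA. Qed.

Lemma measurable_xi_past n i : (i < n)%N ->
  measurable_fun setT (xi i : g_sigma_algebraType (past n) -> R).
Proof.
move=> ilt _ B mB; rewrite setTI; apply: sub_sigma_algebra.
exists (fun k => if k == inl i then xi i @^-1` B else setT).
  move=> k; case: eqP => [-> _|_ _]; first by exists B; rewrite ?setTI.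
  by case: k => n'; exists setT => //; rewrite preimage_setT setTI.
rewrite (bigD1_seq (inl i))/=; last 2 first.
- by apply/mapP; exists i => //; rewrite mem_iota.
- by rewrite map_inj_uniq ?iota_uniq// => x y [].
rewrite eqxx big1 ?setIT// => k /negbTE -> //.
Qed.

(** Fubini for the next increment, which is exponential and independent of the
past. *)
Lemma past_increment n (C : set (g_sigma_algebraType (past n) * R)%type) :
  measurable C ->
  P [set w | C (w, xi n w)] =
  (\int[lebesgue_measure]_x ((exponential_pdf 1 x)%:E * P [set w | C (w, x)]))%E.
Proof.
move=> mC.
apply: (@indep_density _ _ T (g_sigma_algebraType (past n)) R P
  (mfun_Sub (mem_set (@midp n))) (xi n) (exponential_pdf 1)) => //.
- exact: measurable_exponential_pdf.
- by move=> r; exact: exponential_pdf_ge0.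
- by move=> B mB; exact: (increment_law scheme n mB).
- move=> A B mA mB.
  apply: (@g_rectangles_indep _ _ _ P _ F (karlin_independent scheme)
    karlin_sigma_measurable karlin_sigmaI (J n) [:: inl n]) => //.
    rewrite cat_uniq map_inj_uniq ?iota_uniq//=; last by move=> x y [].
    rewrite orbF andbT; apply/negP => /mapP[k]; rewrite mem_iota add0n => /andP[_ kn] [nk].
    by rewrite nk ltnn in kn.
  exists (fun k => if k == inl n then xi n @^-1` B else setT).
    by move=> k; rewrite inE => /eqP ->; rewrite eqxx; exists B; rewrite ?setTI.
  by rewrite big_seq1 eqxx.
Qed.

End Increment.

(** * Poisson weights and tails *)

Section PoissonTail.
Context {R : realType}.
Implicit Types (y z c u v r a b : R) (i j n : nat).

Definition poi i y : R := expR (- y) * y ^+ i / i`!%:R.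

(** The probability that a Poisson variable of mean [y] is at least [j]. *)
Definition ptail j y : R := 1 - \sum_(i < j) poi i y.

Lemma ptail0 y : ptail 0 y = 1.
Proof. by rewrite /ptail big_ord0 subr0. Qed.

Lemma ptailS j y : ptail j.+1 y = ptail j y - poi j y.
Proof. by rewrite /ptail big_ord_recr/= opprD addrA. Qed.

Lemma poi0 y : poi 0 y = expR (- y).
Proof. by rewrite /poi expr0 mulr1 fact0 divr1. Qed.

Lemma ptail1 y : ptail 1 y = 1 - expR (- y).
Proof. by rewrite ptailS ptail0 poi0. Qed.

Lemma poi_ge0 i y : 0 <= y -> 0 <= poi i y.
Proof. by move=> y0; rewrite /poi !mulr_ge0 ?expR_ge0 ?invr_ge0 ?exprn_ge0. Qed.

Lemma ptail_at0 j : ptail j.+1 0 = 0.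
Proof.
rewrite /ptail big_ord_recl/= poi0 oppr0 expR0 big1 ?addr0 ?subrr// => i _.
by rewrite /poi expr0n/= mulr0 mul0r.
Qed.

Lemma is_derive_eqfun (f g : R -> R) y a b :
  is_derive y 1 f a -> (forall z, g z = f z) -> b = a -> is_derive y 1 g b.
Proof. by move=> h fg ->; rewrite (_ : g = f)//; apply/funext. Qed.

Lemma is_derive_expRN y :
  is_derive y 1 (fun z : R => expR (- z)) (- expR (- y)).
Proof.
have h := @is_derive1_comp R expR -%R y (expR (- y)) (- 1) (is_derive_expR _) (is_deriveNid _ _).
by apply: (is_derive_eqfun h) => //; rewrite mulrN1.
Qed.

Lemma is_derive_poi0 y : is_derive y 1 (poi 0) (- poi 0 y).
Proof.
by apply: (is_derive_eqfun (is_derive_expRN y)) => [z|]; rewrite poi0.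
Qed.

Lemma is_derive_poiS i y : is_derive y 1 (poi i.+1) (poi i y - poi i.+1 y).
Proof.
have hX := @is_deriveX _ _ (@id R) i.+1 y 1 1 (is_derive_id _ _).
have hM := @is_deriveM _ _ _ _ _ _ _ _ (is_derive_expRN y) hX.
have hZ := @is_deriveZ _ _ _ _ (i.+1`!%:R^-1) _ _ _ hM.
apply: (is_derive_eqfun hZ) => [z|]; first by rewrite /poi !fctE/= mulrC.
rewrite /poi !fctE/= factS natrM invfM /GRing.scale/=.
have i0 : (i.+1%:R : R) != 0 by rewrite pnatr_eq0.
have f0 : (i`!%:R : R) != 0 by rewrite pnatr_eq0 -lt0n fact_gt0.
move: (i.+1%:R) (i`!%:R) i0 f0 => a b a0 b0.
by field; rewrite ?a0 ?b0.
Qed.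

(** The tail is the distribution function of a gamma variable, with density
[poi j]. *)
Lemma is_derive_ptail j y : is_derive y 1 (ptail j.+1) (poi j y).
Proof.
elim: j => [|j IH].
  have h := @is_deriveB _ _ _ _ _ _ _ _ _ (@is_derive_cst _ _ _ (1 : R) y 1) (is_derive_poi0 y).
  apply: (is_derive_eqfun h) => [z|]; last by rewrite sub0r opprK.
  by rewrite ptail1 !fctE poi0.
have h := @is_deriveB _ _ _ _ _ _ _ _ _ IH (is_derive_poiS j y).
apply: (is_derive_eqfun h) => [z|]; last by rewrite opprB addrC subrK.
by rewrite ptailS.
Qed.

Lemma continuous_ptail j : continuous (ptail j).
Proof.
case: j => [|j] y.
  have -> : ptail 0 = cst 1 by apply/funext => z; rewrite ptail0.
  exact: cvg_cst.
have [dy _] := is_derive_ptail j y.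
by apply/differentiable_continuous/derivable1_diffP.
Qed.

Lemma continuous_expRN : continuous (fun z : R => expR (- z)).
Proof.
move=> y; have [dy _] := is_derive_expRN y.
by apply/differentiable_continuous/derivable1_diffP.
Qed.

(** The mean value theorem in the form used throughout: monotonicity from a given
nonnegative derivative. *)
Lemma is_derive_ge0_le (f df : R -> R) a b : a <= b ->
  (forall z : R, is_derive z 1 f (df z)) -> (forall z, a < z < b -> 0 <= df z) ->
  f a <= f b.
Proof.
move=> ab fd df0.
have dv (z : R) : derivable f z 1 by have [] := fd z.
have cf : continuous f by move=> z; apply/differentiable_continuous/derivable1_diffP.
apply: (@ger0_derive1_le_cc _ f a b) => //.
- by move=> z; rewrite in_itv/= => zab; rewrite derive1E; have [_ ->] := fd z; exact: df0.
- exact: continuous_subspaceT.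
- by rewrite in_itv/= lexx.
- by rewrite in_itv/= lexx ab.
Qed.

Lemma ptail_nd j a b : 0 <= a -> a <= b -> ptail j a <= ptail j b.
Proof.
case: j => [|j] a0 ab; first by rewrite !ptail0.
apply: (is_derive_ge0_le ab (is_derive_ptail j)) => z /andP[az _].
by rewrite poi_ge0// (le_trans a0)// ltW.
Qed.

Lemma ptail_ge0 j y : 0 <= y -> 0 <= ptail j y.
Proof.
case: j => [|j] y0; first by rewrite ptail0.
by rewrite -(ptail_at0 j) ptail_nd.
Qed.

Lemma ptail_le1 j y : 0 <= y -> ptail j y <= 1.
Proof. by move=> y0; rewrite /ptail gerBl sumr_ge0// => i _; exact: poi_ge0. Qed.

Lemma ptail_leS i j y : 0 <= y -> (i <= j)%N -> ptail j y <= ptail i y.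
Proof.
move=> y0 /subnK <-; elim: (j - i)%N => [//|n IH].
by rewrite addSn ptailS (le_trans _ IH)// gerBl poi_ge0.
Qed.

Lemma ptail1_le y : ptail 1 y <= y.
Proof. by rewrite ptail1; have := expR_ge1Dx (- y); lra. Qed.

Lemma ptail2_le y : 0 <= y -> ptail 2 y <= y ^+ 2.
Proof.
move=> y0; rewrite ptailS ptail1 /poi expr1 (_ : 1`! = 1%N)// divr1.
have h := expR_ge1Dx (- y); have := ler_wpM2r (addr_ge0 ler01 y0) h.
rewrite expr2; lra.
Qed.

(** The ratio [ptail j (c y) / ptail j y] is bounded by [c ^ j]: for [z = c y]
the density at [z] is at most [c ^ (j - 1)] times that at [y]. *)
Lemma ptail_scale j c y : 1 <= c -> 0 <= y ->
  ptail j (c * y) <= c ^+ j * ptail j y.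
Proof.
case: j => [|j] c1 y0; first by rewrite !ptail0 expr0 mulr1.
have c0 : 0 <= c by exact: le_trans c1.
pose f z := c ^+ j.+1 * ptail j.+1 z - ptail j.+1 (c * z).
have fd (z : R) : is_derive z 1 f (c ^+ j.+1 * poi j z - c * poi j (c * z)).
  have hc := @is_deriveZ _ _ _ (@id R) c z 1 1 (is_derive_id _ _).
  have h1 := @is_derive1_comp R (ptail j.+1) (c \*: (@id R)) z (poi j (c * z)) (c *: 1) (is_derive_ptail _ _) hc.
  have h2 := @is_deriveZ _ _ _ _ (c ^+ j.+1) _ _ _ (is_derive_ptail j z).
  have h := @is_deriveB _ _ _ _ _ _ _ _ _ h2 h1.
  by apply: (is_derive_eqfun h) => // ; rewrite /GRing.scale/= mulr1 [c * _]mulrC.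
rewrite -subr_ge0 -/(f y); suff : f 0 <= f y by rewrite /f mulr0 ptail_at0 mulr0 subrr.
apply: (is_derive_ge0_le y0 fd) => z /andP[z0 _].
rewrite /poi exprMn exprS.
have -> : c * c ^+ j * (expR (- z) * z ^+ j / j`!%:R) -
   c * (expR (- (c * z)) * (c ^+ j * z ^+ j) / j`!%:R) =
   (c * c ^+ j * z ^+ j / j`!%:R) * (expR (- z) - expR (- (c * z))) by ring.
rewrite mulr_ge0//; first by rewrite !mulr_ge0// ?invr_ge0 ?exprn_ge0// ltW.
by rewrite subr_ge0 ler_expR lerN2 ler_peMl// ltW.
Qed.

Lemma is_derive_conv n r z :
  is_derive z 1 (fun x => - (expR (- x) * ptail n.+1 (r - x)))
    (expR (- z) * ptail n (r - z)).
Proof.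
have hB := @is_deriveB _ _ _ _ _ _ _ _ _ (@is_derive_cst _ _ _ (r : R) z 1) (@is_derive_id _ _ z 1).
have h1 := @is_derive1_comp R (ptail n.+1) (cst r - (@id R)) z (poi n (r - z)) (0 - 1) (is_derive_ptail _ _) hB.
have hM := @is_deriveM _ _ _ _ _ _ _ _ (is_derive_expRN z) h1.
have h := @is_deriveN _ _ _ _ _ _ _ hM.
apply: (is_derive_eqfun h) => //.
rewrite /GRing.scale/= !fctE/= ptailS; ring.
Qed.

(** Convolution with the exponential law raises the index of the tail by one; the
primitive is the one of the preceding lemma. *)
Lemma expint_ptail n r c u v : u <= v ->
  (\int[lebesgue_measure]_(x in `[u, v]) (expR (- x) * (c * ptail n (r - x)))%:E =
   (c * (expR (- u) * ptail n.+1 (r - u) - expR (- v) * ptail n.+1 (r - v)))%:E)%E.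
Proof.
rewrite le_eqVlt => /predU1P[<-|uv].
  by rewrite set_itv1 integral_set1 subrr mulr0.
pose F := (fun x => c * - (expR (- x) * ptail n.+1 (r - x))).
have dF (z : R) : is_derive z 1 F (expR (- z) * (c * ptail n (r - z))).
  have h := @is_deriveZ _ _ _ _ c _ _ _ (is_derive_conv n r z).
  by apply: (is_derive_eqfun h) => //; rewrite /GRing.scale/=; ring.
have dv (z : R) : derivable F z 1 by have [] := dF z.
have cF : continuous F by move=> z; apply/differentiable_continuous/derivable1_diffP.
rewrite (@continuous_FTC2 _ _ F)//.
- by rewrite -EFinB /F; congr EFin; ring.
- apply: continuous_subspaceT => z; apply: cvgM; first exact: continuous_expRN.
  apply: cvgM; first exact: cvg_cst.
  apply: (@continuous_comp _ _ _ (fun x => r - x) (ptail n)); last exact: continuous_ptail.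
  by apply: cvgB; [exact: cvg_cst | exact: cvg_id].
- split => //.
  + exact/cvg_at_right_filter/cF.
  + exact/cvg_at_left_filter/cF.
- by move=> z _; rewrite derive1E; have [_ ->] := dF z.
Qed.

Lemma sum_poi_cvg y : (fun n => \sum_(i < n) poi i y) @ \oo --> (1 : R).
Proof.
have h : series (exp_coeff y) @ \oo --> expR y by exact: is_cvg_series_exp_coeff.
have := cvgr_scale (c := expR (- y)) h.
rewrite expRN mulVf ?gt_eqF ?expR_gt0// => h'.
apply: cvg_trans h'; apply: near_eq_cvg; apply: nearW => n /=.
rewrite /series/= big_mkord mulr_sumr; apply: eq_bigr => i _.
by rewrite /poi /exp_coeff/= expRN mulrA.
Qed.

Lemma ptail_cvg0 y : (fun n => ptail n y) @ \oo --> (0 : R).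
Proof.
rewrite -(subrr 1); apply: cvgB; [exact: cvg_cst | exact: sum_poi_cvg].
Qed.

End PoissonTail.

(** * The law of the arrival times *)

Section Renewal.
Context {d} {T : measurableType d} {R : realType} (P : probability T R).
Variables (p : nat -> R) (xi : nat -> {RV P >-> R}) (X : nat -> {RV P >-> nat}).
Hypothesis scheme : poissonized_karlin p xi X.
Implicit Types (s t r : R) (a b n : nat).

Notation past := (past xi X).

(** Time of the [n]-th arrival; [throw_time] is shifted by one. *)
Definition psum n (w : T) : R := \sum_(i < n) xi i w.

Lemma psumS n w : psum n.+1 w = psum n w + xi n w.
Proof. by rewrite /psum big_ord_recr. Qed.

Lemma measurable_psum_past n m : (m <= n)%N ->
  measurable_fun setT (psum m : g_sigma_algebraType (past n) -> R).
Proof.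
move=> mn; elim: m mn => [|m IH] mn.
  rewrite (_ : psum 0 = cst 0); first exact: measurable_cst.
  by apply/funext => w; rewrite /psum big_ord0.
rewrite (_ : psum m.+1 = fun w => psum m w + xi m w); last first.
  by apply/funext => w; rewrite psumS.
by apply: measurable_funD; [apply: IH; exact: ltnW | exact: measurable_xi_past].
Qed.

Lemma past_psum_le n m t : (m <= n)%N -> <<s past n >> [set w | psum m w <= t].
Proof.
move=> mn; have := measurable_psum_past mn measurableT (measurable_itv `]-oo, t]).
rewrite setTI; congr (<<s past n >> _).
Qed.

Lemma past_psum_gt n m t : (m <= n)%N -> <<s past n >> [set w | t < psum m w].
Proof.
move=> mn; have := measurable_psum_past mn measurableT (measurable_itv `]t, +oo[).
rewrite setTI; congr (<<s past n >> _).
by apply/seteqP; split => w /=; rewrite in_itv/= andbT.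
Qed.

Lemma pastI n D E : <<s past n >> D -> <<s past n >> E -> <<s past n >> (D `&` E).
Proof. exact: (@measurableI _ (g_sigma_algebraType (past n))). Qed.

Lemma measurable_psum_le m t : measurable [set w | psum m w <= t].
Proof. exact: (past_measurable (past_psum_le t (leqnn m))). Qed.

Lemma measurable_psum_gt m t : measurable [set w | t < psum m w].
Proof. exact: (past_measurable (past_psum_gt t (leqnn m))). Qed.

(** Conditioning on the waiting time that follows the event [D]. *)
Lemma past_increment_le n D t : <<s past n >> D ->
  P (D `&` [set w | psum n.+1 w <= t]) =
  (\int[lebesgue_measure]_(x in `[0%R, +oo[)
     ((expR (- x))%:E * P (D `&` [set w | (psum n w <= t - x)%R])))%E.
Proof.
move=> mD.
pose C : set (g_sigma_algebraType (past n) * R) :=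
  [set z | D z.1] `&` [set z | psum n z.1 + z.2 <= t].
have mC : measurable C.
  apply: measurableI.
    have := @measurable_fst _ _ (g_sigma_algebraType (past n)) R measurableT D mD.
    by rewrite setTI.
  have mf : measurable_fun setT (fun z : g_sigma_algebraType (past n) * R => psum n z.1 + z.2).
    apply: measurable_funD => //.
    apply: (measurableT_comp (measurable_psum_past (leqnn n))) => //.
  have := mf measurableT _ (measurable_itv `]-oo, t]).
  rewrite setTI; congr measurable; apply/seteqP; split => z /=; rewrite in_itv//.
have := past_increment scheme mC.
rewrite (_ : [set w | C (w, xi n w)] = D `&` [set w | psum n.+1 w <= t]); last first.
  by apply/seteqP; split => w; rewrite /C/= psumS.
move=> ->; rewrite [RHS]integral_mkcond; apply: eq_integral => x _.
rewrite patchE /exponential_pdf patchE; case: ifPn => _; last by rewrite mul0e.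
rewrite mul1r mulN1r; congr (_ * P _)%E.
by apply/seteqP; split => w; rewrite /C/= lerBrDr.
Qed.

Lemma expint_zero (h : R -> \bar R) :
  (forall x : R, 0 <= x -> h x = 0%E) ->
  (\int[lebesgue_measure]_(x in `[0%R, +oo[) ((expR (- x))%:E * h x) = 0)%E.
Proof.
move=> h0; apply: integral0_eq => x/=; rewrite in_itv/= andbT => x0.
by rewrite h0// mule0.
Qed.

(** The integrand changes its shape at [u]: for short waiting times only the event of
the past constrains, for longer ones the end of the interval does. *)
Lemma expint_split n m (h : R -> \bar R) c c' u r : 0 <= u -> u <= r ->
  (forall x : R, 0 <= x <= u -> h x = (c * ptail m (r - x))%:E) ->
  (forall x : R, u < x <= r -> h x = (c' * ptail n (r - x))%:E) ->
  (forall x, r < x -> h x = 0%E) ->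
  (\int[lebesgue_measure]_(x in `[0%R, +oo[) ((expR (- x))%:E * h x) =
   (c * (ptail m.+1 r - expR (- u) * ptail m.+1 (r - u)) +
    c' * (expR (- u) * ptail n.+1 (r - u)))%:E)%E.
Proof.
move=> u0 ur hm hn h0.
have mg k c0 : measurable_fun setT (fun x : R => (expR (- x) * (c0 * ptail k (r - x)))%:E).
  apply/measurable_EFinP; apply: measurable_funM.
    by apply: continuous_measurable_fun; exact: continuous_expRN.
  apply: measurable_funM; first exact: measurable_cst.
  apply: continuous_measurable_fun => x.
  apply: (@continuous_comp _ _ _ (fun x => r - x) (ptail k)); last exact: continuous_ptail.
  by apply: cvgB; [exact: cvg_cst | exact: cvg_id].
pose g x := ((expR (- x))%:E * h x)%E.
have e1 x : x \in `[0, u] -> g x = (expR (- x) * (c * ptail m (r - x)))%:E.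
  by rewrite in_itv/= => xu; rewrite /g hm.
have e2 x : x \in `]u, r] -> g x = (expR (- x) * (c' * ptail n (r - x)))%:E.
  by rewrite in_itv/= => xu; rewrite /g hn.
have e3 x : x \in `]r, +oo[ -> g x = 0%E.
  by rewrite in_itv/= andbT => xu; rewrite /g h0// mule0.
have m1 : measurable_fun `[0, u] g.
  apply: (@eq_measurable_fun _ _ _ _ _ (fun x : R => (expR (- x) * (c * ptail m (r - x)))%:E)).
    by move=> x; rewrite inE => xu; rewrite e1.
  exact: measurable_funTS.
have m2 : measurable_fun `]u, r] g.
  apply: (@eq_measurable_fun _ _ _ _ _ (fun x : R => (expR (- x) * (c' * ptail n (r - x)))%:E)).
    by move=> x; rewrite inE => xu; rewrite e2.
  exact: measurable_funTS.
have m3 : measurable_fun `]r, +oo[ g.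
  apply: (@eq_measurable_fun _ _ _ _ _ (cst 0%E)).
    by move=> x; rewrite inE => xu; rewrite e3.
  exact: measurable_cst.
have split_itv : [set` `[0%R, +oo[] = `[0%R, u] `|` (`]u, r] `|` `]r, +oo[) :> set R.
  rewrite -itv_bndbnd_setU ?bnd_simp// -itv_bndbnd_setU ?bnd_simp//.
have m23 : measurable_fun (`]u, r] `|` `]r, +oo[) g.
  by apply/measurable_funU => //; split.
have D1 : [disjoint `[0%R, u] & `]u, r] `|` `]r, +oo[]%classic.
  apply/disj_set2P; rewrite -subset0 => z/= [] /[swap].
  rewrite !in_itv/= andbT => -[/andP[uz _]|rz] /andP[_].
    by rewrite leNgt uz.
  by rewrite leNgt (le_lt_trans ur).
have D2 : [disjoint `]u, r] & `]r, +oo[]%classic.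
  apply/disj_set2P; rewrite -subset0 => z/= [].
  by rewrite !in_itv/= andbT leNgt => /andP[_ /negbTE ->].
rewrite -/(g _) split_itv integral_setU//; last 2 first.
- exact: measurableU.
- by apply/measurable_funU => //; (exact: measurableU || split).
rewrite integral_setU// [X in (_ + (_ + X))%E]integral0_eq ?adde0; last first.
  by move=> x /=; exact: e3.
have i1 : (\int[lebesgue_measure]_(x in `[0%R, u]) g x =
    (c * (ptail m.+1 r - expR (- u) * ptail m.+1 (r - u)))%:E)%E.
  have := expint_ptail m r c u0; rewrite oppr0 expR0 mul1r addr0 => <-.
  by apply: eq_integral => x; rewrite inE; exact: e1.
have i2 : (\int[lebesgue_measure]_(x in `]u, r]) g x =
    (c' * (expR (- u) * ptail n.+1 (r - u)))%:E)%E.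
  have := expint_ptail n r c' ur; rewrite subrr ptail_at0 mulr0 subr0 => <-.
  rewrite -integral_itv_obnd_cbnd; last by exact: measurable_funTS.
  by apply: eq_integral => x; rewrite inE; exact: e2.
by rewrite EFinD; congr (_ + _)%E; [exact: i1 | exact: i2].
Qed.

(** Induction on [n]: each waiting time convolves the law with the exponential law. *)
Lemma law_psum n : (forall t, 0 <= t -> P [set w | psum n w <= t] = (ptail n t)%:E) /\
  (forall t, t < 0 -> P [set w | psum n w <= t] = 0%E).
Proof.
elim: n => [|n [IH1 IH2]].
  have e0 w : psum 0 w = 0 by rewrite /psum big_ord0.
  split=> t t0.
    rewrite ptail0 (_ : [set _ | _] = setT) ?probability_setT//.
    by apply/seteqP; split => w //= _; rewrite e0.
  rewrite (_ : [set _ | _] = set0) ?measure0//.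
  by apply/seteqP; split => w //=; rewrite e0 leNgt t0.
have step t := @past_increment_le n setT t (@measurableT _ (g_sigma_algebraType (past n))).
split=> t t0; have := step t; rewrite setTI => ->.
  rewrite (@expint_split n n _ 1 0 t t)//.
  - by rewrite subrr !ptail_at0 !(mulr0, mul1r, subr0, addr0).
  - by move=> x /andP[x0 xt]; rewrite setTI mul1r IH1// subr_ge0.
  - by move=> x /andP[/lt_le_trans/[apply]]; rewrite ltxx.
  - by move=> x tx; rewrite setTI IH2// subr_lt0.
by apply: expint_zero => x x0; rewrite setTI IH2//; lra.
Qed.

(** The two terms correspond to a last waiting time of at most, or more than, [t - s]. *)
Lemma law_psum2 n s t : 0 <= s -> s <= t ->
  P ([set w | psum n w <= s] `&` [set w | psum n.+1 w <= t]) =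
  (ptail n s * (1 - expR (- (t - s))) + expR (- (t - s)) * ptail n.+1 s)%:E.
Proof.
move=> s0 st; have t0 := le_trans s0 st.
rewrite past_increment_le; last exact: past_psum_le.
rewrite (@expint_split n 0 _ (ptail n s) 1 (t - s) t) ?subr_ge0//.
- rewrite opprB addrCA subrr addr0 mul1r !ptail1.
  have -> : expR (- t) = expR (s - t) * expR (- s).
    by rewrite -expRD; congr expR; ring.
  by congr EFin; ring.
- by rewrite gerBl.
- move=> x /andP[x0 xts]; rewrite ptail0 mulr1 -(law_psum n).1//.
  congr (P _); apply/seteqP; split => w /=; first by case.
  by move=> ws; split => //; lra.
- move=> x /andP[tsx xt]; rewrite mul1r -(law_psum n).1 ?subr_ge0//.
  congr (P _); apply/seteqP; split => w /=; first by case.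
  by move=> ws; split => //; lra.
- move=> x tx; rewrite (_ : _ `&` _ = [set w | psum n w <= t - x]).
    by rewrite (law_psum n).2// subr_lt0.
  by apply/seteqP; split => w /=; [case | move=> ws; split => //; lra].
Qed.

(** Exactly [n] arrivals up to time [s]. *)
Definition passage n s : set T := [set w | psum n w <= s] `&` [set w | s < psum n.+1 w].

Lemma past_passage n m s : (n < m)%N -> <<s past m >> (passage n s).
Proof.
by move=> nm; apply: pastI; [apply: past_psum_le; exact: ltnW | exact: past_psum_gt].
Qed.

Lemma law_passage n s : 0 <= s -> P (passage n s) = (poi n s)%:E.
Proof.
move=> s0; have := law_psum2 n s0 (lexx s).
rewrite subrr oppr0 expR0 subrr mulr0 add0r mul1r => h.
have -> : passage n s = [set w | psum n w <= s] `\` [set w | psum n.+1 w <= s].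
  apply/seteqP; split => w [/= h1 h2]; split => //=.
    by apply/negP; rewrite -ltNge.
  by rewrite ltNge; apply/negP.
rewrite measureD//; [|exact: measurable_psum_le..|].
  rewrite -/(_ `&` _).
  transitivity ((ptail n s)%:E - (ptail n.+1 s)%:E)%E.
    by congr (_ - _)%E; [exact: (law_psum n).1 | exact: h].
  by rewrite -EFinB; congr EFin; rewrite ptailS; ring.
by rewrite (le_lt_trans (probability_le1 _ (measurable_psum_le _ _)))// ltry.
Qed.

(** By induction on [b]; after the first arrival beyond [s] the waiting times start
afresh from [s], whence the value [t - s]. *)
Lemma law_passage_le a b s t : 0 <= s ->
  P (passage a s `&` [set w | psum (a + b.+1) w <= t]) =
  (if s <= t then poi a s * ptail b.+1 (t - s) else 0)%:E.
Proof.
move=> s0; elim: b t => [|b IH] t.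
  rewrite addn1; case: leP => [st|ts]; last first.
    rewrite (_ : _ `&` _ = set0) ?measure0//; apply/seteqP; split => w //=.
    by move=> [[/= ws sw] wt]; lra.
  have -> : passage a s `&` [set w | psum a.+1 w <= t] =
     ([set w | psum a w <= s] `&` [set w | psum a.+1 w <= t]) `\`
       ([set w | psum a w <= s] `&` [set w | psum a.+1 w <= s]).
    apply/seteqP; split => w /=.
      by move=> [[/= ? sw] ?]; split => // -[_]; rewrite leNgt sw.
    move=> [[? ?] h]; split => //; split => //=; rewrite ltNge; apply/negP => h'.
    exact: h.
  rewrite measureD; last first.
  - by rewrite (le_lt_trans (probability_le1 _ _))// ?ltry//; apply: measurableI; exact: measurable_psum_le.
  - by apply: measurableI; exact: measurable_psum_le.
  - by apply: measurableI; exact: measurable_psum_le.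
  transitivity ((ptail a s * (1 - expR (- (t - s))) + expR (- (t - s)) * ptail a.+1 s)%:E
     - (ptail a.+1 s)%:E)%E.
    congr (_ - _)%E; first exact: law_psum2.
    rewrite -[RHS](_ : P ([set w | psum a w <= s] `&` [set w | psum a.+1 w <= s]) = _).
      congr (P _); apply/seteqP; split => w /=; first by case.
      by move=> [ws1 ws2]; split => //; split => //; lra.
    by have := law_psum2 a s0 (lexx s); rewrite subrr oppr0 expR0 subrr mulr0 add0r mul1r.
  by rewrite -EFinB; congr EFin; rewrite ptail1 ptailS; ring.
rewrite addnS past_increment_le; last by apply: past_passage; rewrite addnS ltnS leq_addr.
case: leP => [st|ts].
  rewrite (@expint_split b.+1 b.+1 _ (poi a s) (poi a s) (t - s) (t - s)) ?subr_ge0//.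
  - by rewrite subrr !ptail_at0; congr EFin; ring.
  - by move=> x /andP[x0 xt]; rewrite IH ifT; [congr (_ * ptail _ _)%:E; ring | lra].
  - by move=> x /andP[/lt_le_trans/[apply]]; rewrite ltxx.
  - by move=> x tx; rewrite IH ifF//; apply/negbTE; rewrite -ltNge; lra.
by apply: expint_zero => x x0; rewrite IH ifF//; apply/negbTE; rewrite -ltNge; lra.
Qed.

(** The event is the difference of two events of the preceding form. *)
Lemma law_passage2 a b s t : 0 <= s -> s <= t ->
  P (passage a s `&` passage (a + b) t) = (poi a s * poi b (t - s))%:E.
Proof.
move=> s0 st.
have mp n r : measurable (passage n r) by exact: past_measurable (past_passage _ (ltnSn n)).
have fin A : measurable A -> (P A < +oo)%E.
  by move=> mA; rewrite (le_lt_trans (probability_le1 _ mA))// ltry.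
case: b => [|b].
  rewrite addn0 (_ : _ `&` _ = passage a s `\` [set w | psum (a + 1) w <= t]); last first.
    rewrite addn1; apply/seteqP; split => w /=.
      move=> [[/= h1 h2] [/= h3 h4]]; split => //=.
      by apply/negP; rewrite -ltNge.
    by move=> [[/= h1 h2] /negP]; rewrite -ltNge => h3; split => //; split => //=; lra.
  rewrite measureD//; [|exact: measurable_psum_le|exact: fin].
  transitivity ((poi a s)%:E - (poi a s * ptail 1 (t - s))%:E)%E.
    by congr (_ - _)%E; [exact: law_passage | have := law_passage_le a 0 t s0; rewrite st].
  by rewrite -EFinB; congr EFin; rewrite ptail1 poi0; ring.
pose D := passage a s `&` [set w | psum (a + b.+1) w <= t].
have mD : measurable D by apply: measurableI => //; exact: measurable_psum_le.
have pD : <<s past (a + b.+1)%N >> D.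
  by apply: pastI; [apply: past_passage; rewrite addnS ltnS leq_addr | exact: past_psum_le].
rewrite (_ : _ `&` _ = D `\` [set w | psum (a + b.+1).+1 w <= t]); last first.
  apply/seteqP; split => w /=.
    by move=> [h1 [/= h3 h4]]; split => //=; apply/negP; rewrite -ltNge.
  by move=> [[/= h1 h2] /negP]; rewrite -ltNge => h3.
rewrite measureD//; [|exact: measurable_psum_le|exact: fin].
have h1 : P (D `&` [set w | psum (a + b.+1).+1 w <= t]) =
    P (passage a s `&` [set w | psum (a + b.+2) w <= t]).
  have pa : <<s past (a + b.+1)%N >> (passage a s).
    by apply: past_passage; rewrite addnS ltnS leq_addr.
  have e := past_increment_le t pD.
  rewrite addnS in e; rewrite addnS e (addnS a b.+1) addnS.
  have := past_increment_le t pa; rewrite addnS => ->.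
  apply: eq_integral => x; rewrite inE/= in_itv/= andbT => x0.
  congr (_ * P _)%E; rewrite /D addnS; apply/seteqP; split => w /=.
    by move=> [[? ?] ?].
  move=> [? wx]; split => //; split => //=.
  by rewrite (le_trans wx)// gerBl.
transitivity ((poi a s * ptail b.+1 (t - s))%:E - (poi a s * ptail b.+2 (t - s))%:E)%E.
  congr (_ - _)%E; first by have := law_passage_le a b t s0; rewrite st.
  by apply: (eq_trans h1); have := law_passage_le a b.+1 t s0; rewrite st.
by rewrite -EFinB; congr EFin; rewrite (ptailS b.+1); ring.
Qed.

End Renewal.

(** * Ball counts along regular trajectories *)

Section Counts.
Context {d} {T : measurableType d} {R : realType} (P : probability T R).
Variables (p : nat -> R) (xi : nat -> {RV P >-> R}) (X : nat -> {RV P >-> nat}).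
Hypothesis scheme : poissonized_karlin p xi X.
Implicit Types (s t r : R) (a b n k : nat).

Notation past := (past xi X).
Notation psum := (psum xi).
Notation passage := (passage xi).
Notation Ev := (Ev P).

(** The number of balls thrown up to time [t]; the default value concerns only
trajectories with bounded arrival times. *)
Definition renewals t (w : T) : nat :=
  if pselect (exists n, t < psum n.+1 w) is left h then ex_minn h else 0%N.

(** On such trajectories the arrival times are nondecreasing and tend to infinity,
so that every time is passed exactly once. *)
Definition regular (w : T) : Prop :=
  (forall i, 0 <= xi i w) /\ (forall m : nat, exists n, m%:R < psum n w).

(** If the arrival times stay below [m], then [psum n w <= m] for all [n], which has
probability at most [ptail n m], hence 0 in the limit. *)
Lemma ae_regular : {ae P, forall w, regular w}.
Proof.
have xi0 i : {ae P, forall w, 0 <= xi i w}.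
  exists [set w | xi i w < 0]; split.
  - have := measurable_funPT (xi i) measurableT _ (measurable_itv `]-oo, 0[).
    by rewrite setTI; congr measurable; apply/seteqP; split => w /=; rewrite in_itv.
  - have := increment_law scheme i (measurable_itv `]-oo, (0:R)[).
    rewrite /distribution /pushforward (_ : _ @^-1` _ = [set w | xi i w < 0]); last first.
      by apply/seteqP; split => w /=; rewrite in_itv.
    move=> ->; rewrite /exponential_prob; apply: integral0_eq => x /=.
    by rewrite in_itv/= => x0; rewrite lt0_exponential_pdf.
  - by move=> w /=; rewrite ltNge => /negP.
have psy (m : nat) : {ae P, forall w, exists n, m%:R < psum n w}.
  exists (\bigcap_n [set w | psum n w <= m%:R]); split.
  - by apply: bigcapT_measurable => n; exact: (measurable_psum_le xi X).
  - apply/eqP; rewrite eq_le measure_ge0 andbT.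
    have h n : (P (\bigcap_n [set w | (psum n w <= m%:R)%R]) <= (ptail n m%:R)%:E)%E.
      rewrite -(law_psum scheme n).1 ?ler0n//; apply: le_measure.
      + by apply/mem_set; apply: bigcapT_measurable => i; exact: (measurable_psum_le xi X).
      + by apply/mem_set; exact: (measurable_psum_le xi X).
      + by move=> w /(_ n I).
    have /fin_numPlt := fin_num_measure P _ (bigcapT_measurable (fun n => measurable_psum_le xi X n m%:R)).
    move: h; case: (P _) => [r||] h _; [|by have := h 0%N|by rewrite leNye].
    rewrite lee_fin; apply: (cvgr_to_ge (@ptail_cvg0 R m%:R)).
    by apply: nearW => n; rewrite -lee_fin.
  - move=> w /= nw n _ /=; rewrite leNgt; apply/negP => mn; apply: nw.
    by exists n.
have : {ae P, forall w i, 0 <= xi i w} by exact/ae_foralln.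
have : {ae P, forall w (m : nat), exists n, m%:R < psum n w} by exact/ae_foralln.
by apply: filterS2 => w h1 h2; split.
Qed.

Lemma regular_psum w m n : regular w -> (m <= n)%N -> psum m w <= psum n w.
Proof.
move=> [xi0 _] /subnK <-; elim: (n - m)%N => [//|i IH].
by rewrite addSn psumS (le_trans IH)// lerDl.
Qed.

Lemma regular_exceeds w t : regular w -> exists n, t < psum n.+1 w.
Proof.
move=> rw; have [n hn] := rw.2 (Num.truncn t).+1.
exists n; rewrite (lt_le_trans (truncnS_gt t))// (le_trans (ltW hn))//.
exact: regular_psum.
Qed.

Lemma renewals_passage w t : regular w -> 0 <= t -> passage (renewals t w) t w.
Proof.
move=> rw t0; rewrite /renewals; case: pselect => [h|]; last first.
  by move=> []; exact: regular_exceeds.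
case: ex_minnP => n tn nmin; split => //=.
case: n tn nmin => [_ _|n tn nmin]; first by rewrite /psum big_ord0.
by rewrite leNgt; apply/negP => /nmin; rewrite ltnn.
Qed.

Lemma passage_uniq w t m n : regular w -> passage m t w -> passage n t w -> m = n.
Proof.
move=> rw [/= m1 m2] [/= n1 n2]; apply/eqP; rewrite eqn_leq.
apply/andP; split; rewrite leqNgt; apply/negP => /(regular_psum rw).
  by move=> h; have := lt_le_trans n2 (le_trans h m1); rewrite ltxx.
by move=> h; have := lt_le_trans m2 (le_trans h n1); rewrite ltxx.
Qed.

Lemma renewals_lt w t n : regular w -> 0 <= t ->
  (n < renewals t w)%N = (psum n.+1 w <= t).
Proof.
move=> rw t0; have [/= h1 h2] := renewals_passage rw t0.
apply/idP/idP => [nr|]; first exact: le_trans (regular_psum rw nr) h1.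
rewrite leqNgt ltnS => nt; apply/negP => rn.
by have := lt_le_trans h2 (le_trans (regular_psum rw (rn : (_ < _.+1)%N)) nt); rewrite ltxx.
Qed.

Lemma renewals_le w s t : regular w -> 0 <= s -> s <= t ->
  (renewals s w <= renewals t w)%N.
Proof.
move=> rw s0 st; rewrite leqNgt; apply/negP; rewrite renewals_lt// => h.
have := renewals_lt (renewals t w) rw (le_trans s0 st).
by rewrite ltnn (le_trans h st).
Qed.

Lemma measurable_renewals t : measurable_fun setT (renewals t).
Proof.
apply: measurable_nat => u.
pose A n := [set w | t < psum n.+1 w].
have mA n : measurable (A n) by exact: (measurable_psum_gt xi X).
pose B := \bigcap_i (if (i < u)%N then ~` A i else setT).
have mB : measurable B.
  by apply: bigcapT_measurable => i; case: ifP => _ //; exact: measurableC.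
pose C := if u == 0%N then ~` (\bigcup_n A n) else set0.
have mC : measurable C.
  by rewrite /C; case: ifP => _ //; apply: measurableC; exact: bigcupT_measurable.
suff -> : [set w | renewals t w = u] = (A u `&` B) `|` C.
  by apply: measurableU => //; exact: measurableI.
apply/seteqP; split => w /=; rewrite /renewals.
  case: pselect => [h|h].
    case: ex_minnP => n tn nmin nu; left; split; first by rewrite -nu.
    move=> i _; case: ifPn => // iu; rewrite /A/= => /nmin.
    by rewrite nu leqNgt iu.
  move=> u0; right; rewrite /C -u0 eqxx => -[n _ An].
  by apply: h; exists n.
move=> [[Au Bu]|].
  case: pselect => [h|[]]; last by exists u.
  case: ex_minnP => n tn nmin; apply/eqP; rewrite eqn_leq nmin// leqNgt.
  by apply/negP => nu; have := Bu n I; rewrite nu; apply.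
rewrite /C; case: eqP => // -> h.
by case: pselect => // -[n An]; exfalso; apply: h; exists n.
Qed.

Definition cnt k n (w : T) : nat := \sum_(i < n) (X i w == k).

(** A finite version of [box_content], equal to it on regular trajectories. *)
Definition pcount k t w : nat := cnt k (renewals t w) w.

Lemma measurable_X_eq i k : measurable [set w | X i w = k].
Proof.
have := measurable_funPT (X i) measurableT [set k] I.
by rewrite setTI.
Qed.

Lemma measurable_cnt k n : measurable_fun setT (cnt k n).
Proof.
elim: n => [|n IH].
  rewrite (_ : cnt k 0 = cst 0%N); first exact: measurable_cst.
  by apply/funext => w; rewrite /cnt big_ord0.
rewrite (_ : cnt k n.+1 = fun w => (cnt k n w + (X n w == k))%N); last first.
  by apply/funext => w; rewrite /cnt big_ord_recr.
apply: measurable_fun_addn => //.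
apply: (@measurable_glue _ _ _ _ (X n) (fun v _ => nat_of_bool (v == k))) => //.
Qed.

Lemma measurable_pcount k t : measurable_fun setT (pcount k t).
Proof.
apply: (@measurable_glue _ _ _ _ (renewals t) (fun n w => cnt k n w)).
  exact: measurable_renewals.
by move=> n; exact: measurable_cnt.
Qed.

Lemma cnt_le k m n w : (m <= n)%N -> (cnt k m w <= cnt k n w)%N.
Proof.
move=> /subnK <-; elim: (n - m)%N => [//|i IH].
by rewrite addSn /cnt big_ord_recr/= (leq_trans IH)// leq_addr.
Qed.

Lemma pcount_le w k s t : regular w -> 0 <= s -> s <= t ->
  (pcount k s w <= pcount k t w)%N.
Proof. by move=> rw s0 st; apply: cnt_le; exact: renewals_le. Qed.

Import finmap.

Lemma box_contentE w k t : regular w -> 0 <= t ->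
  box_content xi X k t w = (pcount k t w)%:R%:E.
Proof.
move=> rw t0; rewrite /box_content.
have -> : [set n | throw_time xi n w <= t /\ X n w = k] =
    [set` [fset n in [seq n <- iota 0 (renewals t w) | X n w == k]]%fset].
  apply/seteqP; split => n /=.
    move=> [nt Xn]; rewrite !inE/= mem_filter mem_iota/= add0n renewals_lt//.
    by rewrite Xn eqxx/=.
  rewrite !inE/= mem_filter mem_iota/= add0n renewals_lt// => /andP[/eqP Xn nt].
  by [].
have fD := finite_fset [fset n in [seq n <- iota 0 (renewals t w) | X n w == k]]%fset.
rewrite /counting asboolT//.
rewrite set_fsetK card_fseq undup_id ?filter_uniq ?iota_uniq//.
rewrite size_filter /pcount /cnt -sum1_count big_mkcond/=.
have -> : iota 0 (renewals t w) = index_iota 0 (renewals t w) by rewrite /index_iota subn0.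
by rewrite big_mkord.
Qed.

End Counts.

(** * The joint generating function of the box contents *)

Section Poissonization.
Context {d} {T : measurableType d} {R : realType} (P : probability T R).
Variables (p : nat -> R) (xi : nat -> {RV P >-> R}) (X : nat -> {RV P >-> nat}).
Hypothesis scheme : poissonized_karlin p xi X.
Implicit Types (s t r : R) (a b n k m : nat).

Notation past := (past xi X).
Notation passage := (passage xi).
Notation Ev := (Ev P).
Notation pcount := (pcount xi X).
Notation renewals := (renewals xi).
Notation cnt := (cnt X).

(** The boxes from [m] on do not enter the generating function and have weight 1. *)
Definition weight m (x : nat -> R) k : R := if (k < m)%N then x k else 1.

Definition mean_weight m (x : nat -> R) : R := 1 + \sum_(k < m) p k * (x k - 1).

Lemma weightE m x k : weight m x k = 1 + \sum_(i < m) (x i - 1) * (k == i)%:R.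
Proof.
rewrite /weight; case: ltnP => [km|mk].
  rewrite (bigD1 (Ordinal km))//= eqxx mulr1 big1 ?addr0; first by rewrite addrC subrK.
  move=> i /eqP ik; case: eqP => [ki|_]; last by rewrite mulr0.
  by exfalso; apply: ik; exact/val_inj.
rewrite big1 ?addr0// => i _; case: eqP => [ki|_]; last by rewrite mulr0.
by move: (ltn_ord i); rewrite -ki ltnNge mk.
Qed.

Lemma indep_X_step E J B c k : <<s past E.1 >> E.2 ->
  (forall i, i \in J -> exists2 j, i = inr j & (c < j)%N) -> uniq J ->
  rectangles (karlin_sigma xi X) J B ->
  rectangles (karlin_sigma xi X) (inr c :: J) (B `&` [set w | X c w = k]) /\
  P (B `&` [set w | X c w = k]) = (P B * (p k)%:E)%E.
Proof.
move=> _ Jc uJ RB.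
have cJ : inr c \notin J by apply/negP => /Jc[j [->]]; rewrite ltnn.
have Rc : rectangles (karlin_sigma xi X) [:: inr c] [set w | X c w = k].
  exists (fun=> [set w | X c w = k]); last by rewrite big_seq1.
  by move=> i; rewrite inE => /eqP ->; exists [set k] => //; rewrite setTI.
split.
  have [A FA ->] := RB.
  exists (fun i => if i == inr c then [set w | X c w = k] else A i).
    move=> i; rewrite inE; case: eqP => [-> _|_ /=]; last exact: FA.
    by exists [set k] => //; rewrite setTI.
  rewrite big_cons eqxx setIC; congr (_ `&` _); apply: eq_big_seq => i iJ.
  by case: eqP => // ic; rewrite -ic iJ in cJ.
rewrite (rectangles_indep (karlin_independent scheme) _ RB Rc); last first.
  by rewrite cat_uniq uJ/= orbF cJ.
by rewrite -(box_law scheme c k).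
Qed.

(** Peeling off the labels one at a time: each label is independent of the arrival
times and of the other labels. *)
Lemma Ev_word m (w_ : nat -> nat -> R) n E c :
  <<s past n >> E ->
  (forall i k, `|w_ i k| <= 1) ->
  forall J B, (forall i, i \in J -> exists2 j, i = inr j & (c <= j)%N) -> uniq J ->
  rectangles (karlin_sigma xi X) J B ->
  Ev (fun w => \1_E w * \1_B w * \prod_(i < c) weight m (w_ i) (X i w)) =
  fine (P E) * fine (P B) * \prod_(i < c) mean_weight m (w_ i).
Proof.
move=> sE w1.
have mE := past_measurable sE.
have bw i : bdd_rv (fun w => weight m (w_ i) (X i w)).
  apply: (@bdd_rv_nat _ _ _ (X i) (fun k => weight m (w_ i) k) 1) => // k.
  by rewrite /weight; case: ifP => // _; rewrite normr1.
have bP l : bdd_rv (fun w => \prod_(i < l) weight m (w_ i) (X i w)).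
  by apply: bdd_rv_prod => i _; exact: bw.
have mR J B : rectangles (karlin_sigma xi X) J B -> measurable B.
  by apply: rectangles_measurable; exact: karlin_sigma_measurable.
elim: c => [|c IH] J B Jc uJ RB.
  under eq_fun do rewrite big_ord0 mulr1.
  rewrite big_ord0 mulr1 -fineM ?fin_num_measure//; [|exact: mR RB].
  have uJJ : uniq ([seq inl i | i <- iota 0 n] ++ J).
    rewrite cat_uniq uJ andbT map_inj_uniq ?iota_uniq/=; last by move=> x y [].
    by apply/hasPn => i /Jc[j -> _]; apply/negP => /mapP[].
  rewrite -(g_rectangles_indep (karlin_independent scheme)
    (@karlin_sigma_measurable _ _ _ P xi X) (@karlin_sigmaI _ _ _ P xi X) uJJ sE RB).
  rewrite -Ev_indic; last by apply: measurableI => //; exact: mR RB.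
  by congr Ev; apply/funext => w; rewrite indicI.
have mB := mR _ _ RB.
have bB k : bdd_rv (fun w => \1_E w * \1_(B `&` [set w | X c w = k]) w *
    \prod_(i < c) weight m (w_ i) (X i w)).
  apply: bdd_rvM => //; apply: bdd_rvM; apply: bdd_rv_indic => //.
  by apply: measurableI => //; exact: measurable_X_eq.
have -> : (fun w => \1_E w * \1_B w * \prod_(i < c.+1) weight m (w_ i) (X i w)) =
   (fun w => \1_E w * \1_B w * \prod_(i < c) weight m (w_ i) (X i w) +
     \sum_(k < m) (w_ c k - 1) * (\1_E w * \1_(B `&` [set w | X c w = k]) w *
        \prod_(i < c) weight m (w_ i) (X i w))).
  apply/funext => w; rewrite big_ord_recr/= [weight m (w_ c) _]weightE mulrA mulrDr mulr1.
  congr (_ + _); rewrite mulr_sumr; apply: eq_bigr => k _.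
  rewrite indicI/= [\1_[set _ | _] w]indicE.
  have -> : (w \in [set w | X c w = k]) = (X c w == k).
    by apply/idP/eqP => [/set_mem|h]//; exact/mem_set.
  ring.
rewrite EvD//; last 2 first.
- by apply: bdd_rvM => //; apply: bdd_rvM; exact: bdd_rv_indic.
- by apply: bdd_rv_sum => k _; apply: bdd_rvM => //; exact: bdd_rv_cst.
rewrite Ev_sum; last by move=> k _; apply: bdd_rvM => //; exact: bdd_rv_cst.
rewrite (IH J B)//; last by move=> i /Jc[j -> cj]; exists j => //; exact: ltnW.
rewrite big_ord_recr/= mulrA /mean_weight mulrDr mulr1; congr (_ + _).
rewrite mulr_sumr; apply: eq_bigr => k _.
have [R2 P2] := @indep_X_step (n, E) J B c k sE Jc uJ RB.
rewrite EvZ// (IH (inr c :: J) _ _ _ R2); last 2 first.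
- by move=> i; rewrite inE => /predU1P[->|/Jc[j -> cj]]; [exists c | exists j => //; exact: ltnW].
- by rewrite /= uJ andbT; apply/negP => /Jc[j [->]]; rewrite ltnn.
rewrite P2 fineM ?fin_num_measure//=; ring.
Qed.

Lemma prod_cnt m (x : nat -> R) n w : \prod_(k < m) x k ^+ cnt k n w =
  \prod_(i < n) weight m x (X i w).
Proof.
transitivity (\prod_(k < m) \prod_(i < n) (x k ^+ (X i w == k))).
  apply: eq_bigr => k _; rewrite /cnt.
  by elim/big_rec2: _ => [|i u v _ <-]; rewrite ?expr0// exprD.
rewrite exchange_big/=; apply: eq_bigr => i _; rewrite /weight.
case: ltnP => [im|mi].
  rewrite (bigD1 (Ordinal im))//= eqxx expr1 big1 ?mulr1// => k /eqP ki.
  case: eqP => [ik|_]; last by rewrite expr0.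
  by exfalso; apply: ki; exact/val_inj.
rewrite big1// => k _; case: eqP => [ik|_]; last by rewrite expr0.
by move: (ltn_ord k); rewrite -ik ltnNge mi.
Qed.

Lemma poi_pgf r x : series (fun b => poi b r * x ^+ b) @ \oo --> expR (r * (x - 1)).
Proof.
have := @sum_poi_cvg R (r * x).
have -> : expR (r * (x - 1)) = expR (- r + r * x) * 1.
  by rewrite mulr1; congr expR; ring.
move=> h; have := cvgr_scale (c := expR (- r + r * x)) h.
apply: cvg_trans; apply: near_eq_cvg; apply: nearW => n /=.
rewrite /series/= big_mkord mulr_sumr; apply: eq_bigr => b _.
have e : expR (- r + r * x) * expR (- (r * x)) = expR (- r).
  by rewrite -expRD addrK.
by rewrite /poi -e exprMn; ring.
Qed.

(** Given the numbers [a] and [b] of balls thrown before [s] and between [s] and [t],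
the labels of the [a + b] balls are independent, so that the expectation is
[mean_weight m x ^+ a * mean_weight m y ^+ b]; the Poisson series in [a] and [b]
then sum to exponentials. *)
Lemma Ev_pgf m (x y : nat -> R) s t :
  (forall k, 0 <= x k <= 1) -> (forall k, 0 <= y k <= 1) -> 0 <= s -> s <= t ->
  Ev (fun w => \prod_(k < m) (x k ^+ pcount k s w *
        y k ^+ (pcount k t w - pcount k s w))) =
  \prod_(k < m) (expR (s * p k * (x k - 1)) * expR ((t - s) * p k * (y k - 1))).
Proof.
move=> x01 y01 s0 st; have t0 := le_trans s0 st.
have mN r := measurable_renewals xi X r.
have mM : measurable_fun setT (fun w => (renewals t w - renewals s w)%N).
  apply: measurable_nat => u.
  have : measurable_fun setT (fun w => (renewals t w - renewals s w)%N).
    exact: measurable_fun_subn.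
  move=> /(_ measurableT [set u] I); rewrite setTI; exact.
set f := (fun w => _).
have norm01 (z : R) n : 0 <= z <= 1 -> `|z ^+ n| <= 1.
  by move=> /andP[z0 z1]; rewrite normrX exprn_ile1// ger0_norm.
have bf : bdd_rv f.
  apply: bdd_rv_prod => k _; apply: bdd_rvM.
    apply: (@bdd_rv_nat _ _ _ _ (fun n => x k ^+ n) 1); first exact: measurable_pcount.
    by move=> n; exact: norm01.
  apply: (@bdd_rv_nat _ _ _ (fun w => (pcount k t w - pcount k s w)%N) (fun n => y k ^+ n) 1).
    by apply: measurable_fun_subn; exact: measurable_pcount.
  by move=> n; exact: norm01.
have mp n r : measurable (passage n r).
  by apply: (@past_measurable _ _ _ P xi X n.+1); exact: past_passage.
have key a b : Ev (fun w => f w * (renewals s w == a)%:R *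
     ((renewals t w - renewals s w)%N == b)%:R) =
   poi a s * mean_weight m x ^+ a * (poi b (t - s) * mean_weight m y ^+ b).
  pose E := passage a s `&` passage (a + b) t.
  (* the first [a] balls are thrown before [s] *)
  pose wt i := if (i < a)%N then x else y.
  have sE : <<s past (a + b).+1 >> E.
    by apply: pastI; apply: past_passage => //; rewrite ltnS leq_addr.
  have wt1 i k : `|wt i k| <= 1.
    rewrite /wt; case: ifP => _; rewrite ger0_norm.
    - by case/andP: (x01 k). - by case/andP: (x01 k).
    - by case/andP: (y01 k). - by case/andP: (y01 k).
  have := @Ev_word m wt (a + b).+1 E (a + b) sE wt1 [::] setT _ _ _.
  rewrite probability_setT/= mulr1 (law_passage2 scheme)//=.
  have -> : \prod_(i < a + b) mean_weight m (wt i) = mean_weight m x ^+ a * mean_weight m y ^+ b.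
    rewrite big_split_ord/=; congr (_ * _).
      rewrite -[a in RHS]card_ord -prodr_const; apply: eq_bigr => i _.
      by rewrite /wt ltn_ord.
    rewrite -[b in RHS]card_ord -prodr_const; apply: eq_bigr => i _.
    by rewrite /wt ltnNge leq_addr.
  move=> h; rewrite [RHS]mulrACA -h//; last by exists (fun=> setT) => //; rewrite big_nil.
  apply: Ev_ae.
  - by apply: bdd_rvM; [apply: bdd_rvM => //|]; exact: bdd_rv_eq.
  - apply: bdd_rvM.
      by apply: bdd_rvM; apply: bdd_rv_indic => //; exact: past_measurable sE.
    apply: bdd_rv_prod => i _.
    apply: (@bdd_rv_nat _ _ _ (X i) (fun k => weight m (wt i) k) 1) => // k.
    by rewrite /weight; case: ifP => // _; rewrite normr1.
  apply: filterS (ae_regular scheme) => w rw.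
  rewrite indicT mulr1 indicE.
  have pE : (w \in E) = (renewals s w == a) && ((renewals t w - renewals s w)%N == b).
    apply/idP/andP => [/set_mem|].
      move=> [h1 h2]; have ps := renewals_passage rw s0; have pt := renewals_passage rw t0.
      rewrite (passage_uniq rw ps h1) (passage_uniq rw pt h2).
      by rewrite eqxx addKn eqxx.
    move=> [/eqP sa /eqP tb]; have ps := renewals_passage rw s0; have pt := renewals_passage rw t0.
    apply/mem_set; split; first by rewrite -sa.
    by rewrite -sa -tb subnKC//; exact: renewals_le.
  rewrite pE; case: eqP => [sa|_]/=; last by rewrite mulr0 !mul0r.
  case: eqP => [tb|_]/=; last by rewrite mulr0 !mul0r.
  rewrite !mulr1 mul1r /f.
  have tab : renewals t w = (a + b)%N by rewrite -sa -tb subnKC//; exact: renewals_le.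
  rewrite big_split/=.
  under eq_bigr do rewrite /pcount sa.
  under [X in _ * X]eq_bigr do rewrite /pcount sa tab.
  rewrite prod_cnt big_split_ord/=; congr (_ * _).
    by apply: eq_bigr => i _; rewrite /wt ltn_ord.
  transitivity (\prod_(i < b) weight m y (X (a + i)%N w)); last first.
    by apply: eq_bigr => i _; rewrite /wt ltnNge leq_addr.
  have -> : \prod_(i < b) weight m y (X (a + i)%N w) =
     \prod_(k < m) y k ^+ (\sum_(i < b) (X (a + i)%N w == k)).
    transitivity (\prod_(k < m) \prod_(i < b) (y k ^+ (X (a + i)%N w == k))).
      rewrite exchange_big/=; apply: eq_bigr => i _.
      rewrite /weight; case: ltnP => [im|mi].
        rewrite (bigD1 (Ordinal im))//= eqxx expr1 big1 ?mulr1// => k /eqP ki.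
        case: eqP => [ik|_]; last by rewrite expr0.
        by exfalso; apply: ki; exact/val_inj.
      rewrite big1// => k _; case: eqP => [ik|_]; last by rewrite expr0.
      by move: (ltn_ord k); rewrite -ik ltnNge mi.
    apply: eq_bigr => k _.
    by elim/big_rec2: _ => [|i u v _ ->]; rewrite ?expr0// exprD.
  apply: eq_bigr => k _; congr (_ ^+ _).
  by rewrite /cnt big_split_ord/= addKn.
have -> : \prod_(k < m) (expR (s * p k * (x k - 1)) * expR ((t - s) * p k * (y k - 1))) =
    expR (s * (mean_weight m x - 1)) * expR ((t - s) * (mean_weight m y - 1)).
  rewrite big_split/= -!expR_sum /mean_weight !(addrC 1) !addrK !mulr_sumr.
  by congr (expR _ * expR _); apply: eq_bigr => k _; rewrite mulrA.
have step a : Ev (fun w => f w * (renewals s w == a)%:R) =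
    poi a s * mean_weight m x ^+ a * expR ((t - s) * (mean_weight m y - 1)).
  have bfa : bdd_rv (fun w => f w * (renewals s w == a)%:R).
    by apply: bdd_rvM => //; exact: bdd_rv_eq.
  have h1 := Ev_partition (P := P) mM bfa.
  have h2 := cvgr_scale (c := poi a s * mean_weight m x ^+ a) (@poi_pgf (t - s) (mean_weight m y)).
  apply: (cvgr_eq_lim h1 h2) => n; rewrite /series/= mulr_sumr.
  by apply: eq_bigr => b _; rewrite key.
have h1 := Ev_partition (P := P) (mN s) bf.
have h2 := cvgr_scale (c := expR ((t - s) * (mean_weight m y - 1))) (@poi_pgf s (mean_weight m x)).
rewrite mulrC; apply: (cvgr_eq_lim h1 h2) => n; rewrite /series/= mulr_sumr.
by apply: eq_bigr => a _; rewrite step mulrC.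
Qed.

End Poissonization.

(** * Independence of the boxes *)

Section BoxIndependence.
Context {d} {T : measurableType d} {R : realType} (P : probability T R).
Variables (p : nat -> R) (xi : nat -> {RV P >-> R}) (X : nat -> {RV P >-> nat}).
Hypothesis scheme : poissonized_karlin p xi X.
Hypothesis p_ge0 : forall k, 0 <= p k.
Implicit Types (s t r : R) (a b n k m j u v : nat).

Notation Ev := (Ev P).
Notation pcount := (pcount xi X).

Let pow_bdd (z : R) n : 0 <= z <= 1 -> `|z ^+ n| <= 1.
Proof. by move=> /andP[z0 z1]; rewrite normrX exprn_ile1// ger0_norm. Qed.

Lemma poi_le1 i (y : R) : 0 <= y -> poi i y <= 1.
Proof.
move=> y0; have := ptail_le1 i y0; have := ptail_ge0 i.+1 y0; rewrite ptailS; lra.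
Qed.

Lemma law_pcount k t n : 0 <= t ->
  Ev (fun w => (pcount k t w == n)%:R) = poi n (t * p k).
Proof.
move=> t0.
have h := @Ev_pgf_coef _ T R P (pcount k t) (fun=> 1) (fun u => poi u (t * p k))
  (fun z => expR (t * p k * (z - 1))) 1 1 (measurable_pcount xi X k t) (bdd_rv_cst 1) _ _ _ n.
have -> : (fun w => (pcount k t w == n)%:R) = (fun w => 1 * (pcount k t w == n)%:R : R).
  by apply/funext => w; rewrite mul1r.
rewrite h ?mul1r//.
- by move=> i; rewrite ger0_norm ?poi_le1 ?poi_ge0// mulr_ge0.
- by move=> x _; exact: poi_pgf.
move=> x /andP[x0 x1].
pose xs i : R := if i == k then x else 1.
have xs01 i : 0 <= xs i <= 1 by rewrite /xs; case: ifP => _; rewrite ?ler01 ?lexx// x0 ltW.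
have one01 (i : nat) : 0 <= (1 : R) <= 1 by rewrite ler01 lexx.
have := Ev_pgf scheme k.+1 xs01 one01 t0 (lexx t).
rewrite big_ord_recr/= big1; last first.
  move=> i _; rewrite /xs (ltn_eqF (ltn_ord i)) subrr !mulr0 expR0 mulr1//.
rewrite mul1r /xs eqxx !subrr !mulr0 expR0 mulr1 mul1r => <-.
congr Ev; apply/funext => w; rewrite mul1r big_ord_recr/= big1 ?mul1r; last first.
  by move=> i _; rewrite (ltn_eqF (ltn_ord i)) !expr1n mulr1.
by rewrite eqxx expr1n mulr1.
Qed.

Lemma law_pcount_ge k t j : 0 <= t ->
  Ev (fun w => (j <= pcount k t w)%N%:R) = ptail j (t * p k).
Proof.
move=> t0.
have bE n := @bdd_rv_eq _ _ R _ n (measurable_pcount xi X k t).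
have -> : (fun w => (j <= pcount k t w)%N%:R : R) =
    (fun w => 1 - \sum_(i < j) (pcount k t w == i)%:R).
  apply/funext => w; case: leqP => [ju|uj].
    rewrite big1 ?subr0// => i _; case: eqP => // e.
    by move: (ltn_ord i); rewrite -e ltnNge ju.
  rewrite (bigD1 (Ordinal uj))//= eqxx big1 ?addr0 ?subrr// => i /eqP ni.
  by case: eqP => // e; exfalso; apply: ni; exact/val_inj.
rewrite EvB; [|exact: bdd_rv_cst|exact: bdd_rv_sum].
rewrite Ev_cst Ev_sum//; congr (1 - _).
by apply: eq_bigr => i _; rewrite law_pcount.
Qed.

(** Independence of the boxes at two times: the generating function factorizes,
and the power series in the two variables of one box determine the weights of
that box while those of the other boxes are kept. *)
Theorem box_independence m s t (phi : nat -> nat -> nat -> R) M :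
  0 <= s -> s <= t -> (forall k u v, `|phi k u v| <= M) ->
  Ev (fun w => \prod_(k < m) phi k (pcount k s w) (pcount k t w - pcount k s w)%N) =
  \prod_(k < m) Ev (fun w => phi k (pcount k s w) (pcount k t w - pcount k s w)%N).
Proof.
move=> s0 st phiM.
pose U k := pcount k s; pose V k w := (pcount k t w - pcount k s w)%N.
have mU k : measurable_fun setT (U k) by exact: measurable_pcount.
have mV k : measurable_fun setT (V k).
  by apply: measurable_fun_subn; exact: measurable_pcount.
pose A k x := expR (s * p k * (x - 1)); pose B k y := expR ((t - s) * p k * (y - 1)).
have bphi k : bdd_rv (fun w => phi k (U k w) (V k w)).
  exact: (bdd_rv_nat2 (mU k) (mV k) (phiM k)).
have bx k (z : R) : 0 <= z <= 1 -> bdd_rv (fun w => z ^+ U k w).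
  by move=> z01; apply: (bdd_rv_nat (mU k)) => n; exact: pow_bdd.
have by_ k (z : R) : 0 <= z <= 1 -> bdd_rv (fun w => z ^+ V k w).
  by move=> z01; apply: (bdd_rv_nat (mV k)) => n; exact: pow_bdd.
have lt01 (z : R) : 0 <= z < 1 -> 0 <= z <= 1 by move=> /andP[-> /ltW].
(* weights of one box, given that its generating function factors out *)
have factor k (Y : T -> R) c : bdd_rv Y ->
    (forall x y : R, 0 <= x < 1 -> 0 <= y < 1 ->
       Ev (fun w => Y w * (x ^+ U k w * y ^+ V k w)) = c * (A k x * B k y)) ->
    forall u v, Ev (fun w => Y w * (U k w == u)%:R * (V k w == v)%:R) =
      c * (poi u (s * p k) * poi v ((t - s) * p k)).
  move=> bY YAB u v.
  have sp0 : 0 <= s * p k by rewrite mulr_ge0.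
  have tp0 : 0 <= (t - s) * p k by rewrite mulr_ge0// subr_ge0.
  have h1 (y : R) : 0 <= y < 1 -> Ev (fun w => (Y w * y ^+ V k w) * (U k w == u)%:R) =
      c * B k y * poi u (s * p k).
    move=> y01; apply: (@Ev_pgf_coef _ T R P (U k) _ (fun u => poi u (s * p k)) (A k) _ 1) => //.
    - by apply: bdd_rvM => //; apply: by_; exact: lt01.
    - by move=> i; rewrite ger0_norm ?poi_le1 ?poi_ge0.
    - by move=> x _; exact: poi_pgf.
    - move=> x x01; rewrite -mulrA [B k y * _]mulrC -YAB//.
      by congr Ev; apply/funext => w; rewrite -mulrA [y ^+ _ * _]mulrC.
  rewrite mulrA.
  apply: (@Ev_pgf_coef _ T R P (V k) _ (fun v => poi v ((t - s) * p k)) (B k) _ 1) => //.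
  - by apply: bdd_rvM => //; exact: bdd_rv_eq.
  - by move=> i; rewrite ger0_norm ?poi_le1 ?poi_ge0.
  - by move=> x _; exact: poi_pgf.
  - move=> y y01; rewrite mulrAC -h1//.
    by congr Ev; apply/funext => w; rewrite mulrAC.
have one k u v : Ev (fun w => (U k w == u)%:R * (V k w == v)%:R) =
    poi u (s * p k) * poi v ((t - s) * p k).
  have := @factor k (fun=> 1) 1 (bdd_rv_cst 1) _ u v; rewrite mul1r => <-.
    by congr Ev; apply/funext => w; rewrite mul1r.
  move=> x y x01 y01.
  pose xs i : R := if i == k then x else 1; pose ys i : R := if i == k then y else 1.
  have xs01 i : 0 <= xs i <= 1 by rewrite /xs; case: ifP => _; [exact: lt01 | by rewrite ler01 lexx].
  have ys01 i : 0 <= ys i <= 1 by rewrite /ys; case: ifP => _; [exact: lt01 | by rewrite ler01 lexx].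
  have := Ev_pgf scheme k.+1 xs01 ys01 s0 st.
  rewrite big_ord_recr/= big1; last first.
    by move=> i _; rewrite /xs /ys (ltn_eqF (ltn_ord i)) subrr !mulr0 expR0 mulr1.
  rewrite mul1r /xs /ys eqxx mul1r => <-.
  congr Ev; apply/funext => w; rewrite mul1r big_ord_recr/= big1 ?mul1r ?eqxx//.
  by move=> i _; rewrite (ltn_eqF (ltn_ord i)) !expr1n mulr1.
(* the boxes before [l] are tested by [phi], the others by powers *)
pose mixed l (x y : nat -> R) (w : T) k :=
  if (k < l)%N then phi k (U k w) (V k w) else x k ^+ U k w * y k ^+ V k w.
have bmixed l x y k : (forall k, 0 <= x k <= 1) -> (forall k, 0 <= y k <= 1) ->
    bdd_rv (fun w => mixed l x y w k).
  move=> x01 y01; rewrite /mixed; case: (ltnP k l) => _; first exact: bphi.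
  by apply: bdd_rvM; [exact: bx | exact: by_].
pose val_ l (x y : nat -> R) k : R :=
  if (k < l)%N then Ev (fun w => phi k (U k w) (V k w)) else A k (x k) * B k (y k).
suff claim l : (l <= m)%N -> forall x y : nat -> R,
    (forall k, 0 <= x k < 1) -> (forall k, 0 <= y k < 1) ->
    Ev (fun w => \prod_(k < m) mixed l x y w k) = \prod_(k < m) val_ l x y k.
  have z01 (k : nat) : 0 <= (0 : R) < 1 by rewrite lexx ltr01.
  have := claim m (leqnn m) (fun=> 0) (fun=> 0) z01 z01.
  rewrite /mixed /val_ => h.
  rewrite [RHS](eq_bigr (fun k : 'I_m => if (k < m)%N then
    Ev (fun w => phi k (U k w) (V k w)) else A k 0 * B k 0)); last first.
    by move=> k _; rewrite ltn_ord.
  rewrite -h; congr Ev; apply/funext => w.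
  by apply: eq_bigr => k _; rewrite ltn_ord.
elim: l => [_ x y x01 y01|l IH lm x y x01 y01].
  by rewrite (Ev_pgf scheme m (fun k => lt01 _ (x01 k)) (fun k => lt01 _ (y01 k)) s0 st).
pose o := Ordinal lm.
pose Y w := \prod_(k < m | k != o) mixed l.+1 x y w k.
pose c := \prod_(k < m | k != o) val_ l.+1 x y k.
have bY : bdd_rv Y.
  by apply: bdd_rv_prod => k _; apply: bmixed => i; exact: lt01.
have mixedE (k : 'I_m) : k != o -> forall x' y', mixed l.+1 x y ^~ k =
     mixed l (fun i => if i == l then x' else x i) (fun i => if i == l then y' else y i) ^~ k.
  move=> ko x' y'; have kl : (k : nat) == l = false.
    by apply/negbTE; apply: contra ko => /eqP e; apply/eqP/val_inj.
  by apply/funext => w; rewrite /mixed kl ltnS leq_eqVlt kl.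
have valE (k : 'I_m) : k != o -> forall x' y', val_ l.+1 x y k =
     val_ l (fun i => if i == l then x' else x i) (fun i => if i == l then y' else y i) k.
  move=> ko x' y'; have kl : (k : nat) == l = false.
    by apply/negbTE; apply: contra ko => /eqP e; apply/eqP/val_inj.
  by rewrite /val_ kl ltnS leq_eqVlt kl.
have YAB x' y' : 0 <= x' < 1 -> 0 <= y' < 1 ->
    Ev (fun w => Y w * (x' ^+ U l w * y' ^+ V l w)) = c * (A l x' * B l y').
  move=> x'01 y'01.
  pose xs i := if i == l then x' else x i; pose ys i := if i == l then y' else y i.
  have xs01 i : 0 <= xs i < 1 by rewrite /xs; case: ifP.
  have ys01 i : 0 <= ys i < 1 by rewrite /ys; case: ifP.
  have := IH (ltnW lm) xs ys xs01 ys01.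
  rewrite [RHS](bigD1 o)//= {1}/val_ ltnn /xs /ys eqxx mulrC => h.
  rewrite /c (eq_bigr _ (fun (k : 'I_m) ko => valE k ko x' y')) -h.
  congr Ev; apply/funext => w; rewrite (bigD1 o)//= {1}/mixed ltnn eqxx mulrC /Y.
  by congr (_ * _); apply: eq_bigr => k ko; have := mixedE k ko x' y' => /(congr1 (fun f => f w)).
have h := factor l Y c bY YAB.
have h2 := @Ev_factor2 _ T R P (U l) (V l) Y c (mU l) (mV l) bY _ _ _ (phiM l).
rewrite (bigD1 o)//= {1}/val_ ltnSn mulrC -/c -h2; last first.
  by move=> u v; rewrite h one.
congr Ev; apply/funext => w; rewrite (bigD1 o)//= {1}/mixed ltnSn mulrC //.
Qed.

End BoxIndependence.

(** * Exponential estimates for sums of independent bits *)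

Section ExpBounds.
Context {R : realType}.
Implicit Types (u v z c e s : R).

Lemma is_derive_cubic_exp c0 c1 c2 c3 e s z :
  is_derive z 1 (fun z => c0 + c1 * z + c2 * z ^+ 2 + c3 * z ^+ 3 + e * expR (s * z))
    (c1 + 2 * c2 * z + 3 * c3 * z ^+ 2 + e * (s * expR (s * z))).
Proof.
have h1 := @is_deriveZ _ _ _ _ c1 _ _ _ (@is_derive_id _ _ z 1).
have h2 := @is_deriveZ _ _ _ _ c2 _ _ _ (@is_deriveX _ _ (@id R) 2 z 1 1 (is_derive_id _ _)).
have h3 := @is_deriveZ _ _ _ _ c3 _ _ _ (@is_deriveX _ _ (@id R) 3 z 1 1 (is_derive_id _ _)).
have hs := @is_deriveZ _ _ _ (@id R) s z 1 1 (is_derive_id _ _).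
have h4 := @is_deriveZ _ _ _ _ e _ _ _
  (@is_derive1_comp R expR (s \*: (@id R)) z _ _ (is_derive_expR _) hs).
have h0 := @is_derive_cst _ _ _ c0 z 1.
have h := @is_deriveD _ _ _ _ _ _ _ _ _ (@is_deriveD _ _ _ _ _ _ _ _ _
  (@is_deriveD _ _ _ _ _ _ _ _ _ (@is_deriveD _ _ _ _ _ _ _ _ _ h0 h1) h2) h3) h4.
apply: (is_derive_eqfun h) => //.
by rewrite /GRing.scale/= expr1; ring.
Qed.

(** Iterating this on the derivative reduces a Taylor estimate of the exponential to
one of lower order. *)
Lemma cubic_exp_ge0 c0 c1 c2 c3 e s u : 0 <= u ->
  0 <= c0 + e ->
  (forall z, 0 < z < u -> 0 <= c1 + 2 * c2 * z + 3 * c3 * z ^+ 2 + e * (s * expR (s * z))) ->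
  0 <= c0 + c1 * u + c2 * u ^+ 2 + c3 * u ^+ 3 + e * expR (s * u).
Proof.
move=> u0 ce d0.
have := is_derive_ge0_le u0 (is_derive_cubic_exp c0 c1 c2 c3 e s) d0.
apply: le_trans; rewrite !mulr0 !expr0n/= !mulr0 !addr0 expR0 mulr1//.
Qed.

Lemma expR_ge2 u : 0 <= u -> 1 + u + u ^+ 2 / 2 <= expR u.
Proof.
move=> u0; have : 0 <= -1 + -1 * u + - 2^-1 * u ^+ 2 + 0 * u ^+ 3 + 1 * expR (1 * u).
  apply: cubic_exp_ge0 => [//||z /andP[z0 _]]; first by lra.
  by have := expR_ge1Dx z; rewrite !mul1r; lra.
by rewrite !mul1r; lra.
Qed.

Lemma expR_le_half u : 0 <= u <= 2^-1 -> expR u <= 1 + 2 * u.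
Proof.
move=> /andP[u0 u2]; have h := expR_ge1Dx (- u).
have e0 := expR_gt0 u.
have e1 : expR u * expR (- u) = 1 by rewrite expRN mulfV// gt_eqF.
have h1 : expR u * (1 - u) <= 1 by rewrite -[leRHS]e1 ler_wpM2l// ltW.
have h2 : 0 <= expR u * (2^-1 - u) by rewrite mulr_ge0 ?subr_ge0// ltW.
have h3 : expR u <= 2 by lra.
have h4 : 0 <= (2 - expR u) * u by rewrite mulr_ge0// subr_ge0.
lra.
Qed.

Lemma expR_le2 u : 0 <= u <= 2^-1 -> expR u <= 1 + u + u ^+ 2.
Proof.
move=> /andP[u0 u2]; have : 0 <= 1 + 1 * u + 1 * u ^+ 2 + 0 * u ^+ 3 + -1 * expR (1 * u).
  apply: cubic_exp_ge0 => [//||z /andP[z0 zu]]; first by lra.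
  have : 0 <= z <= 2^-1 by rewrite ltW//= (le_trans (ltW zu)).
  by move=> /expR_le_half; rewrite !mul1r; lra.
by rewrite !mul1r; lra.
Qed.

Lemma expR_le3 u : 0 <= u <= 2^-1 -> expR u <= 1 + u + u ^+ 2 / 2 + u ^+ 3 / 3.
Proof.
move=> /andP[u0 u2]; have : 0 <= 1 + 1 * u + 2^-1 * u ^+ 2 + 3^-1 * u ^+ 3 + -1 * expR (1 * u).
  apply: cubic_exp_ge0 => [//||z /andP[z0 zu]]; first by lra.
  have : 0 <= z <= 2^-1 by rewrite ltW//= (le_trans (ltW zu)).
  by move=> /expR_le2; rewrite !mul1r; lra.
by rewrite !mul1r; lra.
Qed.

Lemma expRN_le2 u : 0 <= u -> expR (- u) <= 1 - u + u ^+ 2 / 2.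
Proof.
move=> u0; have : 0 <= 1 + -1 * u + 2^-1 * u ^+ 2 + 0 * u ^+ 3 + -1 * expR (-1 * u).
  apply: cubic_exp_ge0 => [//||z /andP[z0 zu]]; first by lra.
  by have := expR_ge1Dx (- z); rewrite !mulN1r; lra.
by rewrite !mulN1r; lra.
Qed.

Lemma expRN_ge3 u : 0 <= u -> 1 - u + u ^+ 2 / 2 - u ^+ 3 / 6 <= expR (- u).
Proof.
move=> u0; have : 0 <= -1 + 1 * u + - 2^-1 * u ^+ 2 + 6^-1 * u ^+ 3 + 1 * expR (-1 * u).
  apply: cubic_exp_ge0 => [//||z /andP[z0 zu]]; first by lra.
  by have := expRN_le2 (ltW z0); rewrite !mulN1r; lra.
by rewrite !mulN1r; lra.
Qed.

Lemma expR_cubic_ub u : `|u| <= 2^-1 -> expR u <= 1 + u + u ^+ 2 / 2 + `|u| ^+ 3 / 3.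
Proof.
case: (leP 0 u) => [u0|u0].
  by rewrite (ger0_norm u0) => u2; apply: expR_le3; rewrite u0.
rewrite (ltr0_norm u0) => _.
have v0 : 0 <= - u by rewrite oppr_ge0 ltW.
have := expRN_le2 v0; rewrite opprK sqrrN => h; rewrite (le_trans h)//.
by rewrite lerDl mulr_ge0 ?exprn_ge0 ?invr_ge0.
Qed.

Lemma expR_cubic_lb u : 1 + u + u ^+ 2 / 2 - `|u| ^+ 3 / 6 <= expR u.
Proof.
case: (leP 0 u) => [u0|u0].
  by rewrite (ger0_norm u0) (le_trans _ (expR_ge2 u0))// gerBl mulr_ge0 ?exprn_ge0 ?invr_ge0.
have v0 : 0 <= - u by rewrite oppr_ge0 ltW.
by have := expRN_ge3 v0; rewrite opprK sqrrN (ltr0_norm u0).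
Qed.

(** Two-sided third order estimates: the centred variable has mean 0, variance
[r * (1 - r)], and its third absolute moment is at most its variance. *)
Lemma bernoulli_mgf_ub (r th : R) : 0 <= r <= 1 -> `|th| <= 2^-1 ->
  r * expR (th * (1 - r)) + (1 - r) * expR (th * (0 - r)) <=
  expR (r * (1 - r) * (th ^+ 2 / 2 * (1 + `|th|))).
Proof.
move=> /andP[r0 r1] th2.
have r1' : 0 <= 1 - r by rewrite subr_ge0.
have a0 := normr_ge0 th.
have b1 : `|th * (1 - r)| <= 2^-1.
  by rewrite normrM (le_trans _ th2)// ler_piMr// ger0_norm// gerBl.
have b2 : `|th * (0 - r)| <= 2^-1.
  by rewrite normrM (le_trans _ th2)// ler_piMr// sub0r normrN ger0_norm.
have h1 := ler_wpM2l r0 (expR_cubic_ub b1).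
have h2 := ler_wpM2l r1' (expR_cubic_ub b2).
rewrite (le_trans (lerD h1 h2))// (le_trans _ (expR_ge1Dx _))//.
rewrite !normrM sub0r normrN (ger0_norm r0) (ger0_norm r1') !exprMn sqrrN.
set a := `|th| in a0 *; set q := r * (1 - r).
have q0 : 0 <= q by rewrite mulr_ge0.
have a2 : th ^+ 2 = a ^+ 2 by rewrite /a -normrX ger0_norm// sqr_ge0.
have -> : r * (1 + th * (1 - r) + th ^+ 2 * (1 - r) ^+ 2 / 2 + a ^+ 3 * (1 - r) ^+ 3 / 3) +
  (1 - r) * (1 + th * - r + th ^+ 2 * r ^+ 2 / 2 + a ^+ 3 * r ^+ 3 / 3) =
  1 + q * (th ^+ 2 / 2) + q * (a ^+ 3 / 3) * ((1 - r) ^+ 2 + r ^+ 2).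
  by rewrite /q; field.
have -> : q * (th ^+ 2 / 2 * (1 + a)) = q * (th ^+ 2 / 2) + q * (a ^+ 3 / 3) * (3 / 2).
  by rewrite a2; field.
rewrite -addrA lerD2l lerD2l ler_wpM2l//.
  by rewrite mulr_ge0// mulr_ge0 ?exprn_ge0 ?invr_ge0.
have : 0 <= r * (1 - r) by []. 
lra.
Qed.

Lemma bernoulli_mgf_lb (r th : R) : 0 <= r <= 1 -> 0 <= th <= 2^-1 ->
  expR (r * (1 - r) * (th ^+ 2 / 2 * (1 - 2 * th))) <=
  r * expR (th * (1 - r)) + (1 - r) * expR (th * (0 - r)).
Proof.
move=> /andP[r0 r1] /andP[th0 th2].
have r1' : 0 <= 1 - r by rewrite subr_ge0.
have h1 := ler_wpM2l r0 (expR_cubic_lb (th * (1 - r))).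
have h2 := ler_wpM2l r1' (expR_cubic_lb (th * (0 - r))).
rewrite (le_trans _ (lerD h1 h2))//.
rewrite !normrM sub0r normrN (ger0_norm r0) (ger0_norm r1') (ger0_norm th0) !exprMn sqrrN.
set q := r * (1 - r).
have q0 : 0 <= q by rewrite mulr_ge0.
have q1 : q <= 1 by rewrite /q mulr_ile1// gerBl.
have -> : r * (1 + th * (1 - r) + th ^+ 2 * (1 - r) ^+ 2 / 2 - th ^+ 3 * (1 - r) ^+ 3 / 6) +
  (1 - r) * (1 + th * - r + th ^+ 2 * r ^+ 2 / 2 - th ^+ 3 * r ^+ 3 / 6) =
  1 + q * (th ^+ 2 / 2) - q * (th ^+ 3 / 6) * (1 - 2 * q).
  by rewrite /q; field.
set w := th ^+ 2 / 2.
have w0 : 0 <= w by rewrite mulr_ge0 ?exprn_ge0 ?invr_ge0.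
have w1 : w <= th / 4.
  have : 0 <= th * (2^-1 - th) by rewrite mulr_ge0// subr_ge0.
  by rewrite /w expr2; lra.
set y := q * (w * (1 - 2 * th)).
have c0 : 0 <= 1 - 2 * th by lra.
have y0 : 0 <= y by rewrite /y mulr_ge0// mulr_ge0.
have yw : y <= q * w by rewrite /y ler_wpM2l// ler_piMr// gerBl mulr_ge0.
have qw : q * w <= w by rewrite ler_piMl.
have y2 : 0 <= y <= 2^-1 by rewrite y0/=; lra.
rewrite (le_trans (expR_le2 y2))//.
have yy : y ^+ 2 <= q * w * (th / 4).
  rewrite expr2 (@le_trans _ _ (q * w * y))//; first by rewrite ler_wpM2r.
  by rewrite ler_wpM2l ?mulr_ge0//; lra.
have e3 : q * (th ^+ 3 / 6) = q * w * th / 3 by rewrite /w; field.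
have qwt : 0 <= q * w * th by rewrite !mulr_ge0.
have qqwt : 0 <= q * w * th * q by rewrite !mulr_ge0.
have yE : y = q * w - 2 * (q * w * th) by rewrite /y; ring.
rewrite e3; move: yy yE; clearbody y => yy yE; lra.
Qed.

End ExpBounds.

Section BernoulliSums.
Context {d} {T : measurableType d} {R : realType} (P : probability T R).
Notation Ev := (Ev P).
Implicit Types (b : nat -> T -> bool) (th : R) (Q : pred nat).

(** Mutual independence is stated through products of functions of the bits, which is
the form that moment generating functions consume. *)
Definition indep_bits b : Prop :=
  (forall k, measurable_fun setT (b k)) /\
  forall m (phi : nat -> bool -> R),
    Ev (fun w => \prod_(k < m) phi k (b k w)) = \prod_(k < m) Ev (fun w => phi k (b k w)).

Definition bit_mean b k : R := Ev (fun w => (b k w)%:R).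

Definition centred_sum b (Q : pred nat) m (w : T) : R :=
  \sum_(k < m | Q k) ((b k w)%:R - bit_mean b k).

Definition bit_var b k : R := bit_mean b k * (1 - bit_mean b k).

Lemma bdd_rv_bit b (phi : nat -> bool -> R) k : measurable_fun setT (b k) ->
  bdd_rv (fun w => phi k (b k w)).
Proof.
move=> mb; split.
  by apply: (measurableT_comp (f := phi k)) => // _ Y _; rewrite setTI.
exists (`|phi k true| + `|phi k false|) => w.
by case: (b k w); rewrite ?lerDl ?lerDr.
Qed.

Lemma bit_mean01 b k : measurable_fun setT (b k) -> 0 <= bit_mean b k <= 1.
Proof.
move=> mb; apply/andP; split; first by apply: Ev_ge0.
rewrite -(Ev_cst P 1); apply: Ev_le; [exact: (@bdd_rv_bit _ (fun _ c => c%:R))|exact: bdd_rv_cst|].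
by move=> w; case: (b k w).
Qed.

Lemma Ev_bit b (phi : nat -> bool -> R) k : measurable_fun setT (b k) ->
  Ev (fun w => phi k (b k w)) =
  bit_mean b k * phi k true + (1 - bit_mean b k) * phi k false.
Proof.
move=> mb; have bb := @bdd_rv_bit b (fun _ c => c%:R) k mb.
have -> : (fun w => phi k (b k w)) =
   (fun w => phi k false + (phi k true - phi k false) * (b k w)%:R).
  by apply/funext => w; case: (b k w); rewrite ?mulr1 ?mulr0 ?addr0// addrC subrK.
rewrite EvD; [|exact: bdd_rv_cst|by apply: bdd_rvM => //; exact: bdd_rv_cst].
rewrite Ev_cst EvZ// -/(bit_mean b k); ring.
Qed.

Lemma bdd_rv_centred_sum b Q m : (forall k, measurable_fun setT (b k)) ->
  bdd_rv (centred_sum b Q m).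
Proof.
move=> mb; apply: bdd_rv_sum => k _; apply: bdd_rvB; last exact: bdd_rv_cst.
exact: (@bdd_rv_bit _ (fun _ c => c%:R)).
Qed.

Lemma bdd_rv_expR (f : T -> R) : bdd_rv f -> bdd_rv (fun w => expR (f w)).
Proof.
move=> [mf [M fM]]; split; first exact: measurableT_comp.
exists (expR M) => w; rewrite ger0_norm ?expR_ge0// ler_expR.
exact: le_trans (ler_norm _) (fM w).
Qed.

Lemma Ev_exp_centred_sum b Q m th : indep_bits b ->
  Ev (fun w => expR (th * centred_sum b Q m w)) =
  \prod_(k < m | Q k) (bit_mean b k * expR (th * (1 - bit_mean b k)) +
     (1 - bit_mean b k) * expR (th * (0 - bit_mean b k))).
Proof.
move=> [mb ib].
pose phi k (c : bool) : R := if Q k then expR (th * (c%:R - bit_mean b k)) else 1.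
have -> : (fun w => expR (th * centred_sum b Q m w)) =
    (fun w => \prod_(k < m) phi k (b k w)).
  apply/funext => w; rewrite /centred_sum mulr_sumr expR_sum big_mkcond/=.
  by apply: eq_bigr => k _; rewrite /phi; case: ifP.
rewrite ib [RHS]big_mkcond/=; apply: eq_bigr => k _.
rewrite Ev_bit// /phi; case: ifP => // _; ring.
Qed.

Lemma mgf_ub b Q m th V : indep_bits b -> `|th| <= 2^-1 ->
  \sum_(k < m | Q k) bit_var b k <= V ->
  Ev (fun w => expR (th * centred_sum b Q m w)) <=
  expR (V * (th ^+ 2 / 2 * (1 + `|th|))).
Proof.
move=> ib th2 sV; have [mb _] := ib; rewrite Ev_exp_centred_sum//.
apply: (@le_trans _ _ (expR (\sum_(k < m | Q k) bit_var b k * (th ^+ 2 / 2 * (1 + `|th|))))).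
  rewrite expR_sum; apply: ler_prod => k _.
  have r01 := bit_mean01 (mb k); have /andP[r0 r1] := r01.
  rewrite bernoulli_mgf_ub// andbT.
  by rewrite addr_ge0// mulr_ge0 ?expR_ge0// subr_ge0.
rewrite ler_expR -mulr_suml ler_wpM2r//.
by apply: mulr_ge0; [rewrite mulr_ge0 ?sqr_ge0 | rewrite addr_ge0].
Qed.

Lemma mgf_lb b Q m th : indep_bits b -> 0 <= th <= 2^-1 ->
  expR ((\sum_(k < m | Q k) bit_var b k) * (th ^+ 2 / 2 * (1 - 2 * th))) <=
  Ev (fun w => expR (th * centred_sum b Q m w)).
Proof.
move=> ib th2; have [mb _] := ib; rewrite Ev_exp_centred_sum//.
rewrite mulr_suml expR_sum; apply: ler_prod => k _.
by rewrite expR_ge0 bernoulli_mgf_lb// bit_mean01.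
Qed.

(** Chernoff bound for the limit of centred sums; truncating the exponential at
the level of the event makes bounded convergence applicable. *)
Lemma chernoff_limit b Q (Y : T -> R) th V a : indep_bits b -> `|th| <= 2^-1 ->
  (forall m, \sum_(k < m | Q k) bit_var b k <= V) ->
  measurable_fun setT Y ->
  {ae P, forall w, centred_sum b Q m w @[m --> \oo] --> Y w} ->
  fine (P [set w | a <= th * Y w]) <= expR (- a + V * (th ^+ 2 / 2 * (1 + `|th|))).
Proof.
move=> ib th2 sV mY cY; have [mb _] := ib.
pose tr (x : R) := Num.min (expR (th * x)) (expR a).
have tr0 x : 0 <= tr x by rewrite le_min !expR_ge0.
have btr (f : T -> R) : measurable_fun setT f -> bdd_rv (tr \o f).
  move=> mf; split.
    apply: measurable_minr; last exact: measurable_cst.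
    by apply: measurableT_comp => //; apply: measurable_funM => //; exact: measurable_cst.
  by exists (expR a) => w; rewrite ger0_norm//= ge_min lexx orbT.
have mE : measurable [set w | a <= th * Y w].
  have mf : measurable_fun setT (fun w => th * Y w).
    by apply: measurable_funM => //; exact: measurable_cst.
  have := mf measurableT _ (measurable_itv `[a, +oo[); rewrite setTI.
  by congr measurable; apply/seteqP; split => w /=; rewrite in_itv/= andbT.
have mS m := (bdd_rv_centred_sum Q m mb).1.
have lim_tr : Ev (tr \o centred_sum b Q m) @[m --> \oo] --> Ev (tr \o Y).
  apply: (@Ev_cvg _ _ _ P _ _ (expR a)).
  - by move=> m; exact: (btr _ (mS m)).1.
  - exact: btr.
  - by move=> m w /=; rewrite ger0_norm//= ge_min lexx orbT.
  - apply: filterS cY => w cw /=.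
    have ctr : {for Y w, continuous tr}.
      apply: continuous_min; last exact: cvg_cst.
      apply: continuous_comp; last exact: continuous_expR.
      by apply: cvgM; [exact: cvg_cst | exact: cvg_id].
    exact: (continuous_cvg _ ctr cw).
have bound : Ev (tr \o Y) <= expR (V * (th ^+ 2 / 2 * (1 + `|th|))).
  apply: (cvgr_to_le lim_tr); apply: nearW => m.
  apply: le_trans (mgf_ub ib th2 (sV m)); apply: Ev_le.
  - exact: btr.
  - apply: bdd_rv_expR; apply: bdd_rvM; [exact: bdd_rv_cst | exact: bdd_rv_centred_sum].
  - by move=> w /=; rewrite ge_min lexx.
rewrite -Ev_indic// expRD (le_trans _ (ler_wpM2l (expR_ge0 _) bound))//.
rewrite -EvZ; last exact: btr.
apply: Ev_le; [exact: bdd_rv_indic|by apply: bdd_rvM; [exact: bdd_rv_cst|exact: btr]|].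
move=> w; rewrite indicE; have [/set_mem/= aY|_] := boolP (w \in _); last by rewrite mulr_ge0 ?expR_ge0//= tr0.
rewrite /tr min_r ?ler_expR// -expRD addNr expR0//.
Qed.

(** Tilting by [th] puts the mass of [exp (th * Y)] near [V * th]: comparison with
the tilts [th * (1 + kap)] and [th * (1 - kap)] shows that the part outside of
[[V * th * (1 - kap), V * th * (1 + kap)]] is at most half of the total, and on
this interval the density of the tilt is explicitly bounded. *)
Lemma lower_tail (Y : T -> R) V kap th : bdd_rv Y -> 0 <= V ->
  (forall h, 0 <= h <= 2^-1 -> expR (V * (h ^+ 2 / 2 * (1 - 2 * h))) <=
     Ev (fun w => expR (h * Y w)) <= expR (V * (h ^+ 2 / 2 * (1 + h)))) ->
  0 < kap <= 2^-1 -> 0 < th -> th <= kap ^+ 2 / 20 -> 12 <= V * th ^+ 2 * kap ^+ 2 ->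
  2^-1 * expR (- (V * th ^+ 2 / 2 * (1 + 3 * kap))) <=
  fine (P [set w | V * th * (1 - kap) <= Y w]).
Proof.
move=> bY V0 mgf /andP[k0 k1] th0 thk big.
have kk : kap ^+ 2 <= kap / 2 by rewrite expr2 ler_wpM2l// ltW.
have th2 : th <= 2^-1 / 2 by lra.
pose h := kap * th; pose y1 := V * th * (1 - kap); pose y2 := V * th * (1 + kap).
have h0 : 0 < h by rewrite mulr_gt0.
have hth : h <= th / 2 by rewrite /h [th / 2]mulrC ler_wpM2r// ltW.
have bE c : bdd_rv (fun w => expR (c * Y w)).
  by apply: bdd_rv_expR; apply: bdd_rvM => //; exact: bdd_rv_cst.
have mA : measurable [set w | y1 <= Y w].
  have := bY.1 measurableT _ (measurable_itv `[y1, +oo[); rewrite setTI.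
  by congr measurable; apply/seteqP; split => w /=; rewrite in_itv/= andbT.
set A := [set w | _ <= Y w] in mA *.
pose M c := Ev (fun w => expR (c * Y w)).
have split_M : M th <= expR (th * y2) * fine (P A) +
    expR (- (h * y2)) * M (th + h) + expR (h * y1) * M (th - h).
  rewrite -Ev_indic// -!EvZ//; last exact: bdd_rv_indic.
  have b1 : bdd_rv (fun w => expR (th * y2) * \1_A w).
    by apply: bdd_rvM; [exact: bdd_rv_cst | exact: bdd_rv_indic].
  have b2 : bdd_rv (fun w => expR (- (h * y2)) * expR ((th + h) * Y w)).
    by apply: bdd_rvM; [exact: bdd_rv_cst | exact: bE].
  have b3 : bdd_rv (fun w => expR (h * y1) * expR ((th - h) * Y w)).
    by apply: bdd_rvM; [exact: bdd_rv_cst | exact: bE].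
  rewrite -EvD// -EvD//; last exact: bdd_rvD.
  apply: Ev_le; [exact: bE | by apply: bdd_rvD => //; exact: bdd_rvD |].
  move=> w; rewrite -!expRD.
  (* above [y2] the larger tilt dominates, below [y1] the smaller one *)
  have e1 : th * Y w <= - (h * y2) + (th + h) * Y w -> expR (th * Y w) <=
     expR (th * y2) * \1_A w + expR (- (h * y2) + (th + h) * Y w) + expR (h * y1 + (th - h) * Y w).
    move=> e; rewrite -ler_expR in e; rewrite (le_trans e)//.
    by rewrite -addrA addrCA lerDl addr_ge0 ?expR_ge0// mulr_ge0 ?expR_ge0// indicE.
  case: (ltP y2 (Y w)) => [yY|Yy].
    apply: e1; rewrite mulrDl addrCA lerDl addrC subr_ge0 ler_wpM2l// ltW//.
  have [yA|/negP yA] := boolP (w \in A).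
    rewrite indicE yA mulr1 -addrA (@le_trans _ _ (expR (th * y2)))//.
      by rewrite ler_expR ler_wpM2l// ltW.
    by rewrite lerDl addr_ge0 ?expR_ge0.
  have Yy1 : Y w < y1 by rewrite ltNge; apply/negP => ?; apply: yA; exact/mem_set.
  have e : th * Y w <= h * y1 + (th - h) * Y w.
    by rewrite mulrBl addrCA lerDl subr_ge0 ler_wpM2l// ltW.
  rewrite -ler_expR in e; rewrite (le_trans e)// lerDr.
  by rewrite addr_ge0 ?expR_ge0// mulr_ge0 ?expR_ge0// indicE.
pose G := V * th ^+ 2.
have G0 : 0 <= G by rewrite mulr_ge0 ?exprn_ge0// ltW.
have Mth : expR (G * (2^-1 - th)) <= M th.
  have /mgf/andP[+ _] : 0 <= th <= 2^-1 by rewrite ltW//=; lra.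
  by apply: le_trans; rewrite ler_expR /G le_eqVlt; apply/orP; left; apply/eqP; field.
have B2 : expR (- (h * y2)) * M (th + h) <= expR (G * (2^-1 - kap ^+ 2 / 2 + 4 * th)).
  have /mgf/andP[_ ub] : 0 <= th + h <= 2^-1 by rewrite addr_ge0 ?ltW//=; lra.
  rewrite (le_trans (ler_wpM2l (expR_ge0 _) ub))// -expRD ler_expR.
  have -> : - (h * y2) + V * ((th + h) ^+ 2 / 2 * (1 + (th + h))) =
    G * (2^-1 - kap ^+ 2 / 2 + (1 + kap) ^+ 3 * th / 2) by rewrite /h /y2 /G; field.
  rewrite ler_wpM2l// lerD2l.
  have : (1 + kap) ^+ 3 <= 8.
    rewrite (_ : 8 = 2 ^+ 3); last by ring.
    by rewrite lerXn2r// ?nnegrE//; lra.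
  move=> /(ler_wpM2r (ltW th0)); lra.
have B3 : expR (h * y1) * M (th - h) <= expR (G * (2^-1 - kap ^+ 2 / 2 + 4 * th)).
  have /mgf/andP[_ ub] : 0 <= th - h <= 2^-1 by apply/andP; split; lra.
  rewrite (le_trans (ler_wpM2l (expR_ge0 _) ub))// -expRD ler_expR.
  have -> : h * y1 + V * ((th - h) ^+ 2 / 2 * (1 + (th - h))) =
    G * (2^-1 - kap ^+ 2 / 2 + (1 - kap) ^+ 3 * th / 2) by rewrite /h /y1 /G; field.
  rewrite ler_wpM2l// lerD2l.
  have : (1 - kap) ^+ 3 <= 1 by rewrite exprn_ile1//; lra.
  move=> /(ler_wpM2r (ltW th0)); lra.
(* the gain [kap ^ 2 / 2] of the tilts exceeds the cubic errors and a factor 4 *)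
have B4 : 4 * expR (G * (2^-1 - kap ^+ 2 / 2 + 4 * th)) <= expR (G * (2^-1 - th)).
  have -> : expR (G * (2^-1 - th)) = expR (G * (kap ^+ 2 / 2 - 5 * th)) *
      expR (G * (2^-1 - kap ^+ 2 / 2 + 4 * th)) by rewrite -expRD; congr expR; field.
  rewrite ler_wpM2r ?expR_ge0// (le_trans _ (expR_ge1Dx _))//.
  have : G * (kap ^+ 2 / 4) <= G * (kap ^+ 2 / 2 - 5 * th) by rewrite ler_wpM2l//; lra.
  by rewrite -/G in big; lra.
have key : 2^-1 * expR (G * (2^-1 - th)) <= expR (th * y2) * fine (P A) by lra.
have e2 := expR_gt0 (th * y2).
rewrite -(ler_pM2l e2); apply: le_trans key; rewrite mulrCA ler_wpM2l// -expRD ler_expR.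
have -> : th * y2 + - (V * th ^+ 2 / 2 * (1 + 3 * kap)) = G * (2^-1 - kap / 2).
  by rewrite /G /y2; field.
by rewrite ler_wpM2l// lerD2l lerN2; lra.
Qed.

End BernoulliSums.

(** * The Borel-Cantelli lemmas *)

Section BorelCantelli.
Context {d} {T : measurableType d} {R : realType} (P : probability T R).
Notation Ev := (Ev P).
Implicit Types (E : nat -> set T) (u : nat -> R).

Lemma borel_cantelli1 E u C : (forall n, measurable (E n)) ->
  (forall n, fine (P (E n)) <= u n) -> (forall n, \sum_(i < n) u i <= C) ->
  {ae P, forall w, exists N, forall n, (N <= n)%N -> ~ E n w}.
Proof.
move=> mE Eu uC.
have s : (\sum_(n <oo) P (E n) < +oo)%E.
  apply: (@le_lt_trans _ _ C%:E); last by rewrite ltry.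
  apply: lime_le; first exact: is_cvg_nneseries.
  apply: nearW => n; rewrite big_mkord.
  rewrite (eq_bigr (fun i : 'I_n => (fine (P (E i)))%:E)); last first.
    by move=> i _; rewrite fineK// fin_num_measure.
  rewrite sumEFin lee_fin (le_trans _ (uC n))//; apply: ler_sum => i _; exact: Eu.
have := lim_sup_set_cvg0 mE s => h.
exists (lim_sup_set E); split => //.
  by apply: bigcapT_measurable => n; apply: bigcup_measurable => k _; exact: mE.
move=> w /= nw n _; apply/not_exists2P => h'; apply: nw; exists n => k nk Ek.
by have := h' k; case=> // /(_ Ek).
Qed.

(** Pairwise independence suffices: the variance of the number of occurrences is at
most its mean, which is unbounded, so that Chebyshev's inequality forces
infinitely many occurrences. *)
Lemma borel_cantelli2 E : (forall n, measurable (E n)) ->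
  (forall i j, i <> j -> fine (P (E i `&` E j)) = fine (P (E i)) * fine (P (E j))) ->
  (forall A, exists n, A <= \sum_(i < n) fine (P (E i))) ->
  {ae P, forall w N, exists2 n, (N <= n)%N & E n w}.
Proof.
move=> mE pE sE; apply/ae_foralln => N.
pose F := \bigcap_n (if (N <= n)%N then ~` E n else setT).
have mF : measurable F.
  by apply: bigcapT_measurable => n; case: ifP => _ //; exact: measurableC.
exists F; split => //; last first.
  move=> w /= h n _; case: ifPn => // Nn En; apply: h; by exists n.
pose pr n := fine (P (E n)).
have pr01 n : 0 <= pr n <= 1.
  rewrite /pr fine_ge0//= -lee_fin fineK ?fin_num_measure//.
  exact: probability_le1.
have bI n : bdd_rv (\1_(E n) : T -> R) by exact: bdd_rv_indic.
have EvI n : Ev \1_(E n) = pr n by exact: Ev_indic.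
pose c n w : R := \1_(E n) w - pr n.
have bc n : bdd_rv (c n) by apply: bdd_rvB => //; exact: bdd_rv_cst.
have cov i j : Ev (fun w => c i w * c j w) = if i == j then pr i * (1 - pr i) else 0.
  have -> : (fun w => c i w * c j w) = (fun w => (\1_(E i `&` E j) w - pr i * \1_(E j) w) - pr j * c i w).
    by apply/funext => w; rewrite indicI/= /c; ring.
  have b1 : bdd_rv (\1_(E i `&` E j) : T -> R) by apply: bdd_rv_indic; exact: measurableI.
  have b2 k f : bdd_rv f -> bdd_rv (fun w : T => k * f w).
    by move=> bf; apply: bdd_rvM => //; exact: bdd_rv_cst.
  rewrite EvB; [|by apply: bdd_rvB => //; exact: b2|exact: b2].
  rewrite EvB//; last exact: b2.
  rewrite !EvZ// EvI Ev_indic; last exact: measurableI.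
  have -> : Ev (c i) = 0 by rewrite EvB//; [rewrite EvI Ev_cst subrr|exact: bdd_rv_cst].
  rewrite mulr0 subr0; case: eqP => [<-|ij]; first by rewrite setIid -/(pr i); ring.
  by rewrite pE// subrr.
pose s n := \sum_(N <= i < n) pr i.
have var n : Ev (fun w => (\sum_(N <= i < n) c i w) ^+ 2) <= s n.
  have -> : (fun w => (\sum_(N <= i < n) c i w) ^+ 2) =
      (fun w => \sum_(N <= i < n) \sum_(N <= j < n) c i w * c j w).
    apply/funext => w; rewrite expr2 mulr_suml; apply: eq_bigr => i _.
    by rewrite mulr_sumr.
  rewrite Ev_sum; last by move=> i _; apply: bdd_rv_sum => j _; exact: bdd_rvM.
  rewrite /s big_seq [leRHS]big_seq; apply: ler_sum => i iN.
  rewrite Ev_sum; last by move=> j _; exact: bdd_rvM.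
  rewrite (bigD1_seq i) ?iota_uniq//= cov eqxx big1 ?addr0; last first.
    by move=> j /negbTE ji; rewrite cov eq_sym ji.
  have /andP[p0 p1] := pr01 i.
  by rewrite ler_piMr// gerBl.
have key n : s n ^+ 2 * fine (P F) <= s n.
  apply: le_trans (var n); rewrite -Ev_indic// -EvZ; last exact: bdd_rv_indic.
  apply: Ev_le.
  - by apply: bdd_rvM; [exact: bdd_rv_cst|exact: bdd_rv_indic].
  - under eq_fun do rewrite expr2.
    by apply: bdd_rvM; apply: bdd_rv_sum => i _.
  - move=> w; rewrite indicE; have [/set_mem Fw|_] := boolP (w \in F); last by rewrite mulr0 sqr_ge0.
    rewrite mulr1 (_ : \sum_(N <= i < n) c i w = - s n) ?sqrrN//.
    rewrite /s -sumrN big_nat [RHS]big_nat; apply: eq_bigr => i /andP[Ni _].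
    have := Fw i I; rewrite Ni /c indicE => nE.
    by rewrite memNset// sub0r.
apply/eqP; rewrite eq_le measure_ge0 andbT -[leLHS]fineK ?fin_num_measure// lee_fin.
rewrite leNgt; apply/negP => F0.
have [n sn] := sE (\sum_(i < N) pr i + (fine (P F))^-1 + 1).
have Nn : (N <= n)%N.
  rewrite leqNgt; apply/negP => nN.
  have : \sum_(i < n) pr i <= \sum_(i < N) pr i.
    rewrite -!(big_mkord xpredT) (big_cat_nat (leq0n n) (ltnW nN))/= lerDl.
    by apply: sumr_ge0 => i _; case/andP: (pr01 i).
  have : 0 < (fine (P F))^-1 by rewrite invr_gt0.
  by move=> a b; move: sn; rewrite leNgt => /negP; apply; rewrite (le_lt_trans b)//; lra.
have sn1 : (fine (P F))^-1 + 1 <= s n.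
  have e : \sum_(i < n) fine (P (E i)) = \sum_(i < N) pr i + s n.
    by rewrite -!(big_mkord xpredT pr) -(big_cat_nat (leq0n N) Nn) big_mkord.
  by move: sn; rewrite e -addrA lerD2l.
have F1 : 0 < (fine (P F))^-1 by rewrite invr_gt0.
have s0 : 0 < s n by apply: lt_le_trans sn1; lra.
have := key n; rewrite expr2 -mulrA ger_pMr//.
rewrite leNgt => /negP; apply.
by rewrite mulrC -ltr_pdivrMl// mulr1; apply: lt_le_trans sn1; rewrite ltrDl.
Qed.

End BorelCantelli.

(** * Sums over the boxes *)

Lemma counting_nat {R : realType} (A : set nat) :
  counting A = (\sum_(n <oo) ((n \in A)%:R : R)%:E)%E.
Proof.
have AE : A = \bigcup_n (A `&` [set n]).
  by apply/seteqP; split => [n An|n [m _ []]//]; exists n.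
rewrite {1}AE measure_bigcup//=; last first.
  by apply/trivIsetP => i j _ _ ij; apply/seteqP; split => // n [[_ ->] [_ /eqP]]; rewrite (negbTE ij).
rewrite (@eq_eseriesl _ _ xpredT); last by move=> n; rewrite in_setT.
apply: eq_eseriesr => n _.
have [/set_mem An|/negP An] := boolP (n \in A).
  rewrite (_ : _ `&` _ = [set n]); last by apply/seteqP; split => [m []//|m ->].
  rewrite /counting asboolT; last exact: finite_set1.
  by rewrite fset_set1 finmap.cardfs1.
rewrite (_ : _ `&` _ = set0) ?measure0//.
by apply/seteqP; split => // m [/= Am mn]; apply: An; rewrite -mn; exact/mem_set.
Qed.

Section BoxSums.
Context {R : realType}.
Variable p : nat -> R.
Hypothesis p_ge0 : forall k, 0 <= p k.
Hypothesis p_sum1 : (\sum_(0 <= k <oo) (p k)%:E = 1)%E.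
Implicit Types (f g : nat -> R) (t c : R) (n m k : nat).

(** Domination by a multiple of the probabilities makes every sum over the boxes
converge and makes linearity and comparison available. *)
Definition boxdom f : Prop := (forall k, 0 <= f k) /\ exists C, forall k, f k <= C * p k.

Definition boxsum f : R := limn (series f).

Lemma series_p_le1 n : \sum_(k < n) p k <= 1.
Proof.
rewrite -lee_fin -p_sum1 -sumEFin -(big_mkord xpredT (fun k => (p k)%:E)).
by apply: nneseries_lim_ge => k _; rewrite lee_fin.
Qed.

Lemma p_le1 k : p k <= 1.
Proof.
by apply: le_trans (series_p_le1 k.+1); rewrite big_ord_recr/= lerDr sumr_ge0.
Qed.

Lemma boxdom_p : boxdom p.
Proof. by split => //; exists 1 => k; rewrite mul1r. Qed.

Lemma boxdom_le f g : boxdom g -> (forall k, 0 <= f k <= g k) -> boxdom f.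
Proof.
move=> [g0 [C gC]] fg; split; first by move=> k; case/andP: (fg k).
by exists C => k; case/andP: (fg k) => _ /le_trans; apply.
Qed.

Lemma boxdomD f g : boxdom f -> boxdom g -> boxdom (fun k => f k + g k).
Proof.
move=> [f0 [C fC]] [g0 [D gD]]; split; first by move=> k; rewrite addr_ge0.
by exists (C + D) => k; rewrite mulrDl lerD.
Qed.

Lemma boxdomZ c f : 0 <= c -> boxdom f -> boxdom (fun k => c * f k).
Proof.
move=> c0 [f0 [C fC]]; split; first by move=> k; rewrite mulr_ge0.
by exists (c * C) => k; rewrite -mulrA ler_wpM2l.
Qed.

Lemma boxsum_bound f n C : (forall k, f k <= C * p k) -> 0 <= C -> \sum_(k < n) f k <= C.
Proof.
move=> fC C0; apply: (@le_trans _ _ (\sum_(k < n) C * p k)); first exact: ler_sum.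
by rewrite -mulr_sumr ler_piMr// series_p_le1.
Qed.

Lemma boxsum_cvg f : boxdom f -> series f @ \oo --> boxsum f.
Proof.
move=> [f0 [C fC]]; apply: nondecreasing_is_cvgn.
  by apply/nondecreasing_seqP => n; rewrite /series/= big_nat_recr//= lerDl.
exists (Num.max C 0) => _ [n _ <-]; rewrite /series/= big_mkord.
apply: boxsum_bound; last by rewrite le_max lexx orbT.
by move=> k; rewrite (le_trans (fC k))// ler_wpM2r// le_max lexx.
Qed.

Lemma boxsum_ge f n : boxdom f -> \sum_(k < n) f k <= boxsum f.
Proof.
move=> df; apply: (cvgr_to_ge (boxsum_cvg df)); exists n => // m /= nm.
rewrite /series/= (big_cat_nat (leq0n n) nm)/= big_mkord lerDl.
by apply: sumr_ge0 => k _; exact: df.1.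
Qed.

Lemma boxsum_lim_le f C : boxdom f -> (forall n, \sum_(k < n) f k <= C) -> boxsum f <= C.
Proof.
move=> df fC; apply: (cvgr_to_le (boxsum_cvg df)); apply: nearW => n.
by rewrite /series/= big_mkord.
Qed.

Lemma boxsum_ge0 f : boxdom f -> 0 <= boxsum f.
Proof. by move=> df; have := boxsum_ge 0 df; rewrite big_ord0. Qed.

Lemma boxsum_le f g : boxdom f -> boxdom g -> (forall k, f k <= g k) -> boxsum f <= boxsum g.
Proof.
move=> df dg fg; apply: boxsum_lim_le => // n; apply: le_trans (boxsum_ge n dg).
exact: ler_sum.
Qed.

Lemma boxsumD f g : boxdom f -> boxdom g ->
  boxsum (fun k => f k + g k) = boxsum f + boxsum g.
Proof.
move=> df dg; apply/cvg_lim => //.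
rewrite (_ : series _ = (fun n => series f n + series g n)); last first.
  by apply/funext => n; rewrite /series/= big_split.
by apply: cvgD; exact: boxsum_cvg.
Qed.

Lemma boxsumZ c f : boxdom f -> boxsum (fun k => c * f k) = c * boxsum f.
Proof.
move=> df; apply/cvg_lim => //.
rewrite (_ : series _ = (fun n => c * series f n)); last first.
  by apply/funext => n; rewrite /series/= mulr_sumr.
by apply: cvgr_scale; exact: boxsum_cvg.
Qed.

Lemma boxsumB f g : boxdom f -> boxdom g ->
  boxsum (fun k => f k - g k) = boxsum f - boxsum g.
Proof.
move=> df dg; apply/cvg_lim => //.
rewrite (_ : series _ = (fun n => series f n - series g n)); last first.
  by apply/funext => n; rewrite /series/= sumrB.
by apply: cvgB; exact: boxsum_cvg.
Qed.

Lemma boxdom_sum N (c : 'I_N -> R) (f : 'I_N -> nat -> R) : (forall i, 0 <= c i) ->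
  (forall i, boxdom (f i)) -> boxdom (fun k => \sum_(i < N) c i * f i k).
Proof.
move=> c0 df; elim: N c f c0 df => [|N IH] c f c0 df.
  rewrite (_ : (fun k => _) = (fun k => 0 * p k)); first by apply: boxdomZ => //; exact: boxdom_p.
  by apply/funext => k; rewrite big_ord0 mul0r.
rewrite (_ : (fun k => _) = (fun k => c ord0 * f ord0 k +
    \sum_(i < N) c (lift ord0 i) * f (lift ord0 i) k)); last first.
  by apply/funext => k; rewrite big_ord_recl.
by apply: boxdomD; [exact: boxdomZ | exact: IH].
Qed.

Lemma boxsum_sum N (c : 'I_N -> R) (f : 'I_N -> nat -> R) : (forall i, 0 <= c i) ->
  (forall i, boxdom (f i)) ->
  boxsum (fun k => \sum_(i < N) c i * f i k) = \sum_(i < N) c i * boxsum (f i).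
Proof.
move=> c0 df; elim: N c f c0 df => [|N IH] c f c0 df.
  rewrite (_ : (fun k => _) = (fun k => 0 * p k)); last first.
    by apply/funext => k; rewrite big_ord0 mul0r.
  by rewrite boxsumZ ?mul0r ?big_ord0//; exact: boxdom_p.
rewrite (_ : (fun k => _) = (fun k => c ord0 * f ord0 k +
    \sum_(i < N) c (lift ord0 i) * f (lift ord0 i) k)); last first.
  by apply/funext => k; rewrite big_ord_recl.
rewrite boxsumD; [|exact: boxdomZ|exact: boxdom_sum].
by rewrite boxsumZ// IH// big_ord_recl.
Qed.

Lemma boxsum_eseries f : boxdom f -> (\sum_(k <oo) (f k)%:E)%E = (boxsum f)%:E.
Proof.
move=> df; apply/cvg_lim => //.
rewrite (_ : (fun n => _) = (fun n => (series f n)%:E)); last first.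
  by apply/funext => n; rewrite sumEFin.
by apply/cvg_EFin; [exact: nearW | exact: boxsum_cvg].
Qed.

Lemma boxdom_fun (F : R -> R) C t : 0 <= t -> (forall y, 0 <= y -> 0 <= F y <= C * y) ->
  boxdom (fun k => F (t * p k)).
Proof.
move=> t0 FC; split; first by move=> k; case/andP: (FC (t * p k) (mulr_ge0 t0 (p_ge0 k))).
exists (C * t) => k; case/andP: (FC (t * p k) (mulr_ge0 t0 (p_ge0 k))) => _.
by rewrite mulrA.
Qed.

Lemma boxdom_ind t : boxdom (fun k => (1 <= t * p k)%R%:R : R).
Proof.
split => //; exists `|t| => k; case: (leP 1 (t * p k)) => /= [h|_]; last first.
  by rewrite mulr0n mulr_ge0.
by rewrite mulr1n (le_trans h)// ler_wpM2r// ler_norm.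
Qed.

(** Writing [1 / p k <= t] as [1 <= t * p k] removes the exception for the boxes of
probability 0. *)
Lemma rhoE t : rho p t = boxsum (fun k => (1 <= t * p k)%R%:R : R).
Proof.
rewrite /rho counting_nat -[RHS]/(fine (boxsum _)%:E) -boxsum_eseries; last exact: boxdom_ind.
congr fine; apply: eq_eseriesr => k _; congr (_%:R%:E); congr nat_of_bool.
apply/idP/idP => [/set_mem/= [pk]|h].
  by rewrite -[in X in X -> _](mul1r (_^-1)) ler_pdivrMr.
have pk : 0 < p k.
  rewrite lt0r p_ge0 andbT; apply/eqP => pk0.
  by move: h; rewrite pk0 mulr0 ler10.
by apply/mem_set; split => //=; rewrite -[X in X <= _]mul1r ler_pdivrMr.
Qed.

Lemma rho_ge0 t : 0 <= rho p t.
Proof. by rewrite rhoE; apply: boxsum_ge0; exact: boxdom_ind. Qed.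

Lemma rho_nd s t : s <= t -> rho p s <= rho p t.
Proof.
move=> st; rewrite !rhoE; apply: boxsum_le; [exact: boxdom_ind..|] => k.
case: (leP 1 (s * p k)) => h; last by rewrite mulr0n ler0n.
by rewrite (_ : (1 <= t * p k)%R)// (le_trans h)// ler_wpM2r.
Qed.

(** Up to terms of the order of [rho p t], the expected number of occupied boxes. *)
Definition capped t : R := boxsum (fun k => Num.min 1 (t * p k)).

(** This controls the errors that come from the boxes with a small [t * p k]. *)
Definition capped2 t : R := boxsum (fun k => Num.min 1 (t * p k) ^+ 2).

Lemma boxdom_capped t : 0 <= t -> boxdom (fun k => Num.min 1 (t * p k)).
Proof.
move=> t0; apply: (@boxdom_fun (fun y => Num.min 1 y) 1) => // y y0.
by rewrite le_min ler01 y0/= mul1r ge_min lexx orbT.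
Qed.

Lemma boxdom_capped2 t : 0 <= t -> boxdom (fun k => Num.min 1 (t * p k) ^+ 2).
Proof.
move=> t0; apply: (boxdom_le (boxdom_capped t0)) => k; have y0 := mulr_ge0 t0 (p_ge0 k).
rewrite sqr_ge0/= expr2 ler_piMr// ?ge_min ?lexx//.
by rewrite le_min ler01 y0.
Qed.

Lemma capped_le t : 0 <= t -> capped t <= t.
Proof.
move=> t0; apply: boxsum_lim_le; first exact: boxdom_capped.
by move=> n; apply: (@boxsum_bound (fun k => Num.min 1 (t * p k)) n t) => // k; rewrite ge_min lexx orbT.
Qed.

Lemma capped2_le_capped t : 0 <= t -> capped2 t <= capped t.
Proof.
move=> t0; apply: boxsum_le; [exact: boxdom_capped2|exact: boxdom_capped|] => k.
have y0 := mulr_ge0 t0 (p_ge0 k).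
by rewrite expr2 ler_piMr// ?ge_min ?lexx// le_min ler01 y0.
Qed.

(** Comparison at the scales [t] and [2 t]: the boxes that matter have
probability at least [1 / (2 t)]. *)
Lemma capped2_double t : 0 <= t -> capped2 t <= 4^-1 * capped2 (2 * t) + rho p (2 * t).
Proof.
move=> t0; have t20 : 0 <= 2 * t by rewrite mulr_ge0.
rewrite /capped2 rhoE -boxsumZ; last exact: boxdom_capped2.
rewrite -boxsumD; last 2 first.
- by apply: boxdomZ; [rewrite invr_ge0 | exact: boxdom_capped2].
- exact: boxdom_ind.
apply: boxsum_le; [exact: boxdom_capped2| |].
  by apply: boxdomD; [apply: boxdomZ; [rewrite invr_ge0 | exact: boxdom_capped2]|exact: boxdom_ind].
move=> k; have := mulr_ge0 t0 (p_ge0 k); rewrite -!mulrA; set y := t * p k => y0.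
have m0 (z : R) : 0 <= z -> 0 <= Num.min 1 z by move=> z0; rewrite le_min ler01 z0.
case: (leP 1 (2 * y)) => h /=.
  rewrite (@le_trans _ _ 1)//; last by rewrite lerDr mulr_ge0 ?invr_ge0 ?sqr_ge0.
  by rewrite exprn_ile1// ?m0// ge_min lexx.
have y1 : y <= 1 by lra.
by rewrite addr0 (min_r y1) [(2 * y) ^+ 2]exprMn; lra.
Qed.

(** From [t] to [2 * t], a box with [1 <= t * p k] keeps its value 1 instead of
doubling it. *)
Lemma capped_double t : 0 <= t -> 2^-1 * capped (2 * t) + 2^-1 * rho p t <= capped t.
Proof.
move=> t0; have t20 : 0 <= 2 * t by rewrite mulr_ge0.
have h0 : (0 : R) <= 2^-1 by rewrite invr_ge0.
rewrite /capped rhoE -boxsumZ; last exact: boxdom_capped.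
rewrite -boxsumZ; last exact: boxdom_ind.
rewrite -boxsumD; last 2 first.
- by apply: boxdomZ => //; exact: boxdom_capped.
- by apply: boxdomZ => //; exact: boxdom_ind.
apply: boxsum_le; [|exact: boxdom_capped|].
  by apply: boxdomD; apply: boxdomZ => //; [exact: boxdom_capped|exact: boxdom_ind].
move=> k; have := mulr_ge0 t0 (p_ge0 k); rewrite -!mulrA; set y := t * p k => y0.
case: (leP 1 y) => h /=.
  have y2 : 1 <= 2 * y by lra.
  by rewrite min_l//; lra.
rewrite mulr0 addr0; case: (leP 1 (2 * y)) => h2; lra.
Qed.

Lemma capped2_scale t c : 0 < c -> 0 <= t ->
  boxsum (fun k => Num.min c (t * p k) ^+ 2) = c ^+ 2 * capped2 (t / c).
Proof.
move=> c0 t0; rewrite /capped2 -boxsumZ; last by apply: boxdom_capped2; rewrite divr_ge0// ltW.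
congr boxsum; apply/funext => k; rewrite -exprMn; congr (_ ^+ 2).
rewrite minr_pMr ?(ltW c0)// mulr1; congr (Num.min _ _).
by rewrite mulrA [c * _]mulrC divfK// gt_eqF.
Qed.

End BoxSums.

(** * Consequences of regular variation *)

Lemma pinfty_nearP {R : realType} (Q : R -> Prop) :
  (\forall t \near +oo, Q t) <-> exists2 M : R, 0 < M & forall t, M <= t -> Q t.
Proof.
split=> [[M [_ hM]]|[M M0 hM]].
  exists (Num.max 1 (M + 1)); first by rewrite lt_max ltr01.
  by move=> t; rewrite ge_max => /andP[_ Mt]; apply: hM; lra.
by exists M; split; [exact: num_real | move=> t /ltW; exact: hM].
Qed.

Section RegularVariation.
Context {R : realType}.
Variable p : nat -> R.
Hypothesis p_ge0 : forall k, 0 <= p k.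
Hypothesis p_sum1 : (\sum_(0 <= k <oo) (p k)%:E = 1)%E.
Hypothesis rho_rv : forall l : R, 0 < l -> rho p (l * t) / rho p t @[t --> +oo] --> l.
Hypothesis rho_pos : \forall t \near +oo, 0 < rho p t.
Implicit Types (t c l : R) (n m k : nat).

Lemma rho_ratio_le l c : 0 < l -> l < c ->
  \forall t \near +oo, rho p (l * t) <= c * rho p t.
Proof.
move=> l0 lc; have /cvgr_lt h := rho_rv l0.
near=> t; have t0 : 0 < rho p t by near: t.
rewrite -ler_pdivrMr//; apply: ltW; near: t; exact: h.
Unshelve. all: by end_near. Qed.

Lemma rho_ratio_ge l c : 0 < l -> c < l ->
  \forall t \near +oo, c * rho p t <= rho p (l * t).
Proof.
move=> l0 lc; have /cvgr_gt h := rho_rv l0.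
near=> t; have t0 : 0 < rho p t by near: t.
rewrite -ler_pdivlMr//; apply: ltW; near: t; exact: h.
Unshelve. all: by end_near. Qed.

(** Iterating [capped2_double]: from [t] to [2 ^ i * t] the counting function grows at
most like [3 ^ i], which loses against the factors [1 / 4]. *)
Lemma capped2_le_rho : \forall t \near +oo, capped2 p t <= 12 * rho p t.
Proof.
have h23 : (2 : R) < 3 by lra.
have /pinfty_nearP[M M0 hM] := rho_ratio_le (ltr0Sn R 1) h23.
apply/pinfty_nearP; exists M => // t Mt.
have t0 : 0 < t by exact: lt_le_trans Mt.
have Mt2 i : M <= 2 ^+ i * t.
  by rewrite (le_trans Mt)// ler_peMl ?(ltW t0)// exprn_ege1// ler1n.
have rho3 i : rho p (2 ^+ i * t) <= 3 ^+ i * rho p t.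
  elim: i => [|i IH]; first by rewrite !expr0 !mul1r.
  rewrite exprS -mulrA (le_trans (hM _ (Mt2 i)))// exprS -mulrA.
  by rewrite ler_wpM2l.
have iter i : capped2 p t <= 12 * (1 - (3 / 4) ^+ i) * rho p t +
    4^-1 ^+ i * capped2 p (2 ^+ i * t).
  elim: i => [|i IH]; first by rewrite !expr0 !mul1r subrr mulr0 mul0r add0r.
  rewrite (le_trans IH)//.
  have ti0 : 0 <= 2 ^+ i * t by rewrite mulr_ge0 ?exprn_ge0 ?ltW.
  have q0 : (0 : R) <= 4^-1 ^+ i by rewrite exprn_ge0 ?invr_ge0.
  have d := ler_wpM2l q0 (capped2_double p_ge0 p_sum1 ti0).
  have r3 : 4^-1 ^+ i * rho p (2 * (2 ^+ i * t)) <= 3 * ((3 / 4) ^+ i * rho p t).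
    have := ler_wpM2l q0 (rho3 i.+1); rewrite [2 ^+ i.+1]exprS -(mulrA 2) => /le_trans; apply.
    by rewrite le_eqVlt; apply/orP; left; apply/eqP; rewrite exprMn exprS; ring.
  rewrite !exprS -(mulrA 2).
  move: d r3; rewrite mulrDr; lra.
have lim0 : (fun i => 2^-1 ^+ i * t) @ \oo --> (0 : R).
  rewrite -(mul0r t); apply: cvgM; last exact: cvg_cst.
  by apply: cvg_expr; rewrite ger0_norm ?invr_ge0// invf_lt1// ltr1n.
rewrite -[leRHS]addr0; have lim12 : (fun i => 12 * rho p t + 2^-1 ^+ i * t) @ \oo --> 12 * rho p t + 0.
  by apply: cvgD => //; exact: cvg_cst.
apply: (cvgr_to_ge lim12); apply: nearW => i; rewrite (le_trans (iter i))//.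
have ti0 : 0 <= 2 ^+ i * t by rewrite mulr_ge0 ?exprn_ge0 ?ltW.
apply: lerD.
  rewrite ler_wpM2r ?rho_ge0// ler_piMr// gerBl exprn_ge0//.
have q0 : (0 : R) <= 4^-1 ^+ i by rewrite exprn_ge0 ?invr_ge0.
rewrite (le_trans (ler_wpM2l q0 (le_trans (capped2_le_capped p_ge0 p_sum1 ti0) (capped_le p_ge0 p_sum1 ti0))))//.
by rewrite mulrA -exprMn (_ : 4^-1 * 2 = 2^-1 :> R)//; field.
Qed.

(** By [capped_double], each of the scales [t, 2 * t, 4 * t, ...] contributes to
[capped p t] at least a fixed multiple of [rho p t]. *)
Lemma rho_o_capped A : \forall t \near +oo, A * rho p t <= capped p t.
Proof.
pose n := (Num.truncn (4 * A)).+1.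
have An : 4 * A <= n%:R by exact/ltW/truncnS_gt.
have h i : \forall t \near +oo, 2^-1 * 2 ^+ i * rho p t <= rho p (2 ^+ i * t).
  have i0 : (0 : R) < 2 ^+ i by rewrite exprn_gt0.
  by apply: rho_ratio_ge => //; rewrite gtr_pMl// invf_lt1// ltr1n.
have : \forall t \near +oo, forall i, (i < n)%N -> 2^-1 * 2 ^+ i * rho p t <= rho p (2 ^+ i * t).
  elim: (n) => [|m IH]; first exact: nearW.
  have hm := h m; near=> t => i; rewrite ltnS leq_eqVlt => /predU1P[->|].
    by near: t.
  by move: i; near: t.
move=> /pinfty_nearP[M M0 hM]; apply/pinfty_nearP; exists M => // t Mt.
have t0 : 0 < t by exact: lt_le_trans Mt.
have iter i : (i <= n)%N -> i%:R / 4 * rho p t + 2^-1 ^+ i * capped p (2 ^+ i * t) <= capped p t.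
  elim: i => [_|i IH lin]; first by rewrite mul0r mul0r add0r !expr0 !mul1r.
  apply: le_trans (IH (ltnW lin)).
  have ti0 : 0 <= 2 ^+ i * t by rewrite mulr_ge0 ?exprn_ge0 ?ltW.
  have q0 : (0 : R) <= 2^-1 ^+ i by rewrite exprn_ge0 ?invr_ge0.
  have d := ler_wpM2l q0 (capped_double p_ge0 p_sum1 ti0).
  have r := ler_wpM2l q0 (hM t Mt i lin).
  have e : 2^-1 ^+ i * (2^-1 * 2 ^+ i * rho p t) = 2^-1 * rho p t.
    have z : 2^-1 ^+ i * 2 ^+ i = 1 :> R by rewrite -exprMn mulVf ?pnatr_eq0// expr1n.
    have aux (u v w : R) : u * v = 1 -> u * (2^-1 * v * w) = 2^-1 * w.
      by move=> uv; rewrite -[RHS]mul1r -uv; ring.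
    exact: aux.
  rewrite e in r.
  rewrite exprS [2 ^+ i.+1]exprS -(mulrA 2) -natr1.
  move: d r; rewrite mulrDr (mulrCA _ 2^-1) (mulrCA _ 2^-1 (rho p _)).
  rewrite -(mulrA 2^-1 (2^-1 ^+ i)); lra.
have tn0 : 0 <= 2 ^+ n * t by rewrite mulr_ge0 ?exprn_ge0 ?ltW.
apply: le_trans (iter n (leqnn n)); rewrite -[leLHS]addr0; apply: lerD.
  by rewrite ler_wpM2r ?rho_ge0//; lra.
rewrite mulr_ge0 ?exprn_ge0 ?invr_ge0//; apply: boxsum_ge0 => //.
exact: boxdom_capped.
Unshelve. all: by end_near. Qed.

(** Regular variation of index 1 gives any growth exponent below 1; the rate 19/10 is
close enough to 2 for the chaining argument. *)
Lemma rho_growth : exists2 c : R, 0 < c & \forall n \near \oo, c * (19 / 10) ^+ n <= rho p (2 ^+ n).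
Proof.
have h19 : (19 / 10 : R) < 2 by lra.
have /pinfty_nearP[M M0 hM] : \forall t \near +oo, 0 < rho p t /\ 19 / 10 * rho p t <= rho p (2 * t).
  by apply: filterS2 rho_pos (rho_ratio_ge (ltr0Sn R 1) h19) => t; split.
have [n0 hn0] : exists n0, M <= 2 ^+ n0.
  exists (Num.truncn M).+1; rewrite (le_trans (ltW (truncnS_gt M)))//.
  by rewrite -natrX ler_nat ltnW// ltn_expl.
have Mn n : M <= 2 ^+ (n0 + n).
  by rewrite (le_trans hn0)// exprD ler_peMr ?exprn_ge0// exprn_ege1// ler1n.
exists (rho p (2 ^+ n0) / (19 / 10) ^+ n0).
  by rewrite divr_gt0 ?exprn_gt0//; exact: (hM _ hn0).1.
exists n0 => // n /= /subnKC <-; rewrite [X in _ * X <= _]exprD mulrA divfK; last first.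
  by rewrite gt_eqF// exprn_gt0.
elim: (n - n0)%N => [|i IH]; first by rewrite expr0 mulr1 addn0.
rewrite addnS exprS mulrCA [2 ^+ _.+1]exprS.
by rewrite (le_trans _ (hM _ (Mn i)).2)// ler_wpM2l.
Qed.

End RegularVariation.

(** * Abel summation against the counting function *)

(** Here [F] is a distribution function with density [y * f1 y], and [H] is the
primitive of [f1]: the weight of [dF] against [1 / y]. *)
Section Abel.
Context {R : realType}.
Variable p : nat -> R.
Hypothesis p_ge0 : forall k, 0 <= p k.
Hypothesis p_sum1 : (\sum_(0 <= k <oo) (p k)%:E = 1)%E.
Hypothesis rho_rv : forall l : R, 0 < l -> rho p (l * t) / rho p t @[t --> +oo] --> l.
Hypothesis rho_pos : \forall t \near +oo, 0 < rho p t.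
Variables (F H f1 : R -> R) (C l I : R).
Hypothesis f1_bound : forall y, 0 <= y -> 0 <= f1 y <= C.
Hypothesis dF : forall y : R, is_derive y 1 F (y * f1 y).
Hypothesis dH : forall y : R, is_derive y 1 H (f1 y).
Hypothesis F0 : F 0 = 0.
Hypothesis H0 : H 0 = 0.
Hypothesis F_le : forall y, 0 <= y -> F y <= l.
Hypothesis H_cvg : H y @[y --> +oo] --> I.
Implicit Types (y t a b d q : R) (n N k i : nat).

Let C_ge0 : 0 <= C.
Proof. by have /andP[/le_trans + h] := f1_bound (lexx 0); apply. Qed.

Let F_nd a b : 0 <= a -> a <= b -> F a <= F b.
Proof.
move=> a0 ab; apply: (is_derive_ge0_le ab dF) => z /andP[/ltW az _].
have z0 := le_trans a0 az.
by rewrite mulr_ge0//; case/andP: (f1_bound z0).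
Qed.

Let F_ge0 y : 0 <= y -> 0 <= F y.
Proof. by move=> y0; rewrite -F0 F_nd. Qed.

Let H_nd a b : 0 <= a -> a <= b -> H a <= H b.
Proof.
move=> a0 ab; apply: (is_derive_ge0_le ab dH) => z /andP[/ltW az _].
by case/andP: (f1_bound (le_trans a0 az)).
Qed.

Let H_le y : 0 <= y -> H y <= I.
Proof.
move=> y0; apply: (cvgr_to_ge H_cvg); exists y; split; first exact: num_real.
by move=> z /ltW yz; exact: H_nd.
Qed.

Let H_small y : 0 <= y -> H y <= C * y.
Proof.
move=> y0; rewrite -subr_ge0.
have dG (z : R) : is_derive z 1 (fun z => C * z - H z) (C - f1 z).
  have h := @is_deriveB _ _ _ _ _ _ _ _ _ (@is_deriveZ _ _ _ _ C _ _ _ (@is_derive_id _ _ z 1)) (dH z).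
  by apply: (is_derive_eqfun h) => //; rewrite /GRing.scale/= mulr1.
have := is_derive_ge0_le y0 dG; rewrite mulr0 H0 subr0; apply=> z /andP[/ltW z0 _].
by rewrite subr_ge0; case/andP: (f1_bound z0).
Qed.

Let incr_ge a b : 0 <= a -> a <= b -> a * (H b - H a) <= F b - F a.
Proof.
move=> a0 ab; have dG (z : R) : is_derive z 1 (fun z => F z - a * H z) (z * f1 z - a * f1 z).
  have h := @is_deriveB _ _ _ _ _ _ _ _ _ (dF z) (@is_deriveZ _ _ _ _ a _ _ _ (dH z)).
  exact: (is_derive_eqfun h).
have : F a - a * H a <= F b - a * H b; last by lra.
apply: (is_derive_ge0_le ab dG) => z /andP[/ltW az _].
have /andP[z0 _] := f1_bound (le_trans a0 az).
by rewrite -mulrBl mulr_ge0// subr_ge0.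
Qed.

Let incr_le a b : 0 <= a -> a <= b -> F b - F a <= b * (H b - H a).
Proof.
move=> a0 ab; have dG (z : R) : is_derive z 1 (fun z => b * H z - F z) (b * f1 z - z * f1 z).
  have h := @is_deriveB _ _ _ _ _ _ _ _ _ (@is_deriveZ _ _ _ _ b _ _ _ (dH z)) (dF z).
  exact: (is_derive_eqfun h).
have : b * H a - F a <= b * H b - F b; last by lra.
apply: (is_derive_ge0_le ab dG) => z /andP[/ltW az /ltW zb].
have /andP[z0 _] := f1_bound (le_trans a0 az).
by rewrite -mulrBl mulr_ge0// subr_ge0.
Qed.

Let F_small y : 0 <= y -> F y <= C * y ^+ 2.
Proof.
move=> y0; have := incr_le (lexx 0) y0; rewrite F0 H0 !subr0 => /le_trans; apply.
by rewrite expr2 mulrCA ler_wpM2l// H_small.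
Qed.

Section Steps.
Variables (d q : R).
Hypotheses (d0 : 0 < d) (q1 : 1 < q).
Let y_ i := d * q ^+ i.

Let y_gt0 i : 0 < y_ i. Proof. by rewrite mulr_gt0// exprn_gt0// (lt_trans ltr01). Qed.
Let y_le i : y_ i <= y_ i.+1.
Proof. by rewrite /y_ ler_wpM2l ?ltW// exprS ltr_pMl// exprn_gt0// (lt_trans ltr01). Qed.
Let y_S i : y_ i.+1 = q * y_ i. Proof. by rewrite /y_ exprS; ring. Qed.

Let steps_le N y : 0 <= y ->
  \sum_(i < N) (F (y_ i.+1) - F (y_ i)) * (y_ i.+1 <= y)%R%:R <= F (Num.min y (y_ N)).
Proof.
move=> y0; elim: N => [|N IH].
  by rewrite big_ord0 F_ge0// le_min y0 ltW.
rewrite big_ord_recr/=; case: (leP (y_ N.+1) y) => h; last first.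
  rewrite mulr0 addr0 (le_trans IH)//; apply: F_nd; first by rewrite le_min y0 ltW.
  by rewrite ge_min lexx.
move: IH; rewrite mulr1 (min_r (le_trans (y_le N) h)); lra.
Qed.

Let steps_ge N y : 0 <= y ->
  F y <= F (Num.min y d) + \sum_(i < N) (F (y_ i.+1) - F (y_ i)) * (y_ i <= y)%R%:R
    + (F y - F (y_ N)) * (y_ N <= y)%R%:R.
Proof.
move=> y0; elim: N => [|N IH].
  rewrite big_ord0 addr0 /y_ expr0 mulr1.
  by case: (leP d y) => h; rewrite ?mulr1 ?mulr0; lra.
rewrite big_ord_recr/= (le_trans IH)//; case: (leP (y_ N) y) => h.
  rewrite !mulr1; case: (leP (y_ N.+1) y) => h2; rewrite ?mulr1 ?mulr0; first by lra.
  by have := F_nd y0 (ltW h2); lra.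
rewrite (_ : (y_ N.+1 <= y) = false) ?mulr0; first by lra.
by apply/negbTE; rewrite -ltNge (lt_le_trans h (y_le N)).
Qed.

Let boxdom_F t : 0 <= t -> boxdom p (fun k => F (t * p k)).
Proof.
move=> t0; apply: (@boxdom_le _ _ _ (fun k => C * t ^+ 2 * p k)).
  by apply: boxdomZ; [rewrite mulr_ge0 ?sqr_ge0 | exact: boxdom_p].
move=> k; have y0 := mulr_ge0 t0 (p_ge0 k); rewrite F_ge0//= (le_trans (F_small y0))//.
rewrite exprMn -mulrA ler_wpM2l// ler_wpM2l ?sqr_ge0// expr2 ler_piMr//.
exact: p_le1.
Qed.

Let ind_scale y t k : 0 < y -> (1 <= y^-1 * t * p k) = (y <= t * p k).
Proof. by move=> y0; rewrite -mulrA ler_pdivlMl// mulr1. Qed.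

(** A lower Riemann sum: [F] is replaced by a step function with jumps at
[d * q ^ i], and each jump contributes a value of [rho], to which regular
variation applies. *)
Lemma abel_lower N a : a < q^-1 * (H (d * q ^+ N) - H d) ->
  \forall t \near +oo, a * rho p t <= boxsum (fun k => F (t * p k)).
Proof.
rewrite -/(y_ N) => ha.
have dFi i : 0 <= F (y_ i.+1) - F (y_ i) by rewrite subr_ge0 F_nd// ltW.
have lim : \sum_(i < N) (F (y_ i.+1) - F (y_ i)) * (rho p ((y_ i.+1)^-1 * t) / rho p t)
    @[t --> +oo] --> \sum_(i < N) (F (y_ i.+1) - F (y_ i)) * (y_ i.+1)^-1.
  apply: cvgr_sum => i; apply: cvgr_scaleF; apply: rho_rv.
  by rewrite invr_gt0.
have low : q^-1 * (H (y_ N) - H d) <= \sum_(i < N) (F (y_ i.+1) - F (y_ i)) * (y_ i.+1)^-1.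
  have -> : H (y_ N) - H d = \sum_(i < N) (H (y_ i.+1) - H (y_ i)).
    rewrite -(big_mkord xpredT (fun i => H (y_ i.+1) - H (y_ i))).
    by rewrite telescope_sumr// /y_ expr0 mulr1.
  rewrite mulr_sumr; apply: ler_sum => i _; rewrite ler_pdivlMr//.
  have -> : q^-1 * (H (y_ i.+1) - H (y_ i)) * y_ i.+1 = y_ i * (H (y_ i.+1) - H (y_ i)).
    rewrite [X in _ * X = _]y_S [LHS]mulrAC mulrA mulVf ?mul1r//.
    by rewrite gt_eqF// (lt_trans ltr01).
  by apply: incr_ge => //; exact: ltW.
have [M [_ hM]] := cvgr_gt _ lim _ (lt_le_trans ha low).
near=> t; have t0 : 0 <= t by near: t; exact: nbhs_pinfty_ge.
have r0 : 0 < rho p t by near: t.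
have := hM t; rewrite (_ : M < t); last by near: t; apply: nbhs_pinfty_gt; exact: num_real.
move=> /(_ isT) h.
rewrite -ler_pdivlMr//; apply: (le_trans (ltW h)); rewrite ler_pdivlMr// mulr_suml.
rewrite (eq_bigr (fun i : 'I_N => (F (y_ i.+1) - F (y_ i)) * rho p ((y_ i.+1)^-1 * t))); last first.
  by move=> i _; rewrite -mulrA divfK// gt_eqF.
under eq_bigr => i _ do rewrite rhoE//.
rewrite -(boxsum_sum p_ge0 p_sum1 (f := fun (i : 'I_N) k => (1 <= (y_ i.+1)^-1 * t * p k)%R%:R))//; last first.
  by move=> i; exact: boxdom_ind.
apply: boxsum_le => //.
- by apply: boxdom_sum => // i; exact: boxdom_ind.
- exact: boxdom_F.
move=> k; have yk0 := mulr_ge0 t0 (p_ge0 k).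
under eq_bigr => i _ do rewrite ind_scale//.
apply: (le_trans (steps_le N yk0)); apply: F_nd; first by rewrite le_min yk0 ltW.
by rewrite ge_min lexx.
Unshelve. all: by end_near. Qed.

(** The three error terms bound the boxes with [t * p k < d], through
[F y <= C * y ^ 2] and [capped2_le_rho]; the overshoot of the upper Riemann sum;
and the boxes with [t * p k] beyond the last step. *)
Lemma abel_upper N a : 12 * C * d + q * I + l / (d * q ^+ N) < a ->
  \forall t \near +oo, boxsum (fun k => F (t * p k)) <= a * rho p t.
Proof.
rewrite -/(y_ N) => ha.
have dFi i : 0 <= F (y_ i.+1) - F (y_ i) by rewrite subr_ge0 F_nd// ltW.
have l0 : 0 <= l by exact: le_trans (F_ge0 (lexx 0)) (F_le (lexx 0)).
pose c := 12 * (C * d ^+ 2).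
have lim : c * (rho p (d^-1 * t) / rho p t) +
    \sum_(i < N) (F (y_ i.+1) - F (y_ i)) * (rho p ((y_ i)^-1 * t) / rho p t)
    + l * (rho p ((y_ N)^-1 * t) / rho p t)
    @[t --> +oo] --> c * d^-1 + \sum_(i < N) (F (y_ i.+1) - F (y_ i)) * (y_ i)^-1 + l * (y_ N)^-1.
  have rv y : 0 < y -> rho p (y^-1 * t) / rho p t @[t --> +oo] --> y^-1.
    by move=> y0; apply: rho_rv; rewrite invr_gt0.
  apply: cvgD; last by apply: cvgr_scaleF; exact: rv.
  apply: cvgD; first by apply: cvgr_scaleF; exact: rv.
  by apply: cvgr_sum => i; apply: cvgr_scaleF; exact: rv.
have low : \sum_(i < N) (F (y_ i.+1) - F (y_ i)) * (y_ i)^-1 <= q * I.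
  apply: (@le_trans _ _ (q * (H (y_ N) - H d))); last first.
    rewrite ler_wpM2l// ?(le_trans ler01) ?(ltW q1)//.
    by rewrite (le_trans _ (H_le (ltW (y_gt0 N))))// gerBl -H0 H_nd// ltW.
  have -> : H (y_ N) - H d = \sum_(i < N) (H (y_ i.+1) - H (y_ i)).
    rewrite -(big_mkord xpredT (fun i => H (y_ i.+1) - H (y_ i))).
    by rewrite telescope_sumr// /y_ expr0 mulr1.
  rewrite mulr_sumr; apply: ler_sum => i _; rewrite ler_pdivrMr// mulrAC -y_S.
  by apply: incr_le => //; exact: ltW.
have ha' : c * d^-1 + \sum_(i < N) (F (y_ i.+1) - F (y_ i)) * (y_ i)^-1 + l * (y_ N)^-1 < a.
  apply: le_lt_trans ha; rewrite lerD2r lerD// /c expr2 !mulrA mulfK// gt_eqF//.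
have [M [_ hM]] := cvgr_lt _ lim _ ha'.
have /pinfty_nearP[M2 M20 hM2] := capped2_le_rho p_ge0 p_sum1 rho_rv rho_pos.
near=> t; have t0 : 0 <= t by near: t; exact: nbhs_pinfty_ge.
have r0 : 0 < rho p t by near: t.
have := hM t; rewrite (_ : M < t); last by near: t; apply: nbhs_pinfty_gt; exact: num_real.
move=> /(_ isT) h.
have td : M2 <= t / d by rewrite ler_pdivlMr//; near: t; apply: nbhs_pinfty_ge; exact: num_real.
rewrite -ler_pdivrMr//; apply: le_trans (ltW h); rewrite ler_pdivrMr// !mulrDl mulr_suml.
rewrite (eq_bigr (fun i : 'I_N => (F (y_ i.+1) - F (y_ i)) * rho p ((y_ i)^-1 * t))); last first.
  by move=> i _; rewrite -mulrA divfK// gt_eqF.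
rewrite -!(mulrA _ (_ / _)) !divfK ?gt_eqF//.
under [X in _ <= _ + X + _]eq_bigr => i _ do rewrite rhoE//.
rewrite -(boxsum_sum p_ge0 p_sum1 (f := fun (i : 'I_N) k => (1 <= (y_ i)^-1 * t * p k)%R%:R))//; last first.
  by move=> i; exact: boxdom_ind.
have bd : boxdom p (fun k => Num.min d (t * p k) ^+ 2).
  apply: (@boxdom_le _ _ _ (fun k => d * (t * p k))).
    by apply: boxdomZ => //; [exact: ltW|apply: boxdomZ => //; exact: boxdom_p].
  move=> k; rewrite sqr_ge0/= expr2.
  have yk0 := mulr_ge0 t0 (p_ge0 k).
  by rewrite ler_pM ?le_min ?yk0 ?(ltW d0)// ge_min lexx ?orbT.
have small : boxsum (fun k => C * Num.min d (t * p k) ^+ 2) <= c * rho p (d^-1 * t).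
  rewrite (boxsumZ p_ge0 p_sum1)// capped2_scale// /c (mulrC _ t).
  have := ler_wpM2l (mulr_ge0 C_ge0 (sqr_ge0 d)) (hM2 _ td); lra.
set S := boxsum _ in small *.
rewrite (le_trans _ (lerD (lerD small (lexx _)) (lexx _)))// /S [rho p _]rhoE//.
rewrite -(boxsumZ p_ge0 p_sum1); last exact: boxdom_ind.
have b1 : boxdom p (fun k => C * Num.min d (t * p k) ^+ 2) by exact: boxdomZ.
have b2 : boxdom p (fun k => \sum_(i < N) (F (y_ i.+1) - F (y_ i)) * (1 <= (y_ i)^-1 * t * p k)%R%:R).
  by apply: boxdom_sum => // i; exact: boxdom_ind.
have b3 : boxdom p (fun k => l * (1 <= (y_ N)^-1 * t * p k)%R%:R).
  by apply: boxdomZ => //; exact: boxdom_ind.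
have b12 := boxdomD b1 b2.
rewrite -(boxsumD p_ge0 p_sum1 b1 b2) -(boxsumD p_ge0 p_sum1 b12 b3).
apply: boxsum_le => //; [exact: boxdom_F | exact: boxdomD |].
move=> k; have yk0 := mulr_ge0 t0 (p_ge0 k).
apply: (le_trans (steps_ge N yk0)); apply: lerD; last first.
  rewrite ind_scale//; apply: ler_wpM2r; first exact: ler0n.
  by rewrite (le_trans _ (F_le yk0))// gerBl F_ge0// ltW.
apply: lerD.
  by rewrite minC F_small// le_min yk0 ltW.
by apply: ler_sum => i _; rewrite ind_scale.
Unshelve. all: by end_near. Qed.
End Steps.

(** The sum of [F (t * p k)] is the integral of [rho (t / y)] against [dF y], where
[dF y = y * f1 y dy] and [rho (t / y)] is close to [rho t / y]; so the limit is the
integral [I] of [f1].  The geometric steps replace dominated convergence. *)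
Lemma boxsum_rho_cvg : boxsum (fun k => F (t * p k)) / rho p t @[t --> +oo] --> I.
Proof.
have l0 : 0 <= l by exact: le_trans (F_ge0 (lexx 0)) (F_le (lexx 0)).
have I0 : 0 <= I by rewrite -H0; exact: H_le.
apply/cvgrPdist_le => e e0.
pose h := Num.min 1 (e / (I + 3)).
have I3 : 0 < I + 3 by lra.
have h0 : 0 < h by rewrite lt_min ltr01 divr_gt0.
have hI : h * (I + 3) <= e by rewrite -ler_pdivlMr// ge_min lexx orbT.
have h1 : h <= 1 by rewrite ge_min lexx.
pose d := h / (12 * C + 1).
have C1 : 0 < 12 * C + 1 by have := C_ge0; lra.
have d0 : 0 < d by rewrite divr_gt0.
have dC : 12 * C * d + d = h by rewrite -[X in _ + X]mul1r -mulrDl /d mulrC divfK ?gt_eqF.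
have Cd0 : 0 <= C * d by rewrite mulr_ge0 ?C_ge0 ?ltW.
pose q := 1 + h.
have q1 : 1 < q by rewrite /q; lra.
have q0 : 0 < q by exact: lt_trans q1.
have [M M0 hM] : exists2 M : R, 0 < M & forall y, M <= y -> I - h <= H y.
  apply/pinfty_nearP; have hl : I - h < I by lra.
  by apply: filterS (cvgr_gt _ H_cvg _ hl) => y /ltW.
have [N hN] : exists N, Num.max M (l / h) <= d * q ^+ N.
  set A := Num.max _ _.
  exists (Num.truncn (A / (d * h))).+1; set N := _.+1.
  have AN : A <= N%:R * (d * h).
    by have := ltW (truncnS_gt (A / (d * h))); rewrite -/N ler_pdivrMr// mulr_gt0.
  have bern n : 1 + n%:R * h <= q ^+ n.
    elim: n => [|n IH]; first by rewrite expr0 mul0r addr0.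
    rewrite exprS /q; have := ler_wpM2l (ltW q0) IH.
    have : 0 <= n%:R * h ^+ 2 by rewrite mulr_ge0 ?sqr_ge0.
    rewrite expr2 -natr1 /q; lra.
  rewrite (le_trans AN)// mulrCA ler_wpM2l ?(ltW d0)// (le_trans _ (bern N)); lra.
have {hN} [hN1 hN2] : M <= d * q ^+ N /\ l / h <= d * q ^+ N.
  by move: hN; rewrite ge_max => /andP.
have y0 : 0 < d * q ^+ N by rewrite mulr_gt0// exprn_gt0.
have up : 12 * C * d + q * I + l / (d * q ^+ N) < I + e.
  have : l / (d * q ^+ N) <= h.
    by rewrite ler_pdivrMr// mulrC -ler_pdivrMr.
  rewrite /q; lra.
have lo : I - e < q^-1 * (H (d * q ^+ N) - H d).
  have Hd := H_small (ltW d0).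
  have HN := hM _ hN1.
  have : q^-1 * (I - 2 * h) <= q^-1 * (H (d * q ^+ N) - H d).
    by rewrite ler_wpM2l ?invr_ge0 ?(ltW q0)//; lra.
  apply: lt_le_trans; rewrite -(ltr_pM2l q0) mulrA mulfV ?gt_eqF// mul1r.
  have [eI|eI] := leP (I - e) 0.
    have : q * (I - e) <= I - e by rewrite /q mulrDl mul1r gerDl mulr_ge0_le0// ltW.
    nra.
  have : 0 <= h * I by rewrite mulr_ge0// ltW.
  rewrite /q; nra.
near=> t.
have r0 : 0 < rho p t by near: t.
have u : boxsum (fun k => F (t * p k)) <= (I + e) * rho p t.
  by near: t; exact: abel_upper up.
have v : (I - e) * rho p t <= boxsum (fun k => F (t * p k)).
  by near: t; exact: abel_lower lo.
rewrite ler_distlC; apply/andP; split.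
  by rewrite ler_pdivlMr.
by rewrite ler_pdivrMr.
Unshelve. all: by end_near. Qed.

End Abel.

(** * Poisson tails summed over the boxes *)

Lemma pinfty_scale {R : realType} (f : R -> R) (l b : R) : 0 < l ->
  f t @[t --> +oo] --> b -> f (l * t) @[t --> +oo] --> b.
Proof.
move=> l0 fb; apply/cvgrPdist_le => e e0.
have /pinfty_nearP[M M0 hM] : \forall t \near +oo, `|b - f t| <= e.
  by move/cvgrPdist_le : fb; exact.
apply/pinfty_nearP; exists (M / l); first by rewrite divr_gt0.
by move=> t; rewrite ler_pdivrMr// mulrC; exact: hM.
Unshelve. all: by end_near. Qed.

Section FromL.
Context {R : realType}.
Variable p : nat -> R.
Hypothesis p_ge0 : forall k, 0 <= p k.
Hypothesis p_sum1 : (\sum_(0 <= k <oo) (p k)%:E = 1)%E.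
Variable L : R -> R.
Hypothesis L_sv : slowly_varying L.
Hypothesis rho_equiv : asymp_equiv (rho p) (fun t => t * L t).

Lemma L_near : exists2 M : R, 0 < M & measurable_fun `[M, +oo[ L /\
  forall t, M <= t -> 0 < L t.
Proof.
have [[a [mL L0]] _] := L_sv.
exists (Num.max 1 a); first by rewrite lt_max ltr01.
split.
  by apply: measurable_funS mL => // x /=; rewrite !in_itv/= !andbT ge_max => /andP[].
by move=> t; rewrite ge_max => /andP[_]; exact: L0.
Qed.

Lemma L_pos_near : \forall t \near +oo, 0 < t * L t.
Proof.
have [M M0 [_ hM]] := L_near; apply/pinfty_nearP; exists M => // t Mt.
by rewrite mulr_gt0 ?hM// (lt_le_trans M0).
Qed.

Lemma rho_pos : \forall t \near +oo, 0 < rho p t.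
Proof.
have h01 : (0 : R) < 1 by [].
apply: filterS2 L_pos_near (cvgr_gt _ rho_equiv _ h01) => t L0.
by rewrite pmulr_lgt0// invr_gt0.
Qed.

(** The slowly varying factor cancels, which leaves [(l * t) / t]. *)
Lemma rho_rv l : 0 < l -> rho p (l * t) / rho p t @[t --> +oo] --> l.
Proof.
move=> l0.
have e1 : rho p (l * t) / (l * t * L (l * t)) @[t --> +oo] --> (1 : R).
  exact: (@pinfty_scale _ (fun t => rho p t / (t * L t))).
have e2 : (rho p t / (t * L t))^-1 @[t --> +oo] --> (1^-1 : R).
  by apply: cvgV; [exact: oner_neq0 | exact: rho_equiv].
have e3 := L_sv.2 l l0.
have h : rho p (l * t) / (l * t * L (l * t)) * (l * (L (l * t) / L t)) * (rho p t / (t * L t))^-1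
    @[t --> +oo] --> 1 * (l * 1) * 1^-1.
  by apply: cvgM => //; apply: cvgM => //; exact: cvgr_scaleF.
rewrite !(mulr1, mul1r, invr1) in h; apply: cvg_trans h; apply: near_eq_cvg; near=> t.
have t0 : t != 0 by rewrite gt_eqF//; near: t; exact: nbhs_pinfty_gt.
have L0 : t * L t != 0 by rewrite gt_eqF//; near: t; exact: L_pos_near.
have L1 : l * t * L (l * t) != 0.
  rewrite gt_eqF//; near: t; have /pinfty_nearP[M M0 hM] := L_pos_near.
  apply/pinfty_nearP; exists (M / l); first by rewrite divr_gt0.
  by move=> t; rewrite ler_pdivrMr// mulrC; exact: hM.
have r0 : rho p t != 0 by rewrite gt_eqF//; near: t; exact: rho_pos.
move: L0 L1; rewrite !mulf_eq0 !negb_or t0/= => L0 /andP[_ L1].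
field.
by rewrite t0 L0 L1 r0 gt_eqF.
Unshelve. all: by end_near. Qed.

End FromL.

Section PoissonLimits.
Context {R : realType}.
Implicit Types (y : R) (i j : nat).

Lemma poiS_mul i y : poi i.+1 y = y * (poi i y / i.+1%:R).
Proof.
rewrite /poi factS natrM exprS; field.
by rewrite nat1r !pnatr_eq0/= -lt0n fact_gt0.
Qed.

Lemma poi_cvg_infty i : poi i y @[y --> +oo] --> (0 : R).
Proof.
apply/cvgrPdist_le => e e0; apply/pinfty_nearP; exists (i.+1%:R / e); first by rewrite divr_gt0.
move=> y; rewrite ler_pdivrMr// => hy.
have y0 : 0 < y by rewrite -(pmulr_lgt0 _ e0) (lt_le_trans _ hy).
rewrite sub0r normrN ger0_norm ?poi_ge0 ?(ltW y0)//.
have := @poi_le1 R i.+1 y (ltW y0); rewrite poiS_mul mulrA ler_pdivrMr// mul1r => h.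
by rewrite -(ler_pM2l y0) (le_trans h).
Qed.

Lemma ptail_cvg_infty j : ptail j y @[y --> +oo] --> (1 : R).
Proof.
rewrite /ptail -[X in _ --> X]subr0; apply: cvgB; first exact: cvg_cst.
have := @cvgr_sum R R +oo _ j (fun i : 'I_j => poi i) (fun=> 0) (fun i : 'I_j => poi_cvg_infty i) => /(_ _).
by rewrite (big1 _ _ (fun i : 'I_j => 0))//; apply.
Qed.

(** Consecutive Poisson weights at [y] multiply to a multiple of a Poisson weight at
[2 * y], which has a Poisson tail as its primitive. *)
Lemma poi_mul_poi i y :
  poi i y * poi i.+1 y = 'C(i.*2.+1, i)%:R / 2 ^+ i.*2.+1 * poi i.*2.+1 (2 * y).
Proof.
have hb : 'C(i.*2.+1, i)%:R * (i`!%:R * i.+1`!%:R) = i.*2.+1`!%:R :> R.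
  rewrite -!natrM; congr _%:R; rewrite -(@bin_fact i.*2.+1 i) ?leqW -?addnn ?leq_addr//.
  by rewrite -addSn addnK.
have e2 : expR (- (2 * y)) = expR (- y) * expR (- y) by rewrite -expRD; congr expR; ring.
rewrite /poi -hb e2 exprMn -addnn (_ : y ^+ (i + i).+1 = y ^+ i * y ^+ i.+1); last by rewrite -exprD addnS.
field.
by rewrite !pnatr_eq0 -!lt0n !fact_gt0 bin_gt0 expf_neq0// leqW// addnn -addnn leq_addr.
Qed.

Lemma is_derive_ptail_sqr j y :
  is_derive y 1 (fun z => ptail j.+1 z ^+ 2) (2 * (ptail j.+1 y * poi j y)).
Proof.
have h := @is_deriveM _ _ _ _ _ _ _ _ (is_derive_ptail j y) (is_derive_ptail j y).
apply: (is_derive_eqfun h) => [z|]; first by rewrite expr2.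
by rewrite /GRing.scale/=; ring.
Qed.

Lemma is_derive_ptail2 j y : is_derive y 1 (fun z => ptail j.+1 (2 * z)) (2 * poi j (2 * y)).
Proof.
have h2 := @is_deriveZ _ _ _ _ 2 _ _ _ (@is_derive_id _ _ y 1).
have h := @is_derive1_comp R (ptail j.+1) (fun z => 2 * z) y _ _ (is_derive_ptail j (2 * y)) h2.
apply: (is_derive_eqfun h) => //.
by rewrite /GRing.scale/=; ring.
Qed.

End PoissonLimits.

Section LevelTwo.
Context {R : realType}.
Variable p : nat -> R.
Hypothesis p_ge0 : forall k, 0 <= p k.
Hypothesis p_sum1 : (\sum_(0 <= k <oo) (p k)%:E = 1)%E.
Hypothesis rho_rv : forall l : R, 0 < l -> rho p (l * t) / rho p t @[t --> +oo] --> l.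
Hypothesis rho_pos : \forall t \near +oo, 0 < rho p t.

(** Here [F = ptail i.+2] has the derivative [poi i.+1 y = y * poi i y / i.+1], and
the primitive of [poi i] is [ptail i.+1], with limit 1. *)
Lemma boxsum_ptail_rho i :
  boxsum (fun k => ptail i.+2 (t * p k)) / rho p t @[t --> +oo] --> (i.+1%:R^-1 : R).
Proof.
apply: (@boxsum_rho_cvg _ p p_ge0 p_sum1 rho_rv rho_pos (ptail i.+2)
  (fun y => i.+1%:R^-1 * ptail i.+1 y) (fun y => poi i y / i.+1%:R) 1 1).
- move=> y y0; rewrite divr_ge0 ?poi_ge0//= ler_pdivrMr// mul1r.
  by rewrite (le_trans (poi_le1 _ y0))// ler1n.
- by move=> y; apply: (is_derive_eqfun (is_derive_ptail i.+1 y)) => //; rewrite poiS_mul.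
- move=> y; apply: (is_derive_eqfun (@is_deriveZ _ _ _ _ i.+1%:R^-1 _ _ _ (is_derive_ptail i y))) => //.
  by rewrite /GRing.scale/= mulrC.
- exact: ptail_at0.
- by rewrite ptail_at0 mulr0.
- by move=> y y0; exact: ptail_le1.
- by rewrite -[X in _ --> X]mulr1; apply: cvgr_scaleF; exact: ptail_cvg_infty.
Qed.

(** The density of [ptail i.+2 ^ 2] divided by [y] is a multiple of
[ptail i.+2 * poi i]; its primitive is found by writing [ptail i.+2] as
[ptail i.+1 - poi i.+1] and using [poi_mul_poi] for the second term. *)
Lemma boxsum_ptail_sqr_rho i :
  boxsum (fun k => ptail i.+2 (t * p k) ^+ 2) / rho p t @[t --> +oo] -->
  (i.+1%:R^-1 * (1 - 'C(i.*2.+1, i)%:R / 2 ^+ i.*2.+1) : R).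
Proof.
pose c : R := 'C(i.*2.+1, i)%:R / 2 ^+ i.*2.+1.
apply: (@boxsum_rho_cvg _ p p_ge0 p_sum1 rho_rv rho_pos (fun y => ptail i.+2 y ^+ 2)
  (fun y => i.+1%:R^-1 * (ptail i.+1 y ^+ 2 - c * ptail i.*2.+2 (2 * y)))
  (fun y => 2 * (poi i y * ptail i.+2 y) / i.+1%:R) 2 1).
- move=> y y0; have pp : 0 <= poi i y * ptail i.+2 y by apply: mulr_ge0; [exact: poi_ge0 | exact: ptail_ge0].
  rewrite ler_pdivrMr// divr_ge0 ?(mulr_ge0 _ pp)//=.
  rewrite ler_wpM2l// (le_trans _ (_ : 1 <= _)) ?ler1n//.
  by rewrite mulr_ile1 ?poi_ge0 ?ptail_ge0 ?poi_le1 ?ptail_le1.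
- move=> y; apply: (is_derive_eqfun (is_derive_ptail_sqr i.+1 y)) => //.
  by rewrite poiS_mul; ring.
- move=> y; have h := @is_deriveZ _ _ _ _ i.+1%:R^-1 _ _ _ (@is_deriveB _ _ _ _ _ _ _ _ _
    (is_derive_ptail_sqr i y) (@is_deriveZ _ _ _ _ c _ _ _ (is_derive_ptail2 i.*2.+1 y))).
  apply: (is_derive_eqfun h) => //.
  have := poi_mul_poi i y; rewrite -/c /GRing.scale/= (ptailS i.+1) => e.
  rewrite [LHS]mulrC; congr (_ * _).
  transitivity (2 * (ptail i.+1 y * poi i y) - 2 * (poi i y * poi i.+1 y)); first by ring.
  by rewrite e; ring.
- by rewrite ptail_at0 expr0n.
- by rewrite !ptail_at0 mulr0 !ptail_at0 expr0n/= mulr0 subrr mulr0.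
- by move=> y y0; rewrite exprn_ile1 ?ptail_ge0 ?ptail_le1.
- apply: cvgr_scaleF; apply: cvgB.
    rewrite -(expr1n _ 2); exact: (cvgM (ptail_cvg_infty _) (ptail_cvg_infty _)).
  rewrite -[X in _ --> X]mulr1; apply: cvgr_scaleF.
  by apply: pinfty_scale => //; exact: ptail_cvg_infty.
Qed.

End LevelTwo.

(** * The integrated tail of the slowly varying function *)

Section HatL.
Context {R : realType}.
Variable p : nat -> R.
Hypothesis p_ge0 : forall k, 0 <= p k.
Hypothesis p_sum1 : (\sum_(0 <= k <oo) (p k)%:E = 1)%E.
Implicit Types (y t b : R).
Local Notation mu := (@lebesgue_measure R).

Lemma integral_inv_sqr b : 0 < b -> (\int[mu]_(y in `[b, +oo[) (y ^- 2)%:E = (b^-1)%:E)%E.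
Proof.
move=> b0.
have dinv (y : R) : y != 0 -> is_derive y 1 (fun z : R => - z^-1) (y ^- 2).
  move=> y0; have h := @is_deriveN _ _ _ _ _ _ _ (@is_deriveV R id y 1 1 y0 (@is_derive_id _ _ y 1)).
  by apply: (is_derive_eqfun h) => //; rewrite /GRing.scale/= mulr1 opprK.
rewrite (@ge0_continuous_FTC2y _ (fun y => y ^- 2) (fun z : R => - z^-1) b 0).
- by rewrite sub0e -EFinN opprK.
- by move=> y _; rewrite invr_ge0 sqr_ge0.
- apply: continuous_in_subspaceT => y /set_mem/=; rewrite in_itv/= andbT => yb.
  have y0 : y != 0 by rewrite gt_eqF// (lt_le_trans b0).
  by apply: cvgV; [rewrite expf_neq0 | exact: exprn_continuous].
- rewrite -oppr0; apply: cvgN; apply/cvgrPdist_le => e e0; apply/pinfty_nearP.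
  exists e^-1; first by rewrite invr_gt0.
  move=> y ey; have y0 : 0 < y by rewrite (lt_le_trans _ ey) ?invr_gt0.
  by rewrite sub0r normrN ger0_norm ?invr_ge0 ?(ltW y0)// invf_ple ?posrE.
- by move=> y yb; have [] := dinv y; rewrite ?gt_eqF// (lt_trans b0).
- by apply: cvg_at_right_filter; apply: cvgN; apply: cvgV; [exact: lt0r_neq0 | exact: cvg_id].
- move=> y; rewrite in_itv/= andbT => yb; have y0 : y != 0 by rewrite gt_eqF// (lt_trans b0).
  by rewrite derive1E; have [_ ->] := dinv y y0.
Qed.

Lemma eseries_rho y : ((rho p y * y ^- 2)%:E =
  \sum_(k <oo) ((1 <= y * p k)%R%:R * y ^- 2)%:E)%E.
Proof.
rewrite rhoE// mulrC -(boxsumZ p_ge0 p_sum1); last exact: boxdom_ind.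
rewrite -(boxsum_eseries p_ge0 p_sum1); last by apply: boxdomZ; rewrite ?invr_ge0 ?sqr_ge0//; exact: boxdom_ind.
by apply: eq_eseriesr => k _; rewrite mulrC.
Qed.

Lemma measurable_inv t : 0 < t -> measurable_fun `[t, +oo[ (fun y : R => y^-1).
Proof.
move=> t0; apply: (@eq_measurable_fun _ _ _ _ _ (fun y : R => (Num.max y t)^-1)).
  by move=> y /set_mem/=; rewrite in_itv/= andbT => ty; rewrite max_l.
apply: nonincreasing_measurable => // x y xy.
have m0 (z : R) : 0 < Num.max z t by rewrite lt_max t0 orbT.
rewrite lef_pV2 ?posrE//; rewrite ge_max !le_max xy lexx orbT//.
Qed.

Lemma measurable_rho_term t k : 0 < t ->
  measurable_fun `[t, +oo[ (fun y : R => ((1 <= y * p k)%R%:R * y ^- 2)%:E).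
Proof.
move=> t0; apply/measurable_EFinP; apply: measurable_funM.
  apply: nondecreasing_measurable => // x y xy.
  have := ler_wpM2r (p_ge0 k) xy; case: (leP 1 (x * p k)) => [h1 h2|_ _]; last exact: ler0n.
  by rewrite (le_trans h1 h2).
rewrite (_ : (fun y => _) = (fun y => y^-1 ^+ 2)); last by apply/funext => y; rewrite exprVn.
by apply: measurable_funX; exact: measurable_inv.
Qed.

Lemma measurable_rho_sqr t : 0 < t ->
  measurable_fun `[t, +oo[ (fun y => (rho p y * y ^- 2)%:E).
Proof.
move=> t0; apply/measurable_EFinP; apply: measurable_funM.
  by apply: nondecreasing_measurable => // x y; exact: rho_nd.
rewrite (_ : (fun y => _) = (fun y => y^-1 ^+ 2)); last by apply/funext => y; rewrite exprVn.
by apply: measurable_funX; exact: measurable_inv.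
Qed.

(** Box [k] contributes the tail integral of [y ^- 2] from [1 / p k] or [t], whichever
is larger, which is [Num.min 1 (t * p k) / t]. *)
Lemma integral_rho t : 0 < t ->
  (\int[mu]_(y in `[t, +oo[) (rho p y * y ^- 2)%:E = (capped p t / t)%:E)%E.
Proof.
move=> t0; under eq_integral do rewrite eseries_rho.
rewrite integral_nneseries//; last 2 first.
- by move=> k; exact: measurable_rho_term.
- by move=> k y _; rewrite lee_fin mulr_ge0 ?invr_ge0 ?sqr_ge0.
rewrite /capped mulrC -(boxsumZ p_ge0 p_sum1); last by apply: boxdom_capped => //; exact: ltW.
rewrite -(boxsum_eseries p_ge0 p_sum1); last first.
  by apply: boxdomZ; [rewrite invr_ge0 ltW | apply: boxdom_capped => //; exact: ltW].
apply: eq_eseriesr => k _.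
have [pk0|pk0] := leP (p k) 0.
  have -> : p k = 0 by apply/le_anti; rewrite pk0 p_ge0.
  rewrite mulr0 min_r// mulr0 integral0_eq// => y _.
  by rewrite mulr0 ler10 mul0r.
pose b := Num.max t (p k)^-1.
have b0 : 0 < b by rewrite lt_max t0.
have -> : (t^-1 * Num.min 1 (t * p k))%R = b^-1.
  rewrite /b; case: (leP t (p k)^-1) => h.
    rewrite invrK min_r ?mulKf ?gt_eqF//.
    by rewrite -ler_pdivlMr// mul1r.
  rewrite min_l ?mulr1//.
  by rewrite -ler_pdivrMr// mul1r ltW.
rewrite -integral_inv_sqr// integral_mkcond [RHS]integral_mkcond.
apply: eq_integral => y _; rewrite /patch/=.
have -> : (y \in `[b, +oo[%classic) = (y \in `[t, +oo[%classic) && (1 <= y * p k).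
  rewrite !mem_setE !in_itv/= !andbT /b ge_max; congr (_ && _).
  by rewrite -[(_^-1)%R]mul1r ler_pdivrMr.
case: (y \in _) => //=; case: (1 <= _) => /=; rewrite ?mul1r ?mul0r//.
Qed.

Variable L : R -> R.
Hypothesis L_sv : slowly_varying L.
Hypothesis rho_equiv : asymp_equiv (rho p) (fun t => t * L t).

Lemma rho_L_near e : 0 < e -> e < 1 -> exists2 M, 0 < M &
  forall y, M <= y -> [/\ 0 < L y, y^-1 * L y * (1 - e) <= rho p y * y ^- 2 &
    rho p y * y ^- 2 <= y^-1 * L y * (1 + e)].
Proof.
move=> e0 e1; have l1 : 1 - e < 1 by lra.
have l2 : 1 < 1 + e by lra.
have [M M0 [_ hM]] := L_near L_sv.
have /pinfty_nearP[M1 M10 hM1] : \forall y \near +oo, 1 - e <= rho p y / (y * L y) <= 1 + e.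
  near=> y; apply/andP; split; apply: ltW; near: y.
    exact: cvgr_gt _ rho_equiv _ l1.
  exact: cvgr_lt _ rho_equiv _ l2.
exists (Num.max M M1); first by rewrite lt_max M0.
move=> y; rewrite ge_max => /andP[My M1y].
have L0 := hM _ My; have y0 : 0 < y by exact: lt_le_trans My.
have /andP[h1 h2] := hM1 _ M1y.
have yL0 : 0 < y * L y by rewrite mulr_gt0.
move: h1 h2; rewrite ler_pdivlMr// ler_pdivrMr// => h1 h2.
have q0 : 0 <= y ^- 2 by rewrite invr_ge0 sqr_ge0.
have eqy : y * L y * y ^- 2 = y^-1 * L y by field; rewrite gt_eqF.
split => //.
  by have := ler_wpM2r q0 h1; rewrite -(mulrA (1 - e)) eqy mulrC.
by have := ler_wpM2r q0 h2; rewrite -(mulrA (1 + e)) eqy [_ * (1 + e)]mulrC.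
Unshelve. all: by end_near. Qed.

Lemma measurable_invL t : 0 < t -> measurable_fun `[t, +oo[ L ->
  measurable_fun `[t, +oo[ (fun y => (y^-1 * L y)%:E).
Proof.
move=> t0 mL; apply/measurable_EFinP; apply: measurable_funM => //.
exact: measurable_inv.
Qed.

(** On [[t, +oo[] the integrands [y^-1 * L y] and [rho p y * y ^- 2] have a ratio
close to 1.  The integrability of the first follows from that of the second. *)
Lemma hatL_bounds e : 0 < e -> e < 1 -> \forall t \near +oo,
  [/\ mu.-integrable `[t, +oo[ (fun y : R => (y^-1 * L y)%:E),
      hatL L t * (1 - e) <= capped p t / t & capped p t / t <= hatL L t * (1 + e)].
Proof.
move=> e0 e1; have [M M0 hM] := rho_L_near e0 e1.
have [M1 M10 [mL _]] := L_near L_sv.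
apply/pinfty_nearP; exists (Num.max M M1); first by rewrite lt_max M0.
move=> t; rewrite ge_max => /andP[Mt M1t]; have t0 : 0 < t by exact: lt_le_trans Mt.
have mLt : measurable_fun `[t, +oo[ (fun y => (y^-1 * L y)%:E).
  apply: measurable_invL => //; apply: measurable_funS mL => // x /=.
  by rewrite !in_itv/= !andbT; exact: le_trans.
have pos y : `[t, +oo[%classic y -> 0 <= y^-1 * L y.
  rewrite /= in_itv/= andbT => ty; have [L0 _ _] := hM _ (le_trans Mt ty).
  by rewrite mulr_ge0 ?(ltW L0)// invr_ge0 (le_trans (ltW t0)).
have Z (c : R) : 0 <= c -> (c%:E * \int[mu]_(y in `[t, +oo[) (y^-1 * L y)%:E =
    \int[mu]_(y in `[t, +oo[) (c%:E * (y^-1 * L y)%:E))%E.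
  by move=> c0; rewrite ge0_integralZl// => y ty; rewrite lee_fin pos.
have e1' : 0 <= 1 - e by lra.
have e2' : 0 <= 1 + e by lra.
have I0 : (0 <= \int[mu]_(y in `[t, +oo[) (y^-1 * L y)%:E)%E.
  by apply: integral_ge0 => y ty; rewrite lee_fin pos.
have lo : ((1 - e)%:E * \int[mu]_(y in `[t, +oo[) (y^-1 * L y)%:E <= (capped p t / t)%:E)%E.
  rewrite Z//.
  rewrite -(integral_rho t0); apply: ge0_le_integral => //.
  - by move=> y ty; rewrite mule_ge0// lee_fin pos.
  - by apply: measurable_funeM.
  - exact: measurable_rho_sqr.
  move=> y /=; rewrite in_itv/= andbT => ty; have [_ h _] := hM _ (le_trans Mt ty).
  by rewrite -EFinM lee_fin mulrC.
have hi : ((capped p t / t)%:E <= (1 + e)%:E * \int[mu]_(y in `[t, +oo[) (y^-1 * L y)%:E)%E.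
  rewrite Z//.
  rewrite -(integral_rho t0); apply: ge0_le_integral => //.
  - by move=> y ty; rewrite lee_fin mulr_ge0 ?rho_ge0// invr_ge0 sqr_ge0.
  - exact: measurable_rho_sqr.
  - by apply: measurable_funeM.
  move=> y /=; rewrite in_itv/= andbT => ty; have [_ _ h] := hM _ (le_trans Mt ty).
  by rewrite -EFinM lee_fin [leRHS]mulrC.
have fI : (\int[mu]_(y in `[t, +oo[) (y^-1 * L y)%:E)%E \is a fin_num.
  have p1 : (0 < (1 - e)%:E)%E by rewrite lte_fin subr_gt0.
  move: I0 lo; case: (\int[mu]_(y in _) _)%E => [r| |]//=.
  by rewrite gt0_muley.
split.
- apply/integrableP; split => //.
  under eq_integral => y ty.
    rewrite gee0_abs; last by rewrite lee_fin pos// -in_setE.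
    over.
  by rewrite ltey_eq fI.
- by rewrite -lee_fin mulrC EFinM /hatL /Rintegral fineK.
- by rewrite [leRHS]mulrC -lee_fin [X in (_ <= X)%E]EFinM /hatL /Rintegral fineK.
Qed.

Lemma hatL_integrable : \forall t \near +oo,
  mu.-integrable `[t, +oo[ (fun y : R => (y^-1 * L y)%:E).
Proof.
have e0 : (0 : R) < 2^-1 by rewrite invr_gt0.
have e1 : (2^-1 : R) < 1 by rewrite invf_lt1// ltr1n.
by apply: filterS (hatL_bounds e0 e1) => t [].
Qed.

Lemma hatL_asymp (capped_pos : \forall t \near +oo, 0 < capped p t) :
  capped p t / (t * hatL L t) @[t --> +oo] --> (1 : R).
Proof.
apply/cvgrPdist_le => e e0.
pose h := Num.min e 2^-1.
have h0 : 0 < h by rewrite lt_min e0 invr_gt0 ltr0n.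
have h1 : h < 1.
  by rewrite gt_min; apply/orP; right; rewrite invf_lt1// ltr1n.
near=> t; have t0 : 0 < t by near: t; exact: nbhs_pinfty_gt.
have [_ a1 a2] : [/\ mu.-integrable `[t, +oo[ (fun y : R => (y^-1 * L y)%:E),
      hatL L t * (1 - h) <= capped p t / t & capped p t / t <= hatL L t * (1 + h)].
  by near: t; exact: hatL_bounds.
have c0 : 0 < capped p t / t by rewrite divr_gt0//; near: t.
have H0 : 0 < hatL L t by rewrite -(@pmulr_lgt0 _ (1 + h))//; [exact: lt_le_trans a2|lra].
have he : h <= e by rewrite ge_min lexx.
rewrite invfM mulrA ler_distlC; apply/andP; split.
  by rewrite ler_pdivlMr// mulrC (le_trans _ a1)// ler_wpM2l ?(ltW H0)//; lra.
by rewrite ler_pdivrMr// (le_trans a2)// [leRHS]mulrC ler_wpM2l ?(ltW H0)//; lra.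
Unshelve. all: by end_near. Qed.

End HatL.

(** * Mean and variance as sums over the boxes *)

Section BoxMoments.
Context {R : realType}.
Variable p : nat -> R.
Hypothesis p_ge0 : forall k, 0 <= p k.
Hypothesis p_sum1 : (\sum_(0 <= k <oo) (p k)%:E = 1)%E.
Implicit Types (y t c : R) (i j k n : nat).

(** The mean of the number of boxes with at least [j] balls; see [meanKE]. *)
Definition boxmean j t : R := boxsum (fun k => ptail j (t * p k)).

(** The variance of the same number; see [varKE]. *)
Definition boxvar j t : R :=
  boxsum (fun k => ptail j (t * p k) * (1 - ptail j (t * p k))).

Lemma ptail_le_capped j y : 0 <= y -> (0 < j)%N -> ptail j y <= Num.min 1 y.
Proof.
move=> y0 j0; rewrite le_min ptail_le1//=.
by rewrite (le_trans (ptail_leS y0 j0))// ptail1_le.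
Qed.

Lemma boxdom_ptail j t : (0 < j)%N -> 0 <= t -> boxdom p (fun k => ptail j (t * p k)).
Proof.
move=> j0 t0; apply: (boxdom_le (boxdom_capped p_ge0 t0)) => k.
have y0 := mulr_ge0 t0 (p_ge0 k).
by rewrite ptail_ge0//= ptail_le_capped.
Qed.

Lemma bern_var_bounds j y : 0 <= y ->
  0 <= ptail j y * (1 - ptail j y) <= ptail j y.
Proof.
move=> y0; have h0 := @ptail_ge0 R j _ y0; have h1 := @ptail_le1 R j _ y0.
have h2 : 0 <= 1 - ptail j y by rewrite subr_ge0.
by rewrite (mulr_ge0 h0 h2)/= ler_piMr// gerBl.
Qed.

Lemma boxdom_bern j t : (0 < j)%N -> 0 <= t ->
  boxdom p (fun k => ptail j (t * p k) * (1 - ptail j (t * p k))).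
Proof.
move=> j0 t0; apply: (boxdom_le (boxdom_ptail j0 t0)) => k.
by apply: bern_var_bounds; rewrite mulr_ge0.
Qed.

Lemma boxdom_ptail_sqr j t : (0 < j)%N -> 0 <= t -> boxdom p (fun k => ptail j (t * p k) ^+ 2).
Proof.
move=> j0 t0; apply: (boxdom_le (boxdom_ptail j0 t0)) => k.
have y0 := mulr_ge0 t0 (p_ge0 k).
by rewrite sqr_ge0/= expr2 ler_piMr ?ptail_le1 ?ptail_ge0.
Qed.

Lemma boxvarE j t : (0 < j)%N -> 0 <= t ->
  boxvar j t = boxmean j t - boxsum (fun k => ptail j (t * p k) ^+ 2).
Proof.
move=> j0 t0; rewrite /boxmean -(boxsumB p_ge0 p_sum1); [|exact: boxdom_ptail|exact: boxdom_ptail_sqr].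
by congr boxsum; apply/funext => k; rewrite mulrBr mulr1 expr2.
Qed.

Lemma boxvar_le j t : (0 < j)%N -> 0 <= t -> boxvar j t <= boxmean j t.
Proof.
move=> j0 t0; apply: (boxsum_le p_ge0 p_sum1); [exact: boxdom_bern|exact: boxdom_ptail|] => k.
by have /andP[] := @bern_var_bounds j _ (mulr_ge0 t0 (p_ge0 k)).
Qed.

Lemma boxmean_ge0 j t : (0 < j)%N -> 0 <= t -> 0 <= boxmean j t.
Proof. by move=> j0 t0; apply: (boxsum_ge0 p_ge0 p_sum1); exact: boxdom_ptail. Qed.

Lemma boxmean_nd j s t : (0 < j)%N -> 0 <= s -> s <= t -> boxmean j s <= boxmean j t.
Proof.
move=> j0 s0 st; have t0 := le_trans s0 st.
apply: (boxsum_le p_ge0 p_sum1); [exact: boxdom_ptail|exact: boxdom_ptail|] => k.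
by apply: ptail_nd; [rewrite mulr_ge0 | rewrite ler_wpM2r].
Qed.

Lemma boxmean_scale j c t : (0 < j)%N -> 1 <= c -> 0 <= t ->
  boxmean j (c * t) <= c ^+ j * boxmean j t.
Proof.
move=> j0 c1 t0; have c0 : 0 <= c by exact: le_trans c1.
rewrite /boxmean -(boxsumZ p_ge0 p_sum1); last exact: boxdom_ptail.
apply: (boxsum_le p_ge0 p_sum1).
- by apply: boxdom_ptail => //; rewrite mulr_ge0.
- by apply: boxdomZ; [rewrite exprn_ge0 | exact: boxdom_ptail].
- by move=> k; rewrite -mulrA ptail_scale// mulr_ge0.
Qed.

Lemma boxmean_le_capped j t : (0 < j)%N -> 0 <= t -> boxmean j t <= capped p t.
Proof.
move=> j0 t0; apply: (boxsum_le p_ge0 p_sum1); [exact: boxdom_ptail|exact: boxdom_capped|] => k.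
by rewrite ptail_le_capped// mulr_ge0.
Qed.

(** The boxes with [1 <= t * p k] are hit with probability at least [ptail j 1]. *)
Lemma boxmean_ge_rho j t : (0 < j)%N -> 0 <= t -> ptail j 1 * rho p t <= boxmean j t.
Proof.
move=> j0 t0; have h0 := @ptail_ge0 R j 1 ler01.
rewrite (rhoE p_ge0 p_sum1) -(boxsumZ p_ge0 p_sum1); last exact: boxdom_ind.
apply: (boxsum_le p_ge0 p_sum1); [by apply: boxdomZ => //; exact: boxdom_ind|exact: boxdom_ptail|] => k.
case: (leP 1 (t * p k)) => h; last by rewrite mulr0 ptail_ge0// mulr_ge0.
by rewrite mulr1; apply: ptail_nd.
Qed.

Lemma ptail_gt0 j : 0 < ptail j (1 : R).
Proof.
have := @ptail_ge0 R j.+1 1 ler01; rewrite ptailS subr_ge0; apply: lt_le_trans.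
by rewrite /poi expr1n mulr1 divr_gt0 ?expR_gt0// ltr0n fact_gt0.
Qed.

Lemma capped_ptail1 y : 0 <= y -> Num.min 1 y - Num.min 1 y ^+ 2 <= ptail 1 y.
Proof.
move=> y0; case: (leP 1 y) => h; first by rewrite expr1n subrr ptail_ge0.
rewrite ptail1 expRN; have e0 : 0 < expR y := expR_gt0 y.
have e1 := expR_ge1Dx y.
have : (expR y)^-1 <= (1 + y)^-1 by rewrite lef_pV2 ?posrE//; lra.
have : (1 + y)^-1 <= 1 - y + y ^+ 2.
  rewrite -[leLHS]mul1r ler_pdivrMr; last by lra.
  have : 0 <= y ^+ 3 by rewrite exprn_ge0.
  rewrite !exprS expr0; lra.
lra.
Qed.

Hypothesis rho_rv : forall l : R, 0 < l -> rho p (l * t) / rho p t @[t --> +oo] --> l.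
Hypothesis rho_pos : \forall t \near +oo, 0 < rho p t.

Lemma capped_pos : \forall t \near +oo, 0 < capped p t.
Proof.
apply: filterS2 rho_pos (rho_o_capped p_ge0 p_sum1 rho_rv rho_pos 1) => t r0.
by rewrite mul1r; exact: lt_le_trans.
Qed.

(** The error is negligible by [rho_o_capped]. *)
Lemma capped_asymp (f : R -> R) C :
  (\forall t \near +oo, capped p t - C * rho p t <= f t <= capped p t) ->
  f t / capped p t @[t --> +oo] --> (1 : R).
Proof.
move=> hf; apply/cvgrPdist_le => e e0; near=> t.
have c0 : 0 < capped p t by near: t; exact: capped_pos.
have /andP[f1 f2] : capped p t - C * rho p t <= f t <= capped p t by near: t.
have h : C / e * rho p t <= capped p t by near: t; exact: rho_o_capped.
have h2 : C * rho p t <= e * capped p t.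
  by have := ler_wpM2l (ltW e0) h; rewrite mulrA mulrCA divff ?mulr1// gt_eqF.
rewrite ler_distlC; apply/andP; split; [rewrite ler_pdivlMr//|rewrite ler_pdivrMr//].
  by rewrite mulrBl mul1r; lra.
by rewrite mulrDl mul1r (le_trans f2)// lerDl mulr_ge0// ltW.
Unshelve. all: by end_near. Qed.

Lemma boxmean1_capped : boxmean 1 t / capped p t @[t --> +oo] --> (1 : R).
Proof.
apply: (@capped_asymp _ 12); near=> t.
have t0 : 0 <= t by near: t; exact: nbhs_pinfty_ge.
rewrite boxmean_le_capped// andbT lerBlDr.
have c2 : capped2 p t <= 12 * rho p t by near: t; exact: capped2_le_rho.
rewrite (le_trans _ (lerD (lexx _) c2))// /boxmean /capped2 -(boxsumD p_ge0 p_sum1).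
- apply: (boxsum_le p_ge0 p_sum1); [exact: boxdom_capped|by apply: boxdomD; [exact: boxdom_ptail|exact: boxdom_capped2]|].
  by move=> k; have := capped_ptail1 (mulr_ge0 t0 (p_ge0 k)); lra.
- exact: boxdom_ptail.
- exact: boxdom_capped2.
Unshelve. all: by end_near. Qed.

Lemma boxvar1_capped : boxvar 1 t / capped p t @[t --> +oo] --> (1 : R).
Proof.
apply: (@capped_asymp _ 24); near=> t.
have t0 : 0 <= t by near: t; exact: nbhs_pinfty_ge.
rewrite (le_trans (boxvar_le _ t0))// ?boxmean_le_capped// andbT lerBlDr.
have c2 : capped2 p t <= 12 * rho p t by near: t; exact: capped2_le_rho.
have d2 := boxdom_capped2 p_ge0 t0.
have d22 : boxdom p (fun k => 2 * Num.min 1 (t * p k) ^+ 2) by exact: boxdomZ.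
rewrite (@le_trans _ _ (boxvar 1 t + 2 * capped2 p t))//; last by rewrite lerD2l; lra.
rewrite /boxvar /capped2 -(boxsumZ p_ge0 p_sum1)// -(boxsumD p_ge0 p_sum1)//; last exact: boxdom_bern.
apply: (boxsum_le p_ge0 p_sum1); [exact: boxdom_capped|by apply: boxdomD => //; exact: boxdom_bern|].
move=> k; have y0 := mulr_ge0 t0 (p_ge0 k).
have h1 := capped_ptail1 y0; have h2 := @ptail_le_capped 1 _ y0 isT.
have : ptail 1 (t * p k) ^+ 2 <= Num.min 1 (t * p k) ^+ 2.
  by rewrite ler_pXn2r// nnegrE ?ptail_ge0// le_min ler01.
rewrite mulrBr mulr1 -expr2; lra.
Unshelve. all: by end_near. Qed.

(** Subtraction of the limits for [ptail] and for its square. *)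
Lemma boxvar_rho i : boxvar i.+2 t / rho p t @[t --> +oo] -->
  (i.+1%:R^-1 * ('C(i.*2.+1, i)%:R / 2 ^+ i.*2.+1) : R).
Proof.
rewrite (_ : _ * _ = i.+1%:R^-1 - i.+1%:R^-1 * (1 - 'C(i.*2.+1, i)%:R / 2 ^+ i.*2.+1)); last by ring.
have h := cvgB (boxsum_ptail_rho p_ge0 p_sum1 rho_rv rho_pos (i := i)) (boxsum_ptail_sqr_rho p_ge0 p_sum1 rho_rv rho_pos (i := i)).
apply: cvg_trans (h _); apply: near_eq_cvg; near=> t.
have t0 : 0 <= t by near: t; exact: nbhs_pinfty_ge.
by rewrite boxvarE// mulrBl.
Unshelve. all: by end_near. Qed.

End BoxMoments.

(** * Moments of infinite sums of independent bits *)

Section BitMoments.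
Context {d} {T : measurableType d} {R : realType} (P : probability T R).
Notation Ev := (Ev P).
Implicit Types (m n k : nat) (b : nat -> T -> bool) (Y : T -> R).

(** The monotone convergence theorem for a sequence that is monotone everywhere but
converges only almost everywhere. *)
Lemma integral_ae_lim (g : nat -> T -> R) Y l : (forall n, bdd_rv (g n)) ->
  (forall w, g 0%N w = 0) -> (forall n w, g n w <= g n.+1 w) ->
  measurable_fun setT Y -> {ae P, forall w, g n w @[n --> \oo] --> Y w} ->
  Ev (g n) @[n --> \oo] --> l -> (\int[P]_w (Y w)%:E = l%:E)%E.
Proof.
move=> bg g0 gnd mY gY gl.
pose h n w := g n.+1 w - g n w.
have h0 n w : 0 <= h n w by rewrite subr_ge0.
have bh n : bdd_rv (h n) by exact: bdd_rvB.
have mh n : measurable_fun setT (fun w => (h n w)%:E) by apply/measurable_EFinP; have [] := bh n.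
have sumh n w : \sum_(0 <= i < n) h i w = g n w by rewrite telescope_sumr// g0 subr0.
transitivity (\int[P]_w (\sum_(n <oo) (h n w)%:E)%E)%E.
  apply: ae_eq_integral => //.
  - exact/measurable_EFinP.
  - rewrite (_ : (fun w => _) = (fun w => \sum_(n <oo | n \in xpredT) (h n w)%:E)%E).
      by apply: ge0_emeasurable_sum => // n w _ _; rewrite lee_fin.
    by apply/funext => w; exact: eq_eseriesl.
  - apply: filterS gY => w gYw _; apply/esym/cvg_lim => //.
    rewrite (_ : (fun n => _) = (fun n => (g n w)%:E)); last first.
      by apply/funext => n; rewrite sumEFin sumh.
    by apply/cvg_EFin; [exact: nearW | exact: gYw].
rewrite integral_nneseries//; last by move=> n w _; rewrite lee_fin.
apply/cvg_lim => //.
rewrite (_ : (fun n => _) = (fun n => (Ev (g n))%:E)); last first.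
  apply/funext => n; rewrite (eq_bigr (fun i => (Ev (h i))%:E)); last first.
    move=> i _; rewrite /Ev /Rintegral fineK//; apply: integrable_fin_num => //.
    exact: bdd_rv_integrable.
  rewrite sumEFin; congr EFin.
  rewrite (eq_bigr (fun i => Ev (g i.+1) - Ev (g i))); last by move=> i _; rewrite -EvB.
  rewrite telescope_sumr// (_ : g 0%N = fun=> 0); last by apply/funext.
  by rewrite Ev_cst subr0.
by apply/cvg_EFin; [exact: nearW | exact: gl].
Qed.

Variable b : nat -> T -> bool.
Hypothesis ib : indep_bits P b.

Let S m w : R := \sum_(k < m) (b k w)%:R.

Let bb k : bdd_rv (fun w => (b k w)%:R : R).
Proof. by have [mb _] := ib; exact: (@bdd_rv_bit _ _ _ b (fun _ c => c%:R)). Qed.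

Let bS m : bdd_rv (S m). Proof. by apply: bdd_rv_sum => k _; exact: bb. Qed.

Lemma Ev_bit_pair k l : (k < l)%N ->
  Ev (fun w => (b k w)%:R * (b l w)%:R) = bit_mean P b k * bit_mean P b l.
Proof.
move=> kl; have [mb prod] := ib.
pose phi i (c : bool) : R := if (i == k) || (i == l) then c%:R else 1.
have E1 (F : nat -> R) : (forall i, i != k -> i != l -> F i = 1) ->
    \prod_(i < l.+1) F i = F k * F l.
  move=> F1; rewrite big_ord_recr/= (bigD1 (Ordinal kl))//= big1 ?mulr1// => i ik.
  by apply: F1; [exact: ik | rewrite ltn_eqF].
have := prod l.+1 phi; rewrite (E1 (fun i => Ev (fun w => phi i (b i w)))); last first.
  move=> i /negbTE ik /negbTE il; rewrite /phi ik il; exact: Ev_cst.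
rewrite /phi !eqxx orbT /= => <-; congr Ev; apply/funext => w.
rewrite (E1 (fun i => if (i == k) || (i == l) then (b i w)%:R else 1)) ?eqxx ?orbT//.
by move=> i /negbTE -> /negbTE ->.
Qed.

Lemma Ev_sum_bits m : Ev (S m) = \sum_(k < m) bit_mean P b k.
Proof. by rewrite /S Ev_sum. Qed.

Lemma Ev_sum_bits_sqr m : Ev (fun w => S m w ^+ 2) =
  \sum_(k < m) bit_var P b k + (\sum_(k < m) bit_mean P b k) ^+ 2.
Proof.
elim: m => [|m IH].
  rewrite !big_ord0 expr0n addr0 (_ : (fun w => _) = fun=> 0) ?Ev_cst//.
  by apply/funext => w; rewrite /S big_ord0 expr0n.
have bSb : bdd_rv (fun w => S m w * (b m w)%:R) by exact: bdd_rvM.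
have SE : (fun w => S m.+1 w ^+ 2) =
    (fun w => S m w ^+ 2 + (2 * (S m w * (b m w)%:R) + (b m w)%:R)).
  apply/funext => w; rewrite /S big_ord_recr/=; case: (b m w) => /=; ring.
have b2 : bdd_rv (fun w => 2 * (S m w * (b m w)%:R)) by apply: bdd_rvM => //; exact: bdd_rv_cst.
rewrite SE EvD; [|by under eq_fun do rewrite expr2; exact: bdd_rvM|exact: bdd_rvD].
rewrite IH EvD// EvZ// -/(bit_mean P b m).
have -> : Ev (fun w => S m w * (b m w)%:R) = (\sum_(k < m) bit_mean P b k) * bit_mean P b m.
  rewrite (_ : (fun w => _) = (fun w => \sum_(k < m) (b k w)%:R * (b m w)%:R)); last first.
    by apply/funext => w; rewrite mulr_suml.
  rewrite Ev_sum; last by move=> k _; exact: bdd_rvM.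
  by rewrite mulr_suml; apply: eq_bigr => k _; rewrite Ev_bit_pair.
rewrite !big_ord_recr/= /bit_var; ring.
Qed.

Variables (Y : T -> R) (mu v : R).
Hypothesis mY : measurable_fun setT Y.
Hypothesis SY : {ae P, forall w, S m w @[m --> \oo] --> Y w}.
Hypothesis mu_cvg : \sum_(k < m) bit_mean P b k @[m --> \oo] --> mu.
Hypothesis v_cvg : \sum_(k < m) bit_var P b k @[m --> \oo] --> v.

Let S0 w : S 0 w = 0. Proof. by rewrite /S big_ord0. Qed.

Let S_ge0 m w : 0 <= S m w. Proof. by apply: sumr_ge0. Qed.

Let S_nd m w : S m w <= S m.+1 w. Proof. by rewrite /S big_ord_recr lerDl. Qed.

Lemma bits_mean : (\int[P]_w (Y w)%:E = mu%:E)%E.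
Proof.
apply: (@integral_ae_lim S) => //.
by under eq_fun do rewrite Ev_sum_bits.
Qed.

(** The partial sums are nonnegative and nondecreasing, so their squares are too. *)
Lemma bits_second_moment : (\int[P]_w (Y w ^+ 2)%:E = (v + mu ^+ 2)%:E)%E.
Proof.
apply: (@integral_ae_lim (fun m w => S m w ^+ 2)).
- by move=> m; under eq_fun do rewrite expr2; exact: bdd_rvM.
- by move=> w; rewrite S0 expr0n.
- by move=> m w; rewrite ler_pXn2r ?nnegrE.
- exact: measurable_funX.
- apply: filterS SY => w SYw; rewrite expr2; under eq_fun do rewrite expr2.
  exact: cvgM.
- under eq_fun do rewrite Ev_sum_bits_sqr; apply: cvgD => //.
  by rewrite expr2; under eq_fun do rewrite expr2; exact: cvgM.
Qed.

Lemma bits_variance : 'V_P[Y]%E = v%:E.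
Proof.
have iY : P.-integrable setT (EFin \o Y).
  have Y0 : {ae P, forall w, 0 <= Y w}.
    by apply: filterS SY => w SYw; apply: (cvgr_to_ge SYw); exact: nearW.
  apply/integrableP; split; first exact/measurable_EFinP.
  rewrite (_ : (\int[P]_x `|(EFin \o Y) x| = mu%:E)%E) ?ltry// -bits_mean.
  apply: ae_eq_integral => //.
  - by apply: measurableT_comp => //; exact/measurable_EFinP.
  - exact/measurable_EFinP.
  - by apply: filterS Y0 => w Yw _; apply: gee0_abs; rewrite lee_fin.
have iY2 : P.-integrable setT (fun w => (Y w ^+ 2)%:E).
  apply/integrableP; split; first by apply/measurable_EFinP; exact: measurable_funX.
  rewrite (_ : (\int[P]_x `|(Y x ^+ 2)%:E| = (v + mu ^+ 2)%:E)%E) ?ltry// -bits_second_moment.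
  by apply: eq_integral => w _; rewrite gee0_abs// lee_fin sqr_ge0.
rewrite /variance unlock unlock bits_mean /=.
have -> : (\int[P]_w (((Y \- cst mu) * (Y \- cst mu)) w)%:E =
    \int[P]_w ((Y w ^+ 2)%:E + ((- 2 * mu)%:E * (Y w)%:E + (mu ^+ 2)%:E)))%E.
  apply: eq_integral => w _; rewrite -EFinM -!EFinD; congr EFin.
  rewrite (_ : _ w = (Y w - mu) * (Y w - mu))//; ring.
rewrite integralD//; last first.
  apply: integrableD => //; first exact: integrableZl.
  exact: finite_measure_integrable_cst.
rewrite integralD//; [|exact: integrableZl|exact: finite_measure_integrable_cst].
rewrite integralZl// integral_cst// bits_mean bits_second_moment.
rewrite [X in ((mu ^+ 2)%:E * X)%E](_ : _ = 1%E); last exact: probability_setT.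
rewrite mule1 -EFinM -!EFinD; congr EFin; ring.
Qed.

End BitMoments.

(** * The occupancy numbers as sums of independent bits *)

Section OccupancyInterface.
Context {d} {T : measurableType d} {R : realType} (P : probability T R).
Variables (p : nat -> R) (xi : nat -> {RV P >-> R}) (X : nat -> {RV P >-> nat}).
Hypothesis scheme : poissonized_karlin p xi X.
Hypothesis p_ge0 : forall k, 0 <= p k.
Hypothesis p_sum1 : (\sum_(0 <= k <oo) (p k)%:E = 1)%E.
Implicit Types (s t r : R) (a n k m j u v : nat).

Notation Ev := (Ev P).
Notation pcount := (pcount xi X).

Definition hit j t k w : bool := (j <= pcount k t w)%N.

(** The box is brought to level [j] between the times [s] and [t]; on the
regular event this says that it is hit at [t] but not at [s]. *)
Definition newhit j s t k w : bool :=
  (pcount k s w < j <= pcount k s w + (pcount k t w - pcount k s w))%N.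

(** Any rule that decides about box [k] from its contents at [s] and its increment up
to [t] yields independent bits; this one fact feeds the bits at a single time, the
increments, and the mixtures of two times. *)
Lemma indep_bits_pcount (g : nat -> nat -> nat -> bool) s t : 0 <= s -> s <= t ->
  indep_bits P (fun k w => g k (pcount k s w) (pcount k t w - pcount k s w)%N).
Proof.
move=> s0 st; split.
  move=> k; apply: (measurable_glue (U := pcount k s)
    (g := fun u w => g k u (pcount k t w - pcount k s w)%N)) => [|u]; first exact: measurable_pcount.
  apply: (@measurableT_comp _ _ _ _ _ _ (g k u)).
    by move=> _ B _; rewrite setTI.
  by apply: measurable_fun_subn; exact: measurable_pcount.
move=> m phi.
pose M := \sum_(k < m) (`|phi k true| + `|phi k false|).
pose f k u v := if (k < m)%N then phi k (g k u v) else 0.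
have fM k u v : `|f k u v| <= M.
  rewrite /f /M; case: ltnP => km; last by rewrite normr0 sumr_ge0// => i _; rewrite addr_ge0.
  rewrite (bigD1 (Ordinal km))//= (@le_trans _ _ (`|phi k true| + `|phi k false|))//.
    by case: (g k u v); rewrite ?lerDl ?lerDr.
  by rewrite lerDl sumr_ge0// => i _; rewrite addr_ge0.
have := box_independence scheme p_ge0 m s0 st fM.
rewrite (eq_bigr (fun k : 'I_m => Ev (fun w => phi k (g k (pcount k s w) (pcount k t w - pcount k s w)%N)))).
  move=> <-; congr Ev; apply/funext => w; apply: eq_bigr => k _.
  by rewrite /f ltn_ord.
by move=> k _; rewrite /f ltn_ord.
Qed.

Lemma indep_hit j t : 0 <= t -> indep_bits P (hit j t).
Proof. by move=> t0; exact: (@indep_bits_pcount (fun _ u _ => (j <= u)%N) t t t0 (lexx t)). Qed.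

Lemma indep_newhit j s t : 0 <= s -> s <= t -> indep_bits P (newhit j s t).
Proof.
by move=> s0 st; exact: (@indep_bits_pcount (fun _ u v => (u < j <= u + v)%N)).
Qed.

Lemma hit_mean j t k : 0 <= t -> bit_mean P (hit j t) k = ptail j (t * p k).
Proof. by move=> t0; exact: (law_pcount_ge scheme p_ge0). Qed.

Lemma newhitE j s t k w : regular xi w -> 0 <= s -> s <= t ->
  (newhit j s t k w)%:R = (hit j t k w)%:R - (hit j s k w)%:R :> R.
Proof.
move=> rw s0 st; have h := pcount_le X k rw s0 st.
rewrite /newhit /hit subnKC//; case: (ltnP (pcount k s w) j) => h1 /=.
  by rewrite subr0.
by rewrite (leq_trans h1 h) subrr.
Qed.

Lemma newhit_mean j s t k : 0 <= s -> s <= t ->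
  bit_mean P (newhit j s t) k = ptail j (t * p k) - ptail j (s * p k).
Proof.
move=> s0 st; have t0 := le_trans s0 st.
have [mb _] := indep_newhit j s0 st.
have [mt _] := indep_hit j t0; have [ms _] := indep_hit j s0.
have bt := @bdd_rv_bit _ T R (hit j t) (fun _ c => c%:R) k (mt k).
have bs := @bdd_rv_bit _ T R (hit j s) (fun _ c => c%:R) k (ms k).
rewrite -!hit_mean// /bit_mean -EvB//; apply: Ev_ae.
- exact: (@bdd_rv_bit _ T R (newhit j s t) (fun _ c => c%:R)).
- exact: bdd_rvB.
- by apply: filterS (ae_regular scheme) => w rw; rewrite newhitE.
Qed.

Lemma pcount_eventually0 t w : exists m, forall k, (m <= k)%N -> pcount k t w = 0%N.
Proof.
exists (\sum_(i < renewals xi t w) (X i w).+1)%N => k mk.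
rewrite /pcount /cnt big1// => i _; apply/eqP; rewrite eqb0; apply/eqP => Xk.
move: mk; rewrite (bigD1 i)//= Xk addSn ltnNge; apply/negP; rewrite negbK.
exact: leq_addr.
Qed.

(** At a regular point only the boxes already visited count. *)
Lemma occupancy_eventually j t w : regular xi w -> 0 <= t -> (0 < j)%N ->
  exists M, forall m, (M <= m)%N -> \sum_(k < m) (hit j t k w)%:R = occupancy xi X j t w.
Proof.
move=> rw t0 j0; have [M hM] := pcount_eventually0 t w.
exists M => m Mm; rewrite /occupancy counting_nat.
have memE k : (k \in [set k | (j%:R%:E <= box_content xi X k t w)%E]) = hit j t k w.
  apply/idP/idP => [/set_mem/=|h]; first by rewrite (box_contentE X k rw t0) lee_fin ler_nat.
  by apply/mem_set => /=; rewrite (box_contentE X k rw t0) lee_fin ler_nat.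
under eq_eseriesr do rewrite memE.
have -> : (\sum_(k <oo) ((hit j t k w)%:R : R)%:E = (\sum_(k < m) (hit j t k w)%:R)%:E)%E => //.
apply/cvg_lim => //; apply: cvg_near_cst; exists m => // n /= mn.
rewrite sumEFin; congr EFin.
rewrite (big_cat_nat (leq0n m) mn)/= big_mkord [X in _ + X]big_nat_cond [X in _ + X]big1 ?addr0//.
move=> k /andP[/andP[mk _] _]; rewrite /hit hM ?(leq_trans Mm)//.
by rewrite leqNgt j0.
Qed.

Lemma measurable_counting (A : nat -> set T) : (forall n, measurable (A n)) ->
  measurable_fun setT (fun w => counting [set n | A n w] : \bar R).
Proof.
move=> mA; rewrite (_ : (fun w => _) = (fun w => \sum_(n <oo | n \in xpredT) (\1_(A n) w)%:E)%E).
  apply: ge0_emeasurable_sum => [n w _ _|n _]; first by rewrite lee_fin.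
  by apply/measurable_EFinP; exact: measurable_indic.
by apply/funext => w; rewrite counting_nat [RHS](@eq_eseriesl _ _ xpredT)//.
Qed.

Lemma measurable_box_content k t : measurable_fun setT (box_content xi X k t).
Proof.
apply: (@measurable_counting (fun n => [set w | throw_time xi n w <= t /\ X n w = k])) => n.
apply: measurableI; last exact: measurable_X_eq.
have mt : measurable_fun setT (throw_time xi n).
  by apply: measurable_sum => i; exact: measurable_funPT.
have := mt measurableT _ (measurable_itv `]-oo, t]); rewrite setTI.
by congr measurable; apply/seteqP; split => w /=; rewrite in_itv.
Qed.

Lemma measurable_occupancy j t : measurable_fun setT (occupancy xi X j t).
Proof.
apply: (@measurableT_comp _ _ _ _ _ _ fine) => //.
apply: (@measurable_counting (fun k => [set w | (j%:R%:E <= box_content xi X k t w)%E])) => k.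
have := measurable_box_content k t measurableT (emeasurable_itv `[j%:R%:E, +oo[).
rewrite setTI; congr measurable; apply/seteqP; split => w /=; rewrite in_itv/= ?andbT//.
Qed.

Lemma occupancy_cvg j t w : regular xi w -> 0 <= t -> (0 < j)%N ->
  \sum_(k < m) (hit j t k w)%:R @[m --> \oo] --> occupancy xi X j t w.
Proof.
move=> rw t0 j0; have [M hM] := occupancy_eventually rw t0 j0.
by apply: cvg_near_cst; exists M => // m /= Mm; exact: hM.
Qed.

Lemma boxsum_cvg_ord (f : nat -> R) : boxdom p f -> \sum_(k < m) f k @[m --> \oo] --> boxsum f.
Proof.
move=> df; have := boxsum_cvg p_ge0 p_sum1 df; apply: cvg_trans.
by apply: near_eq_cvg; apply: nearW => n; rewrite /series/= big_mkord.
Qed.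

Lemma hit_mean_cvg j t : (0 < j)%N -> 0 <= t ->
  \sum_(k < m) bit_mean P (hit j t) k @[m --> \oo] --> boxmean p j t.
Proof.
move=> j0 t0; under eq_fun do under eq_bigr do rewrite hit_mean//.
by apply: boxsum_cvg_ord; exact: boxdom_ptail.
Qed.

Lemma hit_var_cvg j t : (0 < j)%N -> 0 <= t ->
  \sum_(k < m) bit_var P (hit j t) k @[m --> \oo] --> boxvar p j t.
Proof.
move=> j0 t0; rewrite /bit_var; under eq_fun do under eq_bigr do rewrite hit_mean//.
by apply: boxsum_cvg_ord; exact: boxdom_bern.
Qed.

Lemma ae_occupancy_cvg j t : (0 < j)%N -> 0 <= t ->
  {ae P, forall w, \sum_(k < m) (hit j t k w)%:R @[m --> \oo] --> occupancy xi X j t w}.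
Proof.
by move=> j0 t0; apply: filterS (ae_regular scheme) => w rw; exact: occupancy_cvg.
Qed.

Theorem meanKE j t : (0 < j)%N -> 0 <= t -> meanK xi X j t = boxmean p j t.
Proof.
move=> j0 t0; rewrite /meanK unlock.
by rewrite (bits_mean (indep_hit j t0) (measurable_occupancy j t) (ae_occupancy_cvg j0 t0) (hit_mean_cvg j0 t0)).
Qed.

Theorem varKE j t : (0 < j)%N -> 0 <= t -> varK xi X j t = boxvar p j t.
Proof.
move=> j0 t0; rewrite /varK.
by rewrite (bits_variance (indep_hit j t0) (measurable_occupancy j t) (ae_occupancy_cvg j0 t0)
  (hit_mean_cvg j0 t0) (hit_var_cvg j0 t0)).
Qed.

Definition fluct j t w : R := occupancy xi X j t w - boxmean p j t.

Lemma measurable_fluct j t : measurable_fun setT (fluct j t).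
Proof. by apply: measurable_funB => //; exact: measurable_occupancy. Qed.

Lemma fluct_cvg j t w : regular xi w -> (0 < j)%N -> 0 <= t ->
  centred_sum P (hit j t) xpredT m w @[m --> \oo] --> fluct j t w.
Proof.
move=> rw j0 t0; rewrite /centred_sum; under eq_fun do rewrite sumrB.
by apply: cvgB; [exact: occupancy_cvg | exact: hit_mean_cvg].
Qed.

Lemma fluct_incr_cvg j s t w : regular xi w -> (0 < j)%N -> 0 <= s -> s <= t ->
  centred_sum P (newhit j s t) xpredT m w @[m --> \oo] --> fluct j t w - fluct j s w.
Proof.
move=> rw j0 s0 st; have t0 := le_trans s0 st.
rewrite (_ : (fun m => _) = (fun m => centred_sum P (hit j t) xpredT m w -
    centred_sum P (hit j s) xpredT m w)); first by apply: cvgB; exact: fluct_cvg.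
apply/funext => m; rewrite /centred_sum -sumrB.
by apply: eq_bigr => k _; rewrite newhitE// newhit_mean// !hit_mean//; ring.
Qed.

Lemma sum_hit_var_le j t m : (0 < j)%N -> 0 <= t ->
  \sum_(k < m) bit_var P (hit j t) k <= boxvar p j t.
Proof.
move=> j0 t0; rewrite /bit_var; under eq_bigr do rewrite hit_mean//.
by apply: (boxsum_ge p_ge0 p_sum1); exact: boxdom_bern.
Qed.

Lemma sum_newhit_var_le j s t m : (0 < j)%N -> 0 <= s -> s <= t ->
  \sum_(k < m) bit_var P (newhit j s t) k <= boxmean p j t - boxmean p j s.
Proof.
move=> j0 s0 st; have t0 := le_trans s0 st.
rewrite /boxmean -(boxsumB p_ge0 p_sum1); [|exact: boxdom_ptail|exact: boxdom_ptail].
have le k : ptail j (s * p k) <= ptail j (t * p k).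
  by apply: ptail_nd; [rewrite mulr_ge0 | rewrite ler_wpM2r].
rewrite (@le_trans _ _ (\sum_(k < m) (ptail j (t * p k) - ptail j (s * p k))))//.
  apply: ler_sum => k _; rewrite /bit_var newhit_mean// ler_piMr// ?subr_ge0//.
  by rewrite gerBl subr_ge0.
apply: (boxsum_ge p_ge0 p_sum1); apply: (boxdom_le (boxdom_ptail p_ge0 j0 t0)) => k.
by rewrite subr_ge0 le/= gerBl ptail_ge0// mulr_ge0.
Qed.

End OccupancyInterface.

(** * Growth estimates and tail bounds *)

Section Growth.
Context {R : realType}.
Implicit Types (q A c x : R) (n : nat).

Lemma near_nat_ge A : \forall n \near \oo, A <= n%:R.
Proof.
exists (Num.truncn A).+1 => // n /= An; rewrite (le_trans (ltW (truncnS_gt A)))//.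
by rewrite ler_nat.
Qed.

Lemma near_ln_ge A : \forall n \near \oo, A <= ln (n%:R : R).
Proof.
near=> n; have h : expR A <= n%:R by near: n; exact: near_nat_ge.
by rewrite -[A]expRK ler_ln ?posrE ?expR_gt0// (lt_le_trans _ h)// expR_gt0.
Unshelve. all: by end_near. Qed.

Lemma expR_ge_cube x : 0 <= x -> (x / 3) ^+ 3 <= expR x.
Proof.
move=> x0; have -> : expR x = expR (x / 3) ^+ 3.
  by rewrite -expRM_natl; congr expR; field.
rewrite lerXn2r ?nnegrE ?expR_ge0 ?divr_ge0//.
by have := expR_ge1Dx (x / 3); lra.
Qed.

Lemma near_pow_ge q A : 1 < q -> \forall n \near \oo, A * n%:R ^+ 2 <= q ^+ n.
Proof.
move=> q1; have l0 : 0 < ln q by rewrite ln_gt0.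
near=> n; have h : A * (3 / ln q) ^+ 3 <= n%:R by near: n; exact: near_nat_ge.
have q0 : 0 < q by exact: lt_trans q1.
have -> : q ^+ n = expR (n%:R * ln q) by rewrite expRM_natl lnK.
rewrite (le_trans _ (expR_ge_cube _))//; last by rewrite mulr_ge0// ltW.
have -> : (n%:R * ln q / 3) ^+ 3 = n%:R * (ln q / 3) ^+ 3 * n%:R ^+ 2 by ring.
rewrite ler_wpM2r ?sqr_ge0// -ler_pdivrMr; last by rewrite exprn_gt0 ?divr_gt0.
by rewrite -exprVn invf_div.
Unshelve. all: by end_near. Qed.

Lemma sum_inv_sqr n : \sum_(i < n) (i.+1%:R ^+ 2 : R)^-1 <= 2.
Proof.
suff : \sum_(i < n.+1) (i.+1%:R ^+ 2 : R)^-1 <= 2 - n.+1%:R^-1.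
  rewrite big_ord_recr/= => h; have : (0 : R) <= (n.+1%:R ^+ 2)^-1 by rewrite invr_ge0 sqr_ge0.
  have : (0 : R) <= n.+1%:R^-1 by rewrite invr_ge0.
  move: h; set A := \sum_(i < n) _; set B := n.+1%:R ^- 2; set C := n.+1%:R^-1; lra.
elim: n => [|n IH]; first by rewrite big_ord_recr big_ord0/= add0r expr1n invr1; lra.
rewrite big_ord_recr/=; set N : R := n.+1%:R in IH *.
have N0 : 0 < N by rewrite ltr0n.
have -> : n.+2%:R = N + 1 :> R by rewrite /N -natr1.
have h : (N + 1)^-1 + ((N + 1) ^+ 2)^-1 <= N^-1.
  rewrite -subr_ge0 (_ : _ - _ = (N * (N + 1) ^+ 2)^-1).
    by rewrite invr_ge0 mulr_ge0 ?sqr_ge0// ltW.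
  by field; rewrite !gt_eqF//; lra.
move: IH h; set A := \sum_(i < n.+1) _; set B := (N + 1) ^- 2; set C := (N + 1)^-1; set D := N^-1; lra.
Qed.

(** Telescoping: [n ^ (- e)] decreases by at least [e] times the next term. *)
Lemma sum_inv_power e n : 0 < e ->
  \sum_(i < n) expR (- ((1 + e) * ln (i.+1%:R : R))) <= 1 + e^-1.
Proof.
move=> e0; pose f i : R := expR (- (e * ln (i.+1%:R : R))).
have f0 i : 0 <= f i by exact: expR_ge0.
have step i : e * expR (- ((1 + e) * ln (i.+2%:R : R))) <= f i - f i.+1.
  have i2 : (0 : R) < i.+2%:R by rewrite ltr0n.
  have i1 : (0 : R) < i.+1%:R by rewrite ltr0n.
  have -> : expR (- ((1 + e) * ln (i.+2%:R : R))) = i.+2%:R^-1 * f i.+1.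
    by rewrite mulrDl mul1r opprD expRD expRN lnK ?posrE.
  have -> : f i = f i.+1 * expR (e * (ln (i.+2%:R : R) - ln (i.+1%:R : R))).
    by rewrite -expRD; congr expR; ring.
  have h := expR_ge1Dx (e * (ln (i.+2%:R : R) - ln (i.+1%:R : R))).
  have l : i.+2%:R^-1 <= ln (i.+2%:R : R) - ln (i.+1%:R : R).
    rewrite -ln_div ?posrE// -[_ / _]invf_div lnV ?posrE ?divr_gt0//.
    have := @le_ln1Dx R (- i.+2%:R^-1); rewrite (_ : 1 + - _ = i.+1%:R / i.+2%:R).
      by move=> /(_ _); rewrite lerNr; apply; rewrite ltrN2 invf_lt1// ltr1n.
    by rewrite -[in RHS](addrK 1 i.+1%:R) natr1 mulrBl mulfV ?mul1r// gt_eqF.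
  have := ler_wpM2l (ltW e0) l => l'.
  have : f i.+1 * (1 + e * i.+2%:R^-1) <= f i.+1 * expR (e * (ln (i.+2%:R : R) - ln (i.+1%:R : R))).
    by rewrite ler_wpM2l// (le_trans _ h)// lerD2l.
  by rewrite lerBrDl => /(le_trans _); apply; rewrite mulrDr mulr1 mulrA [_ * f _]mulrC.
have tel m : e * \sum_(i < m) expR (- ((1 + e) * ln (i.+2%:R : R))) <= 1 - f m.
  elim: m => [|m IH]; first by rewrite big_ord0 mulr0 /f ln1 mulr0 oppr0 expR0 subrr.
  by rewrite big_ord_recr/= mulrDr; have := step m; lra.
case: n => [|n]; first by rewrite big_ord0 addr_ge0// invr_ge0 ltW.
rewrite big_ord_recl/= ln1 mulr0 oppr0 expR0 lerD2l -(ler_pM2l e0) mulfV ?gt_eqF//.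
by rewrite (le_trans (tel n))// gerBl.
Qed.

Lemma pow1D_le c n : 0 <= c <= 1 -> (1 + c) ^+ n <= 1 + (2 ^+ n - 1) * c.
Proof.
move=> /andP[c0 c1]; elim: n => [|n IH]; first by rewrite !expr0 subrr mul0r addr0.
rewrite exprS (le_trans (ler_wpM2l _ IH)) ?addr_ge0// exprS.
have q0 : (0 : R) <= 2 ^+ n - 1 by rewrite subr_ge0 exprn_ege1// ler1n.
have : (2 ^+ n - 1) * c * c <= (2 ^+ n - 1) * c by rewrite ler_piMr// mulr_ge0.
lra.
Qed.

Lemma dyadic_block (t : R) : 1 <= t -> exists n, 2 ^+ n <= t < 2 ^+ n.+1.
Proof.
move=> t1; have ex : exists n, t < 2 ^+ n.+1.
  exists (Num.truncn t); rewrite (lt_trans (truncnS_gt t))// -natrX ltr_nat.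
  by rewrite ltn_expl.
exists (ex_minn ex); case: ex_minnP => n tn nmin; rewrite tn andbT.
case: n tn nmin => [//|n] tn nmin; rewrite leNgt; apply/negP => h.
by have := nmin n h; rewrite ltnn.
Qed.

End Growth.

Section TailBounds.
Context {d} {T : measurableType d} {R : realType} (P : probability T R).
Implicit Types (Z : T -> R) (v x th a : R).

(** The moment estimate of [chernoff_limit] as an abstract property of a variable
[Z], with [v] an upper bound of its variance. *)
Definition bits_tail Z v : Prop := measurable_fun setT Z /\
  forall th a, `|th| <= 2^-1 ->
    fine (P [set w | a <= th * Z w]) <= expR (- a + v * (th ^+ 2 / 2 * (1 + `|th|))).

Lemma bits_tail_le Z v v' : v <= v' -> bits_tail Z v -> bits_tail Z v'.
Proof.
move=> vv [mZ hZ]; split => // th a th2; rewrite (le_trans (hZ th a th2))// ler_expR lerD2l.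
by rewrite ler_wpM2r// mulr_ge0 ?addr_ge0// divr_ge0// sqr_ge0.
Qed.

Lemma bits_tailN Z v : bits_tail Z v -> bits_tail (fun w => - Z w) v.
Proof.
move=> [mZ hZ]; split; first exact: measurable_funN.
move=> th a th2; have := hZ (- th) a; rewrite normrN sqrrN => /(_ th2).
by rewrite (_ : [set w | _] = [set w | a <= th * - Z w])//; apply/seteqP; split => w /=; rewrite mulrN mulNr.
Qed.

Lemma bits_tail_th Z v x th : bits_tail Z v -> 0 < th -> th <= 2^-1 ->
  fine (P [set w | x <= Z w]) <= expR (- (th * x) + v * (th ^+ 2 / 2 * (1 + th))).
Proof.
move=> [mZ hZ] t0 t2; have := hZ th (th * x); rewrite gtr0_norm// => /(_ t2).
by rewrite (_ : [set w | _] = [set w | x <= Z w])//; apply/seteqP; split => w /=; rewrite ler_pM2l.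
Qed.

(** The choice [th = x / (2 * v)] for [x <= v] and [th = 1 / 2] otherwise. *)
Lemma bits_tail_crude Z v x : bits_tail Z v -> 0 < v -> 0 < x ->
  fine (P [set w | x <= Z w]) <= expR (- (x ^+ 2 / (4 * v))) + expR (- (x / 4)).
Proof.
move=> hZ v0 x0; case: (leP x v) => xv.
  have th0 : 0 < x / (2 * v) by rewrite divr_gt0// mulr_gt0.
  have th2 : x / (2 * v) <= 2^-1 by rewrite ler_pdivrMr ?mulr_gt0//; lra.
  rewrite (le_trans (bits_tail_th _ hZ th0 th2))// (@le_trans _ _ (expR (- (x ^+ 2 / (4 * v)))))//; last by rewrite lerDl expR_ge0.
  rewrite ler_expR; set th := x / (2 * v) in th0 th2 *.
  have -> : th * x = 2 * (v * th ^+ 2) by rewrite /th; field; rewrite gt_eqF.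
  have -> : x ^+ 2 / (4 * v) = v * th ^+ 2 by rewrite /th; field; rewrite gt_eqF.
  have z0 : 0 <= v * th ^+ 2 by rewrite mulr_ge0 ?sqr_ge0// ltW.
  have : v * th ^+ 2 * th <= v * th ^+ 2 * 2^-1 by rewrite ler_wpM2l.
  lra.
have h0 : (0 : R) < 2^-1 by rewrite invr_gt0.
rewrite (le_trans (bits_tail_th _ hZ h0 (lexx _)))// (@le_trans _ _ (expR (- (x / 4))))//; last by rewrite lerDr expR_ge0.
rewrite ler_expR; lra.
Qed.

(** The optimal choice [th = x / v] for a Gaussian variable of variance [v]. *)
Lemma bits_tail_sharp Z v x : bits_tail Z v -> 0 < v -> 0 < x -> x <= v / 2 ->
  fine (P [set w | x <= Z w]) <= expR (- (x ^+ 2 / (2 * v) * (1 - x / v))).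
Proof.
move=> hZ v0 x0 xv; have th0 : 0 < x / v by rewrite divr_gt0.
have th2 : x / v <= 2^-1 by rewrite ler_pdivrMr//; lra.
rewrite (le_trans (bits_tail_th _ hZ th0 th2))// ler_expR le_eqVlt; apply/orP; left.
by apply/eqP; field; rewrite gt_eqF.
Qed.

Lemma union_bound N (A : nat -> set T) (u : nat -> R) :
  (forall i, measurable (A i)) -> (forall i, (i < N)%N -> fine (P (A i)) <= u i) ->
  fine (P (\big[setU/set0]_(i < N) A i)) <= \sum_(i < N) u i.
Proof.
move=> mA; elim: N => [|N IH] uA; first by rewrite !big_ord0 measure0.
rewrite !big_ord_recr/=; have mU : measurable (\big[setU/set0]_(i < N) A i).
  by apply: bigsetU_measurable.
have fU B : measurable B -> P B \is a fin_num by move=> mB; exact: fin_num_measure.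
rewrite (@le_trans _ _ (fine (P (\big[setU/set0]_(i < N) A i) + P (A N)))%E)//.
  apply: fine_le; [exact/fU/measurableU| |exact: measureU2].
  by rewrite fin_numD !fU.
rewrite fineD ?fU// lerD ?uA//; apply: IH => i iN; apply: uA.
by rewrite ltnW.
Qed.

Lemma bigsetU_ord_mem N (A : nat -> set T) i w : (i < N)%N -> A i w ->
  (\big[setU/set0]_(i < N) A i) w.
Proof. by move=> iN Aw; rewrite -bigcup_mkord; exists i. Qed.

(** The bounds are indexed from 1 because they involve logarithms or inverses of the
index. *)
Lemma borel_cantelli_near E (b : nat -> R) C : (forall n, measurable (E n)) ->
  (forall n, 0 <= b n) -> (forall m, \sum_(i < m) b i.+1 <= C) ->
  (\forall n \near \oo, fine (P (E n)) <= b n) ->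
  {ae P, forall w, \forall n \near \oo, ~ E n w}.
Proof.
move=> mE b0 bC [N _ hN].
have := @borel_cantelli1 _ _ _ P (fun n => E (N + n).+1) (fun n => b (N + n).+1) C.
move=> /(_ _ _ _)[]//.
- by move=> n; apply: hN => /=; rewrite -addnS leq_addr.
- move=> m; apply: le_trans (bC (N + m)%N); rewrite big_split_ord/= lerDr.
  by apply: sumr_ge0 => i _; exact: b0.
move=> A hA; exists A; case: hA => mA A0 sub; split => // w /= nE; apply: sub => /= -[M hM].
apply: nE; exists (N + M).+1 => // n /= Mn.
have -> : n = (N + (M + (n - (N + M).+1))).+1 by rewrite addnA -addSn subnKC.
by apply: hM; exact: leq_addr.
Qed.

Lemma bits_tail_event Z v x : bits_tail Z v -> measurable [set w | x <= Z w].
Proof.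
move=> [mZ _]; have := mZ measurableT _ (measurable_itv `[x, +oo[); rewrite setTI.
by congr measurable; apply/seteqP; split => w /=; rewrite in_itv/= andbT.
Qed.

End TailBounds.

(** * The upper half of the law of the iterated logarithm *)

(** The model: [Y] is the fluctuation at time [t] of a nondecreasing counting
process of mean [Phi] and variance [V].  The increments are controlled through
[Phi], which bounds both their variance and, by monotonicity, their size. *)
Section UpperLIL.
Context {d} {T : measurableType d} {R : realType} (P : probability T R).
Variables (Y : R -> T -> R) (V Phi : R -> R) (j : nat) (c0 c1 : R).
Implicit Types (s t x e a : R) (n l i m q : nat) (w : T).
Hypothesis Y_tail : forall t, 0 <= t -> bits_tail P (Y t) (V t).
Hypothesis Y_incr_tail : forall s t, 0 <= s -> s <= t ->
  bits_tail P (fun w => Y t w - Y s w) (Phi t - Phi s).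
Hypothesis YPhi_nd : {ae P, forall w, forall s t, 0 <= s -> s <= t ->
  Y s w + Phi s <= Y t w + Phi t}.
Hypothesis Phi_ge0 : forall t, 0 <= t -> 0 <= Phi t.
Hypothesis Phi_le : forall t, 0 <= t -> Phi t <= t.
Hypothesis Phi_nd : forall s t, 0 <= s -> s <= t -> Phi s <= Phi t.
Hypothesis Phi_scale : forall c t, 1 <= c -> 0 <= t -> Phi (c * t) <= c ^+ j * Phi t.
Hypothesis V_incr : forall s t, 0 <= s -> s <= t -> `|V t - V s| <= Phi t - Phi s.
Hypothesis c0_bound : 0 < c0 <= 1.
Hypothesis c1_gt0 : 0 < c1.
Hypothesis V_ge : \forall t \near +oo, c0 * Phi t <= V t.
Hypothesis Phi_growth : \forall n \near \oo, c1 * (19 / 10) ^+ n <= Phi (2 ^+ n).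

Let C : R := 4 ^+ j.

Let C_ge1 : 1 <= C. Proof. by rewrite exprn_ege1// ler1n. Qed.

Let two_gt0 n : (0 : R) < 2 ^+ n. Proof. by rewrite exprn_gt0. Qed.

(** Between the ends of a block, the growth [Phi (c * t) <= c ^ j * Phi t] is turned
into a Lipschitz estimate. *)
Lemma Phi_incr n s t : 2 ^+ n <= s -> s <= t -> t <= 2 ^+ n.+1 ->
  Phi t - Phi s <= C * ((t - s) / 2 ^+ n) * Phi (2 ^+ n).
Proof.
move=> ns st tn; have n0 := two_gt0 n.
have s0 : 0 < s by exact: lt_le_trans ns.
pose r := (t - s) / s.
have r0 : 0 <= r by rewrite divr_ge0 ?subr_ge0// ltW.
have r2 : r <= (t - s) / 2 ^+ n by rewrite ler_wpM2l ?subr_ge0// lef_pV2 ?posrE.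
have r1 : r <= 1.
  by rewrite ler_pdivrMr// mul1r; move: tn; rewrite exprS; lra.
have tE : t = (1 + r) * s by rewrite mulrDl mul1r divfK ?gt_eqF// subrKC.
have h1 : Phi t <= (1 + (2 ^+ j - 1) * r) * Phi s.
  rewrite {1}tE (le_trans (Phi_scale _ (ltW s0)))//; first by rewrite lerDl.
  by rewrite ler_wpM2r ?Phi_ge0 ?(ltW s0)// pow1D_le// r0.
have h2 : Phi s <= 2 ^+ j * Phi (2 ^+ n).
  rewrite (le_trans (Phi_nd (ltW s0) (le_trans st tn)))// exprS.
  by rewrite Phi_scale ?ler1n ?ltW.
have q0 : (0 : R) <= 2 ^+ j - 1 by rewrite subr_ge0 exprn_ege1// ler1n.
have d0 : 0 <= (t - s) / 2 ^+ n by rewrite divr_ge0 ?subr_ge0// ltW.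
apply: (@le_trans _ _ (2 ^+ j * ((t - s) / 2 ^+ n) * (2 ^+ j * Phi (2 ^+ n)))).
  rewrite (@le_trans _ _ ((2 ^+ j - 1) * r * Phi s))//; first by move: h1; rewrite mulrDl mul1r; lra.
  apply: ler_pM => //; first by rewrite mulr_ge0.
    by rewrite Phi_ge0// ltW.
  by apply: ler_pM => //; rewrite gerBl.
by rewrite /C (_ : 4 = 2 * 2) ?exprMn; [rewrite le_eqVlt; apply/orP; left; apply/eqP; ring | ring].
Qed.

Let grid n l i : R := 2 ^+ n * (1 + i%:R / 2 ^+ l).

Let grid_ge n l i : 2 ^+ n <= grid n l i.
Proof.
rewrite /grid ler_peMr ?(ltW (two_gt0 n))// lerDl divr_ge0//.
Qed.

Let grid_le n l i : (i <= 2 ^ l)%N -> grid n l i <= 2 ^+ n.+1.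
Proof.
move=> il; rewrite /grid exprS [leRHS]mulrC ler_wpM2l ?(ltW (two_gt0 n))//.
have : i%:R / 2 ^+ l <= (1 : R) by rewrite ler_pdivrMr// mul1r -natrX ler_nat.
lra.
Qed.

Let grid_ge0 n l i : 0 <= grid n l i. Proof. exact: le_trans (ltW (two_gt0 n)) (grid_ge n l i). Qed.

Let grid_half n l i : grid n l i./2 <= grid n l.+1 i /\
  grid n l.+1 i <= grid n l i./2 + 2 ^+ n / 2 ^+ l.+1.
Proof.
have e : i%:R / 2 ^+ l.+1 = i./2%:R / 2 ^+ l + (odd i)%:R / 2 ^+ l.+1 :> R.
  rewrite -{1}(odd_double_half i) natrD -muln2 natrM exprS.
  by field; rewrite gt_eqF.
have o0 : 0 <= (odd i)%:R / 2 ^+ l.+1 :> R by rewrite divr_ge0// ltW.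
have o1 : (odd i)%:R / 2 ^+ l.+1 <= (2 ^+ l.+1)^-1 :> R.
  by case: (odd i); rewrite ?mul1r// mul0r invr_ge0 ltW.
rewrite /grid e addrA; split; first by rewrite ler_wpM2l ?lerDl// ltW.
by rewrite [2 ^+ n * (_ + (odd i)%:R / _)]mulrDr lerD2l ler_wpM2l// ltW.
Qed.

(** Each step of the chain goes from the index [k] of level [l.+1] to its neighbour
[k./2] of level [l]. *)
Lemma grid_chain w n l0 m i (x_ : nat -> R) : (l0 <= m)%N -> (i <= 2 ^ m)%N ->
  (forall l k, (l0 <= l < m)%N -> (k <= 2 ^ l.+1)%N ->
     Y (grid n l.+1 k) w - Y (grid n l k./2) w <= x_ l) ->
  exists q, [/\ (q <= 2 ^ l0)%N, grid n l0 q <= grid n m i,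
    grid n m i <= grid n l0 q + 2 ^+ n * ((2 ^+ l0)^-1 - (2 ^+ m)^-1) &
    Y (grid n m i) w <= Y (grid n l0 q) w + \sum_(l0 <= l < m) x_ l].
Proof.
move=> l0m; elim: m l0m i => [|m IH] l0m i im step.
  have e0 : l0 = 0%N by apply/eqP; rewrite -leqn0.
  by exists i; rewrite e0 subrr mulr0 addr0 big_geq// addr0.
move: l0m; rewrite leq_eqVlt => /predU1P[->|l0m].
  by exists i; rewrite subrr mulr0 addr0 big_geq// addr0.
have i2 : (i./2 <= 2 ^ m)%N by have := half_leq im; rewrite expnS mul2n doubleK.
have [q [q0 q1 q2 q3]] : exists q, [/\ (q <= 2 ^ l0)%N, grid n l0 q <= grid n m i./2,
    grid n m i./2 <= grid n l0 q + 2 ^+ n * ((2 ^+ l0)^-1 - (2 ^+ m)^-1) &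
    Y (grid n m i./2) w <= Y (grid n l0 q) w + \sum_(l0 <= l < m) x_ l].
  apply: IH => // l k /andP[l0l lm] kl; apply: step => //.
  by rewrite l0l ltnW.
have [g1 g2] := grid_half n m i.
exists q; split => //; first exact: le_trans g1.
  have e : (2 ^+ m)^-1 = (2 ^+ m.+1)^-1 + (2 ^+ m.+1)^-1 :> R by rewrite exprS; field; rewrite gt_eqF.
  move: q2 g2; rewrite e; lra.
rewrite big_nat_recr//=; have := step m i; rewrite ltnSn andbT => /(_ l0m im); lra.
Qed.

Lemma grid_locate n m t : 2 ^+ n <= t -> t < 2 ^+ n.+1 ->
  exists2 i, (i < 2 ^ m)%N & grid n m i <= t <= grid n m i.+1.
Proof.
move=> nt tn; have n0 := two_gt0 n; have m0 := two_gt0 m.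
pose z := (t / 2 ^+ n - 1) * 2 ^+ m.
have z0 : 0 <= z by rewrite mulr_ge0 ?(ltW m0)// subr_ge0 ler_pdivlMr// mul1r.
have tz : t = 2 ^+ n * (1 + z / 2 ^+ m).
  by rewrite /z mulfK ?gt_eqF// subrKC mulrC divfK// gt_eqF.
have /andP[i1 i2] := truncn_itv z0.
exists (Num.truncn z).
  rewrite -(ltr_nat R) (le_lt_trans i1)// natrX /z -[ltRHS]mul1r ltr_pM2r//.
  by rewrite ltrBlDr ltr_pdivrMr// -exprS.
rewrite tz /grid !ler_pM2l// !lerD2l !ler_pM2r ?invr_gt0// i1 ltW//.
Qed.

Let a_ n : R := ln n%:R.

Let V_exp : \forall n \near \oo, forall t, 2 ^+ n <= t -> c0 * c1 * (19 / 10) ^+ n <= V t.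
Proof.
have [/andP[c00 c01]] := c0_bound.
have [M M0 hM] : exists2 M : R, 0 < M & forall t, M <= t -> c0 * Phi t <= V t.
  exact/pinfty_nearP.
near=> n => t nt; have t0 := le_trans (ltW (two_gt0 n)) nt.
have Mn : M <= 2 ^+ n.
  have : M <= n%:R by near: n; exact: near_nat_ge.
  by move=> /le_trans; apply; rewrite -natrX ler_nat ltnW// ltn_expl.
rewrite (le_trans _ (hM _ (le_trans Mn nt)))//.
have g : c1 * (19 / 10) ^+ n <= Phi (2 ^+ n) by near: n.
rewrite -mulrA ler_wpM2l ?(ltW c00)// (le_trans g)// Phi_nd// ltW.
Unshelve. all: by end_near. Qed.

Lemma variance_growth K : \forall n \near \oo, forall t, 2 ^+ n <= t -> K * n%:R ^+ 2 <= V t.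
Proof.
have [/andP[c00 c01]] := c0_bound.
have q1 : (1 : R) < 19 / 10 by lra.
near=> n => t nt.
have g2 : K / (c0 * c1) * n%:R ^+ 2 <= (19 / 10) ^+ n by near: n; exact: near_pow_ge.
have g : c0 * c1 * (19 / 10) ^+ n <= V t by move: t nt; near: n; exact: V_exp.
rewrite (le_trans _ g)// -ler_pdivrMl ?mulr_gt0// (le_trans _ g2)//.
by rewrite mulrA [_^-1 * K]mulrC.
Unshelve. all: by end_near. Qed.

(** Finitely many points in each block, each exceeding the level with probability at
most [n ^ (- (1 + e))]. *)
Lemma coarse_bound e l0 : 0 < e <= 1 -> {ae P, forall w, \forall n \near \oo,
  forall i, (i <= 2 ^ l0)%N ->
  Y (grid n l0 i) w < (1 + e) * Num.sqrt (2 * V (grid n l0 i) * a_ n)}.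
Proof.
move=> /andP[e0 e1].
pose x n i := (1 + e) * Num.sqrt (2 * V (grid n l0 i) * a_ n).
pose A n i := [set w | x n i <= Y (grid n l0 i) w].
have mA n i : measurable (A n i) by exact: bits_tail_event (Y_tail (grid_ge0 n l0 i)).
pose N1 := (2 ^ l0).+1.
pose E n := \big[setU/set0]_(i < N1) A n i.
pose b n := N1%:R * expR (- ((1 + e) * a_ n)).
have PA : \forall n \near \oo, forall i, fine (P (A n i)) <= expR (- ((1 + e) * a_ n)).
  near=> n => i.
  have n1 : 1 <= n%:R :> R by near: n; exact: near_nat_ge.
  have a1 : 1 <= a_ n by near: n; exact: near_ln_ge.
  have an : a_ n <= n%:R ^+ 2.
    rewrite (@le_trans _ _ n%:R)//; last by rewrite expr2 ler_peMl// (le_trans ler01).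
    by rewrite ltW// ln_sublinear// (lt_le_trans ltr01).
  have vK : (32 / e ^+ 2) * n%:R ^+ 2 <= V (grid n l0 i).
    by move: (grid n l0 i) (grid_ge n l0 i); near: n; exact: variance_growth.
  rewrite /A /x; set v := V _ in vK *; set a := a_ n in a1 an *.
  have e20 : 0 < e ^+ 2 by rewrite exprn_gt0.
  have av : 32 / e ^+ 2 * a <= v.
    by rewrite (le_trans _ vK)// ler_wpM2l// divr_ge0// ltW.
  have v0 : 0 < v.
    by rewrite (lt_le_trans _ av)// mulr_gt0 ?divr_gt0// (lt_le_trans ltr01).
  pose y := (1 + e) * Num.sqrt (2 * v * a).
  have va0 : 0 <= 2 * v * a by rewrite !mulr_ge0 ?(ltW v0)// (le_trans ler01).
  have y2 : y ^+ 2 = (1 + e) ^+ 2 * (2 * v * a) by rewrite exprMn sqr_sqrtr.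
  have y0 : 0 < y.
    by rewrite mulr_gt0 ?sqrtr_gt0 ?mulr_gt0//; lra.
  (* so the relative error of the sharp tail bound is small *)
  have ye : y <= v * (e / 2).
    rewrite -ler_sqr ?nnegrE ?(ltW y0) ?mulr_ge0 ?(ltW v0) ?divr_ge0 ?(ltW e0)//.
    rewrite y2 exprMn expr_div_n.
    have h1 : (1 + e) ^+ 2 <= 2 ^+ 2 by rewrite lerXn2r ?nnegrE//; lra.
    have h2 : 32 * a <= v * e ^+ 2 by move: av; rewrite mulrAC ler_pdivrMr.
    have h3 := ler_wpM2l (ltW v0) h2.
    have h4 := ler_wpM2r va0 h1.
    rewrite (le_trans h4)// !expr2; rewrite !expr2 in h3; lra.
  have yv2 : y <= v / 2.
    by rewrite (le_trans ye)// ler_wpM2l ?(ltW v0)//; lra.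
  rewrite (le_trans (bits_tail_sharp (Y_tail (grid_ge0 n l0 i)) v0 y0 yv2))// ler_expR lerN2.
  have -> : y ^+ 2 / (2 * v) = (1 + e) ^+ 2 * a by rewrite y2; field; rewrite gt_eqF.
  have yv : y / v <= e / 2 by rewrite ler_pdivrMr// mulrC.
  have q0 : 0 <= (1 + e) * a by rewrite mulr_ge0//; lra.
  have : 1 <= (1 + e) * (1 - y / v).
    have : (1 + e) * (1 - e / 2) <= (1 + e) * (1 - y / v) by rewrite ler_wpM2l//; lra.
    apply: le_trans; have : e * e <= e by rewrite ler_piMl// ltW.
    lra.
  by move=> /(ler_wpM2l q0); rewrite mulr1 => /le_trans; apply; rewrite expr2; lra.
have : {ae P, forall w, \forall n \near \oo, ~ E n w}.
  apply: (@borel_cantelli_near _ _ _ P E b (N1%:R * (1 + e^-1))).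
  - by move=> n; apply: bigsetU_measurable.
  - by move=> n; rewrite mulr_ge0 ?expR_ge0.
  - by move=> m; rewrite -mulr_sumr ler_wpM2l// sum_inv_power.
  - near=> n; rewrite (le_trans (@union_bound _ _ _ P N1 (A n) (fun=> expR (- ((1 + e) * a_ n))) (mA n) _))//.
      by move=> i _; move: i; near: n.
    by rewrite sumr_const card_ord /b mulr_natl.
apply: filterS => w hw; near=> n => i il; rewrite ltNge; apply/negP => h.
have : ~ E n w by near: n.
by apply; rewrite /E -bigcup_mkord; exists i.
Unshelve. all: by end_near. Qed.

(** There are about [2 ^ l] steps of level [l], each with a variance of order
[2 ^ (- l) * Phi (2 ^ n)].  The allowed deviation shrinks only like [(4 / 5) ^ l],
and [2 * (4 / 5) ^ 2 = 32 / 25 > 1], so the exponent of the tail bound grows with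
[l] and beats the number of points; the growth [(19 / 10) ^ n] of [Phi] makes the
exponential regime of the tail harmless, since [(16 / 25) * (19 / 10) > 1]. *)
Lemma chain_bound eta : 0 < eta -> exists L, forall l0, (L <= l0)%N ->
  {ae P, forall w, \forall n \near \oo,
  forall l k, (l0 <= l < n)%N -> (k <= 2 ^ l.+1)%N ->
  Y (grid n l.+1 k) w - Y (grid n l k./2) w <
    eta * (4 / 5) ^+ l * Num.sqrt (Phi (2 ^+ n) * a_ n)}.
Proof.
move=> eta0; have [L hL] : exists L, forall l, (L <= l)%N -> 8 <= eta ^+ 2 / (4 * C) * (32 / 25) ^+ l.
  have q1 : (1 : R) < 32 / 25 by lra.
  have [L _ hL] : \forall n \near \oo, 8 <= eta ^+ 2 / (4 * C) * (32 / 25) ^+ n.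
    near=> n; have h : 32 * C / eta ^+ 2 * n%:R ^+ 2 <= (32 / 25) ^+ n by near: n; exact: near_pow_ge.
    have n1 : 1 <= n%:R :> R by near: n; exact: near_nat_ge.
    have e20 : 0 < eta ^+ 2 / (4 * C) by rewrite divr_gt0 ?exprn_gt0// mulr_gt0// (lt_le_trans ltr01).
    rewrite -ler_pdivrMl// (le_trans _ h)//.
    have -> : (eta ^+ 2 / (4 * C))^-1 * 8 = 32 * C / eta ^+ 2.
      by field; rewrite !gt_eqF ?exprn_gt0// (lt_le_trans ltr01).
    rewrite ler_peMr ?exprn_ege1// !mulr_ge0 ?invr_ge0 ?sqr_ge0//.
    by rewrite (le_trans ler01).
  by exists L => l /hL.
exists L => l0 Ll0.
pose x n l := eta * (4 / 5) ^+ l * Num.sqrt (Phi (2 ^+ n) * a_ n).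
pose B n l k := [set w | x n l <= Y (grid n l.+1 k) w - Y (grid n l k./2) w].
have tailB n l k : (k <= 2 ^ l.+1)%N -> bits_tail P (fun w => Y (grid n l.+1 k) w - Y (grid n l k./2) w)
    (C / 2 ^+ l * Phi (2 ^+ n)).
  move=> kl; have [g1 g2] := grid_half n l k.
  apply: bits_tail_le (Y_incr_tail (grid_ge0 n l k./2) g1).
  have P0 : 0 <= Phi (2 ^+ n) by rewrite Phi_ge0// ltW.
  rewrite (le_trans (Phi_incr (grid_ge n l k./2) g1 (grid_le n kl)))// ler_wpM2r//.
  rewrite ler_wpM2l ?(le_trans ler01 C_ge1)// ler_pdivrMr// mulrC.
  rewrite lerBlDl (le_trans g2)// lerD2l ler_wpM2l ?(ltW (two_gt0 n))//.
  by rewrite lef_pV2 ?posrE// exprS ler_peMl ?ltW// ltr1n.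
have mB n l k : measurable (B n l k).
  have [mY1 _] := Y_tail (grid_ge0 n l.+1 k).
  have [mY2 _] := Y_tail (grid_ge0 n l k./2).
  have := measurable_funB mY1 mY2 measurableT (measurable_itv `[x n l, +oo[); rewrite setTI.
  by congr measurable; apply/seteqP; split => w /=; rewrite in_itv/= andbT.
pose E n := \big[setU/set0]_(i < n - l0) \big[setU/set0]_(k < (2 ^ (l0 + i).+1).+1) B n (l0 + i)%N k.
have PB : \forall n \near \oo, forall i k, (i < n - l0)%N -> (k <= 2 ^ (l0 + i).+1)%N ->
    fine (P (B n (l0 + i)%N k)) <= 2 * expR (- (2 * a_ n + 2 * i%:R)).
  have q1 : (1 : R) < 152 / 125 by lra.
  near=> n => i k; rewrite ltn_subRL => iln kl; set l := (l0 + i)%N in iln kl *.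
  have n1 : 1 <= n%:R :> R by near: n; exact: near_nat_ge.
  have a1 : 1 <= a_ n by near: n; exact: near_ln_ge.
  have an : a_ n <= n%:R by rewrite ltW// ln_sublinear// (lt_le_trans ltr01).
  have g : c1 * (19 / 10) ^+ n <= Phi (2 ^+ n) by near: n.
  have F0 : 0 < Phi (2 ^+ n) by rewrite (lt_le_trans _ g)// mulr_gt0// exprn_gt0// divr_gt0.
  have C0 : 0 < C by exact: lt_le_trans C_ge1.
  have v0 : 0 < C / 2 ^+ l * Phi (2 ^+ n) by rewrite mulr_gt0// divr_gt0.
  have s2 : Num.sqrt (Phi (2 ^+ n) * a_ n) ^+ 2 = Phi (2 ^+ n) * a_ n.
    by rewrite sqr_sqrtr// mulr_ge0 ?(ltW F0)// (le_trans ler01).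
  have s0 : 0 < Num.sqrt (Phi (2 ^+ n) * a_ n).
    by rewrite sqrtr_gt0 mulr_gt0// (lt_le_trans ltr01).
  have p0 : (0 : R) < (4 / 5) ^+ l by rewrite exprn_gt0// divr_gt0.
  have x0 : 0 < x n l by rewrite /x !mulr_gt0.
  rewrite /B (le_trans (bits_tail_crude (tailB n l k kl) v0 x0))//.
  rewrite [leRHS]mulrDl mul1r; apply: lerD; rewrite ler_expR lerN2.
    have -> : x n l ^+ 2 / (4 * (C / 2 ^+ l * Phi (2 ^+ n))) =
        eta ^+ 2 / (4 * C) * ((4 / 5) ^+ l ^+ 2 * 2 ^+ l) * a_ n.
      rewrite /x [(_ * Num.sqrt _) ^+ 2]exprMn s2 exprMn; field.
      by rewrite !gt_eqF.
    have -> : (4 / 5) ^+ l ^+ 2 * 2 ^+ l = (32 / 25) ^+ l :> R.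
      by rewrite -exprM mulnC exprM -exprMn; congr (_ ^+ _); field.
    have bern : 1 + 7 / 25 * i%:R <= (32 / 25) ^+ i :> R.
      elim: (i) => [|m IH]; first by rewrite mulr0 addr0 expr0.
      rewrite exprS -natr1; have := ler0n R m; lra.
    rewrite /l exprD mulrA; set K := eta ^+ 2 / (4 * C) * (32 / 25) ^+ l0.
    have K8 : 8 <= K by exact: hL.
    have i0 := ler0n R i.
    have z0 : (0 : R) <= 1 + 7 / 25 * i%:R by lra.
    have h1 : 8 * (1 + 7 / 25 * i%:R) <= K * (32 / 25) ^+ i by apply: ler_pM.
    have a0 : 0 <= a_ n by exact: le_trans a1.
    have h2 : 8 * (1 + 7 / 25 * i%:R) * a_ n <= K * (32 / 25) ^+ i * a_ n by rewrite ler_wpM2r.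
    have h3 : i%:R * 1 <= i%:R * a_ n by rewrite ler_wpM2l.
    rewrite (le_trans _ h2)//; lra.
  have iln' : i%:R <= n%:R :> R by rewrite ler_nat (leq_trans _ (ltnW iln))// leq_addl.
  have x16 : 16 * n%:R <= x n l.
    rewrite -ler_sqr ?nnegrE ?(ltW x0) ?mulr_ge0//.
    have -> : x n l ^+ 2 = eta ^+ 2 * ((16 / 25) ^+ l * (Phi (2 ^+ n) * a_ n)).
      rewrite /x exprMn s2 exprMn -mulrA -exprM mulnC exprM; congr (_ * (_ ^+ _ * _)).
      by field.
    have d0 : (0 : R) <= 16 / 25 by lra.
    have d1 : (16 / 25 : R) <= 1 by lra.
    have e20 : 0 < eta ^+ 2 by rewrite exprn_gt0.
    have h1 : (16 / 25) ^+ n * (c1 * (19 / 10) ^+ n) <= (16 / 25) ^+ l * (Phi (2 ^+ n) * a_ n).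
      apply: ler_pM; rewrite ?exprn_ge0 ?mulr_ge0 ?(ltW c1_gt0)//.
        by apply: ler_wiXn2l => //; exact: ltnW.
      by rewrite (le_trans g)// ler_peMr// ltW.
    have h2 : 256 / (eta ^+ 2 * c1) * n%:R ^+ 2 <= (152 / 125) ^+ n by near: n; exact: near_pow_ge.
    rewrite (le_trans _ (ler_wpM2l (ltW e20) h1))//.
    have -> : eta ^+ 2 * ((16 / 25) ^+ n * (c1 * (19 / 10) ^+ n)) = eta ^+ 2 * c1 * (152 / 125) ^+ n.
      rewrite mulrCA -[in RHS](_ : 16 / 25 * (19 / 10) = 152 / 125 :> R); last by field.
      by rewrite [in RHS]exprMn; ring.
    rewrite -ler_pdivrMl ?mulr_gt0// (le_trans _ h2)// exprMn mulrA.
    by rewrite ler_wpM2r ?sqr_ge0// [leLHS]mulrC ler_wpM2r ?invr_ge0 ?mulr_ge0 ?(ltW c1_gt0) ?(ltW e20)//; lra.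
  lra.
have b_le n m : \sum_(i < m) (2 ^ (l0 + i).+1).+1%:R * (2 * expR (- (2 * a_ n + 2 * i%:R))) <=
    2 ^+ l0 * 16 * expR (- (2 * a_ n)).
  have e4 : expR (- 2) <= 4^-1 :> R.
    rewrite expRN lef_pV2 ?posrE ?expR_gt0//.
    have : (2 : R) <= expR 1 by have := expR_ge1Dx (1 : R); lra.
    move=> h; rewrite (_ : 2 = 1 + 1 :> R)// expRD.
    have := ler_pM _ _ h h; rewrite !ler0n => /(_ isT isT); lra.
  apply: (@le_trans _ _ (\sum_(i < m) 2 ^+ l0 * 8 * expR (- (2 * a_ n)) * 2^-1 ^+ i)).
    apply: ler_sum => i _; rewrite opprD expRD.
    have -> : expR (- (2 * i%:R)) = expR (- 2) ^+ i :> R.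
      by rewrite -expRM_natl; congr expR; ring.
    have h1 : (2 ^ (l0 + i).+1).+1%:R <= 4 * 2 ^+ l0 * 2 ^+ i :> R.
      rewrite -natr1 natrX exprS exprD.
      have : (1 : R) <= 2 ^+ l0 * 2 ^+ i by rewrite -exprD exprn_ege1// ler1n.
      lra.
    have h2 : expR (- 2) ^+ i <= 4^-1 ^+ i :> R by rewrite lerXn2r ?nnegrE ?expR_ge0 ?invr_ge0.
    have E0 : 0 <= expR (- (2 * a_ n)) by exact: expR_ge0.
    apply: (@le_trans _ _ (4 * 2 ^+ l0 * 2 ^+ i * (2 * (expR (- (2 * a_ n)) * 4^-1 ^+ i)))).
      have P1 : 0 <= 2 * (expR (- (2 * a_ n)) * expR (- 2) ^+ i).
        by rewrite mulr_ge0// mulr_ge0// exprn_ge0// expR_ge0.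
      apply: (ler_pM (ler0n _ _) P1 h1).
      by rewrite ler_wpM2l// ler_wpM2l.
    have -> : 4^-1 ^+ i = 2^-1 ^+ i * 2^-1 ^+ i :> R by rewrite -exprMn; congr (_ ^+ _); field.
    have e : 2 ^+ i * 2^-1 ^+ i = 1 :> R by rewrite -exprMn mulfV ?expr1n.
    rewrite le_eqVlt; apply/orP; left; apply/eqP.
    transitivity (8 * 2 ^+ l0 * expR (- (2 * a_ n)) * 2^-1 ^+ i * (2 ^+ i * 2^-1 ^+ i)); first by ring.
    by rewrite e; ring.
  rewrite -mulr_sumr.
  have g m' : \sum_(i < m') 2^-1 ^+ i <= 2 :> R.
    suff -> : \sum_(i < m') 2^-1 ^+ i = 2 * (1 - 2^-1 ^+ m') :> R.
      have : (0 : R) <= 2^-1 ^+ m' by rewrite exprn_ge0 ?invr_ge0.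
      lra.
    elim: m' => [|m' IH]; first by rewrite big_ord0 expr0 subrr mulr0.
    by rewrite big_ord_recr/= IH exprS; field.
  have q0 : 0 <= 2 ^+ l0 * 8 * expR (- (2 * a_ n)) by rewrite !mulr_ge0 ?exprn_ge0 ?expR_ge0.
  have := ler_wpM2l q0 (g m); lra.
have : {ae P, forall w, \forall n \near \oo, ~ E n w}.
  apply: (@borel_cantelli_near _ _ _ P E (fun n => 2 ^+ l0 * 16 * expR (- (2 * a_ n))) (2 ^+ l0 * 16 * 2)).
  - by move=> n; apply: bigsetU_measurable => i _; apply: bigsetU_measurable.
  - by move=> n; rewrite !mulr_ge0 ?exprn_ge0 ?expR_ge0.
  - move=> m; rewrite -mulr_sumr ler_wpM2l ?mulr_ge0 ?exprn_ge0//.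
    rewrite (le_trans _ (@sum_inv_sqr R m))//; apply: ler_sum => i _.
    by rewrite /a_ expRN expRM_natl lnK// posrE.
  - near=> n; apply: le_trans (b_le n (n - l0)%N).
    apply: (@union_bound _ _ _ P (n - l0) (fun i => \big[setU/set0]_(k < (2 ^ (l0 + i).+1).+1) B n (l0 + i)%N k)
      (fun i => (2 ^ (l0 + i).+1).+1%:R * (2 * expR (- (2 * a_ n + 2 * i%:R))))).
      by move=> i; apply: bigsetU_measurable.
    move=> i iN.
    rewrite (le_trans (@union_bound _ _ _ P _ (B n (l0 + i)%N) (fun=> 2 * expR (- (2 * a_ n + 2 * i%:R))) (mB n _) _))//.
      by move=> k; rewrite ltnS => kl; move: i k iN kl; near: n.
    by rewrite sumr_const card_ord -[leLHS]mulr_natl.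
apply: filterS => w hw; near=> n => l k /andP[l0l ln] kl; rewrite ltNge; apply/negP => h.
have : ~ E n w by near: n.
apply; apply: (@bigsetU_ord_mem _ _ _ (fun i => \big[setU/set0]_(k < (2 ^ (l0 + i).+1).+1) B n (l0 + i)%N k) (l - l0)).
  by rewrite ltn_sub2r// (leq_ltn_trans l0l).
by rewrite subnKC//; exact: (@bigsetU_ord_mem _ _ _ (B n l) k).
Unshelve. all: by end_near. Qed.

Let sqrt_le_mul (c A B : R) : 0 <= c -> A <= c ^+ 2 * B -> Num.sqrt A <= c * Num.sqrt B.
Proof.
move=> c0' AB; have -> : c * Num.sqrt B = Num.sqrt (c ^+ 2 * B).
  by rewrite sqrtrM ?sqr_ge0// sqrtr_sqr ger0_norm.
exact: ler_wsqrtr.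
Qed.

(** The variance grows at least geometrically in [n], so that its iterated logarithm
is at least [ln n] up to an additive constant. *)
Let lnln_near e : 0 < e -> \forall n \near \oo, forall t, 2 ^+ n <= t ->
  a_ n <= (1 + e) * ln (ln (V t)).
Proof.
move=> e0; have [/andP[c00 c01]] := c0_bound.
have q1 : (1 : R) < 19 / 15 by lra.
near=> n => t nt.
have n1 : 1 <= n%:R :> R by near: n; exact: near_nat_ge.
have n0 : 0 < n%:R :> R by exact: lt_le_trans n1.
have g : c0 * c1 * (19 / 10) ^+ n <= V t by move: t nt; near: n; exact: V_exp.
have g2 : (c0 * c1)^-1 * n%:R ^+ 2 <= (19 / 15) ^+ n by near: n; exact: near_pow_ge.
have cc : 0 < c0 * c1 by rewrite mulr_gt0.
have g3 : (c0 * c1)^-1 <= (19 / 15) ^+ n.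
  by rewrite (le_trans _ g2)// ler_peMr ?exprn_ege1// invr_ge0 ltW.
have e4 : expR (4^-1 : R) <= 3 / 2.
  have : 0 <= (4^-1 : R) <= 2^-1 by rewrite invr_ge0 ler0n/= lef_pV2 ?posrE// ler_nat.
  by move=> /expR_le_half; lra.
have Vn : expR (n%:R / 4) <= V t.
  rewrite (le_trans _ g)// expRM_natl.
  apply: (@le_trans _ _ ((3 / 2) ^+ n)); first by rewrite lerXn2r ?nnegrE ?expR_ge0//; lra.
  have -> : (19 / 10) ^+ n = (19 / 15) ^+ n * (3 / 2) ^+ n :> R.
    by rewrite -exprMn; congr (_ ^+ _); field.
  rewrite mulrA; apply: ler_peMl; first by rewrite exprn_ge0// divr_ge0.
  by rewrite -ler_pdivrMl// mulr1.
have V0 : 0 < V t by exact: lt_le_trans (expR_gt0 _) Vn.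
have lV : n%:R / 4 <= ln (V t) by rewrite -[leLHS]expRK ler_ln ?posrE ?expR_gt0.
have n4 : 0 < n%:R / 4 :> R by rewrite divr_gt0.
have llV : a_ n - ln 4 <= ln (ln (V t)).
  by rewrite -ln_div ?posrE// ler_ln ?posrE// (lt_le_trans n4).
have a4 : (1 + e) / e * ln 4 <= a_ n by near: n; exact: near_ln_ge.
have e1 : 0 <= 1 + e by lra.
rewrite (le_trans _ (ler_wpM2l e1 llV))//.
have : (1 + e) * ln 4 <= e * a_ n.
  by move: a4; rewrite mulrAC ler_pdivrMr// [_ * e]mulrC.
lra.
Unshelve. all: by end_near. Qed.

(** The point [t] is compared with the next point of the grid of mesh 1, which is
reached by chaining from a coarse point of the block. *)
Theorem upper_lil e : 0 < e <= 1 -> {ae P, forall w, \forall t \near +oo,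
  Y t w <= (1 + e) * Num.sqrt (2 * V t * ln (ln (V t)))}.
Proof.
move=> /andP[e0 e1]; have [/andP[c00 c01]] := c0_bound.
pose h := e / 11; have h0 : 0 < h by rewrite divr_gt0.
have h1 : h <= 1 by rewrite /h; lra.
(* [11] comes from [(1 + 5 * h) * (1 + h) <= 1 + 11 * h]; the steps of the chain
   sum to [5 * eta] units of [sqrt (Phi / V)], at most [1 / c0] *)
pose eta := h * c0 / 10; have eta0 : 0 < eta by rewrite divr_gt0// mulr_gt0.
have [L hL] := chain_bound eta0.
have [l0 [Ll0 hl0]] : exists l0, (L <= l0)%N /\ C / c0 <= h * 2 ^+ l0.
  exists (maxn L (Num.truncn (C / c0 / h)).+1); set m := _.+1; split; first exact: leq_maxl.
  rewrite -ler_pdivrMl// mulrC (le_trans (ltW (truncnS_gt _)))// -/m.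
  rewrite -natrX ler_nat (leq_trans (leq_maxr L m))// ltnW// ltn_expl//.
have hh : 0 < h <= 1 by rewrite h0.
apply: filterS3 (coarse_bound l0 hh) (hL l0 Ll0) YPhi_nd => w coarse chain mono.
suff [N _ hN] : \forall n \near \oo, forall t, 2 ^+ n <= t -> t < 2 ^+ n.+1 ->
    Y t w <= (1 + e) * Num.sqrt (2 * V t * ln (ln (V t))).
  apply/pinfty_nearP; exists (2 ^+ N) => // t Nt.
  have [n /andP[nt tn]] : exists n, 2 ^+ n <= t < 2 ^+ n.+1.
    by apply: dyadic_block; rewrite (le_trans _ Nt)// exprn_ege1// ler1n.
  apply: (hN n) => //=; rewrite -ltnS -(@ltr_eXn2l R 2) ?ltr1n//.
  exact: le_lt_trans Nt tn.
have [M M0 hM] : exists2 M : R, 0 < M & forall t, M <= t -> c0 * Phi t <= V t.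
  exact/pinfty_nearP.
near=> n => t nt tn.
have cn i : (i <= 2 ^ l0)%N ->
    Y (grid n l0 i) w < (1 + h) * Num.sqrt (2 * V (grid n l0 i) * a_ n).
  by move: i; near: n.
have VK u : 2 ^+ n <= u -> C ^+ 2 / h ^+ 2 * n%:R ^+ 2 <= V u.
  by move: u; near: n; exact: variance_growth.
have la u : 2 ^+ n <= u -> a_ n <= (1 + h) * ln (ln (V u)).
  by move: u; near: n; exact: lnln_near.
have n1 : 1 <= n%:R :> R by near: n; exact: near_nat_ge.
have a1 : 1 <= a_ n by near: n; exact: near_ln_ge.
have l0n : (l0 <= n)%N by near: n; exists l0.
have Mn : M <= 2 ^+ n.
  have : M <= n%:R by near: n; exact: near_nat_ge.
  by move=> /le_trans; apply; rewrite -natrX ler_nat ltnW// ltn_expl.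
have n0 := two_gt0 n; have t0 : 0 < t by exact: lt_le_trans nt.
have F0 : 0 <= Phi (2 ^+ n) by rewrite Phi_ge0// ltW.
have Ft : Phi (2 ^+ n) <= Phi t by rewrite Phi_nd// ltW.
have VF : c0 * Phi t <= V t by rewrite hM// (le_trans Mn).
have V0 : 0 <= V t by rewrite (le_trans _ VF)// mulr_ge0 ?(ltW c00)// (le_trans F0).
have VFn : c0 * Phi (2 ^+ n) <= V t by rewrite (le_trans _ VF)// ler_wpM2l// ltW.
have a0 : 0 <= a_ n by exact: le_trans a1.
have Va0 : 0 <= 2 * V t * a_ n by rewrite !mulr_ge0.
set S := Num.sqrt (2 * V t * a_ n).
have S0 : 0 <= S by exact: sqrtr_ge0.
have [i i2 /andP[ti ti1]] := grid_locate n nt tn.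
pose x_ l := eta * (4 / 5) ^+ l * Num.sqrt (Phi (2 ^+ n) * a_ n).
have [q [ql gq gq2 Yq]] : exists q, [/\ (q <= 2 ^ l0)%N, grid n l0 q <= grid n n i.+1,
    grid n n i.+1 <= grid n l0 q + 2 ^+ n * ((2 ^+ l0)^-1 - (2 ^+ n)^-1) &
    Y (grid n n i.+1) w <= Y (grid n l0 q) w + \sum_(l0 <= l < n) x_ l].
  apply: grid_chain => // l k ln kl; apply: ltW; rewrite /x_.
  by move: l k ln kl; near: n.
set s := grid n n i.+1 in ti1 gq gq2 Yq; set u := grid n l0 q in gq gq2 Yq.
have s1 : s = grid n n i + 1.
  by rewrite /s /grid -natr1; field; rewrite gt_eqF.
have nu : 2 ^+ n <= u by exact: grid_ge.
have un : u <= 2 ^+ n.+1 by exact: grid_le.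
have sn : s <= 2 ^+ n.+1 by exact: grid_le.
have l0inv : (1 : R) <= 2 ^+ n / 2 ^+ l0.
  by rewrite ler_pdivlMr// mul1r ler_eXn2l// ltr1n.
have sumx : \sum_(l0 <= l < n) x_ l <= 5 * eta * Num.sqrt (Phi (2 ^+ n) * a_ n).
  have g m m' : \sum_(m <= l < m') (4 / 5) ^+ l <= 5 * (4 / 5) ^+ m :> R.
    case: (leqP m m') => mm; last by rewrite big_geq ?(ltnW mm)// mulr_ge0// exprn_ge0// divr_ge0.
    suff -> : \sum_(m <= l < m') (4 / 5) ^+ l = 5 * ((4 / 5) ^+ m - (4 / 5) ^+ m') :> R.
      by rewrite ler_wpM2l// gerBl exprn_ge0// divr_ge0.
    rewrite -(subnKC mm); elim: (m' - m)%N => [|k IH]; first by rewrite addn0 big_geq// subrr mulr0.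
    by rewrite addnS big_nat_recr ?leq_addr//= IH exprS; field.
  rewrite /x_ -mulr_suml -mulr_sumr ler_wpM2r ?sqrtr_ge0// mulrC ler_wpM2r ?(ltW eta0)//.
  by rewrite (le_trans (g _ _))// ler_piMr// exprn_ile1 ?divr_ge0// ler_pdivrMr// mul1r ler_nat.
have fine_ : 5 * eta * Num.sqrt (Phi (2 ^+ n) * a_ n) <= h * S.
  have : Num.sqrt (Phi (2 ^+ n) * a_ n) <= c0^-1 * S.
    apply: sqrt_le_mul; first by rewrite invr_ge0 ltW.
    rewrite [leRHS]mulrA ler_wpM2r// exprVn -ler_pdivrMl ?invr_gt0 ?exprn_gt0// invrK.
    have : c0 ^+ 2 * Phi (2 ^+ n) <= c0 * Phi (2 ^+ n).
      by rewrite ler_wpM2r// expr2 ler_piMr// ltW.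
    by lra.
  have e50 : 0 <= 5 * eta by rewrite mulr_ge0// ltW.
  move=> /(ler_wpM2l e50) /le_trans; apply.
  rewrite mulrA ler_wpM2r// /eta (_ : _ / c0 = h / 2); first by lra.
  by field; rewrite gt_eqF.
have Vu : V u <= (1 + h) ^+ 2 * V t.
  have VuF : V u - V t <= C * (2 ^+ l0)^-1 * Phi (2 ^+ n).
    have [ut|/ltW tu] := leP u t.
      rewrite (le_trans (ler_norm _))// distrC (le_trans (V_incr _ ut))//; first by rewrite (le_trans _ nu)// ltW.
      rewrite (le_trans (Phi_incr nu ut (ltW tn)))// ler_wpM2r// ler_wpM2l ?(le_trans ler01 C_ge1)//.
      rewrite ler_pdivrMr// mulrC.
      have : 2 ^+ n * ((2 ^+ l0)^-1 - (2 ^+ n)^-1) <= 2 ^+ n * (2 ^+ l0)^-1 :> R.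
        by rewrite ler_wpM2l ?(ltW n0)// gerBl invr_ge0 ltW.
      by lra.
    rewrite (le_trans (ler_norm _))// (le_trans (V_incr _ tu)) ?(ltW t0)//.
    rewrite (le_trans (Phi_incr nt tu un))// ler_wpM2r// ler_wpM2l ?(le_trans ler01 C_ge1)//.
    rewrite ler_pdivrMr// mulrC (le_trans _ l0inv)//.
    by lra.
  have : C * (2 ^+ l0)^-1 * Phi (2 ^+ n) <= h * V t.
    rewrite (@le_trans _ _ (C * (2 ^+ l0)^-1 * (V t / c0)))//.
      by rewrite ler_wpM2l ?mulr_ge0 ?invr_ge0 ?(le_trans ler01 C_ge1) ?(ltW (two_gt0 l0))// ler_pdivlMr// mulrC.
    rewrite mulrCA mulrC ler_wpM2r// mulrAC ler_pdivrMr//.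
  have : 0 <= h ^+ 2 * V t by rewrite mulr_ge0// sqr_ge0.
  have : 0 <= h * V t by rewrite mulr_ge0// ltW.
  by rewrite [(1 + h) ^+ 2]sqrrD; lra.
have Yu : Y u w <= (1 + h) * ((1 + h) * S).
  have : Y u w < (1 + h) * Num.sqrt (2 * V u * a_ n) by apply: cn.
  move=> /ltW /le_trans; apply; have h10 : 0 <= 1 + h by lra.
  rewrite ler_wpM2l//; apply: sqrt_le_mul => //.
  by have := ler_wpM2r a0 Vu; lra.
(* [Y + Phi] is nondecreasing, and [Phi] grows by at most [C] over mesh 1 *)
have Yt : Y t w <= Y s w + C.
  have := mono t s (ltW t0) ti1.
  have : Phi s - Phi t <= C.
    rewrite (le_trans (Phi_incr nt ti1 sn))//.
    have C0 : 0 <= C by exact: le_trans C_ge1.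
    have d1 : (s - t) / 2 ^+ n <= (2 ^+ n)^-1 by rewrite ler_piMl ?invr_ge0 ?(ltW n0)//; lra.
    have : (s - t) / 2 ^+ n * Phi (2 ^+ n) <= (2 ^+ n)^-1 * 2 ^+ n.
      by apply: ler_pM; rewrite ?Phi_le ?divr_ge0 ?subr_ge0 ?(ltW n0).
    by rewrite mulVf ?gt_eqF// => /(ler_wpM2l C0); rewrite mulr1 [C * (_ * Phi _)]mulrA.
  by lra.
have CS : C <= h * S.
  have -> : C = Num.sqrt (C ^+ 2) by rewrite sqrtr_sqr ger0_norm// (le_trans ler01).
  apply: sqrt_le_mul; first exact: ltW.
  have h20 : 0 < h ^+ 2 by rewrite exprn_gt0.
  rewrite -ler_pdivrMl// mulrC.
  have : C ^+ 2 / h ^+ 2 <= V t.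
    by rewrite (le_trans _ (VK t nt))// ler_peMr ?exprn_ege1// divr_ge0 ?sqr_ge0.
  have : V t <= V t * a_ n by rewrite ler_peMr.
  by lra.
have SS : S <= (1 + h) * Num.sqrt (2 * V t * ln (ln (V t))).
  apply: sqrt_le_mul; first by rewrite addr_ge0 ?ltW.
  have ll0 : 0 <= ln (ln (V t)) by rewrite -(pmulr_rge0 _ (_ : 0 < 1 + h)) ?addr_gt0// (le_trans a0)// la.
  have V20 : 0 <= 2 * V t by rewrite mulr_ge0.
  have := ler_wpM2l V20 (la t nt); have W0 := mulr_ge0 V20 ll0.
  have := mulr_ge0 (ltW h0) W0; have := mulr_ge0 (sqr_ge0 h) W0.
  by rewrite [(1 + h) ^+ 2]sqrrD; lra.
have S1 : Y t w <= (1 + 5 * h) * S.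
  have : h * (h * S) <= h * S by rewrite ler_piMl// mulr_ge0// ltW.
  by lra.
rewrite (le_trans S1)//.
have h5 : 0 <= 1 + 5 * h by lra.
rewrite (le_trans (ler_wpM2l h5 SS))// mulrA ler_wpM2r ?sqrtr_ge0//.
have : h * h <= h by rewrite ler_piMl// ltW.
have -> : e = 11 * h by rewrite /h; field.
by lra.
Unshelve. all: by end_near. Qed.

End UpperLIL.

(** * Sums of independent bits over disjoint sets *)

Section DisjointWindows.
Context {d} {T : measurableType d} {R : realType} (P : probability T R).
Notation Ev := (Ev P).
Variable b : nat -> T -> bool.
Hypothesis ib : indep_bits P b.
Variables (Q1 Q2 : pred nat).
Implicit Types (l m k : nat) (F : R -> R -> R) (h : nat -> bool -> R).

Let S (Q : pred nat) l w : R := \sum_(k < l | Q k) (b k w)%:R.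

Let S_recr Q l w : S Q l.+1 w = S Q l w + (Q l)%:R * (b l w)%:R.
Proof. by rewrite /S big_mkcond big_ord_recr -big_mkcond/=; case: (Q l); rewrite ?mul1r ?mul0r. Qed.

Let shift F l : R -> R -> R := fun x y => F (x + (Q1 l)%:R) (y + (Q2 l)%:R).

Let F_recr F l w : F (S Q1 l.+1 w) (S Q2 l.+1 w) =
  (b l w)%:R * shift F l (S Q1 l w) (S Q2 l w) + (~~ b l w)%:R * F (S Q1 l w) (S Q2 l w).
Proof.
rewrite !S_recr /shift; case: (b l w).
  by rewrite !mulr1 mul1r mul0r addr0.
by rewrite !mulr0 !addr0 mul0r mul1r add0r.
Qed.

Let bb h k : bdd_rv (fun w => h k (b k w)).
Proof. by have [mb _] := ib; exact: (@bdd_rv_bit _ _ _ b h). Qed.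

Let bF F l : bdd_rv (fun w => F (S Q1 l w) (S Q2 l w)).
Proof.
elim: l F => [|l IH] F.
  rewrite (_ : (fun w => _) = fun=> F 0 0); first exact: bdd_rv_cst.
  by apply/funext => w; rewrite /S !big_ord0.
under eq_fun do rewrite F_recr.
apply: bdd_rvD; apply: bdd_rvM => //.
- exact: (bb (fun _ c => c%:R)).
- exact: (bb (fun _ c => (~~ c)%:R)).
Qed.

(** Peeling off the bits one at a time, together with later factors that involve
single bits. *)
Lemma prefix_indep F h l m : (l <= m)%N ->
  Ev (fun w => F (S Q1 l w) (S Q2 l w) * \prod_(k < m | (l <= k)%N) h k (b k w)) =
  Ev (fun w => F (S Q1 l w) (S Q2 l w)) * \prod_(k < m | (l <= k)%N) Ev (fun w => h k (b k w)).
Proof.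
have [_ prod] := ib.
elim: l F h m => [|l IH] F h m lm.
  rewrite (_ : (fun w => F _ _) = fun=> F 0 0); last by apply/funext => w; rewrite /S !big_ord0.
  rewrite Ev_cst -[in RHS](prod m h) -EvZ; last by apply: bdd_rv_prod => k _; exact: bb.
  by congr Ev; apply/funext => w; rewrite /S !big_ord0.
pose hc (c : bool) k x : R := if k == l then (x == c)%:R else h k x.
have split_ (m' : nat) (f : nat -> R) : (l < m')%N ->
    \prod_(k < m' | (l <= k)%N) f k = f l * \prod_(k < m' | (l < k)%N) f k.
  move=> lm'; rewrite (bigD1 (Ordinal lm'))//=; congr (_ * _); apply: eq_bigl => k.
  by rewrite ltn_neqAle eq_sym andbC.
have bP (m' : nat) c : bdd_rv (fun w => \prod_(k < m' | (l <= k)%N) hc c k (b k w)).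
  by apply: bdd_rv_prod => k _; exact: bb.
have hcE (m' : nat) c w : (l < m')%N -> \prod_(k < m' | (l <= k)%N) hc c k (b k w) =
    (b l w == c)%:R * \prod_(k < m' | (l < k)%N) h k (b k w).
  move=> lm'; rewrite (split_ m' (fun k => hc c k (b k w)) lm') /hc eqxx; congr (_ * _).
  by apply: eq_bigr => k lk; rewrite gtn_eqF.
have hcEv (m' : nat) c : (l < m')%N -> \prod_(k < m' | (l <= k)%N) Ev (fun w => hc c k (b k w)) =
    Ev (fun w => (b l w == c)%:R) * \prod_(k < m' | (l < k)%N) Ev (fun w => h k (b k w)).
  move=> lm'; rewrite (split_ m' (fun k => Ev (fun w => hc c k (b k w))) lm') /hc eqxx; congr (_ * _).
  by apply: eq_bigr => k lk; rewrite gtn_eqF.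
have key (m' : nat) : (l < m')%N ->
   Ev (fun w => F (S Q1 l.+1 w) (S Q2 l.+1 w) * \prod_(k < m' | (l < k)%N) h k (b k w)) =
   (Ev (fun w => shift F l (S Q1 l w) (S Q2 l w)) * Ev (fun w => (b l w == true)%:R) +
    Ev (fun w => F (S Q1 l w) (S Q2 l w)) * Ev (fun w => (b l w == false)%:R)) *
   \prod_(k < m' | (l < k)%N) Ev (fun w => h k (b k w)).
  move=> lm'; rewrite mulrDl -!mulrA -!hcEv// -!IH ?(ltnW lm')// -EvD; last 2 first.
  - by apply: bdd_rvM.
  - by apply: bdd_rvM.
  congr Ev; apply/funext => w; rewrite F_recr !hcE//; case: (b l w) => /=; ring.
have e0 (f : 'I_l.+1 -> R) : \prod_(k < l.+1 | (l < k)%N) f k = 1.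
  by rewrite big_pred0// => k; rewrite ltnNge -ltnS ltn_ord.
rewrite key//; congr (_ * _); have := key l.+1 (leqnn _); rewrite e0 mulr1 => <-.
by congr Ev; apply/funext => w; rewrite e0 mulr1.
Qed.

Lemma Ev_prefix_step F l : Ev (fun w => F (S Q1 l.+1 w) (S Q2 l.+1 w)) =
  bit_mean P b l * Ev (fun w => shift F l (S Q1 l w) (S Q2 l w)) +
  (1 - bit_mean P b l) * Ev (fun w => F (S Q1 l w) (S Q2 l w)).
Proof.
have [mb _] := ib.
pose h (c : bool) (k : nat) (x : bool) : R := (x == c)%:R.
have e1 c w : \prod_(k < l.+1 | (l <= k)%N) h c k (b k w) = (b l w == c)%:R.
  rewrite (bigD1 ord_max)//= big_pred0 ?mulr1// => k; apply/negbTE.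
  rewrite negb_and -ltnNge negbK; case: (ltnP k l) => //= lk.
  by apply/eqP/val_inj/anti_leq; rewrite /= -ltnS ltn_ord.
have e2 c : \prod_(k < l.+1 | (l <= k)%N) Ev (fun w => h c k (b k w)) = Ev (fun w => (b l w == c)%:R).
  rewrite (bigD1 ord_max)//= big_pred0 ?mulr1// => k; apply/negbTE.
  rewrite negb_and -ltnNge negbK; case: (ltnP k l) => //= lk.
  by apply/eqP/val_inj/anti_leq; rewrite /= -ltnS ltn_ord.
have step c G : Ev (fun w => G (S Q1 l w) (S Q2 l w) * (b l w == c)%:R) =
    Ev (fun w => G (S Q1 l w) (S Q2 l w)) * Ev (fun w => (b l w == c)%:R).
  rewrite -e2 -prefix_indep//; congr Ev; apply/funext => w.
  by rewrite e1.
have p1 : Ev (fun w => (b l w == true)%:R) = bit_mean P b l.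
  by congr Ev; apply/funext => w; case: (b l w).
have p0 : Ev (fun w => (b l w == false)%:R) = 1 - bit_mean P b l.
  by rewrite (@Ev_bit _ _ _ P b (fun _ c => (c == false)%:R) l (mb l))/= mulr0 add0r mulr1.
rewrite -p0 -p1 [X in X + _]mulrC [X in _ + X]mulrC -!step -EvD; last 2 first.
- by apply: bdd_rvM => //; exact: (bb (h true)).
- by apply: bdd_rvM => //; exact: (bb (h false)).
congr Ev; apply/funext => w; rewrite F_recr; case: (b l w) => /=; ring.
Qed.

Hypothesis Q12 : forall k, Q1 k -> Q2 k -> False.

(** Induction on the length: the next bit enters at most one of the two sums. *)
Lemma Ev_disjoint_windows (f g : R -> R) l :
  Ev (fun w => f (S Q1 l w) * g (S Q2 l w)) = Ev (fun w => f (S Q1 l w)) * Ev (fun w => g (S Q2 l w)).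
Proof.
elim: l f g => [|l IH] f g.
  have e0 Q w : S Q 0 w = 0 by rewrite /S big_ord0.
  rewrite (_ : (fun w => f _ * _) = fun=> f 0 * g 0); last by apply/funext => w; rewrite !e0.
  rewrite (_ : (fun w => f _) = fun=> f 0); last by apply/funext => w; rewrite e0.
  rewrite (_ : (fun w => g _) = fun=> g 0); last by apply/funext => w; rewrite e0.
  by rewrite !Ev_cst.
rewrite (Ev_prefix_step (fun x y => f x * g y)) (Ev_prefix_step (fun x y => f x)) (Ev_prefix_step (fun x y => g y)).
rewrite /shift (IH (fun x => f (x + (Q1 l)%:R)) (fun y => g (y + (Q2 l)%:R))) IH.
case q1 : (Q1 l); case q2 : (Q2 l).
- by case: (Q12 q1 q2).
- have -> : (fun w => g (S Q2 l w + false%:R)) = (fun w => g (S Q2 l w)).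
    by apply/funext => w; rewrite addr0.
  by ring.
- have -> : (fun w => f (S Q1 l w + false%:R)) = (fun w => f (S Q1 l w)).
    by apply/funext => w; rewrite addr0.
  by ring.
- have -> : (fun w => g (S Q2 l w + false%:R)) = (fun w => g (S Q2 l w)).
    by apply/funext => w; rewrite addr0.
  have -> : (fun w => f (S Q1 l w + false%:R)) = (fun w => f (S Q1 l w)).
    by apply/funext => w; rewrite addr0.
  by ring.
Qed.

Lemma indep_disjoint_windows m x y :
  fine (P ([set w | x <= centred_sum P b Q1 m w] `&` [set w | y <= centred_sum P b Q2 m w])) =
  fine (P [set w | x <= centred_sum P b Q1 m w]) * fine (P [set w | y <= centred_sum P b Q2 m w]).
Proof.
have mC Q z : measurable [set w | z <= centred_sum P b Q m w].
  have [mc _] := @bdd_rv_centred_sum _ _ _ P b Q m ib.1.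
  have := mc measurableT _ (measurable_itv `[z, +oo[); rewrite setTI.
  by congr measurable; apply/seteqP; split => w /=; rewrite in_itv/= andbT.
pose c (Q : pred nat) := \sum_(k < m | Q k) bit_mean P b k.
have indE Q z : (\1_[set w | z <= centred_sum P b Q m w] : T -> R) =
    (fun w => (z <= S Q m w - c Q)%R%:R).
  apply/funext => w; rewrite indicE; congr (nat_of_bool _)%:R.
  have e : centred_sum P b Q m w = S Q m w - c Q by rewrite /centred_sum sumrB.
  by rewrite -e; apply/idP/idP => [/set_mem|h]; last exact/mem_set.
rewrite -!Ev_indic ?indicI//; last exact: measurableI.
rewrite !indE; exact: (Ev_disjoint_windows (fun u => (x <= u - c Q1)%R%:R) (fun u => (y <= u - c Q2)%R%:R)).
Qed.

End DisjointWindows.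

(** * The lower half of the law of the iterated logarithm *)

(** Comparison with the logarithm, [ln (1 + 1 / x) <= 1 / x]. *)
Lemma harmonic_unbounded {R : realType} (N : nat) (B : R) :
  exists n, B <= \sum_(i < n) ((N + i).+1%:R : R)^-1.
Proof.
have h n : ln ((N + n).+1%:R : R) - ln (N.+1%:R : R) <= \sum_(i < n) ((N + i).+1%:R : R)^-1.
  elim: n => [|n IH]; first by rewrite addn0 subrr big_ord0.
  rewrite big_ord_recr/= addnS; set x : R := (N + n).+1%:R in IH *.
  have x0 : 0 < x by rewrite ltr0n.
  have -> : ((N + n).+2%:R : R) = x * (1 + x^-1) by rewrite mulrDr mulr1 mulfV ?gt_eqF// natr1.
  have xi0 : 0 < x^-1 by rewrite invr_gt0.
  rewrite lnM ?posrE ?addr_gt0//.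
  have : ln (1 + x^-1) <= x^-1 by apply: le_ln1Dx; rewrite (lt_trans _ xi0)// ltrN10.
  move: IH; set A := ln x; set C := x^-1; set D := ln N.+1%:R; set S := \sum_(i < n) _; lra.
have [n0 _ hn0] := near_ln_ge (B + ln (N.+1%:R : R)).
exists n0; apply: le_trans (h n0); rewrite lerBrDr; apply: hn0 => /=.
by rewrite ltnW// ltnS leq_addl.
Qed.

(** The model: [Y t] is the sum of the centred bits [b t k] and has variance
[V t].  The window [A n] contains the bits that carry the variance at the epoch
[n].  The hypothesis [b_mix] expresses, without reference to a filtration, that
bits of different boxes are independent even when read at different times. *)
Section LowerLIL.
Context {d} {T : measurableType d} {R : realType} (P : probability T R).
Notation Ev := (Ev P).
Variables (b : R -> nat -> T -> bool) (Y : R -> T -> R) (V : R -> R).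
Implicit Types (s t x y e : R) (n l i m k : nat) (w : T).
Hypothesis b_indep : forall t, 0 <= t -> indep_bits P (b t).
Hypothesis b_mix : forall s t (A : pred nat), 0 <= s -> s <= t ->
  exists2 z, indep_bits P z &
    {ae P, forall w, forall k, z k w = if A k then b s k w else b t k w}.
Hypothesis mY : forall t, 0 <= t -> measurable_fun setT (Y t).
Hypothesis Y_cvg : forall t, 0 <= t ->
  {ae P, forall w, centred_sum P (b t) xpredT m w @[m --> \oo] --> Y t w}.
Hypothesis V_le : forall t, 0 <= t -> V t <= t.
Hypothesis V_grow : forall K, \forall n \near \oo, forall t, 2 ^+ n <= t -> K * n%:R ^+ 2 <= V t.

Variable kap : R.
Hypothesis kap_bound : 0 < kap <= 5^-1.
Let dlt : R := kap ^+ 2 / 16.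
Let tt n : R := expR (n%:R `^ (1 + kap)).

Variables (A : nat -> pred nat) (M : nat -> nat).
Hypothesis A_disj : forall i l k, i <> l -> A i k -> A l k -> False.
Hypothesis A_fin : forall n k, A n k -> (k < M n)%N.
Let VW n : R := \sum_(k < M n | A n k) bit_var P (b (tt n)) k.
Hypothesis VW_ge : \forall n \near \oo, (1 - dlt) * V (tt n) <= VW n.
Hypothesis VR_le : \forall n \near \oo, forall m,
  \sum_(k < m | ~~ A n k) bit_var P (b (tt n)) k <= dlt * V (tt n).

Let k0 : 0 < kap. Proof. by case/andP: kap_bound. Qed.
Let k5 : kap <= 5^-1. Proof. by case/andP: kap_bound. Qed.
Let dlt0 : 0 < dlt. Proof. by rewrite divr_gt0// exprn_gt0. Qed.
Let tt0 n : 0 <= tt n. Proof. exact: expR_ge0. Qed.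

Let tt_nd i l : (i <= l)%N -> tt i <= tt l.
Proof.
move=> il; rewrite ler_expR ge0_ler_powR ?nnegrE ?ler_nat//.
by rewrite addr_ge0// ltW.
Qed.

Let tt_ge n : (1 <= n)%N -> 2 ^+ n <= tt n.
Proof.
move=> n1; have h : (2 : R) <= expR 1 by have := expR_ge1Dx (1 : R); lra.
rewrite (@le_trans _ _ (expR 1 ^+ n))//; first by rewrite lerXn2r ?nnegrE ?expR_ge0.
rewrite -expRM_natl mulr1 ler_expR -[leLHS]powRr1//.
by rewrite ler_powR ?ler1n// lerDl ltW.
Qed.

Let W n w : R := centred_sum P (b (tt n)) (A n) (M n) w.

Let W_ext n m w : (M n <= m)%N -> centred_sum P (b (tt n)) (A n) m w = W n w.
Proof.
move=> Mm; rewrite /W /centred_sum.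
rewrite -(big_mkord (fun k => A n k) (fun k => (b (tt n) k w)%:R - bit_mean P (b (tt n)) k)).
rewrite (big_cat_nat (leq0n _) Mm)/= big_mkord [X in _ + X]big_nat_cond [X in _ + X]big1 ?addr0//.
by move=> k /andP[/andP[Mk _] /A_fin]; rewrite ltnNge Mk.
Qed.

Let bW n : bdd_rv (W n).
Proof. by apply: bdd_rv_centred_sum; have [] := b_indep (tt0 n). Qed.

Let x_ n : R := (1 - kap) * (1 - 2 * kap) * Num.sqrt (2 * (1 + kap) * VW n * ln n%:R).

Let E n := [set w | x_ n <= W n w].

Let ae_event (B D : set T) : measurable B -> measurable D -> {ae P, forall w, B w <-> D w} ->
  fine (P B) = fine (P D).
Proof.
move=> mB mD BD; have bI (G : set T) : measurable G -> bdd_rv (\1_G : T -> R).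
  by move=> mG; exact: bdd_rv_indic.
rewrite -!Ev_indic//; apply: Ev_ae; [exact: bI|exact: bI|].
apply: filterS BD => w BDw; rewrite !indicE; congr (nat_of_bool _)%:R.
by apply/idP/idP => /set_mem h; apply/mem_set; apply/BDw.
Qed.

Let mge (f : T -> R) x : bdd_rv f -> measurable [set w | x <= f w].
Proof.
move=> [mf _]; have := mf measurableT _ (measurable_itv `[x, +oo[); rewrite setTI.
by congr measurable; apply/seteqP; split => w /=; rewrite in_itv/= andbT.
Qed.

Let mE n : measurable (E n). Proof. exact: mge. Qed.

(** The window of the epoch [i] is read at time [tt i], that of the epoch [l] at time
[tt l]; since they are disjoint, both can be read off one sequence of independent
bits, which is provided by [b_mix]. *)
Let E_indep_lt i l : (i < l)%N -> fine (P (E i `&` E l)) = fine (P (E i)) * fine (P (E l)).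
Proof.
move=> il; have [z iz zE] := b_mix (A i) (tt0 i) (tt_nd (ltnW il)).
pose m := maxn (M i) (M l).
have meanE s' (Q : pred nat) : 0 <= s' -> (forall k, Q k -> {ae P, forall w, z k w = b s' k w}) ->
    forall k, Q k -> bit_mean P z k = bit_mean P (b s') k.
  move=> s'0 h k Qk; apply: Ev_ae.
  - exact: (@bdd_rv_bit _ _ _ z (fun _ c => c%:R) k (iz.1 k)).
  - exact: (@bdd_rv_bit _ _ _ (b s') (fun _ c => c%:R) k ((b_indep s'0).1 k)).
  - by apply: filterS (h k Qk) => w ->.
have zi k : A i k -> {ae P, forall w, z k w = b (tt i) k w}.
  by move=> Ak; apply: filterS zE => w /(_ k); rewrite Ak.
have zl k : A l k -> {ae P, forall w, z k w = b (tt l) k w}.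
  move=> Ak; apply: filterS zE => w /(_ k).
  case: ifP => // Aik; exfalso; apply: (@A_disj i l k) => //.
  by move=> e; rewrite e ltnn in il.
have csE s' (Q : pred nat) : 0 <= s' -> (forall k, Q k -> {ae P, forall w, z k w = b s' k w}) ->
    {ae P, forall w, centred_sum P z Q m w = centred_sum P (b s') Q m w}.
  move=> s'0 h; have : {ae P, forall w k, Q k -> z k w = b s' k w}.
    apply/ae_foralln => k; case Qk : (Q k); last exact: nearW.
    by apply: filterS (h k Qk).
  apply: filterS => w hw; apply: eq_bigr => k Qk; rewrite hw//.
  by rewrite (meanE s' Q s'0 h k Qk).
have ei := csE _ (A i) (tt0 i) zi; have el := csE _ (A l) (tt0 l) zl.
have bz Q : bdd_rv (centred_sum P z Q m) by apply: bdd_rv_centred_sum; exact: iz.1.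
have Q12 k : A i k -> A l k -> False by apply: A_disj => e; rewrite e ltnn in il.
have := @indep_disjoint_windows _ _ _ P z iz (A i) (A l) Q12 m (x_ i) (x_ l).
have Ei : {ae P, forall w, [set w | x_ i <= centred_sum P z (A i) m w] w <-> E i w}.
  by apply: filterS ei => w /= ->; rewrite W_ext// leq_maxl.
have El : {ae P, forall w, [set w | x_ l <= centred_sum P z (A l) m w] w <-> E l w}.
  by apply: filterS el => w /= ->; rewrite W_ext// leq_maxr.
move=> h; rewrite -(ae_event _ _ Ei)// -?(ae_event _ _ El)//; [|exact: mge..].
rewrite -h; apply: ae_event; [exact: measurableI|apply: measurableI; exact: mge|].
by apply: filterS2 Ei El => w a c; split=> -[/a ? /c ?].
Qed.

Let E_indep i l : i <> l -> fine (P (E i `&` E l)) = fine (P (E i)) * fine (P (E l)).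
Proof.
move=> /eqP; rewrite neq_ltn => /orP[il|li]; first exact: E_indep_lt.
by rewrite setIC mulrC E_indep_lt.
Qed.

(** The tail bound is applied with [th] of the order of [sqrt (2 * ln n / VW n)]; its
exponent is [(1 - 2 kap) ^ 2 * (1 + kap) * (1 + 3 kap) * ln n], and the coefficient
is at most 1. *)
Let E_prob : \forall n \near \oo, 2^-1 * n%:R^-1 <= fine (P (E n)).
Proof.
pose K := 2 * (1 + kap) * (20 / kap ^+ 2) ^+ 2 * 2.
near=> n.
have n1 : 1 <= n%:R :> R by near: n; exact: near_nat_ge.
have n0 : 0 < n%:R :> R by exact: lt_le_trans n1.
have a1 : 100 / kap ^+ 2 <= ln n%:R :> R by near: n; exact: near_ln_ge.
have an : ln n%:R <= n%:R ^+ 2 :> R.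
  rewrite (@le_trans _ _ n%:R)//; last by rewrite expr2 ler_peMl// ltW.
  by rewrite ltW// ln_sublinear.
have k20 : 0 < kap ^+ 2 by rewrite exprn_gt0.
set beta := ln n%:R in a1 an.
have b0 : 0 < beta by rewrite (lt_le_trans _ a1)// divr_gt0.
have Vn : K * n%:R ^+ 2 <= V (tt n).
  have : 2 ^+ n <= tt n by apply: tt_ge; rewrite -(ler_nat R).
  by move: (tt n); near: n; exact: V_grow.
have W1 : (1 - dlt) * V (tt n) <= VW n by near: n.
have kk0 : 0 < 2 * (1 + kap) by have := k0; lra.
have K0 : 0 < K by apply: mulr_gt0 => //; apply: mulr_gt0 => //; rewrite exprn_gt0// divr_gt0.
have V0 : 0 < V (tt n) by rewrite (lt_le_trans _ Vn)// mulr_gt0// exprn_gt0.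
have d2 : dlt <= 2^-1.
  have : kap ^+ 2 <= 1 by rewrite exprn_ile1 ?ltW//; have := k5; lra.
  rewrite /dlt; lra.
have W2 : V (tt n) / 2 <= VW n.
  have : dlt * V (tt n) <= 2^-1 * V (tt n) by rewrite ler_wpM2r// ltW.
  lra.
have W0 : 0 < VW n by rewrite (lt_le_trans _ W2)// divr_gt0.
(* then [VW n * th * (1 - kap)] is the level [x_ n] *)
pose th := (1 - 2 * kap) * Num.sqrt (2 * (1 + kap) * beta / VW n).
have q0 : 0 < 1 - 2 * kap by have := k5; lra.
have r0 : 0 < 2 * (1 + kap) * beta / VW n by rewrite divr_gt0// mulr_gt0.
have th0 : 0 < th by rewrite mulr_gt0// sqrtr_gt0.
have th2 : th ^+ 2 = (1 - 2 * kap) ^+ 2 * (2 * (1 + kap) * beta / VW n).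
  by rewrite exprMn sqr_sqrtr// ltW.
have thk : th <= kap ^+ 2 / 20.
  rewrite -ler_sqr ?nnegrE ?(ltW th0) ?divr_ge0 ?(ltW k20)// th2.
  have s1 : (1 - 2 * kap) ^+ 2 <= 1 by rewrite exprn_ile1 ?(ltW q0)//; have := k0; lra.
  rewrite (le_trans (ler_wpM2r (ltW r0) s1))// mul1r ler_pdivrMr// [leRHS]mulrC -ler_pdivrMr ?exprn_gt0 ?divr_gt0//.
  rewrite (le_trans _ W2)// ler_pdivlMr// (le_trans _ Vn)//.
  have -> : 2 * (1 + kap) * beta / (kap ^+ 2 / 20) ^+ 2 * 2 = K * beta.
    by rewrite /K; field; rewrite gt_eqF.
  by rewrite ler_wpM2l// ltW.
have big : 12 <= VW n * th ^+ 2 * kap ^+ 2.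
  rewrite th2; have -> : VW n * ((1 - 2 * kap) ^+ 2 * (2 * (1 + kap) * beta / VW n)) * kap ^+ 2 =
      (1 - 2 * kap) ^+ 2 * (2 * (1 + kap)) * (beta * kap ^+ 2) by field; rewrite gt_eqF.
  have h1 : 100 <= beta * kap ^+ 2 by move: a1; rewrite ler_pdivrMr.
  have h2 : (3 / 5) ^+ 2 <= (1 - 2 * kap) ^+ 2 by rewrite lerXn2r ?nnegrE ?(ltW q0)//; have := k5; lra.
  have h3 : 2 <= 2 * (1 + kap) by have := k0; lra.
  have h4 : (3 / 5) ^+ 2 * 2 <= (1 - 2 * kap) ^+ 2 * (2 * (1 + kap)) by apply: ler_pM => //; rewrite exprn_ge0.
  have h5 : (3 / 5) ^+ 2 * 2 * 100 <= (1 - 2 * kap) ^+ 2 * (2 * (1 + kap)) * (beta * kap ^+ 2).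
    by apply: ler_pM => //; rewrite mulr_ge0 ?exprn_ge0.
  by apply: le_trans h5; lra.
have kb : 0 < kap <= 2^-1 by rewrite k0/=; have := k5; lra.
have mgf h : 0 <= h <= 2^-1 -> expR (VW n * (h ^+ 2 / 2 * (1 - 2 * h))) <=
     Ev (fun w => expR (h * W n w)) <= expR (VW n * (h ^+ 2 / 2 * (1 + h))).
  move=> /andP[h0 h2]; have ib := b_indep (tt0 n).
  rewrite mgf_lb ?h0//=; have := @mgf_ub _ _ _ P (b (tt n)) (A n) (M n) h (VW n) ib.
  by rewrite ger0_norm//; apply.
have := lower_tail (bW n) (ltW W0) mgf kb th0 thk big.
have -> : VW n * th * (1 - kap) = x_ n.
  rewrite /x_ /th -/beta.
  have -> : 2 * (1 + kap) * VW n * beta = VW n ^+ 2 * (2 * (1 + kap) * beta / VW n) by field; rewrite gt_eqF.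
  set r := 2 * (1 + kap) * beta / VW n.
  have -> : Num.sqrt (VW n ^+ 2 * r) = VW n * Num.sqrt r.
    by rewrite sqrtrM ?sqr_ge0// sqrtr_sqr ger0_norm ?(ltW W0).
  by ring.
apply: le_trans; rewrite ler_wpM2l// -[leLHS]lnK ?posrE ?invr_gt0// ler_expR lnV ?posrE// lerN2.
rewrite -/beta th2.
have -> : VW n * ((1 - 2 * kap) ^+ 2 * (2 * (1 + kap) * beta / VW n)) / 2 * (1 + 3 * kap) =
   (1 - 2 * kap) ^+ 2 * (1 + kap) * (1 + 3 * kap) * beta by field; rewrite gt_eqF.
rewrite ler_piMl ?(ltW b0)//.
have k3 : 0 <= kap ^+ 3 by rewrite exprn_ge0// ltW.
have k2 : kap ^+ 3 <= kap ^+ 2 / 5 by rewrite exprS mulrC ler_wpM2l ?(ltW k20)//; have := k5; lra.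
have k4 : 0 <= kap ^+ 4 by rewrite exprn_ge0// ltW.
have k4' : kap ^+ 4 <= kap ^+ 3 / 5 by rewrite exprS mulrC ler_wpM2l.
have -> : (1 - 2 * kap) ^+ 2 * (1 + kap) * (1 + 3 * kap) =
   1 - 9 * kap ^+ 2 + 4 * kap ^+ 3 + 12 * kap ^+ 4 by ring.
lra.
Unshelve. all: by end_near. Qed.

Let E_io : {ae P, forall w, forall N, exists2 n, (N <= n)%N & E n w}.
Proof.
have [N0 _ hN0] := E_prob.
have := @borel_cantelli2 _ _ _ P (fun n => E (N0 + n).+1).
move=> /(_ _ _ _)[].
- by move=> n; exact: mE.
- by move=> i l il; apply: E_indep => -[/addnI].
- move=> B; have [n hn] := harmonic_unbounded N0 (2 * B); exists n.
  have : 2^-1 * (2 * B) <= \sum_(i < n) 2^-1 * ((N0 + i).+1%:R : R)^-1.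
    by rewrite -mulr_sumr ler_wpM2l.
  rewrite mulKf// => /le_trans; apply; apply: ler_sum => i _; apply: hN0 => /=.
  by rewrite leqW// leq_addr.
move=> D [mD D0 sub]; exists D; split => // w /= nE; apply: sub => /= h; apply: nE => N.
have [n Nn En] := h N; exists (N0 + n).+1 => //.
by rewrite leqW// (leq_trans Nn)// leq_addl.
Qed.

(** The bits outside of the window have a total variance of at most [dlt * V], so
that the sharp tail bound is at most [n ^ (- 2)]. *)
Let rest_bound : {ae P, forall w, \forall n \near \oo,
  - (4 * Num.sqrt (dlt * V (tt n) * ln n%:R)) < Y (tt n) w - W n w}.
Proof.
have tailR : \forall n \near \oo, bits_tail P (fun w => - (Y (tt n) w - W n w)) (dlt * V (tt n)).
  near=> n; apply: bits_tailN; split.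
    by apply: measurable_funB; [exact: mY | case: (bW n)].
  move=> th a th2; apply: (@chernoff_limit _ _ _ P (b (tt n)) (fun k => ~~ A n k)) => //.
  - exact: b_indep.
  - by near: n.
  - by apply: measurable_funB; [exact: mY | case: (bW n)].
  - apply: filterS (Y_cvg (tt0 n)) => w Yw.
    have : (fun m => centred_sum P (b (tt n)) xpredT m w - W n w) @ \oo --> Y (tt n) w - W n w.
      by apply: cvgB => //; exact: cvg_cst.
    apply: cvg_trans; apply: near_eq_cvg; near=> m.
    have Mm : (M n <= m)%N by near: m; exists (M n).
    rewrite -(W_ext w Mm) /centred_sum [X in X - _](bigID (fun k : 'I_m => A n k))/=.
    by rewrite [in LHS]addrC addrK.
pose F n := [set w | 4 * Num.sqrt (dlt * V (tt n) * ln n%:R) <= - (Y (tt n) w - W n w)].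
have mF n : measurable (F n).
  have mf : measurable_fun setT (fun w => - (Y (tt n) w - W n w)).
    by apply: measurable_funN; apply: measurable_funB; [exact: mY | case: (bW n)].
  have := mf measurableT _ (measurable_itv `[4 * Num.sqrt (dlt * V (tt n) * ln n%:R), +oo[); rewrite setTI.
  by congr measurable; apply/seteqP; split => w /=; rewrite in_itv/= andbT.
have : {ae P, forall w, \forall n \near \oo, ~ F n w}.
  apply: (@borel_cantelli_near _ _ _ P F (fun n => expR (- (2 * ln n%:R))) 2) => //.
  - move=> m; rewrite (le_trans _ (@sum_inv_sqr R m))//; apply: ler_sum => i _.
    by rewrite expRN expRM_natl lnK// posrE.
  near=> n.
  have n1 : 1 <= n%:R :> R by near: n; exact: near_nat_ge.
  have a1 : 1 <= ln n%:R :> R by near: n; exact: near_ln_ge.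
  have an : ln n%:R <= n%:R ^+ 2 :> R.
    rewrite (@le_trans _ _ n%:R)//; last by rewrite expr2 ler_peMl// (le_trans ler01).
    by rewrite ltW// ln_sublinear// (lt_le_trans ltr01).
  have Vn : 64 / dlt * n%:R ^+ 2 <= V (tt n).
    have : 2 ^+ n <= tt n by apply: tt_ge; rewrite -(ler_nat R).
    by move: (tt n); near: n; exact: V_grow.
  have tl : bits_tail P (fun w => - (Y (tt n) w - W n w)) (dlt * V (tt n)) by near: n.
  rewrite /F; set v := dlt * V (tt n) in tl *; set beta := ln n%:R in a1 an *.
  have vb : 64 * beta <= v.
    rewrite /v -ler_pdivrMl// (le_trans _ Vn)// mulrA [_^-1 * 64]mulrC.
    by rewrite ler_wpM2l// divr_ge0// ltW.
  have v0 : 0 < v by rewrite (lt_le_trans _ vb)// mulr_gt0// (lt_le_trans ltr01).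
  have b0 : 0 < beta by rewrite (lt_le_trans ltr01).
  pose y := 4 * Num.sqrt (v * beta).
  have y0 : 0 < y by rewrite mulr_gt0// sqrtr_gt0 mulr_gt0.
  have y2 : y ^+ 2 = 16 * (v * beta).
    by rewrite exprMn sqr_sqrtr; [ring | rewrite mulr_ge0 ?ltW].
  have yv : y <= v / 2.
    rewrite -ler_sqr ?nnegrE ?(ltW y0) ?divr_ge0 ?(ltW v0)// y2.
    have := ler_wpM2l (ltW v0) vb; rewrite expr_div_n (expr2 v); lra.
  rewrite (le_trans (bits_tail_sharp tl v0 y0 yv))// ler_expR lerN2.
  have -> : y ^+ 2 / (2 * v) = 8 * beta by rewrite y2; field; rewrite gt_eqF.
  have : y / v <= 2^-1 by rewrite ler_pdivrMr// mulrC.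
  move=> h; have b8 : 0 <= 8 * beta by rewrite mulr_ge0// ltW.
  have : 8 * beta * 2^-1 <= 8 * beta * (1 - y / v) by rewrite ler_wpM2l//; lra.
  apply: le_trans; lra.
apply: filterS => w hw; near=> n; rewrite ltNge; apply/negP => h.
have : ~ F n w by near: n.
by apply; rewrite /F/= lerNr.
Unshelve. all: by end_near. Qed.

(** Since [V t <= t], the iterated logarithm of the variance at the epoch [n] is at
most [(1 + kap) * ln n], which the level [x_ n] matches up to factors close to 1. *)
Theorem lower_lil : {ae P, forall w, forall N, exists2 n, (N <= n)%N &
  (1 - 5 * kap) * Num.sqrt (2 * V (tt n) * ln (ln (V (tt n)))) <= Y (tt n) w}.
Proof.
have det : \forall n \near \oo, (1 - 5 * kap) * Num.sqrt (2 * V (tt n) * ln (ln (V (tt n)))) <=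
    x_ n - 4 * Num.sqrt (dlt * V (tt n) * ln n%:R).
  near=> n.
  have n1 : 1 <= n%:R :> R by near: n; exact: near_nat_ge.
  have n0 : 0 < n%:R :> R by exact: lt_le_trans n1.
  have b1 : 1 <= ln n%:R :> R by near: n; exact: near_ln_ge.
  set beta := ln n%:R in b1 *.
  have b0 : 0 <= beta by exact: le_trans b1.
  have Vn : 3 * n%:R ^+ 2 <= V (tt n).
    have : 2 ^+ n <= tt n by apply: tt_ge; rewrite -(ler_nat R).
    by move: (tt n); near: n; exact: V_grow.
  have W1 : (1 - dlt) * V (tt n) <= VW n by near: n.
  have V3 : 3 <= V (tt n) by rewrite (le_trans _ Vn)// ler_peMr// exprn_ege1.
  have V0 : 0 < V (tt n) by exact: lt_le_trans V3.
  have lnV : ln (V (tt n)) <= n%:R `^ (1 + kap).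
    by rewrite -[leRHS]expRK ler_ln ?posrE ?expR_gt0// V_le.
  have lnV0 : 0 < ln (V (tt n)) by rewrite ln_gt0// (lt_le_trans _ V3)// ltr1n.
  have llV : ln (ln (V (tt n))) <= (1 + kap) * beta.
    by rewrite -ln_powR ler_ln ?posrE ?powR_gt0.
  pose S := Num.sqrt (2 * (1 + kap) * V (tt n) * beta).
  have S0 : 0 <= S by exact: sqrtr_ge0.
  have sqrt_mul c B : 0 <= c -> c * Num.sqrt B = Num.sqrt (c ^+ 2 * B).
    by move=> c0'; rewrite sqrtrM ?sqr_ge0// sqrtr_sqr ger0_norm.
  have k1 : 0 <= 1 - kap by have := k5; lra.
  have S1 : Num.sqrt (2 * V (tt n) * ln (ln (V (tt n)))) <= S.
    apply: ler_wsqrtr; have := ler_wpM2l (ltW V0) llV; lra.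
  have S2 : (1 - kap) * S <= Num.sqrt (2 * (1 + kap) * VW n * beta).
    rewrite sqrt_mul//; apply: ler_wsqrtr.
    have d1 : (1 - kap) ^+ 2 <= 1 - dlt.
      rewrite /dlt; have : kap ^+ 2 <= kap by rewrite expr2 ler_piMl ?(ltW k0)//; have := k5; lra.
      have := k0; rewrite sqrrB; lra.
    have h1 : (1 - kap) ^+ 2 * V (tt n) <= VW n by rewrite (le_trans _ W1)// ler_wpM2r// ltW.
    have c0 : 0 <= 2 * (1 + kap) * beta by rewrite !mulr_ge0// addr_ge0// ltW.
    have := ler_wpM2l c0 h1; lra.
  have S3 : 4 * Num.sqrt (dlt * V (tt n) * beta) <= kap * S.
    rewrite !sqrt_mul ?(ltW k0)//; apply: ler_wsqrtr; rewrite /dlt.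
    have : 0 <= kap ^+ 2 * V (tt n) * beta by rewrite !mulr_ge0 ?sqr_ge0// ltW.
    have : 0 <= kap ^+ 2 * V (tt n) * beta * kap by rewrite !mulr_ge0 ?sqr_ge0// ltW.
    lra.
  have q0 : 0 <= (1 - kap) * (1 - 2 * kap) by rewrite mulr_ge0//; have := k5; lra.
  have q5 : 0 <= 1 - 5 * kap by have := k5; lra.
  rewrite (le_trans (ler_wpM2l q5 S1))// /x_ -/beta lerBrDr.
  rewrite (le_trans (lerD (lexx _) S3))// (le_trans _ (ler_wpM2l q0 S2))//.
  rewrite -mulrDl mulrA ler_wpM2r//.
  have k2 : 0 <= kap ^+ 2 * (5 - 2 * kap) by rewrite mulr_ge0 ?sqr_ge0//; have := k5; lra.
  move: k2; rewrite expr2; lra.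
apply: filterS2 E_io rest_bound => w io rest N.
have [N1 _ hN1] : \forall n \near \oo, x_ n <= W n w ->
    (1 - 5 * kap) * Num.sqrt (2 * V (tt n) * ln (ln (V (tt n)))) <= Y (tt n) w.
  near=> n => En.
  have h1 : (1 - 5 * kap) * Num.sqrt (2 * V (tt n) * ln (ln (V (tt n)))) <=
    x_ n - 4 * Num.sqrt (dlt * V (tt n) * ln n%:R) by near: n.
  have h2 : - (4 * Num.sqrt (dlt * V (tt n) * ln n%:R)) < Y (tt n) w - W n w by near: n.
  rewrite (le_trans h1)//; lra.
have [n Nn En] := io (maxn N N1); exists n; first by rewrite (leq_trans (leq_maxl N N1)).
by apply: hN1 => //=; rewrite (leq_trans (leq_maxr N N1)).
Unshelve. all: by end_near. Qed.

End LowerLIL.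

(** * The boxes that carry the variance *)

Section BoxAsymptotics.
Context {R : realType}.
Variable p : nat -> R.
Hypothesis p_ge0 : forall k, 0 <= p k.
Hypothesis p_sum1 : (\sum_(0 <= k <oo) (p k)%:E = 1)%E.
Hypothesis rho_rv : forall l : R, 0 < l -> rho p (l * t) / rho p t @[t --> +oo] --> l.
Hypothesis rho_pos : \forall t \near +oo, 0 < rho p t.
Implicit Types (y s t c : R) (i j k n m : nat).

Lemma boxmean_growth j : (0 < j)%N ->
  exists2 c : R, 0 < c & \forall n \near \oo, c * (19 / 10) ^+ n <= boxmean p j (2 ^+ n).
Proof.
move=> j0; have [c c0 hc] := rho_growth rho_rv rho_pos.
exists (ptail j 1 * c); first by rewrite mulr_gt0// ptail_gt0.
apply: filterS hc => n hn; have n0 : (0 : R) <= 2 ^+ n by rewrite exprn_ge0.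
rewrite (le_trans _ (boxmean_ge_rho p_ge0 p_sum1 j0 n0))// -mulrA ler_wpM2l//.
by rewrite ltW// ptail_gt0.
Qed.

Lemma boxvar2_const_gt0 i : 0 < i.+1%:R^-1 * ('C(i.*2.+1, i)%:R / 2 ^+ i.*2.+1) :> R.
Proof.
rewrite mulr_gt0 ?invr_gt0// divr_gt0 ?exprn_gt0// ltr0n bin_gt0.
by rewrite leqW// -addnn leq_addl.
Qed.

Lemma boxvar2_ge_rho i : exists2 c : R, 0 < c <= 1 & \forall t \near +oo, c * rho p t <= boxvar p i.+2 t.
Proof.
have h := boxvar_rho p_ge0 p_sum1 rho_rv rho_pos (i := i).
set K : R := _ * _ in h; have K0 : 0 < K by exact: boxvar2_const_gt0.
exists (Num.min 1 (K / 2)); first by rewrite lt_min ltr01 divr_gt0//= ge_min lexx.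
have K2 : K / 2 < K by lra.
near=> t; have r0 : 0 < rho p t by near: t.
have t0 : K / 2 < boxvar p i.+2 t / rho p t by near: t; exact: cvgr_gt _ h _ K2.
rewrite (@le_trans _ _ (K / 2 * rho p t))//; last by rewrite -ler_pdivlMr// ltW.
by rewrite ler_wpM2r ?(ltW r0)// ge_min lexx orbT.
Unshelve. all: by end_near. Qed.

Lemma boxvar1_ge_capped : \forall t \near +oo, capped p t / 2 <= boxvar p 1 t.
Proof.
have h := boxvar1_capped p_ge0 p_sum1 rho_rv rho_pos.
have h2 : (2^-1 : R) < 1 by rewrite invf_lt1// ltr1n.
near=> t; have c0 : 0 < capped p t by near: t; exact: capped_pos.
have : 2^-1 < boxvar p 1 t / capped p t by near: t; exact: cvgr_gt _ h _ h2.
by rewrite ltr_pdivlMr// mulrC => /ltW.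
Unshelve. all: by end_near. Qed.

Lemma boxvar_ge_boxmean j : (0 < j)%N ->
  exists2 c : R, 0 < c <= 1 & \forall t \near +oo, c * boxmean p j t <= boxvar p j t.
Proof.
case: j => [//|[|i]] _.
  exists 2^-1; first by rewrite invr_gt0 invf_le1// ltr0n ler1n.
  near=> t; have t0 : 0 <= t by near: t; exact: nbhs_pinfty_ge.
  have h : capped p t / 2 <= boxvar p 1 t by near: t; exact: boxvar1_ge_capped.
  by rewrite (le_trans _ h)// mulrC ler_wpM2r// boxmean_le_capped.
have [c /andP[c0 c1] hc] := boxvar2_ge_rho i.
exists (c / 2); first by rewrite divr_gt0//=; lra.
have h := boxsum_ptail_rho p_ge0 p_sum1 rho_rv rho_pos (i := i).
have i2 : i.+1%:R^-1 < 2 :> R.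
  by rewrite (@le_lt_trans _ _ 1)// ?ltr1n// invf_le1// ler1n.
near=> t; have r0 : 0 < rho p t by near: t.
have h1 : c * rho p t <= boxvar p i.+2 t by near: t.
have : boxmean p i.+2 t / rho p t < 2 by near: t; exact: cvgr_lt _ h _ i2.
rewrite ltr_pdivrMr// => /ltW h2; rewrite (le_trans _ h1)// -mulrA ler_wpM2l ?(ltW c0)//.
by rewrite ler_pdivrMl.
Unshelve. all: by end_near. Qed.

(** Termwise: [b * (1 - b) - a * (1 - a) = (b - a) * (1 - (a + b))]. *)
Lemma boxvar_incr j s t : (0 < j)%N -> 0 <= s -> s <= t ->
  `|boxvar p j t - boxvar p j s| <= boxmean p j t - boxmean p j s.
Proof.
move=> j0 s0 st; have t0 := le_trans s0 st.
have dt := boxdom_ptail p_ge0 j0 t0; have ds := boxdom_ptail p_ge0 j0 s0.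
have et := boxdom_bern p_ge0 j0 t0; have es := boxdom_bern p_ge0 j0 s0.
have key k : `|ptail j (t * p k) * (1 - ptail j (t * p k)) - ptail j (s * p k) * (1 - ptail j (s * p k))|
    <= ptail j (t * p k) - ptail j (s * p k).
  have y0 := mulr_ge0 s0 (p_ge0 k); have yz : s * p k <= t * p k by rewrite ler_wpM2r.
  have z0 := le_trans y0 yz.
  have := ptail_nd j y0 yz; have := @ptail_le1 R j _ z0; have := @ptail_ge0 R j _ y0.
  set a := ptail j (s * p k); set b := ptail j (t * p k) => a0 b1 ab.
  have -> : b * (1 - b) - a * (1 - a) = (b - a) * (1 - (a + b)) by ring.
  rewrite normrM ger0_norm ?subr_ge0// ler_piMr ?subr_ge0// ler_norml.
  by apply/andP; split; lra.
rewrite ler_norml; apply/andP; split.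
  rewrite opprB lerBrDr -lerBrDl opprB addrA lerBrDr -!(boxsumD p_ge0 p_sum1)//.
  apply: (boxsum_le p_ge0 p_sum1); [exact: boxdomD..|] => k.
  by have := key k; rewrite ler_norml => /andP[]; lra.
rewrite lerBlDr addrAC lerBrDr -!(boxsumD p_ge0 p_sum1)//.
apply: (boxsum_le p_ge0 p_sum1); [exact: boxdomD..|] => k.
by have := key k; rewrite ler_norml => /andP[]; lra.
Qed.

Lemma p_small c : 0 < c -> exists m, forall k, c <= p k -> (k < m)%N.
Proof.
move=> c0; have cp : cvgn (series p) by apply/cvg_ex; exists (boxsum p); exact: boxsum_cvg (boxdom_p p_ge0).
have [m _ hm] := cvgr_lt _ (cvg_series_cvg_0 cp) _ c0.
exists m => k ck; rewrite ltnNge; apply/negP => mk.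
by have := hm k mk; rewrite ltNge ck.
Qed.

(** Boxes with [t * p k < h] contribute at most [h ^ 2 * capped2 p (t / h)], of order
[h * rho p t]; those with [1 <= h * t * p k] number [rho p (h * t)], again of order
[h * rho p t]. *)
Lemma window2_rest i e : 0 < e -> exists2 h : R, 0 < h < 1 & \forall t \near +oo, forall m,
  \sum_(k < m | ~~ (h <= t * p k < h^-1)) ptail i.+2 (t * p k) * (1 - ptail i.+2 (t * p k)) <=
  e * boxvar p i.+2 t.
Proof.
move=> e0; have [c /andP[c0 c1] hc] := boxvar2_ge_rho i.
pose h := Num.min 2^-1 (e * c / 26).
have h0 : 0 < h by rewrite lt_min invr_gt0 ltr0n divr_gt0// mulr_gt0.
have h2 : h <= 2^-1 by rewrite ge_min lexx.
have h26 : 26 * h <= e * c by rewrite mulrC -ler_pdivlMr// ge_min lexx orbT.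
have h1 : h < 1 by lra.
exists h; first by rewrite h0.
have hi0 : 0 < h^-1 by rewrite invr_gt0.
have hi2 : h^-1 < 2 * h^-1 by lra.
have hh2 : h < 2 * h by lra.
have /pinfty_nearP[M M0 hM] := capped2_le_rho p_ge0 p_sum1 rho_rv rho_pos.
near=> t => m; have t0 : 0 < t by near: t; exact: nbhs_pinfty_gt.
have r1 : rho p (h^-1 * t) <= 2 * h^-1 * rho p t by near: t; exact: rho_ratio_le.
have r2 : rho p (h * t) <= 2 * h * rho p t by near: t; exact: rho_ratio_le.
have hv : c * rho p t <= boxvar p i.+2 t by near: t.
have Mt : M <= t / h by rewrite ler_pdivlMr//; near: t; apply: nbhs_pinfty_ge; exact: num_real.
have c2 := hM _ Mt.
have d1 : boxdom p (fun k => Num.min h (t * p k) ^+ 2).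
  apply: (@boxdom_le _ _ _ (fun k => h * (t * p k))).
    by apply: boxdomZ; [exact: ltW|apply: boxdomZ; [exact: ltW|exact: boxdom_p]].
  move=> k; rewrite sqr_ge0/= expr2; have yk0 := mulr_ge0 (ltW t0) (p_ge0 k).
  have m0 : 0 <= Num.min h (t * p k) by rewrite le_min yk0 (ltW h0).
  by apply: ler_pM => //; rewrite ge_min lexx ?orbT.
have d2 := boxdom_ind p_ge0 (h * t).
apply: (@le_trans _ _ (boxsum (fun k => Num.min h (t * p k) ^+ 2 + (1 <= h * t * p k)%R%:R))).
  apply: le_trans (boxsum_ge p_ge0 p_sum1 m (boxdomD d1 d2)).
  rewrite big_mkcond/=; apply: ler_sum => k _; have y0 := mulr_ge0 (ltW t0) (p_ge0 k).
  have /andP[b0 b1] := @bern_var_bounds _ i.+2 _ y0.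
  have pos : 0 <= Num.min h (t * p k) ^+ 2 + (1 <= h * t * p k)%R%:R by rewrite addr_ge0 ?sqr_ge0.
  case: ifP => // /negP/negP; rewrite negb_and -ltNge -leNgt => /orP[yh|yh].
    rewrite (min_r (ltW yh)) (le_trans b1)// (le_trans (ptail_leS y0 (_ : 2 <= i.+2)%N))//.
    by rewrite (le_trans (ptail2_le y0))// lerDl.
  have -> : (1 <= h * t * p k)%R by rewrite -mulrA mulrC -ler_pdivrMr// mul1r.
  by rewrite (le_trans b1)// (le_trans (ptail_le1 _ y0))// lerDr sqr_ge0.
rewrite (boxsumD p_ge0 p_sum1)// capped2_scale ?(ltW t0)// -(rhoE p_ge0 p_sum1).
have h20 : 0 <= h ^+ 2 by rewrite sqr_ge0.
have q1 : h ^+ 2 * capped2 p (t / h) <= 24 * h * rho p t.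
  rewrite (le_trans (ler_wpM2l h20 c2))// (mulrC t) mulrCA.
  have := ler_wpM2l h20 r1; rewrite (_ : h ^+ 2 * (2 * h^-1 * rho p t) = 2 * h * rho p t).
    by move=> q; have := ler_wpM2l (ler0n R 12) q; lra.
  by field; rewrite gt_eqF.
have r0 : 0 <= rho p t by exact: rho_ge0.
have q3 := ler_wpM2r r0 h26.
have q4 := ler_wpM2l (ltW e0) hv.
lra.
Unshelve. all: by end_near. Qed.

(** Outside of the window of the boxes with [1 / p k] between [s] and [t], the larger
boxes number at most [rho p s], and the smaller ones contribute at most [s * p k]
each. *)
Lemma window1_rest s t m : 0 <= s -> 0 < t ->
  \sum_(k < m | ~~ (s * p k < 1 <= t * p k)) ptail 1 (s * p k) * (1 - ptail 1 (s * p k)) <=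
  rho p s + s * (capped p t / t).
Proof.
move=> s0 t0.
have d1 := boxdom_ind p_ge0 s.
have q0 : 0 <= s / t by rewrite divr_ge0// ltW.
have dc := boxdom_capped p_ge0 (ltW t0).
have d2 : boxdom p (fun k => s / t * Num.min 1 (t * p k)) by exact: boxdomZ.
have -> : s * (capped p t / t) = boxsum (fun k => s / t * Num.min 1 (t * p k)).
  by rewrite (boxsumZ p_ge0 p_sum1)// /capped; ring.
rewrite (rhoE p_ge0 p_sum1) -(boxsumD p_ge0 p_sum1)//.
apply: le_trans (boxsum_ge p_ge0 p_sum1 m (boxdomD d1 d2)).
rewrite big_mkcond/=; apply: ler_sum => k _; have y0 := mulr_ge0 s0 (p_ge0 k).
have z0 := mulr_ge0 (ltW t0) (p_ge0 k).
have /andP[b0 b1] := @bern_var_bounds _ 1 _ y0.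
have mi : 0 <= Num.min 1 (t * p k) by rewrite le_min ler01.
case: ifP => [/negP/negP|_]; last by rewrite addr_ge0// mulr_ge0.
rewrite negb_and -leNgt -ltNge => /orP[h|h].
  rewrite h (le_trans b1)// (le_trans (ptail_le1 _ y0))// lerDl mulr_ge0//.
rewrite (min_r (ltW h)) (_ : s / t * (t * p k) = s * p k); last by field; rewrite gt_eqF.
by rewrite (le_trans b1)// (le_trans (ptail1_le _))// lerDr.
Qed.

End BoxAsymptotics.

(** * The two halves for the occupancy numbers *)

Section SchemeLIL.
Context {d} {T : measurableType d} {R : realType} (P : probability T R).
Variables (p : nat -> R) (xi : nat -> {RV P >-> R}) (X : nat -> {RV P >-> nat}).
Hypothesis scheme : poissonized_karlin p xi X.
Hypothesis p_ge0 : forall k, 0 <= p k.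
Hypothesis p_sum1 : (\sum_(0 <= k <oo) (p k)%:E = 1)%E.
Hypothesis rho_rv : forall l : R, 0 < l -> rho p (l * t) / rho p t @[t --> +oo] --> l.
Hypothesis rho_pos : \forall t \near +oo, 0 < rho p t.
Implicit Types (s t r c e : R) (a n k m j i : nat).

Notation fluct := (fluct p xi X).
Notation hit := (hit xi X).
Notation pcount := (pcount xi X).

Lemma fluct_tail j t : (0 < j)%N -> 0 <= t -> bits_tail P (fluct j t) (boxvar p j t).
Proof.
move=> j0 t0; split; first exact: measurable_fluct.
move=> th a th2; apply: (chernoff_limit (Q := xpredT) a (indep_hit scheme p_ge0 j t0) th2).
- by move=> m; exact: sum_hit_var_le.
- exact: measurable_fluct.
- by apply: filterS (ae_regular scheme) => w rw; exact: fluct_cvg.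
Qed.

Lemma fluct_incr_tail j s t : (0 < j)%N -> 0 <= s -> s <= t ->
  bits_tail P (fun w => fluct j t w - fluct j s w) (boxmean p j t - boxmean p j s).
Proof.
move=> j0 s0 st.
have mf : measurable_fun setT (fun w => fluct j t w - fluct j s w).
  by apply: measurable_funB; exact: measurable_fluct.
split => // th a th2.
apply: (chernoff_limit (Q := xpredT) a (indep_newhit scheme p_ge0 j s0 st) th2) => //.
- by move=> m; exact: sum_newhit_var_le.
- by apply: filterS (ae_regular scheme) => w rw; exact: fluct_incr_cvg.
Qed.

Lemma occupancy_nd j s t w : regular xi w -> (0 < j)%N -> 0 <= s -> s <= t ->
  occupancy xi X j s w <= occupancy xi X j t w.
Proof.
move=> rw j0 s0 st; have t0 := le_trans s0 st.
have [M1 h1] := occupancy_eventually X rw s0 j0.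
have [M2 h2] := occupancy_eventually X rw t0 j0.
rewrite -(h1 (maxn M1 M2)) ?leq_maxl// -(h2 (maxn M1 M2)) ?leq_maxr//.
apply: ler_sum => k _; rewrite /hit ler_nat.
by case: (leqP j (pcount k s w)) => //= h; rewrite (leq_trans h)// pcount_le.
Qed.

Lemma scheme_var_grow j : (0 < j)%N ->
  forall K : R, \forall n \near \oo, forall t, 2 ^+ n <= t -> K * n%:R ^+ 2 <= boxvar p j t.
Proof.
move=> j0 K.
have [c /andP[c0 c1] hc] := boxvar_ge_boxmean p_ge0 p_sum1 rho_rv rho_pos j0.
have [c' c'0 hc'] := boxmean_growth p_ge0 p_sum1 rho_rv rho_pos j0.
apply: (variance_growth (Phi := boxmean p j) (c0 := c) (c1 := c')) => //; last exact/andP.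
by move=> s t s0 st; exact: boxmean_nd.
Qed.

Theorem scheme_upper_lil j e : (0 < j)%N -> 0 < e <= 1 ->
  {ae P, forall w, \forall t \near +oo,
    fluct j t w <= (1 + e) * Num.sqrt (2 * boxvar p j t * ln (ln (boxvar p j t)))}.
Proof.
move=> j0 e01.
have [c c01 hc] := boxvar_ge_boxmean p_ge0 p_sum1 rho_rv rho_pos j0.
have [c' c'0 hc'] := boxmean_growth p_ge0 p_sum1 rho_rv rho_pos j0.
apply: (@upper_lil _ _ _ P (fluct j) (boxvar p j) (boxmean p j) j c c') => //.
- by move=> t t0; exact: fluct_tail.
- by move=> s t s0 st; exact: fluct_incr_tail.
- apply: filterS (ae_regular scheme) => w rw s t s0 st.
  by rewrite !subrK; exact: occupancy_nd.
- by move=> t t0; exact: boxmean_ge0.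
- by move=> t t0; rewrite (le_trans (boxmean_le_capped p_ge0 p_sum1 j0 t0))// capped_le.
- by move=> s t s0 st; exact: boxmean_nd.
- by move=> l t l1 t0; exact: boxmean_scale.
- by move=> s t s0 st; exact: boxvar_incr.
Qed.

(** On a regular trajectory the content at [t] is the content at [s] plus the
increment, so the mixed bits are functions of this pair. *)
Lemma hit_mix j s t (A : pred nat) : 0 <= s -> s <= t ->
  exists2 z, indep_bits P z &
    {ae P, forall w, forall k, z k w = if A k then hit j s k w else hit j t k w}.
Proof.
move=> s0 st.
exists (fun k w => (fun k u v => if A k then (j <= u)%N else (j <= u + v)%N)
  k (pcount k s w) (pcount k t w - pcount k s w)%N).
  exact: (indep_bits_pcount scheme p_ge0 (fun k u v => if A k then (j <= u)%N else (j <= u + v)%N) s0 st).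
apply: filterS (ae_regular scheme) => w rw k.
by rewrite subnKC//; exact: pcount_le.
Qed.

Section Windows.
Variables (j : nat) (kap : R).
Hypothesis j_gt0 : (0 < j)%N.
Hypothesis kap_bound : 0 < kap <= 5^-1.
Notation tt := (fun n => expR (n%:R `^ (1 + kap))).

Theorem scheme_lower_lil (A : nat -> pred nat) :
  (forall i l k, i <> l -> A i k -> A l k -> False) ->
  (forall n, exists m, forall k, A n k -> (k < m)%N) ->
  (\forall n \near \oo, forall m,
    \sum_(k < m | ~~ A n k) ptail j (tt n * p k) * (1 - ptail j (tt n * p k)) <=
    kap ^+ 2 / 16 * boxvar p j (tt n)) ->
  {ae P, forall w, forall N, exists2 n, (N <= n)%N &
    (1 - 5 * kap) * Num.sqrt (2 * boxvar p j (tt n) * ln (ln (boxvar p j (tt n)))) <=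
    fluct j (tt n) w}.
Proof.
move=> Adis /choice[M AM] Arest.
have varE n k : bit_var P (hit j (tt n)) k = ptail j (tt n * p k) * (1 - ptail j (tt n * p k)).
  by rewrite /bit_var (hit_mean scheme)// expR_ge0.
have bv0 n k : 0 <= ptail j (tt n * p k) * (1 - ptail j (tt n * p k)).
  by have /andP[] := bern_var_bounds j (mulr_ge0 (expR_ge0 (n%:R `^ (1 + kap))) (p_ge0 k)).
have le0 n : forall m, (M n <= m)%N -> \sum_(k < m | A n k) bit_var P (hit j (tt n)) k =
    \sum_(k < M n | A n k) bit_var P (hit j (tt n)) k.
  move=> m Mm; rewrite -(big_mkord (fun k => A n k) (fun k => bit_var P (hit j (tt n)) k)).
  rewrite (big_cat_nat (leq0n _) Mm)/= big_mkord [X in _ + X]big_nat_cond [X in _ + X]big1 ?addr0//.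
  by move=> k /andP[/andP[Mk _] /AM]; rewrite ltnNge Mk.
apply: (@lower_lil _ _ _ P (hit j) (fluct j) (boxvar p j) _ _ _ _ _ _ kap kap_bound A M) => //.
- by move=> t t0; exact: (indep_hit scheme).
- by move=> s t B s0 st; exact: hit_mix.
- by move=> t t0; exact: measurable_fluct.
- by move=> t t0; apply: filterS (ae_regular scheme) => w rw; exact: fluct_cvg.
- move=> t t0; rewrite (le_trans (boxvar_le p_ge0 p_sum1 j_gt0 t0))//.
  by rewrite (le_trans (boxmean_le_capped p_ge0 p_sum1 j_gt0 t0))// capped_le.
- exact: scheme_var_grow.
- apply: filterS Arest => n hn.
  have tn0 : 0 <= tt n by exact: expR_ge0.
  rewrite mulrBl mul1r lerBlDr.
  have hv := hit_var_cvg scheme p_ge0 p_sum1 j_gt0 tn0.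
  rewrite -[leLHS](cvg_lim (@Rhausdorff R) hv); apply: limr_le; first by apply/cvg_ex; eexists; exact: hv.
  exists (M n) => // m /= Mm.
  rewrite (bigID (fun k : 'I_m => A n k))/= (le0 _ _ Mm) lerD2l.
  by under eq_bigr do rewrite varE; exact: hn.
- apply: filterS Arest => n hn m.
  by under eq_bigr do rewrite varE; exact: hn.
Qed.

End Windows.

End SchemeLIL.

(** * Windows of boxes along the epochs *)

Section Windows.
Context {R : realType}.
Variable kap : R.
Hypothesis kap_gt0 : 0 < kap.
Implicit Types (c t : R) (n i l k m : nat).

Definition epoch n : R := expR (n%:R `^ (1 + kap)).

Lemma epoch_gt0 n : 0 < epoch n. Proof. exact: expR_gt0. Qed.

Lemma epoch_nd i l : (i <= l)%N -> epoch i <= epoch l.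
Proof.
move=> il; rewrite ler_expR ge0_ler_powR ?nnegrE ?ler_nat//.
by rewrite addr_ge0// ltW.
Qed.

Lemma epoch_ge n : (0 < n)%N -> n%:R <= epoch n.
Proof.
move=> n0; rewrite (@le_trans _ _ (n%:R `^ (1 + kap)))//.
  by rewrite -[leLHS]powRr1// ler_powR ?ler1n// lerDl ltW.
by rewrite (le_trans _ (expR_ge1Dx _))// lerDr.
Qed.

Lemma near_epoch (Q : R -> Prop) : (\forall t \near +oo, Q t) -> \forall n \near \oo, Q (epoch n).
Proof.
move=> /pinfty_nearP[M M0 hM]; near=> n; apply: hM.
have n0 : (0 < n)%N by near: n; exists 1%N.
by rewrite (le_trans _ (epoch_ge n0))//; near: n; exact: near_nat_ge.
Unshelve. all: by end_near. Qed.

(** [(n + 1) ^ (1 + kap) >= n ^ (1 + kap) + n ^ kap], and the last term is unbounded. *)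
Lemma epoch_ratio c : \forall n \near \oo, c * epoch n <= epoch n.+1.
Proof.
near=> n; have n0 : (0 < n)%N by near: n; exists 1%N.
have nR : 0 < n%:R :> R by rewrite ltr0n.
have lnc : c / kap <= ln (n%:R : R) by near: n; exact: near_ln_ge.
have k1 : 1 + kap != 0 by rewrite gt_eqF// addr_gt0.
have e1 m : (m%:R : R) `^ (1 + kap) = m%:R * m%:R `^ kap.
  by rewrite powRD ?(negbTE k1)// powRr1.
have hc : c <= n%:R `^ kap.
  rewrite /powR gt_eqF// (le_trans _ (expR_ge1Dx _))//.
  by move: lnc; rewrite ler_pdivrMr// mulrC => /le_trans; apply; rewrite lerDr.
have hd : (n%:R : R) `^ (1 + kap) + c <= n.+1%:R `^ (1 + kap).
  rewrite !e1 (@le_trans _ _ (n.+1%:R * n%:R `^ kap))//.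
    by rewrite -natr1 mulrDl mul1r lerD2l.
  by rewrite ler_wpM2l// ge0_ler_powR ?nnegrE ?ler_nat// ltW.
rewrite (@le_trans _ _ (expR (n%:R `^ (1 + kap) + c)))//; last by rewrite ler_expR.
rewrite expRD mulrC ler_wpM2l ?expR_ge0// (le_trans _ (expR_ge1Dx _))// lerDr//.
Unshelve. all: by end_near. Qed.

End Windows.

(** The inequality behind the window of level 1, with [H] and [H'] the values of
[hatL] at two successive epochs. *)
Lemma window1_arith {R : realType} (dl s c v r H H' C' : R) : 0 < dl -> 0 < s ->
  H * (1 - 2^-1) <= c / s -> H' <= dl / 12 * H -> C' <= H' * (1 + 2^-1) ->
  r <= dl / 4 * c -> c / 2 <= v -> r + s * C' <= dl * v.
Proof.
move=> dl0 s0 Hc HH CH rc cv.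
have h1 : C' <= dl / 4 * (c / s).
  have := ler_wpM2l (ltW dl0) Hc; move: HH CH; set q := c / s; lra.
have h2 : s * C' <= dl / 4 * c.
  rewrite (le_trans (ler_wpM2l (ltW s0) h1))// le_eqVlt; apply/orP; left; apply/eqP.
  by field; rewrite gt_eqF.
have := ler_wpM2l (ltW dl0) cv; lra.
Qed.

Section LowerBounds.
Context {d} {T : measurableType d} {R : realType} (P : probability T R).
Variables (p : nat -> R) (xi : nat -> {RV P >-> R}) (X : nat -> {RV P >-> nat}).
Hypothesis scheme : poissonized_karlin p xi X.
Hypothesis p_ge0 : forall k, 0 <= p k.
Hypothesis p_sum1 : (\sum_(0 <= k <oo) (p k)%:E = 1)%E.
Variable L : R -> R.
Hypothesis L_sv : slowly_varying L.
Hypothesis rho_equiv : asymp_equiv (rho p) (fun t => t * L t).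
Variable kap : R.
Hypothesis kap_bound : 0 < kap <= 5^-1.
Implicit Types (s t r c e : R) (a n k m j i l : nat).

Let rrv : forall l : R, 0 < l -> rho p (l * t) / rho p t @[t --> +oo] --> l.
Proof. exact: rho_rv L_sv rho_equiv. Qed.

Let rpos : \forall t \near +oo, 0 < rho p t.
Proof. exact: rho_pos L_sv rho_equiv. Qed.

Let k0 : 0 < kap. Proof. by case/andP: kap_bound. Qed.
Let dlt : R := kap ^+ 2 / 16.
Let dlt0 : 0 < dlt. Proof. by rewrite divr_gt0// exprn_gt0. Qed.
Notation tt := (epoch kap).

Definition exceeds_often j : Prop := {ae P, forall w, forall N, exists2 n, (N <= n)%N &
  (1 - 5 * kap) * Num.sqrt (2 * boxvar p j (tt n) * ln (ln (boxvar p j (tt n)))) <=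
  fluct p xi X j (tt n) w}.

Lemma fin_window t c : 0 < t -> 0 < c -> exists m, forall k, c <= t * p k -> (k < m)%N.
Proof.
move=> t0 c0; have ct : 0 < c / t by rewrite divr_gt0.
have [m hm] := p_small p_ge0 p_sum1 ct.
by exists m => k ck; apply: hm; rewrite ler_pdivrMr// mulrC.
Qed.

(** Boxes with [t * p k] of order one at an epoch have [t * p k] large at the next
one, so that the windows of sufficiently late epochs are disjoint. *)
Lemma lower_lil_level2 i : exceeds_often i.+2.
Proof.
have [h /andP[h0 h1] hrest] := window2_rest p_ge0 p_sum1 rrv rpos i dlt0.
(* from [N] on, successive epochs have a ratio of at least [1 / h ^ 2], the ratio of
the ends of a window *)
have [N _ hN] := epoch_ratio k0 (h ^- 2).
pose A n k := (N <= n)%N && (h <= tt n * p k < h^-1).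
have lt_disj a b k : (a < b)%N -> A a k -> A b k -> False.
  move=> ab /and3P[Na ha _] /and3P[_ _]; apply/negP; rewrite -leNgt.
  have := epoch_nd k0 ab; have := hN a Na => /= => /le_trans h2 /h2 h3.
  rewrite (le_trans _ (ler_wpM2r (p_ge0 k) h3))// -mulrA.
  have q : 0 <= h ^- 2 by rewrite invr_ge0 sqr_ge0.
  rewrite (le_trans _ (ler_wpM2l q ha))// le_eqVlt; apply/orP; left; apply/eqP.
  by field; rewrite gt_eqF.
apply: (scheme_lower_lil scheme p_ge0 p_sum1 rrv rpos _ kap_bound (A := A)) => //.
- move=> a b k ab; case: (ltngtP a b) => // ba ? ?; first exact: (lt_disj a b k).
  exact: (lt_disj b a k).
- move=> n; have [m hm] := fin_window (epoch_gt0 kap n) h0.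
  by exists m => k /and3P[_ hk _]; exact: hm.
have hr := near_epoch k0 hrest.
near=> n => m; have Nn : (N <= n)%N by near: n; exists N.
under eq_bigl do rewrite /A Nn/=.
by move: m; near: n.
Unshelve. all: by end_near. Qed.

(** The windows consist of the boxes with [1 / p k] between two successive epochs.
Beyond the later epoch there remains a proportion of the variance that is given by
the ratio of the values of [hatL]. *)
Lemma lower_lil_level1 : hatL_ratio_vanishes L kap -> exceeds_often 1.
Proof.
move=> hvan.
pose A n k := tt n * p k < 1 <= tt n.+1 * p k.
have lt_disj a b k : (a < b)%N -> A a k -> A b k -> False.
  move=> ab /andP[_ ha] /andP[hb _].
  by have := le_trans ha (ler_wpM2r (p_ge0 k) (epoch_nd k0 ab)); rewrite leNgt hb.
apply: (scheme_lower_lil scheme p_ge0 p_sum1 rrv rpos _ kap_bound (A := A)) => //.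
- move=> a b k ab; case: (ltngtP a b) => // ba ? ?; first exact: (lt_disj a b k).
  exact: (lt_disj b a k).
- move=> n; have [m hm] := fin_window (epoch_gt0 kap n.+1) ltr01.
  by exists m => k /andP[_ hk]; exact: hm.
have e0 : (0 : R) < 2^-1 by rewrite invr_gt0.
have e1 : (2^-1 : R) < 1 by rewrite invf_lt1// ltr1n.
have hb := near_epoch k0 (hatL_bounds p_ge0 p_sum1 L_sv rho_equiv e0 e1).
have hcp := near_epoch k0 (capped_pos p_ge0 p_sum1 rrv rpos).
have hv := near_epoch k0 (boxvar1_ge_capped p_ge0 p_sum1 rrv rpos).
have hro := near_epoch k0 (rho_o_capped p_ge0 p_sum1 rrv rpos (4 / dlt)).
have eta0 : 0 < dlt / 12 by rewrite divr_gt0.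
have posq (a b : R) : 0 < a -> a <= b * (1 + 2^-1) -> 0 < b by lra.
have hb' : \forall n \near \oo, capped p (tt n.+1) / tt n.+1 <= hatL L (tt n.+1) * (1 + 2^-1).
  have [N _ h] := hb; exists N => // n /= Nn.
  by have [] := h n.+1 (leqW Nn).
near=> n => m.
have cp : 0 < capped p (tt n) by near: n.
have tn := epoch_gt0 kap n.
have [_ l1 l2] : [/\ lebesgue_measure.-integrable `[tt n, +oo[ (fun y : R => (y^-1 * L y)%:E),
    hatL L (tt n) * (1 - 2^-1) <= capped p (tt n) / tt n &
    capped p (tt n) / tt n <= hatL L (tt n) * (1 + 2^-1)] by near: n.
have u2 : capped p (tt n.+1) / tt n.+1 <= hatL L (tt n.+1) * (1 + 2^-1) by near: n.
have v1 : capped p (tt n) / 2 <= boxvar p 1 (tt n) by near: n.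
have r1 : 4 / dlt * rho p (tt n) <= capped p (tt n) by near: n.
have H0 : 0 < hatL L (tt n) by apply: (posq _ _ _ l2); rewrite divr_gt0.
have hr : hatL L (tt n.+1) <= dlt / 12 * hatL L (tt n).
  rewrite -ler_pdivrMr//; apply: ltW; near: n; exact: cvgr_lt _ hvan _ eta0.
rewrite (le_trans (window1_rest p_ge0 p_sum1 m (ltW tn) (epoch_gt0 kap n.+1)))//.
have g1 : rho p (tt n) <= dlt / 4 * capped p (tt n).
  have d4 : 0 < 4 / dlt by rewrite divr_gt0.
  by move: r1; rewrite -(ler_pdivlMl _ _ d4) invf_div.
exact: (window1_arith dlt0 tn l1 hr u2 g1 v1).
Unshelve. all: by end_near. Qed.

End LowerBounds.

(** * Upper limits and asymptotic constants *)

Lemma limf_esup_pinfty_le {R : realType} (f : R -> \bar R) (a : R) :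
  (forall e : R, 0 < e -> \forall t \near +oo, (f t <= (a + e)%:E)%E) ->
  (limf_esup f (pinfty_nbhs R) <= a%:E)%E.
Proof.
move=> h; apply/lee_addgt0Pr => e e0; rewrite limf_esupE -EFinD.
apply: (@le_trans _ _ (ereal_sup (f @` [set t | (f t <= (a + e)%:E)%E]))).
  apply: ereal_inf_lbound; exists [set t | (f t <= (a + e)%:E)%E] => //.
  exact: h.
by apply: ge_ereal_sup => _ [t ht <-].
Qed.

Lemma limf_esup_pinfty_ge {R : realType} (f : R -> \bar R) (a : R) :
  (forall e : R, 0 < e -> forall M : R, exists2 t, M < t & ((a - e)%:E <= f t)%E) ->
  (a%:E <= limf_esup f (pinfty_nbhs R))%E.
Proof.
move=> h; rewrite limf_esupE; apply: le_ereal_inf_tmp => _ [V [M [_ hM]] <-].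
apply/lee_addgt0Pr => e e0; have [t Mt ft] := h e e0 M.
rewrite -leeBlDr// -EFinB (le_trans ft)//.
by apply: ereal_sup_ubound; exists t => //; exact: hM.
Qed.

Section Limsup.
Context {d} {T : measurableType d} {R : realType} (P : probability T R).
Variables (p : nat -> R) (xi : nat -> {RV P >-> R}) (X : nat -> {RV P >-> nat}).
Hypothesis scheme : poissonized_karlin p xi X.
Hypothesis p_ge0 : forall k, 0 <= p k.
Hypothesis p_sum1 : (\sum_(0 <= k <oo) (p k)%:E = 1)%E.
Variable L : R -> R.
Hypothesis L_sv : slowly_varying L.
Hypothesis rho_equiv : asymp_equiv (rho p) (fun t => t * L t).
Implicit Types (s t r c e : R) (a n k m j i l : nat).

Let rrv : forall l : R, 0 < l -> rho p (l * t) / rho p t @[t --> +oo] --> l.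
Proof. exact: rho_rv L_sv rho_equiv. Qed.

Let rpos : \forall t \near +oo, 0 < rho p t.
Proof. exact: rho_pos L_sv rho_equiv. Qed.

Variable j : nat.
Hypothesis j_gt0 : (0 < j)%N.
Notation V := (boxvar p j).
Notation ratio t w := ((occupancy xi X j t w - meanK xi X j t) /
    Num.sqrt (varK xi X j t * ln (ln (varK xi X j t)))).

Lemma loglog_var_pos : \forall t \near +oo, 0 < V t /\ 0 < ln (ln (V t)).
Proof.
have [n0 _ hn] := scheme_var_grow p_ge0 p_sum1 rrv rpos j_gt0 (expR 2).
apply/pinfty_nearP; exists (2 ^+ n0.+1); first by rewrite exprn_gt0.
move=> t nt; have := hn n0.+1 (leqnSn n0) t nt.
have q : expR 2 <= expR 2 * n0.+1%:R ^+ 2 :> R.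
  by rewrite ler_peMr ?expR_ge0// exprn_ege1// ler1n.
move=> /(le_trans q) hV; have V0 : 0 < V t by rewrite (lt_le_trans _ hV)// expR_gt0.
split=> //; rewrite ln_gt0// (@lt_le_trans _ _ 2)// ?ltr1n//.
by rewrite -[leLHS]expRK ler_ln ?posrE ?expR_gt0.
Qed.

Lemma ratioE t w : 0 <= t -> ratio t w =
  fluct p xi X j t w / Num.sqrt (V t * ln (ln (V t))).
Proof. by move=> t0; rewrite (meanKE scheme)// (varKE scheme). Qed.

Let sqrt2M t : Num.sqrt (2 * V t * ln (ln (V t))) = Num.sqrt 2 * Num.sqrt (V t * ln (ln (V t))).
Proof. by rewrite -mulrA sqrtrM. Qed.

Lemma le_ratio c t w : 0 <= t -> 0 < V t -> 0 < ln (ln (V t)) ->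
  (c * Num.sqrt (2 * V t * ln (ln (V t))) <= fluct p xi X j t w) =
  (c * Num.sqrt 2 <= ratio t w).
Proof.
move=> t0 V0 l0; have s0 : 0 < Num.sqrt (V t * ln (ln (V t))).
  by rewrite sqrtr_gt0 mulr_gt0.
by rewrite sqrt2M ratioE// ler_pdivlMr// mulrA.
Qed.

Lemma ge_ratio c t w : 0 <= t -> 0 < V t -> 0 < ln (ln (V t)) ->
  (fluct p xi X j t w <= c * Num.sqrt (2 * V t * ln (ln (V t)))) =
  (ratio t w <= c * Num.sqrt 2).
Proof.
move=> t0 V0 l0; have s0 : 0 < Num.sqrt (V t * ln (ln (V t))).
  by rewrite sqrtr_gt0 mulr_gt0.
by rewrite sqrt2M ratioE// ler_pdivrMr// mulrA.
Qed.

Let sqrt2_bound : 0 < Num.sqrt (2 : R) <= 2.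
Proof.
rewrite sqrtr_gt0 ltr0n/= -[leRHS]ger0_norm// -sqrtr_sqr ler_wsqrtr//.
by rewrite -natrX ler_nat.
Qed.

(** The upper half, applied along a sequence of precisions that tends to 0. *)
Lemma lil_limsup_le : {ae P, forall w, (lil_limsup xi X j w <= (Num.sqrt 2)%:E)%E}.
Proof.
have /andP[s0 s2] := sqrt2_bound.
have H m : {ae P, forall w, \forall t \near +oo,
    fluct p xi X j t w <= (1 + m.+1%:R^-1) * Num.sqrt (2 * V t * ln (ln (V t)))}.
  apply: (scheme_upper_lil scheme p_ge0 p_sum1 rrv rpos j_gt0).
  by rewrite invr_gt0 ltr0n/= invf_le1// ler1n.
have /ae_foralln := H; apply: filterS => w hw; apply: limf_esup_pinfty_le => e e0.
pose m := Num.truncn (2 / e).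
have me : m.+1%:R^-1 * 2 <= e.
  by rewrite mulrC ler_pdivrMr// mulrC -ler_pdivrMr// ltW// truncnS_gt.
have ve := loglog_var_pos; have hm := hw m.
near=> t; have t0 : 0 <= t by near: t; exact: nbhs_pinfty_ge.
have [V0 l0] : 0 < V t /\ 0 < ln (ln (V t)) by near: t.
have : fluct p xi X j t w <= (1 + m.+1%:R^-1) * Num.sqrt (2 * V t * ln (ln (V t))) by near: t.
rewrite ge_ratio// lee_fin => /le_trans; apply; rewrite mulrDl mul1r lerD2l.
by rewrite (le_trans _ me)// ler_wpM2l.
Unshelve. all: by end_near. Qed.

(** The lower half, applied along a sequence of values of [kap] that tends to 0; at
level 1 only small values of [kap] are available, hence the bound [g]. *)
Lemma lil_limsup_ge g : 0 < g ->
  (forall kap : R, 0 < kap <= 5^-1 -> kap < g -> exceeds_often p xi X kap j) ->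
  {ae P, forall w, ((Num.sqrt 2)%:E <= lil_limsup xi X j w)%E}.
Proof.
move=> g0 hk; have /andP[s0 s2] := sqrt2_bound.
pose g1 := Num.min 1 g; have g10 : 0 < g1 by rewrite lt_min ltr01.
have g11 : g1 <= 1 by rewrite ge_min lexx.
have g1g : g1 <= g by rewrite ge_min lexx orbT.
pose kap m : R := g1 / (m + 6)%:R.
have m6 m : (0 : R) < (m + 6)%:R by rewrite ltr0n addnS.
have kap0 m : 0 < kap m by rewrite divr_gt0.
have kapg m : kap m < g.
  rewrite (lt_le_trans _ g1g)// ltr_pdivrMr// ltr_pMr// ltr1n addnS ltnS addnS //.
have kap5 m : kap m <= 5^-1.
  rewrite ler_pdivrMr// (le_trans g11)// ler_pdivlMl// mulr1 ler_nat.
  by rewrite (leq_trans _ (leq_addl _ _)).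
have H m : exceeds_often p xi X (kap m) j by apply: hk => //; rewrite kap0/=.
have /ae_foralln := H; apply: filterS => w hw; apply: limf_esup_pinfty_ge => e e0 M.
pose m := Num.truncn (10 / e).
have me : 5 * kap m * 2 <= e.
  have e1 : 10 / e <= (m + 6)%:R.
    by rewrite (le_trans (ltW (truncnS_gt _)))// ler_nat addnS ltnS leq_addr.
  rewrite /kap (_ : 5 * (g1 / (m + 6)%:R) * 2 = 10 * g1 / (m + 6)%:R); last first.
    by ring.
  rewrite ler_pdivrMr// (@le_trans _ _ 10)//; first by rewrite ler_piMr.
  by rewrite mulrC -ler_pdivrMr.
have [M' M'0 hM'] := (pinfty_nearP _).1 loglog_var_pos.
have k0 := kap0 m.
have [N _ hN] : \forall n \near \oo, M < epoch (kap m) n /\ M' <= epoch (kap m) n.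
  apply: (near_epoch k0 (Q := fun t => M < t /\ M' <= t)).
  near=> t; split; near: t; [apply: nbhs_pinfty_gt|apply: nbhs_pinfty_ge]; exact: num_real.
have [n Nn] := hw m N; have [Mn M'n] := hN n Nn; have [V0 l0] := hM' _ M'n.
have t0 := ltW (epoch_gt0 (kap m) n).
rewrite le_ratio// => h; exists (epoch (kap m) n) => //.
rewrite lee_fin (le_trans _ h)// mulrBl mul1r lerD2l lerN2 (le_trans _ me)//.
by rewrite ler_wpM2l// mulr_ge0// ltW.
Unshelve. all: by end_near. Qed.

End Limsup.

(** An equivalence forces its right-hand side to be nonzero eventually, so the
quotients may be multiplied. *)
Lemma asymp_trans {R : realType} (f g h : R -> R) (c : R) :
  f t / g t @[t --> +oo] --> c -> asymp_equiv g h -> f t / h t @[t --> +oo] --> c.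
Proof.
move=> fg gh; rewrite -[c]mulr1; apply: cvg_trans (cvgM fg gh).
apply: near_eq_cvg.
have e0 : (0 : R) < 1 by [].
near=> t; have g0 : 0 < g t / h t by near: t; exact: cvgr_gt _ gh _ e0.
rewrite /= -mulrA mulKf//; apply/negP => /eqP gt0; move: g0.
by rewrite gt0 mul0r ltxx.
Unshelve. all: by end_near. Qed.

Lemma asymp_scale {R : realType} (f g : R -> R) (c : R) : c != 0 ->
  f t / g t @[t --> +oo] --> c -> asymp_equiv f (fun t => c * g t).
Proof.
move=> c0 fg; rewrite /asymp_equiv -[1](mulVf c0).
rewrite (_ : (fun t => _) = (fun t => c^-1 * (f t / g t))).
  by apply: cvgM => //; exact: cvg_cst.
by apply/funext => t; rewrite invfM mulrCA.
Qed.

Lemma asymp_near {R : realType} (f f' g : R -> R) (c : R) :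
  (forall t, 0 <= t -> f t = f' t) -> f' t / g t @[t --> +oo] --> c ->
  f t / g t @[t --> +oo] --> c.
Proof.
move=> ff; apply: cvg_trans; apply: near_eq_cvg; near=> t.
by rewrite ff//; near: t; exact: nbhs_pinfty_ge.
Unshelve. all: by end_near. Qed.

Lemma variance_constant {R : realType} i :
  i.+1%:R^-1 * ('C(i.*2.+1, i)%:R / 2 ^+ i.*2.+1) =
  ((2 * i.+2 - 3)`!)%:R / (((i.+2.-1)`!)%:R ^+ 2 * 2 ^+ (2 * i.+2 - 3)) :> R.
Proof.
have -> : (2 * i.+2 - 3)%N = i.*2.+1 by rewrite mul2n !doubleS.
have le : (i <= i.*2.+1)%N by rewrite -addnn leqW// leq_addl.
have := bin_fact le; rewrite (_ : (i.*2.+1 - i)%N = i.+1); last first.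
  by rewrite -addnn -addSn addnK.
move=> /(congr1 (fun n => n%:R : R)) <-; rewrite [i.+2.-1]/= !factS !natrM.
field.
by rewrite expf_neq0 ?pnatr_eq0//= -lt0n fact_gt0/= addrC natr1 pnatr_eq0.
Qed.

Theorem theorem4p4 (R : realType) (d : measure_display) (T : measurableType d)
    (P : probability T R) (p : nat -> R)
    (p_ge0 : forall k, 0 <= p k)
    (p_sum1 : (\sum_(0 <= k <oo) (p k)%:E = 1)%E)
    (p_infinite : infinite_set [set k | 0 < p k])
    (xi : nat -> {RV P >-> R}) (X : nat -> {RV P >-> nat})
    (scheme : poissonized_karlin p xi X)
    (L : R -> R) (L_sv : slowly_varying L)
    (rho_equiv : asymp_equiv (rho p) (fun t => t * L t)) :
  (\forall t \near +oo,
     lebesgue_measure.-integrable `[t, +oo[ (fun y : R => (y^-1 * L y)%:E)) /\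
  (forall j : nat, (2 <= j)%N ->
     [/\ {ae P, forall w, lil_limsup xi X j w = (Num.sqrt 2)%:E},
         asymp_equiv (meanK xi X j) (fun t => (j.-1)%:R^-1 * (t * L t)) &
         asymp_equiv (varK xi X j)
           (fun t => ((2 * j - 3)`!)%:R /
                     (((j.-1)`!)%:R ^+ 2 * 2 ^+ (2 * j - 3)) * (t * L t))]) /\
  ((hatL_condition L ->
      {ae P, forall w, lil_limsup xi X 1 w = (Num.sqrt 2)%:E}) /\
   (~ hatL_condition L ->
      {ae P, forall w, (lil_limsup xi X 1 w <= (Num.sqrt 2)%:E)%E})) /\
  (asymp_equiv (varK xi X 1) (meanK xi X 1) /\
   asymp_equiv (meanK xi X 1) (fun t => t * hatL L t)).
Proof.
have rrv := rho_rv L_sv rho_equiv; have rpos := rho_pos L_sv rho_equiv.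
have upper j : (0 < j)%N -> {ae P, forall w, (lil_limsup xi X j w <= (Num.sqrt 2)%:E)%E}.
  by move=> j0; exact: (lil_limsup_le scheme p_ge0 p_sum1 L_sv rho_equiv j0).
have equal j g : (0 < j)%N -> 0 < g ->
    (forall kap : R, 0 < kap <= 5^-1 -> kap < g -> exceeds_often p xi X kap j) ->
    {ae P, forall w, lil_limsup xi X j w = (Num.sqrt 2)%:E}.
  move=> j0 g0 hk.
  have lo := lil_limsup_ge scheme p_ge0 p_sum1 L_sv rho_equiv j0 g0 hk.
  apply: filterS2 (upper j j0) lo => w u l.
  by apply/eqP; rewrite eq_le u.
have capp := capped_pos p_ge0 p_sum1 rrv rpos.
split; first exact: (hatL_integrable p_ge0 p_sum1 L_sv rho_equiv).
split; [|split; [split|split]].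
- move=> [|[|i]]// _; split.
  + apply: (equal _ 1) => // kap k5 _.
    exact: (lower_lil_level2 scheme p_ge0 p_sum1 L_sv rho_equiv k5 i).
  + apply: asymp_scale; first by rewrite invr_eq0 pnatr_eq0.
    apply: (asymp_near (f' := boxmean p i.+2)).
      by move=> t t0; rewrite (meanKE scheme).
    apply: asymp_trans rho_equiv; exact: boxsum_ptail_rho.
  + rewrite -variance_constant; apply: asymp_scale.
      by rewrite gt_eqF//; exact: boxvar2_const_gt0.
    apply: (asymp_near (f' := boxvar p i.+2)).
      by move=> t t0; rewrite (varKE scheme).
    apply: asymp_trans rho_equiv; exact: boxvar_rho.
- move=> [g0 g00 hg]; apply: (equal 1%N g0) => // kap k5 kg.
  apply: (lower_lil_level1 scheme p_ge0 p_sum1 L_sv rho_equiv k5 _).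
  by apply: hg; case/andP: k5 => -> _.
- by move=> _; exact: upper.
- apply: (asymp_near (f' := boxvar p 1)).
    by move=> t t0; rewrite (varKE scheme).
  apply: (asymp_trans (boxvar1_capped p_ge0 p_sum1 rrv rpos) _).
  rewrite /asymp_equiv -[1]invr1.
  rewrite (_ : (fun t => _) = (fun t => (meanK xi X 1 t / capped p t)^-1)).
    apply: cvgV; first exact: oner_neq0.
    apply: (asymp_near (f' := boxmean p 1)).
      by move=> t t0; rewrite (meanKE scheme).
    exact: boxmean1_capped.
  by apply/funext => t; rewrite invf_div.
- apply: (asymp_near (f' := boxmean p 1)).
    by move=> t t0; rewrite (meanKE scheme).
  apply: (asymp_trans (boxmean1_capped p_ge0 p_sum1 rrv rpos) _).
  exact: (hatL_asymp p_ge0 p_sum1 L_sv rho_equiv capp).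
Qed.
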